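(* Let $s\ge2$ be an integer, $R>1$, and let $\{P_n\}_{n=0}^\infty$ be the sequence of polynomials orthonormal over the interior $G_1=\{z:|z^s-1|<R^s\}$ of the lemniscate $L_1=\{z:|z^s-1|=R^s\}$. Let $G_\rho=\{z:|z^s-1|<1\}$ and let $L(\zeta,z)$ be as in the context. Then: (a) For all $n=sm+s-1$ with $m\ge0$ an integer, $$P_n(z)=\sqrt{n+1}\,R^{-(n+1)}z^{s-1}(z^s-1)^m.$$ (b) For all $n=sm+l$ with $m\ge0$ and $0\le l\le s-2$ integers, $$\frac{(-1)^mR^{n+1}\,\Gamma\left(n+(3s-l-1)/s\right)P_n(z)}{n!\,\sqrt{n+1}}=\frac{s^{(2s-l-1)/s}}{(s-l-1)!\,\Gamma((1+l-s)/s)}\,\frac{\partial^{s-l-2}L}{\partial\zeta^{s-l-2}}(0,z)+R_n(z),\quad z\in G_\rho,$$ where $R_n(z)=\mathcal{O}(n^{-1})$ locally uniformly on $G_\rho$ as $n\to\infty$, $n\not\equiv s-1 \pmod s$. More precisely (with the $\mathcal{O}$ again locally uniform on $G_\rho$), $$nR_n(z)=\frac{s^{(s-l-1)/s}}{\Gamma((1+l-2s)/s)}\left[\frac{(s-1)}{2\,(s-l-2)!}\,\frac{\partial^{s-l-2}L}{\partial\zeta^{s-l-2}}(0,z)-\frac{s^2}{(2s-l-1)!}\,\frac{\partial^{2s-l-2}L}{\partial\zeta^{2s-l-2}}(0,z)\right]+\mathcal{O}\left(\frac1n\right).$$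
   Context: $\{P_n\}_{n\ge0}$ is the unique sequence of polynomials $P_n(z)=\kappa_nz^n+\text{lower degree terms}$, $\kappa_n>0$, with $\frac1\pi\int_{G_1}P_n\overline{P_m}\,dA=\delta_{nm}$, where $dA$ is area measure. Let $\varphi$ be a conformal map of $G_1$ onto the unit disk and $$L(\zeta,z):=\frac{\varphi'(\zeta)\varphi'(z)}{[\varphi(\zeta)-\varphi(z)]^2},\quad \zeta,z\in G_1,\ \zeta\neq z,$$ which is independent of the choice of $\varphi$ (one may take $\varphi(z)=Rz/[R^{2s}-1+z^s]^{1/s}$). Here $\frac{\partial^jL}{\partial\zeta^j}(0,z)$ is the $j$-th partial derivative in the first variable evaluated at $\zeta=0$. $\Gamma$ is the Euler gamma function. *)

(* Defs.v *)
From HB Require Import structures.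
From mathcomp Require Import all_boot all_order all_algebra.
From mathcomp Require Import all_classical all_reals all_analysis.
From mathcomp Require Import complex.
Set Implicit Arguments.
Unset Strict Implicit.
Unset Printing Implicit Defensive.
Import Order.TTheory GRing.Theory Num.Theory.
Import numFieldNormedType.Exports.
Local Open Scope classical_set_scope.
Local Open Scope ring_scope.
Local Open Scope complex_scope.

(* The topology and the normed module structure of the complex plane are those
   of R[i]^o (R[i] as a normed module over itself), so that [derivable f z 1]
   and [derive1 f z] are complex differentiability and the complex derivative. *)

(* Integral with respect to planar area measure, computed through real and
   imaginary parts. *)
Definition area_integral (R : realType) (A : set R[i]) (f : R[i] -> R[i]) : R[i] :=
  let mu := (@lebesgue_measure R \x @lebesgue_measure R)%E in
  let toC (p : R * R) : R[i] := p.1 +i* p.2 in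
  Rintegral mu (toC @^-1` A) (fun p => complex.Re (f (toC p)))
  +i* Rintegral mu (toC @^-1` A) (fun p => complex.Im (f (toC p))).

(* In R[i], [0 < x] says that x is real and positive. *)
Definition orthonormal_polynomials (R : realType) (G : set R[i])
    (P : nat -> {poly R[i]}) : Prop :=
  [/\ forall n, size (P n) = n.+1,
      forall n, 0 < lead_coef (P n)
    & forall n m, (pi^-1)%:C *
        area_integral G (fun z => (P n).[z] * ((P m).[z])^*) = (n == m)%:R].

Definition lemniscate_interior (R : realType) (s : nat) (t : R) : set R[i] :=
  [set z | `|z ^+ s - 1| < t%:C].

Definition conformal_onto_disk (R : realType) (U : set R[i])
    (phi : R[i] -> R[i]) : Prop :=
  (forall z, U z -> derivable (phi : R[i]^o -> R[i]^o) z 1) /\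
  set_bij U [set w : R[i] | `|w| < 1] phi.

Definition Lker (R : realType) (phi : R[i] -> R[i]) (zeta z : R[i]) : R[i] :=
  derive1 (phi : R[i] -> R[i]^o) zeta * derive1 (phi : R[i] -> R[i]^o) z
  / (phi zeta - phi z) ^+ 2.

Definition dLker0 (R : realType) (phi : R[i] -> R[i]) (j : nat) (z : R[i]) : R[i] :=
  derive1n j ((fun zeta => Lker phi zeta z) : R[i] -> R[i]^o) 0.

(* Euler's integral for x > 0, extended to the nonpositive reals by the
   recurrence Gamma (x + 1) = x Gamma x; the value at the poles
   0, -1, -2, ... is the junk value 0. *)
Definition Gamma_integral (R : realType) (x : R) : R :=
  Rintegral (@lebesgue_measure R) `]0, +oo[%classic
    (fun t => t `^ (x - 1) * expR (- t)).

Definition Gamma (R : realType) (x : R) : R :=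
  let k := if 0 < x then 0%N else (Num.truncn (- x)).+1 in
  Gamma_integral (x + k%:R) / \prod_(i < k) (x + i%:R).

(* f n z = O(g n) as n -> oo with n in D, locally uniformly for z in the open
   set G: each point of G has a neighbourhood on which one constant works. *)
Definition locally_uniformly_O (R : realType) (G : set R[i]) (D : set nat)
    (f : nat -> R[i] -> R[i]) (g : nat -> R) : Prop :=
  forall z0 : R[i]^o, G z0 -> exists (M : R) (N : nat),
    \forall z \near z0, forall n, (N <= n)%N -> D n ->
      `|f n z| <= (M * g n)%:C.

(* Main.v *)
Require Import Defs.
From HB Require Import structures.
From mathcomp Require Import all_boot all_order all_algebra.
From mathcomp Require Import all_classical all_reals all_analysis.
From mathcomp Require Import measurable_realfun.
From mathcomp Require Import complex ring lra zify.
From mathcomp Require cyclic separable cyclotomic.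
Set Implicit Arguments.
Unset Strict Implicit.
Unset Printing Implicit Defensive.
Import Order.TTheory GRing.Theory Num.Theory.
Import numFieldNormedType.Exports.
Import ComplexField.Normc.
Local Open Scope classical_set_scope.
Local Open Scope ring_scope.
Local Open Scope complex_scope.
Local Notation "x ^*" := (conjc x) : ring_scope.
Local Notation Re := complex.Re.
Local Notation Im := complex.Im.

(** Write u = z^s - 1, B = R^(2s), n = sm + l with 0 <= l < s, alpha = (l+1)/s.
 By rotational symmetry P_n = z^l q(u) with deg q = m ([P_upoly]), so it suffices to
 find a monic polynomial f of this form that is almost orthogonal to the polynomials
 of degree < n in that class.

 The tool is the pairing D(F, g) ([Dfun]): the area integral of the conjugate derivative
 of eta F conj(g), where eta is a cutoff equal to 1 near the boundary of G_1. It makes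
 sense for F holomorphic near the boundary only, depends on the boundary values of
 F conj(g) only ([D_compare], from Stokes' theorem [lem_stokes]), and equals the inner
 product of F and g' when F is a polynomial ([D_poly]). On the boundary conj(u) = B/u,
 and |z|^2 = R^2 |1 + u/B|^(2/s). Two families of F pair explicitly:
 - F = z^l u^m (1 + 1/u)^(1 - alpha) kills z^(l+1) u^j for j < m, because F times the
  conjugate has boundary values that extend holomorphically to G_1; for j = m a multiple
  of the logarithmic derivative u'/u contributes ([D_main_lt], [D_main_eq]).
 - F = mu'/mu^(i+1), i > 0, where mu is the conformal map normalized by mu'(0) = 1, pairs
  to 0 with every g: |mu|^2 is a constant nu on the boundary, so up to a factor F conj(g)
  has there the values of mu' conj(h), h = mu^(i+1) g. As h' = mu k is divisible by mu, the
  conjugate derivative of mu' conj(h) is the complex conjugate of that of k (|mu|^2 - nu),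
  which vanishes on the boundary ([D_pole]).
 The derivatives of L at zeta = 0 are combinations of these functions: the Taylor
 coefficients of mu' / (M - mu)^2 at 0 follow from the differential equation of mu
 ([dLker0_ker0], [dLker0_ker1]), and L does not depend on the conformal map by the Schwarz
 lemma ([disc_map_kernel]).

 For l = s - 1 the exponent 1 - alpha vanishes, the first F is itself a polynomial, and
 part (a) is exact ([last_class]). For l <= s - 2 the approximant f ([approx]) consists of
 the polynomial part of the first F and two correction terms, whose coefficients are
 binomial coefficients of index m + 1 and m + 2; near the boundary f is the first F plus a
 combination of two kernels mu'/mu^(i+1), and on compact subsets of G_rho it is that
 combination alone, in both cases with an error smaller by a factor 1/n^2 than the leading
 coefficient ([approximant]). The correction terms use polynomials approximating a power of
 mu(z)/z, which exist with geometric accuracy as mu is holomorphic across the boundary.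
 The pairing then bounds the orthogonality defect of f ([D_bound], [defect]), hence the
 distance from f to P_n over its leading coefficient ([gap_bound]), and determines that
 coefficient up to O(1/n^2) ([kappa_bound], [norming_near1]). Point evaluations are bounded
 on compact subsets, so P_n inherits the expansion of f inside G_rho
 ([monic_asymptotics]).

 It remains to expand a quotient of four Gamma values. Log-convexity of Gamma gives
 ln Gamma(y + e) - ln Gamma(y) - e ln y = e(e-1)/(2y) + O(1/y^2) for 1 <= e <= 2
 ([lratio_asymptotic]). *)

(** * The modulus of complex numbers *)
Section Modulus.
Variable R : realType.
Implicit Types (z w : R[i]) (x y : R).

Lemma normrE z : `|z| = (normc z)%:C. Proof. by []. Qed.

Lemma normc_ge0 z : 0 <= normc z.
Proof. by case: z => a b; exact: sqrtr_ge0. Qed.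

Lemma normcB z w : normc (z - w) <= normc z + normc w.
Proof. by rewrite -(normcN w); exact: le_normcD. Qed.

Lemma le_of_eq x y : x = y -> x <= y. Proof. by move=> ->. Qed.

Lemma normcBC z w : normc (z - w) = normc (w - z).
Proof. by rewrite -normcN opprB. Qed.

Lemma normcX z n : normc (z ^+ n) = normc z ^+ n.
Proof. by elim: n => [|n ih]; rewrite ?expr0 ?normc1// !exprS normcM ih. Qed.

Lemma normcJ z : normc (z^*) = normc z.
Proof. by case: z => a b /=; rewrite sqrrN. Qed.

Lemma normc_real x : normc x%:C = `|x|.
Proof. by rewrite /= expr0n/= addr0 sqrtr_sqr. Qed.

Lemma normc_nat n : normc (n%:R : R[i]) = n%:R.
Proof. by rewrite -(rmorph_nat (real_complex R)) normc_real ger0_norm. Qed.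

Lemma normc_eq0 z : (normc z == 0) = (z == 0).
Proof. by apply/eqP/eqP => [/eq0_normc//|->]; exact: normc0. Qed.

Lemma normc_gt0 z : (0 < normc z) = (z != 0).
Proof. by rewrite lt_def normc_ge0 andbT normc_eq0. Qed.

Lemma normc_sqr z : normc z ^+ 2 = Re z ^+ 2 + Im z ^+ 2.
Proof. by case: z => a b /=; rewrite sqr_sqrtr// addr_ge0 ?sqr_ge0. Qed.

Lemma mul_conjc z : z * z^* = (normc z ^+ 2)%:C.
Proof.
rewrite normc_sqr; case: z => a b /=; apply/eqP; rewrite eq_complex/=.
by apply/andP; split; apply/eqP; ring.
Qed.

Lemma normc_Re z : `|Re z| <= normc z.
Proof.
case: z => a b /=; rewrite -[leLHS]sqrtr_sqr ler_wsqrtr//.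
by rewrite lerDl sqr_ge0.
Qed.

Lemma normc_Im z : `|Im z| <= normc z.
Proof.
case: z => a b /=; rewrite -[leLHS]sqrtr_sqr ler_wsqrtr//.
by rewrite lerDr sqr_ge0.
Qed.

Lemma normc_leD z : normc z <= `|Re z| + `|Im z|.
Proof.
case: z => a b /=; rewrite -[leRHS]ger0_norm ?addr_ge0// -sqrtr_sqr ler_wsqrtr//.
rewrite sqrrD !real_normK ?num_real//.
by rewrite lerD2r lerDl mulrn_wge0 ?mulr_ge0.
Qed.

Lemma normc_lb z w : normc z - normc w <= normc (z + w).
Proof. by rewrite lerBlDr -[z in leLHS](addrK w); exact: normcB. Qed.

Lemma Re_mul_conj z w :
 normc (z + w) ^+ 2 = normc z ^+ 2 + 2 * Re (z^* * w) + normc w ^+ 2.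
Proof. by rewrite !normc_sqr; case: z => a b; case: w => c d /=; ring. Qed.

Lemma conjc_realM x z : (x%:C * z)^* = x%:C * z^*.
Proof.
by rewrite (rmorphM (@conjc R)); congr (_ * _); exact: conjc_real.
Qed.

Lemma Re_real x : Re x%:C = x. Proof. by []. Qed.
Lemma Im_real x : Im x%:C = 0. Proof. by []. Qed.

Lemma ReD z w : Re (z + w) = Re z + Re w.
Proof. by case: z => a b; case: w. Qed.
Lemma ImD z w : Im (z + w) = Im z + Im w.
Proof. by case: z => a b; case: w. Qed.
Lemma ReM z w : Re (z * w) =
 Re z * Re w - Im z * Im w.
Proof. by case: z => a b; case: w. Qed.
Lemma ImM z w : Im (z * w) =
 Re z * Im w + Im z * Re w.
Proof. by case: z => a b; case: w => c d /=; ring. Qed.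
Lemma ReN z : Re (- z) = - Re z. Proof. by case: z. Qed.
Lemma ImN z : Im (- z) = - Im z. Proof. by case: z. Qed.

End Modulus.

(** * Wirtinger derivatives *)
Section Wirtinger.
Variable R : realType.
Local Notation C := R[i].
Implicit Types (z h p q : C) (Y : C -> C) (eps del : R).

Definition little_o (e : C -> C) := forall eps, 0 < eps ->
 exists2 del, 0 < del & forall h, normc h < del -> normc (e h) <= eps * normc h.

Lemma little_o0 : little_o (fun=> 0).
Proof.
by move=> e e0; exists 1 => // h _; rewrite normc0 mulr_ge0 ?normc_ge0// ltW.
Qed.

Lemma little_o_eq e1 e2 : (forall h, e1 h = e2 h) -> little_o e1 -> little_o e2.
Proof. by move=> /funext ->. Qed.

Lemma little_oD e1 e2 : little_o e1 -> little_o e2 ->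
 little_o (fun h => e1 h + e2 h).
Proof.
move=> o1 o2 e e0; have e20 : 0 < e / 2 by rewrite divr_gt0.
have [d1 d10 h1] := o1 _ e20; have [d2 d20 h2] := o2 _ e20.
exists (Num.min d1 d2); first by rewrite lt_min d10.
move=> h; rewrite lt_min => /andP[/h1 a /h2 b].
apply: (le_trans (le_normcD _ _)); rewrite (le_trans (lerD a b))//.
by rewrite -mulrDl -splitr.
Qed.

Lemma little_oM (b e : C -> C) (M d0 : R) : 0 < d0 ->
 (forall h, normc h < d0 -> normc (b h) <= M) -> little_o e ->
 little_o (fun h => b h * e h).
Proof.
move=> d00 bM oe eps eps0.
have M0 : 0 <= M by rewrite (le_trans (normc_ge0 (b 0)))// bM// normc0.
have M1 : 0 < M + 1 by rewrite ltr_wpDl.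
have [d d_0 hd] := oe (eps / (M + 1)) (divr_gt0 eps0 M1).
exists (Num.min d d0); first by rewrite lt_min d_0.
move=> h; rewrite lt_min => /andP[/hd a /bM b'].
rewrite normcM (le_trans (ler_pM (normc_ge0 _) (normc_ge0 _) b' a))//.
rewrite mulrA ler_wpM2r ?normc_ge0// mulrCA ler_piMr ?ltW//.
by rewrite ltr_pdivrMr// mul1r ltrDl.
Qed.

Lemma little_oZ (c : C) e : little_o e -> little_o (fun h => c * e h).
Proof. by apply: (@little_oM _ _ (normc c) 1). Qed.

Lemma little_oN e : little_o e -> little_o (fun h => - e h).
Proof.
move=> oe; have := little_oZ (-1) oe; apply: little_o_eq => h.
by rewrite mulN1r.
Qed.

Lemma little_o_quad (e : C -> C) (M d0 : R) : 0 < d0 ->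
 (forall h, normc h < d0 -> normc (e h) <= M * normc h ^+ 2) -> little_o e.
Proof.
move=> d00 he eps eps0.
have M1 : 0 < `|M| + 1 by rewrite ltr_wpDl.
exists (Num.min d0 (eps / (`|M| + 1))); first by rewrite lt_min d00 divr_gt0.
move=> h; rewrite lt_min => /andP[/he a b]; apply: (le_trans a).
rewrite expr2 mulrA ler_wpM2r ?normc_ge0//.
rewrite (le_trans (ler_wpM2r (normc_ge0 _) (ler_norm M)))//.
rewrite (le_trans (ler_wpM2l (normr_ge0 M) (ltW b)))//.
by rewrite mulrCA ler_piMr ?ltW// ltr_pdivrMr// mul1r ltrDl.
Qed.

Lemma little_oJ e : little_o e -> little_o (fun h => (e h)^*).
Proof.
by move=> oe eps /oe[d d0 hd]; exists d => // h /hd; rewrite normcJ.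
Qed.

Lemma little_o_ext e1 e2 (d0 : R) : 0 < d0 ->
 (forall h, normc h < d0 -> e1 h = e2 h) -> little_o e1 -> little_o e2.
Proof.
move=> d00 e12 o1 eps /o1[d d_0 hd]; exists (Num.min d d0).
 by rewrite lt_min d_0.
by move=> h; rewrite lt_min => /andP[/hd + /e12 <-].
Qed.

(** [Y] is real differentiable at [z], with Wirtinger derivatives [p] (with
  respect to [z]) and [q] (with respect to the conjugate of [z]). *)
Definition wdiff Y z p q :=
 little_o (fun h => Y (z + h) - Y z - (p * h + q * h^*)).

Definition cdiff Y z p := wdiff Y z p 0.

Definition ccont (Y : C -> C) z := forall eps, 0 < eps ->
 exists2 del, 0 < del & forall h, normc h < del -> normc (Y (z + h) - Y z) < eps.

Lemma wdiff_eq Y z p q p' q' : wdiff Y z p q -> p = p' -> q = q' ->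
 wdiff Y z p' q'.
Proof. by move=> + <- <-. Qed.

Lemma wdiff_lin_bound p q h :
 normc (p * h + q * h^*) <= (normc p + normc q) * normc h.
Proof.
by rewrite (le_trans (le_normcD _ _))// !normcM normcJ mulrDl.
Qed.

Lemma wdiff_lip Y z p q : wdiff Y z p q -> exists M del,
 [/\ 0 <= M, 0 < del & forall h, normc h < del ->
   normc (Y (z + h) - Y z) <= M * normc h].
Proof.
move=> /(_ 1 ltr01)[d d0 hd]; exists (normc p + normc q + 1), d; split => //.
 by rewrite !addr_ge0 ?normc_ge0.
move=> h /hd e; rewrite -(subrK (p * h + q * h^*) (Y _ - Y _)).
rewrite (le_trans (le_normcD _ _))// [leRHS]mulrDl addrC lerD//.
exact: wdiff_lin_bound.
Qed.

Lemma wdiff_ccont Y z p q : wdiff Y z p q -> ccont Y z.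
Proof.
move=> /wdiff_lip[M [d [M0 d0 hd]]] eps eps0.
have M1 : 0 < M + 1 by rewrite ltr_wpDl.
exists (Num.min d (eps / (M + 1))); first by rewrite lt_min d0 divr_gt0.
move=> h; rewrite lt_min => /andP[/hd a b]; apply: (le_lt_trans a).
rewrite (le_lt_trans (ler_wpM2l M0 (ltW b)))//.
by rewrite mulrCA gtr_pMr// ltr_pdivrMr// mul1r ltrDl.
Qed.

Lemma wdiff_cst c z : wdiff (fun=> c) z 0 0.
Proof.
by have := little_o0; apply: little_o_eq => h; ring.
Qed.

Lemma wdiff_id z : wdiff id z 1 0.
Proof.
by have := little_o0; apply: little_o_eq => h; ring.
Qed.

Lemma wdiffJ Y z p q : wdiff Y z p q -> wdiff (fun x => (Y x)^*) z (q^*) (p^*).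
Proof.
move=> /little_oJ; apply: little_o_eq => h.
by rewrite !(rmorphB, rmorphD, rmorphM)/= conjcK; ring.
Qed.

Lemma wdiffD Y1 Y2 z p1 q1 p2 q2 : wdiff Y1 z p1 q1 -> wdiff Y2 z p2 q2 ->
 wdiff (fun x => Y1 x + Y2 x) z (p1 + p2) (q1 + q2).
Proof.
move=> w1 w2; have := little_oD w1 w2; apply: little_o_eq => h.
by ring.
Qed.

Lemma wdiffM Y1 Y2 z p1 q1 p2 q2 : wdiff Y1 z p1 q1 -> wdiff Y2 z p2 q2 ->
 wdiff (fun x => Y1 x * Y2 x) z (p1 * Y2 z + Y1 z * p2) (q1 * Y2 z + Y1 z * q2).
Proof.
move=> w1 w2.
have [M1 [d1 [M10 d10 b1]]] := wdiff_lip w1.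
have [M2 [d2 [M20 d20 b2]]] := wdiff_lip w2.
pose E h := (Y1 (z + h) - Y1 z) * (Y2 (z + h) - Y2 z).
have oE : little_o E.
 apply: (@little_o_quad _ (M1 * M2) (Num.min d1 d2)); first by rewrite lt_min d10.
 move=> h; rewrite lt_min => /andP[/b1 a /b2 b]; rewrite /E normcM.
 rewrite (le_trans (ler_pM (normc_ge0 _) (normc_ge0 _) a b))//.
 by rewrite mulrACA expr2.
have := little_oD (little_oD (little_oZ (Y1 z) w2) (little_oZ (Y2 z) w1)) oE.
by apply: little_o_eq => h; rewrite /E; ring.
Qed.

Lemma wdiffN Y z p q : wdiff Y z p q -> wdiff (fun x => - Y x) z (- p) (- q).
Proof.
by move=> w; have := little_oN w; apply: little_o_eq => h; ring.
Qed.

Lemma wdiffB Y1 Y2 z p1 q1 p2 q2 : wdiff Y1 z p1 q1 -> wdiff Y2 z p2 q2 ->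
 wdiff (fun x => Y1 x - Y2 x) z (p1 - p2) (q1 - q2).
Proof. by move=> w1 w2; exact: wdiffD w1 (wdiffN w2). Qed.

Lemma wdiffZ c Y z p q : wdiff Y z p q ->
 wdiff (fun x => c * Y x) z (c * p) (c * q).
Proof.
by move=> w; have := little_oZ c w; apply: little_o_eq => h; ring.
Qed.

Lemma wdiffX Y z p q n : wdiff Y z p q ->
 wdiff (fun x => Y x ^+ n) z (n%:R * Y z ^+ n.-1 * p) (n%:R * Y z ^+ n.-1 * q).
Proof.
move=> w; elim: n => [|n ih].
 by rewrite !mul0r; exact: wdiff_cst.
have := wdiffM w ih; congr wdiff; first by apply/funext => x; rewrite exprS.
- by case: n {ih} => [|n]/=; rewrite ?exprS -?natr1; ring.
- by case: n {ih} => [|n]/=; rewrite ?exprS -?natr1; ring.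
Qed.

Lemma wdiff_comp (f : C -> C) Y z a p q : cdiff f (Y z) a -> wdiff Y z p q ->
 wdiff (fun x => f (Y x)) z (a * p) (a * q).
Proof.
move=> cf w; have [M [d1 [M0 d10 b1]]] := wdiff_lip w.
pose e1 k := f (Y z + k) - f (Y z) - (a * k + 0 * k^*).
have o1 : little_o (fun h => e1 (Y (z + h) - Y z)).
 move=> eps eps0; have M1 : 0 < M + 1 by rewrite ltr_wpDl.
 have [d d0 hd] := cf (eps / (M + 1)) (divr_gt0 eps0 M1).
 exists (Num.min d1 (d / (M + 1))); first by rewrite lt_min d10 divr_gt0.
 move=> h; rewrite lt_min => /andP[/b1 k1 hh].
 have kd : normc (Y (z + h) - Y z) < d.
  apply: (le_lt_trans k1); rewrite (le_lt_trans (ler_wpM2l M0 (ltW hh)))//.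
  by rewrite mulrCA gtr_pMr// ltr_pdivrMr// mul1r ltrDl.
 rewrite (le_trans (hd _ kd))// (le_trans (ler_wpM2l _ k1))//.
  by rewrite ltW// divr_gt0.
 rewrite mulrA ler_wpM2r ?normc_ge0// -mulrA ger_pMr// mulrC.
 by rewrite ler_pdivrMr// mul1r lerDl.
have := little_oD o1 (little_oZ a w); apply: little_o_eq => h.
have E : Y z + (Y (z + h) - Y z) = Y (z + h) by ring.
by rewrite /e1 E; ring.
Qed.

Lemma cdiff_comp (f g : C -> C) z a b : cdiff f (g z) a -> cdiff g z b ->
 cdiff (fun x => f (g x)) z (a * b).
Proof. by move=> cf cg; apply: (wdiff_eq (wdiff_comp cf cg)); rewrite ?mulr0. Qed.

Lemma cdiff_inv z : z != 0 -> cdiff (fun x => x^-1) z (- z^-2).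
Proof.
move=> z0; have nz : 0 < normc z by rewrite normc_gt0.
apply: (@little_o_quad _ (2 * (normc z)^-3) (normc z / 2)).
 by rewrite divr_gt0.
move=> h hh; have nzh : normc z / 2 <= normc (z + h).
 by have := normc_lb z h; lra.
have zh0 : z + h != 0 by rewrite -normc_gt0 (lt_le_trans _ nzh)// divr_gt0.
have -> : (z + h)^-1 - z^-1 - (- z^-2 * h + 0 * h^*) = h ^+ 2 * (z + h)^-1 * z^-2.
 by field; rewrite z0.
have ib : (normc (z + h))^-1 <= 2 / normc z.
 by rewrite -[leRHS]invf_div lef_pV2// posrE ?divr_gt0// normc_gt0.
rewrite !normcM !normcV !normcX.
rewrite (_ : 2 / _ * _ = normc h ^+ 2 * (2 / normc z) / normc z ^+ 2); last first.
 by field; rewrite gt_eqF.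
by rewrite ler_wpM2r ?invr_ge0 ?sqr_ge0// ler_wpM2l// sqr_ge0.
Qed.

Lemma wdiffV Y z p q : wdiff Y z p q -> Y z != 0 ->
 wdiff (fun x => (Y x)^-1) z (- p / Y z ^+ 2) (- q / Y z ^+ 2).
Proof.
move=> w y0; apply: (wdiff_eq (wdiff_comp (cdiff_inv y0) w)).
 by rewrite mulrC mulrN mulNr.
by rewrite mulrC mulrN mulNr.
Qed.

Lemma wdiff_ext Y1 Y2 z p q (d0 : R) : 0 < d0 ->
 (forall h, normc h < d0 -> Y1 (z + h) = Y2 (z + h)) ->
 wdiff Y1 z p q -> wdiff Y2 z p q.
Proof.
move=> d00 Y12; apply: (little_o_ext d00) => h /Y12 ->.
by have := Y12 0; rewrite addr0 normc0 => ->.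
Qed.

Lemma cdiffD f g z p q : cdiff f z p -> cdiff g z q ->
 cdiff (fun x => f x + g x) z (p + q).
Proof. by move=> a b; apply: (wdiff_eq (wdiffD a b)) => //; rewrite addr0. Qed.

Lemma cdiffM f g z p q : cdiff f z p -> cdiff g z q ->
 cdiff (fun x => f x * g x) z (p * g z + f z * q).
Proof.
by move=> a b; apply: (wdiff_eq (wdiffM a b)) => //; rewrite mul0r mulr0 addr0.
Qed.

Lemma cdiffV f z p : cdiff f z p -> f z != 0 ->
 cdiff (fun x => (f x)^-1) z (- p / f z ^+ 2).
Proof.
by move=> a b; apply: (wdiff_eq (wdiffV a b)) => //; rewrite oppr0 mul0r.
Qed.

Lemma cdiffX f z p n : cdiff f z p ->
 cdiff (fun x => f x ^+ n) z (n%:R * f z ^+ n.-1 * p).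
Proof. by move=> b; apply: (wdiff_eq (wdiffX n b)) => //; rewrite mulr0. Qed.

Lemma cdiffZ c f z p : cdiff f z p -> cdiff (fun x => c * f x) z (c * p).
Proof. by move=> b; apply: (wdiff_eq (wdiffZ c b)) => //; rewrite mulr0. Qed.

Lemma cdiffB f g z p q : cdiff f z p -> cdiff g z q ->
 cdiff (fun x => f x - g x) z (p - q).
Proof. by move=> a b; apply: (wdiff_eq (wdiffB a b)) => //; rewrite subr0. Qed.

Lemma cdiff_poly (p : {poly C}) z : cdiff (horner p) z (p^`()).[z].
Proof.
elim/poly_ind: p => [|p c ih].
 rewrite deriv0 horner0; have := wdiff_cst 0 z.
 by apply: wdiff_ext (@ltr01 R) _ => h _; rewrite horner0.
rewrite derivD derivM derivX derivC addr0 mulr1 hornerD hornerM hornerX.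
apply: wdiff_ext (@ltr01 R) _ (wdiff_eq
 (wdiffD (wdiffM ih (wdiff_id z)) (wdiff_cst c z)) _ _) => /=.
- by move=> h _; rewrite hornerD hornerM hornerX hornerC.
- by rewrite mulr1 addr0.
- by rewrite mul0r mulr0 !addr0.
Qed.

(** The values at h = t and h = it, t real, separate the two coefficients. *)
Lemma wdiff_uniq Y z p q p' q' : wdiff Y z p q -> wdiff Y z p' q' ->
 p = p' /\ q = q'.
Proof.
move=> w w'; have o := little_oD w (little_oN w').
have key u : normc u = 1 -> (p - p') * u + (q - q') * u^* = 0.
 move=> u1; apply/eqP; rewrite -normc_eq0 eq_le normc_ge0 andbT.
 apply/ler_addgt0Pr => e e0; rewrite add0r.
 have [d d0] := o _ e0.
 move=> /(_ ((d / 2)%:C * u)).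
 rewrite normcM u1 mulr1 normc_real gtr0_norm ?divr_gt0//.
 rewrite ltr_pdivrMr// mulr_natr mulr2n ltrDl => /(_ d0).
 rewrite (_ : _ + - _ = - ((d / 2)%:C * ((p - p') * u + (q - q') * u^*))); last first.
  by rewrite conjc_realM; ring.
 by rewrite normcN normcM normc_real gtr0_norm ?divr_gt0// mulrC ler_pM2r// divr_gt0.
have i1 : normc (0 +i* 1 : C) = 1 by rewrite /= expr0n expr1n add0r sqrtr1.
have k1 := key 1 (normc1 R); have ki := key _ i1; rewrite conjc1 !mulr1 in k1.
have E : (0 +i* 1 : C)^* = - (0 +i* 1) by apply/eqP; rewrite eq_complex/= oppr0 !eqxx.
move: ki; rewrite E mulrN -mulrBl => /eqP.
rewrite mulf_eq0 => /orP[|/eqP[] /eqP]; last by rewrite oner_eq0.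
rewrite subr_eq0 => /eqP pq; move: k1; rewrite pq -mulr2n => /eqP.
rewrite mulrn_eq0/= => /eqP q0; split; apply/eqP; rewrite -subr_eq0 ?pq q0//.
Qed.

Lemma cdiff_uniq f z p q : cdiff f z p -> cdiff f z q -> p = q.
Proof. by move=> h1 h2; have [] := wdiff_uniq h1 h2. Qed.

Lemma ccontD f g z : ccont f z -> ccont g z -> ccont (fun x => f x + g x) z.
Proof.
move=> cf cg e e0; have e20 : 0 < e / 2 by rewrite divr_gt0.
have [d1 d10 h1] := cf _ e20; have [d2 d20 h2] := cg _ e20.
exists (Num.min d1 d2); first by rewrite lt_min d10.
move=> h; rewrite lt_min => /andP[/h1 a /h2 b].
rewrite (_ : _ - _ = (f (z + h) - f z) + (g (z + h) - g z)); last by ring.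
by apply: (le_lt_trans (le_normcD _ _)); lra.
Qed.

Lemma ccont_bounded f z : ccont f z -> exists2 del : R, 0 < del &
 forall h, normc h < del -> normc (f (z + h)) <= normc (f z) + 1.
Proof.
move=> /(_ 1 ltr01)[d d0 hd]; exists d => // h /hd a.
by rewrite -(subrK (f z) (f _)) (le_trans (le_normcD _ _))// addrC lerD2l ltW.
Qed.

Lemma ccont0M f g z : ccont f z -> f z = 0 -> ccont g z ->
 ccont (fun x => f x * g x) z.
Proof.
move=> cf f0 /ccont_bounded[d2 d20 h2] e e0.
have M1 : 0 < normc (g z) + 1 by rewrite ltr_wpDl ?normc_ge0.
have [d1 d10 h1] := cf (e / (normc (g z) + 1)) (divr_gt0 e0 M1).
exists (Num.min d1 d2); first by rewrite lt_min d10.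
move=> h; rewrite lt_min => /andP[/h1 a /h2 b].
rewrite f0 mul0r subr0 normcM; rewrite f0 subr0 in a.
rewrite (le_lt_trans (ler_wpM2l (normc_ge0 _) b))//.
by rewrite -ltr_pdivlMr.
Qed.

Lemma ccont_cst c z : ccont (fun=> c) z.
Proof. exact: wdiff_ccont (wdiff_cst c z). Qed.

Lemma ccontM f g z : ccont f z -> ccont g z -> ccont (fun x => f x * g x) z.
Proof.
move=> cf cg.
have c1 : ccont (fun x => (f x - f z) * g x) z.
 apply: ccont0M => //; last by rewrite subrr.
 exact: ccontD cf (ccont_cst _ _).
have c2 : ccont (fun x => (g x - g z) * f z) z.
 apply: ccont0M (ccont_cst _ _) => //; last by rewrite subrr.
 exact: ccontD cg (ccont_cst _ _).
have := ccontD (ccontD c1 c2) (ccont_cst (f z * g z) z).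
by congr ccont; apply/funext => x; ring.
Qed.

Lemma ccontJ f z : ccont f z -> ccont (fun x => (f x)^*) z.
Proof.
by move=> cf e /cf[d d0 hd]; exists d => // h /hd; rewrite -rmorphB normcJ.
Qed.

Lemma ccont_comp f g z : ccont f (g z) -> ccont g z -> ccont (fun x => f (g x)) z.
Proof.
move=> cf cg e /cf[d d0 hd]; have [d' d'0 hd'] := cg _ d0.
exists d' => // h /hd' /hd; congr (_ < _); congr normc.
by rewrite [g z + _]addrC subrK.
Qed.

Lemma ccont_ext f g z (d0 : R) : 0 < d0 ->
 (forall h, normc h < d0 -> f (z + h) = g (z + h)) -> ccont f z -> ccont g z.
Proof.
move=> d00 fg cf e /cf[d d_0 hd]; exists (Num.min d d0); first by rewrite lt_min d_0.
move=> h; rewrite lt_min => /andP[/hd + /fg <-].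
by have := fg 0; rewrite addr0 normc0 => <-.
Qed.

(** Real functions with a Lipschitz derivative: the cutoffs are of this kind. *)
Definition quad_diff (K k : R -> R) := exists M : R, forall x h : R,
 `|K (x + h) - K x - k x * h| <= M * h ^+ 2.

Lemma wdiff_quad (K k : R -> R) (t : C -> R) z p q : quad_diff K k ->
 wdiff (fun x => (t x)%:C) z p q ->
 wdiff (fun x => (K (t x))%:C) z ((k (t z))%:C * p) ((k (t z))%:C * q).
Proof.
move=> [M hM] w; have [L [d [L0 d0 b]]] := wdiff_lip w.
have bR h : normc h < d -> `|t (z + h) - t z| <= L * normc h.
 by move=> /b; rewrite -rmorphB normc_real.
have oE : little_o (fun h => (K (t (z + h)) - K (t z)
  - k (t z) * (t (z + h) - t z))%:C).
 apply: (@little_o_quad _ (`|M| * L ^+ 2) d) => // h /bR a.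
 have := hM (t z) (t (z + h) - t z).
 rewrite [t z + _]addrC subrK normc_real => /le_trans -> //; rewrite -mulrA -exprMn.
 rewrite (le_trans (ler_wpM2r (sqr_ge0 _) (ler_norm M)))// ler_wpM2l//.
 rewrite -[leLHS]real_normK ?num_real// ler_pXn2r// nnegrE mulr_ge0//.
 exact: normc_ge0.
have := little_oD oE (little_oZ (k (t z))%:C w).
by apply: little_o_eq => h; ring.
Qed.

End Wirtinger.

(** * Integration of bounded functions of compact support over the plane *)
Section PlaneIntegral.
Variable R : realType.
Local Notation C := R[i].
Local Notation mR := (measurableTypeR R).
Local Notation mu1 := (@lebesgue_measure R).
Local Notation mu2 := (@lebesgue_measure R \x @lebesgue_measure R)%E.
Implicit Types (f g : C -> R) (z w h : C) (A U : set C).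

Definition toC (p : R * R) : C := p.1 +i* p.2.

Definition plane_open U := forall z, U z ->
 exists2 d : R, 0 < d & forall h, normc h < d -> U (z + h).

Definition plane_measurable A := measurable (toC @^-1` A : set (mR * mR)).

Definition plane_mfun f :=
 measurable_fun setT (fun p : mR * mR => f (toC p)).

Lemma open_plane_measurable U : plane_open U -> plane_measurable U.
Proof.
move=> oU; pose box (i : rat * rat * rat * rat) : set (mR * mR) :=
 `]ratr i.1.1.1, ratr i.1.1.2[%classic `*` `]ratr i.1.2, ratr i.2[%classic.
pose F i := if `[< box i `<=` toC @^-1` U >] then box i else set0.
rewrite /plane_measurable (_ : _ @^-1` _ = \bigcup_i F i).
 apply: countable_bigcupT_measurable => // i; rewrite /F; case: ifP => // _.
 by apply: measurableX; exact: measurable_itv.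
apply/seteqP; split => [[x y] /= Uz|p [i _]]; last first.
 by rewrite /F; case: asboolP => // sub /sub.
have [d d0 hd] := oU _ Uz; have e0 : 0 < d / 2 by rewrite divr_gt0.
have rat_near (t : R) : exists a b : rat,
  [/\ ratr a < t, t < ratr b, t - d / 2 < ratr a & ratr b < t + d / 2].
 have [a] := @rat_in_itvoo R (t - d / 2) t ltac:(by rewrite ltrBlDr ltrDl).
 have [b] := @rat_in_itvoo R t (t + d / 2) ltac:(by rewrite ltrDl).
 by rewrite !in_itv/= => /andP[? ?] /andP[? ?]; exists a, b.
have [a1 [b1 [ax xb ax' xb']]] := rat_near x.
have [a2 [b2 [ay yb ay' yb']]] := rat_near y.
exists (a1, b1, a2, b2) => //; rewrite /F ifT.
 by rewrite /box/=; split => /=; rewrite in_itv/= ?ax ?ay.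
apply/asboolP => -[x' y'] [/=]; rewrite !in_itv/= => /andP[x1 x2] /andP[y1 y2].
have -> : toC (x', y') = (x +i* y) + ((x' - x) +i* (y' - y)).
 by rewrite /toC/=; congr Complex; rewrite addrC subrK.
apply: hd; apply: (le_lt_trans (normc_leD _)) => /=.
rewrite [ltRHS]splitr ltrD// ltr_norml; apply/andP; split; lra.
Qed.

Definition rcont f z := forall e : R, 0 < e ->
 exists2 d : R, 0 < d & forall h, normc h < d -> `|f (z + h) - f z| < e.

Lemma plane_mfun_cont U f : plane_open U -> (forall z, U z -> rcont f z) ->
 (forall z, ~ U z -> f z = 0) -> plane_mfun f.
Proof.
move=> oU cf f0; apply: (measurability _ (RGenOpens.measurableE R)).
move=> _ [_ [a [b ->] <-]]; rewrite setTI.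
have mU := open_plane_measurable oU.
have mV : plane_measurable (U `&` [set z | a < f z < b]).
 apply: open_plane_measurable => z [Uz /= /andP[az zb]].
 have [d1 d10 h1] := oU _ Uz.
 have e0 : 0 < Num.min (f z - a) (b - f z) by rewrite lt_min !subr_gt0 az.
 have [d2 d20 h2] := cf _ Uz _ e0.
 exists (Num.min d1 d2); first by rewrite lt_min d10.
 move=> h; rewrite lt_min => /andP[/h1 u /h2]; rewrite lt_min => /andP[v w].
 split => //=; move: v w; rewrite !ltr_norml => /andP[? ?] /andP[? ?].
 by apply/andP; split; lra.
rewrite (_ : _ @^-1` _ = (toC @^-1` (U `&` [set z | a < f z < b])) `|`
  (if a < 0 < b then ~` (toC @^-1` U) else set0)).
 by apply: measurableU => //; case: ifP => // _; exact: measurableC.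
apply/seteqP; split => [p /=|p /=]; rewrite in_itv/=.
 have [Up|Up] := pselect (U (toC p)); first by left.
 by rewrite f0// => ab; right; rewrite ab.
by move=> [[]//|]; case: ifP => // ab /f0 ->.
Qed.

Lemma plane_mfun_indic A : plane_measurable A ->
 plane_mfun (fun z => (z \in A)%:R).
Proof.
move=> mA; rewrite /plane_mfun.
rewrite (_ : (fun _ => _) = (\1_(toC @^-1` A) : mR * mR -> R)).
 exact: measurable_indic.
by apply/funext => p; rewrite indicE; congr (nat_of_bool _)%:R; apply/idP/idP;
 rewrite !inE.
Qed.

Definition tame f := plane_mfun f /\ exists M : R, forall z,
 `|f z| <= M /\ (M < normc z -> f z = 0).

Lemma tame_ext f g : (forall z, f z = g z) -> tame f -> tame g.
Proof. by move=> /funext ->. Qed.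

Lemma tame0 : tame (fun=> 0).
Proof.
split; first exact: measurable_cst.
by exists 0 => z; rewrite normr0.
Qed.

Lemma tameM_bounded f g (N : R) : tame f -> plane_mfun g ->
 (forall z, `|g z| <= N) -> tame (fun z => f z * g z).
Proof.
move=> [mf [M hM]] mg hN; split; first exact: measurable_funM.
have M0 : 0 <= M := le_trans (normr_ge0 _) (hM 0).1.
have N0 : 0 <= N := le_trans (normr_ge0 _) (hN 0).
exists (M * N + M) => z; split.
 rewrite normrM (le_trans (ler_pM _ _ (hM z).1 (hN z)))//.
 by rewrite lerDl.
move=> h; rewrite (hM z).2 ?mul0r// (le_lt_trans _ h)// lerDr mulr_ge0//.
Qed.

Lemma tameD f g : tame f -> tame g -> tame (fun z => f z + g z).
Proof.
move=> [mf [M hM]] [mg [N hN]]; split; first exact: measurable_funD.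
have M0 : 0 <= M := le_trans (normr_ge0 _) (hM 0).1.
have N0 : 0 <= N := le_trans (normr_ge0 _) (hN 0).1.
exists (M + N) => z; split.
 by rewrite (le_trans (ler_normD _ _))// lerD ?(hM z).1 ?(hN z).1.
move=> h; rewrite (hM z).2 ?(hN z).2 ?addr0//; apply: (le_lt_trans _ h).
 by rewrite lerDr. by rewrite lerDl.
Qed.

Lemma tameZ (k : R) f : tame f -> tame (fun z => k * f z).
Proof.
move=> tf; apply: tame_ext (tameM_bounded (N := `|k|) tf (g := fun=> k) _ _).
- by move=> z; rewrite mulrC.
- exact: measurable_cst.
- by [].
Qed.

Lemma tameN f : tame f -> tame (fun z => - f z).
Proof. by move=> /(tameZ (-1)); apply: tame_ext => z; rewrite mulN1r. Qed.

Lemma tameB f g : tame f -> tame g -> tame (fun z => f z - g z).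
Proof. by move=> tf /tameN; exact: tameD. Qed.

Lemma tame_abs f : tame f -> tame (fun z => `|f z|).
Proof.
move=> [mf [M hM]]; split; first exact: measurableT_comp.
exists M => z; rewrite normr_id; split; first exact: (hM z).1.
by move=> /(hM z).2 ->; rewrite normr0.
Qed.

Lemma tame_restr f A : tame f -> plane_measurable A ->
 tame (fun z => f z * (z \in A)%:R).
Proof.
move=> tf mA; apply: (tameM_bounded (N := 1) tf (plane_mfun_indic mA)) => z.
by case: (_ \in _); rewrite ?normr1 ?normr0.
Qed.

Lemma tame_indic A (M : R) : plane_measurable A ->
 (forall z, A z -> normc z <= M) -> tame (fun z => (z \in A)%:R).
Proof.
move=> mA hA; split; first exact: plane_mfun_indic.
exists (`|M| + 1) => z; split.
 by case: (_ \in _); rewrite ?normr1 ?normr0 ?lerDr// addr_ge0.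
move=> h; rewrite memNset// => /hA; apply/negP; rewrite -ltNge.
by apply: le_lt_trans h; rewrite (le_trans (ler_norm _))// lerDl.
Qed.

Lemma tame_cont U f (M : R) : plane_open U -> (forall z, U z -> rcont f z) ->
 (forall z, ~ U z -> f z = 0) -> (forall z, `|f z| <= M) ->
 (forall z, U z -> normc z <= M) -> tame f.
Proof.
move=> oU cf f0 fM UM; split; first exact: plane_mfun_cont cf f0.
exists M => z; split => // Mz; apply: f0 => /UM.
by rewrite leNgt Mz.
Qed.

Definition int2 f := \int[mu2]_p f (toC p).

Definition sq (M : R) : set (mR * mR) :=
 `[- M, M]%classic `*` `[- M, M]%classic.

Lemma measurable_sq M : measurable (sq M).
Proof. by apply: measurableX; exact: measurable_itv. Qed.

Lemma mu2_rect (i j : interval R) :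
 mu2 ([set` i] `*` [set` j]) = (mu1 [set` i] * mu1 [set` j])%E.
Proof. by rewrite product_measure1E//; exact: measurable_itv. Qed.

Lemma mu2_sq_lty M : (mu2 (sq M) < +oo)%E.
Proof.
rewrite mu2_rect !lebesgue_measure_itv/=; case: ifP => _; last by rewrite mule0.
by rewrite -EFinB -EFinM ltry.
Qed.

Lemma tame_integrable f : tame f ->
 mu2.-integrable setT (EFin \o (fun p => f (toC p))).
Proof.
move=> [mf [M hM]].
have -> : (EFin \o (fun p => f (toC p))) =
  (EFin \o (fun p => f (toC p))) \_ (sq `|M|).
 apply/funext => p; rewrite patchE; case: ifPn => //=.
 rewrite notin_setE => np; rewrite (hM _).2// ltNge; apply/negP => pM.
 have pM' : normc (toC p) <= `|M| by rewrite (le_trans pM)// ler_norm.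
 apply: np; split => /=; rewrite in_itv/= -ler_norml.
  by rewrite (le_trans (normc_Re (toC p))).
 by rewrite (le_trans (normc_Im (toC p))).
apply/(integrable_mkcond _ (measurable_sq _)).
apply: measurable_bounded_integrable.
- exact: measurable_sq.
- exact: mu2_sq_lty.
- exact: measurable_funTS.
- exists M; split; first exact: num_real.
 by move=> x Mx y _ /=; rewrite (le_trans (hM _).1)// ltW.
Qed.

Lemma int2D f g : tame f -> tame g ->
 int2 (fun z => f z + g z) = int2 f + int2 g.
Proof. by move=> /tame_integrable tf /tame_integrable tg; exact: RintegralD. Qed.

Lemma int2Z (k : R) f : tame f -> int2 (fun z => k * f z) = k * int2 f.
Proof. by move=> /tame_integrable tf; exact: RintegralZl. Qed.

Lemma int2N f : tame f -> int2 (fun z => - f z) = - int2 f.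
Proof.
move=> tf; rewrite -[RHS]mulN1r -int2Z//; congr int2; apply/funext => z.
by rewrite mulN1r.
Qed.

Lemma int2B f g : tame f -> tame g ->
 int2 (fun z => f z - g z) = int2 f - int2 g.
Proof. by move=> tf tg; rewrite int2D ?int2N//; exact: tameN. Qed.

Lemma int2_le f g : tame f -> tame g -> (forall z, f z <= g z) ->
 int2 f <= int2 g.
Proof.
move=> /tame_integrable tf /tame_integrable tg fg.
by apply: le_Rintegral => // p _; exact: fg.
Qed.

Lemma int2_ge0 f : (forall z, 0 <= f z) -> 0 <= int2 f.
Proof. by move=> f0; exact: Rintegral_ge0. Qed.

Lemma int2_abs f : tame f -> `|int2 f| <= int2 (fun z => `|f z|).
Proof. by move=> /tame_integrable tf; exact: le_normr_Rintegral. Qed.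

Lemma int2_0 : int2 (fun=> 0) = 0.
Proof.
by rewrite /int2 Rintegral_cst// mul0r.
Qed.

(** ** Complex valued functions *)
Definition ctame (F : C -> C) :=
 tame (fun z => Re (F z)) /\ tame (fun z => Im (F z)).

Definition cint (F : C -> C) : C :=
 int2 (fun z => Re (F z)) +i* int2 (fun z => Im (F z)).

Lemma ctame_ext F G : (forall z, F z = G z) -> ctame F -> ctame G.
Proof. by move=> /funext ->. Qed.

Lemma cint_ext F G : (forall z, F z = G z) -> cint F = cint G.
Proof. by move=> /funext ->. Qed.

Lemma ctameD F G : ctame F -> ctame G -> ctame (fun z => F z + G z).
Proof.
move=> [a b] [c d]; split.
 by apply: tame_ext (tameD a c) => z; rewrite ReD.
by apply: tame_ext (tameD b d) => z; rewrite ImD.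
Qed.

Lemma ctameZ (k : C) F : ctame F -> ctame (fun z => k * F z).
Proof.
move=> [a b]; split.
 by apply: tame_ext (tameB (tameZ (Re k) a) (tameZ (Im k) b));
  move=> z; rewrite ReM.
by apply: tame_ext (tameD (tameZ (Re k) b) (tameZ (Im k) a));
  move=> z; rewrite ImM.
Qed.

Lemma ctameN F : ctame F -> ctame (fun z => - F z).
Proof. by move=> /(ctameZ (-1)); apply: ctame_ext => z; rewrite mulN1r. Qed.

Lemma ctameB F G : ctame F -> ctame G -> ctame (fun z => F z - G z).
Proof. by move=> tf /ctameN; exact: ctameD. Qed.

Lemma ctameJ F : ctame F -> ctame (fun z => (F z)^*).
Proof.
move=> [a b]; split; first by apply: tame_ext a => z; case: (F z).
by apply: tame_ext (tameN b) => z; case: (F z).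
Qed.

Lemma ctame_real f : tame f -> ctame (fun z => (f z)%:C).
Proof. by move=> tf; split => //; exact: tame0. Qed.

Lemma cint_real f : cint (fun z => (f z)%:C) = (int2 f)%:C.
Proof. by rewrite /cint/= int2_0. Qed.

Lemma cintD F G : ctame F -> ctame G ->
 cint (fun z => F z + G z) = cint F + cint G.
Proof.
move=> [a b] [c d]; rewrite [RHS](_ : _ = (int2 (fun z => Re (F z))
  + int2 (fun z => Re (G z))) +i* (int2 (fun z => Im (F z))
  + int2 (fun z => Im (G z))))// -!int2D//.
by congr Complex; congr int2; apply/funext => z; rewrite ?ReD ?ImD.
Qed.

Lemma cintZ (k : C) F : ctame F -> cint (fun z => k * F z) = k * cint F.
Proof.
move=> [a b]; rewrite [k * _](_ : _ = (Re k * int2 (fun z => Re (F z))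
  - Im k * int2 (fun z => Im (F z))) +i*
 (Re k * int2 (fun z => Im (F z))
  + Im k * int2 (fun z => Re (F z)))); last by case: k.
rewrite -!int2Z// -int2B -?int2D; do ?exact: tameZ.
by congr Complex; congr int2; apply/funext => z; rewrite ?ReM ?ImM.
Qed.

Lemma cintN F : ctame F -> cint (fun z => - F z) = - cint F.
Proof.
move=> tf; rewrite -[RHS]mulN1r -cintZ//; apply: cint_ext => z.
by rewrite mulN1r.
Qed.

Lemma cintB F G : ctame F -> ctame G ->
 cint (fun z => F z - G z) = cint F - cint G.
Proof. by move=> tf tg; rewrite cintD ?cintN//; exact: ctameN. Qed.

Lemma cint0 : cint (fun=> 0) = 0.
Proof. by have := cint_real (fun=> 0); rewrite int2_0. Qed.

Lemma cintJ F : ctame F -> cint (fun z => (F z)^*) = (cint F)^*.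
Proof.
move=> [a b]; rewrite /cint/= -int2N//.
by congr Complex; congr int2; apply/funext => z; case: (F z).
Qed.

Lemma cint_le F g : ctame F -> tame g -> (forall z, normc (F z) <= g z) ->
 normc (cint F) <= 2 * int2 g.
Proof.
move=> [a b] tg Fg; apply: (le_trans (normc_leD _)) => /=.
rewrite mulr_natl mulr2n lerD// (le_trans (int2_abs _))//; apply: int2_le => //;
 do ?exact: tame_abs.
 by move=> z; rewrite (le_trans (normc_Re _)).
by move=> z; rewrite (le_trans (normc_Im _)).
Qed.

Lemma ccont_Re (F : C -> C) z : ccont F z -> rcont (fun z => Re (F z)) z.
Proof.
move=> cF e /cF[d d0 hd]; exists d => // h /hd; apply: le_lt_trans.
by rewrite -ReN -ReD normc_Re.
Qed.

Lemma ccont_Im (F : C -> C) z : ccont F z -> rcont (fun z => Im (F z)) z.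
Proof.
move=> cF e /cF[d d0 hd]; exists d => // h /hd; apply: le_lt_trans.
by rewrite -ImN -ImD normc_Im.
Qed.

Lemma ctame_cont U F (M : R) : plane_open U -> (forall z, U z -> ccont F z) ->
 (forall z, ~ U z -> F z = 0) -> (forall z, normc (F z) <= M) ->
 (forall z, U z -> normc z <= M) -> ctame F.
Proof.
move=> oU cF F0 FM UM; split; apply: (@tame_cont U _ M) => //.
- by move=> z /cF; exact: ccont_Re.
- by move=> z /F0 ->.
- by move=> z; rewrite (le_trans (normc_Re _)).
- by move=> z /cF; exact: ccont_Im.
- by move=> z /F0 ->.
- by move=> z; rewrite (le_trans (normc_Im _)).
Qed.

End PlaneIntegral.

(** * The theorem of Green and Goursat *)
Section GreenGoursat.
Variable R : realType.
Local Notation C := R[i].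
Local Notation mR := (measurableTypeR R).
Local Notation mu1 := (@lebesgue_measure R).
Implicit Types (P Q c : C -> R) (z w h : C).

Definition rdiff P z (a b : R) := forall e : R, 0 < e ->
 exists2 d : R, 0 < d & forall h, normc h < d ->
 `|P (z + h) - P z - (a * Re h + b * Im h)| <= e * normc h.

Lemma wdiff_Re (Y : C -> C) z p q : wdiff Y z p q ->
 rdiff (fun z => Re (Y z)) z (Re p + Re q)
  (Im q - Im p).
Proof.
move=> wY e /wY[d d0 hd]; exists d => // h /hd; apply: le_trans.
apply: le_trans (normc_Re _); rewrite -lerN2 lerN2; apply: le_of_eq.
congr `|_|; rewrite !(ReD, ReN, ReM).
by case: (h) => h1 h2 /=; ring.
Qed.

Lemma wdiff_Im (Y : C -> C) z p q : wdiff Y z p q ->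
 rdiff (fun z => Im (Y z)) z (Im p + Im q)
  (Re p - Re q).
Proof.
move=> wY e /wY[d d0 hd]; exists d => // h /hd; apply: le_trans.
apply: le_trans (normc_Im _); apply: le_of_eq.
congr `|_|; rewrite !(ImD, ImN, ImM).
by case: (h) => h1 h2 /=; ring.
Qed.

Lemma rdiff_rcont P z a b : rdiff P z a b -> rcont P z.
Proof.
move=> /(_ 1 ltr01)[d d0 hd] e e0.
have M1 : 0 < `|a| + `|b| + 1 + 1 by have := normr_ge0 a; have := normr_ge0 b; lra.
exists (Num.min d (e / (`|a| + `|b| + 1 + 1))); first by rewrite lt_min d0 divr_gt0.
move=> h; rewrite lt_min => /andP[/hd a1 hh].
have a2 : `|a * Re h + b * Im h| <= (`|a| + `|b|) * normc h.
 rewrite (le_trans (ler_normD _ _))// !normrM mulrDl.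
 by rewrite lerD ?ler_wpM2l ?normc_Re ?normc_Im.
rewrite -(subrK (a * Re h + b * Im h) (P _ - P _)).
apply: (le_lt_trans (ler_normD _ _)); apply: (le_lt_trans (lerD a1 a2)).
rewrite -mulrDl.
move: hh; rewrite ltr_pdivlMr// => hh; apply: le_lt_trans hh.
by rewrite mulrC ler_wpM2l ?normc_ge0//; lra.
Qed.

Lemma normc_im (x : R) : normc (0 +i* x) = `|x|.
Proof. by rewrite /= expr0n/= add0r sqrtr_sqr. Qed.

Lemma rcont_x P : (forall z, rcont P z) -> forall y, continuous (fun x => P (x +i* y)).
Proof.
move=> cP y x; apply/cvgrPdist_lt => e e0.
have [d d0 hd] := cP (x +i* y) e e0.
near=> t; rewrite distrC.
have -> : t +i* y = (x +i* y) + (t - x)%:C.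
 by apply/eqP; rewrite eq_complex/= addr0 eqxx andbT; apply/eqP; ring.
apply: hd; rewrite normc_real distrC; near: t.
by apply: cvgr_dist_lt.
Unshelve. all: by end_near. Qed.

Lemma rcont_y P : (forall z, rcont P z) -> forall x, continuous (fun y => P (x +i* y)).
Proof.
move=> cP x y; apply/cvgrPdist_lt => e e0.
have [d d0 hd] := cP (x +i* y) e e0.
near=> t; rewrite distrC.
have -> : x +i* t = (x +i* y) + (0 +i* (t - y)).
 by apply/eqP; rewrite eq_complex/= addr0 eqxx/=; apply/eqP; ring.
apply: hd; rewrite normc_im distrC; near: t.
by apply: cvgr_dist_lt.
Unshelve. all: by end_near. Qed.

Definition lint (g : R -> R) a b := \int[mu1]_(x in `[a, b[) g x.

Lemma cont_integrable (g : R -> R) a b : continuous g ->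
 mu1.-integrable `[a, b[ (EFin \o g).
Proof.
move=> cg; apply: (@integrableS _ _ _ mu1 `[a, b]%classic).
- exact: measurable_itv.
- exact: measurable_itv.
- by move=> x /=; rewrite !in_itv/= => /andP[-> /ltW].
apply: continuous_compact_integrable; first exact: segment_compact.
exact: continuous_subspaceT.
Qed.

Lemma lint_split (g : R -> R) (a b d : R) : continuous g -> a <= b -> b <= d ->
 lint g a d = lint g a b + lint g b d.
Proof.
move=> cg ab bc; rewrite /lint.
have E : `[a, d[%classic = `[a, b[%classic `|` `[b, d[%classic :> set R.
 by rewrite -itv_bndbnd_setU// bnd_simp.
rewrite E Rintegral_setU//.
- by rewrite -E; exact: cont_integrable.
- apply/disj_setPS => x [/=]; rewrite !in_itv/= => /andP[_ xb] /andP[].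
 by rewrite leNgt xb.
Qed.

Lemma lint_near (g : R -> R) (a b k e : R) : continuous g -> a <= b ->
 (forall x, a <= x <= b -> `|g x - k| <= e) ->
 `|lint g a b - k * (b - a)| <= e * (b - a).
Proof.
move=> cg ab ge; have mI : measurable (`[a, b[%classic : set mR).
 exact: measurable_itv.
have len : fine (mu1 `[a, b[) = b - a.
 rewrite lebesgue_measure_itv/=; case: ifP => //.
 rewrite lte_fin; move/negbT; rewrite -leNgt => ba; rewrite /=.
 by apply/eqP; rewrite eq_sym subr_eq0 eq_le ba.
have ci (j : R) : continuous (fun _ : R => j) by move=> x; exact: cst_continuous.
have cgk : continuous (fun x => g x - k).
 by move=> x; apply: cvgB; [exact: cg|exact: ci].
have -> : lint g a b - k * (b - a) = lint (fun x => g x - k) a b.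
 rewrite /lint RintegralB//; [|exact: cont_integrable..].
 by rewrite Rintegral_cst// len.
apply: (le_trans (le_normr_Rintegral _ _)) => //; first exact: cont_integrable.
rewrite -len -Rintegral_cst//; apply: le_Rintegral => //.
- by apply: cont_integrable => x; apply: cvg_norm; exact: cgk.
- exact: cont_integrable.
- by move=> x /=; rewrite in_itv/= => /andP[? /ltW?]; apply: ge; apply/andP.
Qed.

Lemma lint0 (g : R -> R) (a b : R) : (forall x, a <= x <= b -> g x = 0) -> lint g a b = 0.
Proof.
move=> g0; rewrite /lint (@eq_Rintegral _ _ _ mu1 `[a, b[%classic (fun=> 0)).
 by rewrite Rintegral_cst ?mul0r//; exact: measurable_itv.
by move=> x; rewrite inE/= in_itv/= => /andP[? /ltW?]; rewrite g0//; apply/andP.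
Qed.

Definition rect (x0 x1 y0 y1 : R) : set C :=
 [set z | x0 <= Re z < x1 /\ y0 <= Im z < y1].

Lemma rect_pre x0 x1 y0 y1 : @toC R @^-1` rect x0 x1 y0 y1 =
 `[x0, x1[%classic `*` `[y0, y1[%classic.
Proof. by apply/seteqP; split => -[x y] /=; rewrite !in_itv. Qed.

Lemma rect_measurable x0 x1 y0 y1 : plane_measurable (rect x0 x1 y0 y1).
Proof.
by rewrite /plane_measurable rect_pre; apply: measurableX; exact: measurable_itv.
Qed.

Lemma tame_rect x0 x1 y0 y1 : tame (fun z => (z \in rect x0 x1 y0 y1)%:R : R).
Proof.
pose M := Num.max `|x0| `|x1| + Num.max `|y0| `|y1|.
apply: (@tame_indic _ _ M) => [|z [/andP[a b] /andP[c d]]].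
 exact: rect_measurable.
rewrite (le_trans (normc_leD _))// lerD// ler_norml lerNl !le_max.
- apply/andP; split; apply/orP; [left|right].
  by rewrite -normrN (le_trans _ (ler_norm _))// lerN2.
 by rewrite (le_trans (ltW b))// ler_norm.
- apply/andP; split; apply/orP; [left|right].
  by rewrite -normrN (le_trans _ (ler_norm _))// lerN2.
 by rewrite (le_trans (ltW d))// ler_norm.
Qed.

Lemma int2_rect x0 x1 y0 y1 : x0 <= x1 -> y0 <= y1 ->
 int2 (fun z => (z \in rect x0 x1 y0 y1)%:R) = (x1 - x0) * (y1 - y0).
Proof.
move=> x01 y01; rewrite /int2.
have -> : (fun p : R * R => (toC p \in rect x0 x1 y0 y1)%:R : R) =
  (cst (1 : R) \_ (`[x0, x1[%classic `*` `[y0, y1[%classic)).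
 apply/funext => p; rewrite patchE -rect_pre.
 have -> : (p \in (@toC R) @^-1` rect x0 x1 y0 y1) = (toC p \in rect x0 x1 y0 y1).
  by apply/idP/idP; rewrite !inE.
 by case: ifP.
rewrite -Rintegral_mkcond Rintegral_cst; last first.
 by apply: measurableX; exact: measurable_itv.
rewrite mul1r; transitivity (fine ((x1 - x0)%:E * (y1 - y0)%:E)%E); last by [].
congr fine; apply: (etrans (mu2_rect _ _)).
have itvE (a b : R) : a <= b -> mu1 `[a, b[ = (b - a)%:E.
 move=> ab; rewrite lebesgue_measure_itv/=; case: ifP => //.
 rewrite lte_fin; move/negbT; rewrite -leNgt => ba.
 by have -> : a = b by [apply/eqP; rewrite eq_le ab]; rewrite subrr.
by rewrite !itvE.
Qed.

Definition rint c x0 x1 y0 y1 := int2 (fun z => c z * (z \in rect x0 x1 y0 y1)%:R).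

Lemma rint_splitx c x0 x1 x2 y0 y1 : tame c -> x0 <= x1 -> x1 <= x2 ->
 rint c x0 x2 y0 y1 = rint c x0 x1 y0 y1 + rint c x1 x2 y0 y1.
Proof.
move=> tc x01 x12; rewrite /rint -int2D; do ?exact: tame_restr tc (rect_measurable _ _ _ _).
congr int2; apply/funext => z; rewrite -mulrDr -natrD; congr (_ * _%:R).
have inr (a b e d : R) : (z \in rect a b e d) =
  [&& a <= Re z, Re z < b, e <= Im z & Im z < d].
 apply/idP/idP => [|/and4P[h1 h2 h3 h4]]; rewrite inE /rect/=.
  by move=> [/andP[-> ->] /andP[-> ->]].
 by split; apply/andP.
rewrite !inr; case: (y0 <= _); rewrite ?andbF//=; case: (_ < y1); rewrite ?andbF//=.
rewrite !andbT; case: (lerP x1 (Re z)) => h.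
 by rewrite (le_trans x01 h)/=.
by rewrite (lt_le_trans h x12) !andbT addn0.
Qed.

Lemma rint_splity c x0 x1 y0 y1 y2 : tame c -> y0 <= y1 -> y1 <= y2 ->
 rint c x0 x1 y0 y2 = rint c x0 x1 y0 y1 + rint c x0 x1 y1 y2.
Proof.
move=> tc x01 x12; rewrite /rint -int2D; do ?exact: tame_restr tc (rect_measurable _ _ _ _).
congr int2; apply/funext => z; rewrite -mulrDr -natrD; congr (_ * _%:R).
have inr (a b e d : R) : (z \in rect a b e d) =
  [&& e <= Im z, Im z < d, a <= Re z & Re z < b].
 apply/idP/idP => [|/and4P[h1 h2 h3 h4]]; rewrite inE /rect/=.
  by move=> [/andP[-> ->] /andP[-> ->]].
 by split; apply/andP.
rewrite !inr; case: (x0 <= _); rewrite ?andbF//=; case: (_ < x1); rewrite ?andbF//=.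
rewrite !andbT; case: (lerP y1 (Im z)) => h.
 by rewrite (le_trans x01 h)/=.
by rewrite (lt_le_trans h x12) !andbT addn0.
Qed.

Lemma rint_near c (x0 x1 y0 y1 k e : R) : tame c -> x0 <= x1 -> y0 <= y1 -> 0 <= e ->
 (forall z, rect x0 x1 y0 y1 z -> `|c z - k| <= e) ->
 `|rint c x0 x1 y0 y1 - k * ((x1 - x0) * (y1 - y0))| <= e * ((x1 - x0) * (y1 - y0)).
Proof.
move=> tc x01 y01 e0 ce; have tr := tame_rect x0 x1 y0 y1.
have tcr := tame_restr tc (rect_measurable x0 x1 y0 y1).
rewrite -int2_rect// -!int2Z// -int2B//; last exact: tameZ.
apply: (le_trans (int2_abs _)); first exact: tameB tcr (tameZ _ tr).
apply: int2_le => [||z]; do ?exact: tameZ.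
 exact: tame_abs (tameB tcr (tameZ _ tr)).
rewrite -mulrBl; case: (boolP (z \in _)) => [|_]; rewrite ?mulr0 ?normr0//.
by rewrite inE !mulr1 => /ce.
Qed.

(** The boundary integral of [P dx + Q dy] over a rectangle, minus the integral
  of [c] inside; Green's formula says that it vanishes when c = Q_x - P_y. *)
Definition green_defect P Q c x0 x1 y0 y1 : R :=
 lint (fun x => P (x +i* y0)) x0 x1 - lint (fun x => P (x +i* y1)) x0 x1
 + lint (fun y => Q (x1 +i* y)) y0 y1 - lint (fun y => Q (x0 +i* y)) y0 y1
 - rint c x0 x1 y0 y1.

Section Goursat.
Variables (P Q c : C -> R).
Hypothesis tc : tame c.
Hypothesis cc : forall z, rcont c z.
Hypothesis dPQ : forall z, exists a1 b1 a2 b2,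
 [/\ rdiff P z a1 b1, rdiff Q z a2 b2 & c z = a2 - b1].

Let cP z : rcont P z.
Proof. by have [a [b [? [? [/rdiff_rcont]]]]] := dPQ z. Qed.
Let cQ z : rcont Q z.
Proof. by have [? [? [a [b [_ /rdiff_rcont]]]]] := dPQ z. Qed.

Local Notation Phi := (green_defect P Q c).

Lemma green_splitx x0 x1 x2 y0 y1 : x0 <= x1 -> x1 <= x2 ->
 Phi x0 x2 y0 y1 = Phi x0 x1 y0 y1 + Phi x1 x2 y0 y1.
Proof.
move=> x01 x12; rewrite /green_defect (rint_splitx _ _ tc x01 x12).
by rewrite !(lint_split (@rcont_x P cP _) x01 x12); ring.
Qed.

Lemma green_splity x0 x1 y0 y1 y2 : y0 <= y1 -> y1 <= y2 ->
 Phi x0 x1 y0 y2 = Phi x0 x1 y0 y1 + Phi x0 x1 y1 y2.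
Proof.
move=> y01 y12; rewrite /green_defect (rint_splity _ _ tc y01 y12).
by rewrite !(lint_split (@rcont_y Q cQ _) y01 y12); ring.
Qed.

Let sqPhi (q : R * R) (k : R) := Phi q.1 (q.1 + k) q.2 (q.2 + k).

Let step (q : R * R) (k : R) : 0 <= k -> exists q' : R * R,
 [/\ q.1 <= q'.1, q'.1 <= q.1 + k / 2, q.2 <= q'.2, q'.2 <= q.2 + k / 2
  & `|sqPhi q k| <= 4 * `|sqPhi q' (k / 2)|].
Proof.
move=> k0; have k20 : 0 <= k / 2 by rewrite divr_ge0.
have E : sqPhi q k = sqPhi q (k / 2) + sqPhi (q.1, q.2 + k / 2) (k / 2)
  + (sqPhi (q.1 + k / 2, q.2) (k / 2) + sqPhi (q.1 + k / 2, q.2 + k / 2) (k / 2)).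
 rewrite /sqPhi/=; have E2 (a : R) : a + k = a + k / 2 + k / 2.
  by rewrite -addrA -splitr.
 rewrite [q.1 + k]E2 [q.2 + k]E2 (@green_splitx q.1 (q.1 + k / 2)) ?lerDl//.
 rewrite (@green_splity q.1 (q.1 + k / 2) q.2 (q.2 + k / 2)) ?lerDl//.
 by rewrite (@green_splity (q.1 + k / 2) _ q.2 (q.2 + k / 2)) ?lerDl.
apply: contrapT => nex; have big q' : q.1 <= q'.1 -> q'.1 <= q.1 + k / 2 ->
  q.2 <= q'.2 -> q'.2 <= q.2 + k / 2 -> 4 * `|sqPhi q' (k / 2)| < `|sqPhi q k|.
 by move=> a b a' b'; rewrite ltNge; apply/negP => ?; apply: nex; exists q'.
have b1 := big q; have b2 := big (q.1, q.2 + k / 2).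
have b3 := big (q.1 + k / 2, q.2); have b4 := big (q.1 + k / 2, q.2 + k / 2).
move: b1 b2 b3 b4; rewrite /= !lexx !lerDl !k20.
move=> /(_ isT isT isT isT) b1 /(_ isT isT isT isT) b2.
move=> /(_ isT isT isT isT) b3 /(_ isT isT isT isT) b4.
have : `|sqPhi q k| <= `|sqPhi q (k / 2)| + `|sqPhi (q.1, q.2 + k / 2) (k / 2)|
  + (`|sqPhi (q.1 + k / 2, q.2) (k / 2)|
    + `|sqPhi (q.1 + k / 2, q.2 + k / 2) (k / 2)|).
 by rewrite {1}E (le_trans (ler_normD _ _))// lerD// ler_normD.
by move=> b5; clear -b1 b2 b3 b4 b5; lra.
Qed.

(** The affine parts of [P] and [Q] at [p] satisfy the formula exactly, and what remains is
 small on the boundary of the square. *)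
Let local_bound (p : C) (e : R) : 0 < e -> exists2 d : R, 0 < d &
 forall q k, 0 <= k -> k < d -> q.1 <= Re p <= q.1 + k ->
  q.2 <= Im p <= q.2 + k -> `|sqPhi q k| <= e * k ^+ 2.
Proof.
move=> e0; have [a1 [b1 [a2 [b2 [dP dQ cE]]]]] := dPQ p.
have e90 : 0 < e / 9 by rewrite divr_gt0.
have [d1 d10 h1] := dP _ e90; have [d2 d20 h2] := dQ _ e90.
have [d3 d30 h3] := cc p e90.
pose d := Num.min (Num.min d1 d2) d3 / 2.
have d0 : 0 < d by rewrite divr_gt0// !lt_min d10 d20.
exists d => // q k k0 kd /andP[px0 px1] /andP[py0 py1].
have near z : q.1 <= Re z <= q.1 + k -> q.2 <= Im z <= q.2 + k ->
  normc (z - p) <= 2 * k.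
 move=> /andP[zx0 zx1] /andP[zy0 zy1]; apply: (le_trans (normc_leD _)).
 rewrite ReD ReN ImD ImN mulr_natl mulr2n lerD// ler_norml.
  by apply/andP; split; lra.
 by apply/andP; split; lra.
have nearP (g : C -> R) (a b d' : R) : rdiff g p a b -> (forall h, normc h < d' ->
   `|g (p + h) - g p - (a * Re h + b * Im h)| <= e / 9 * normc h) ->
  2 * k < d' -> forall z, normc (z - p) <= 2 * k ->
  `|g z - g p - (a * Re (z - p) + b * Im (z - p))| <= e / 9 * (2 * k).
 move=> _ hg kd' z zp; have := hg (z - p); rewrite [p + _]addrC subrK.
 move=> /(_ (le_lt_trans zp kd'))/le_trans; apply.
 by rewrite ler_wpM2l// ltW.
have [k1 k2 k3] : [/\ 2 * k < d1, 2 * k < d2 & 2 * k < d3].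
 move: kd; rewrite /d ltr_pdivlMr// !lt_min => /andP[/andP[]].
 by rewrite mulrC; split.
have {}h1 := nearP _ _ _ _ dP h1 k1; have {}h2 := nearP _ _ _ _ dQ h2 k2.
have qk1 : q.1 <= q.1 + k by rewrite lerDl.
have qk2 : q.2 <= q.2 + k by rewrite lerDl.
have L1 : `|lint (fun x => P (x +i* q.2) - P (x +i* (q.2 + k))) q.1 (q.1 + k)
   - (- b1 * k) * (q.1 + k - q.1)| <= (e / 9 * (2 * k) *+ 2) * (q.1 + k - q.1).
 apply: lint_near => //.
  by move=> x; apply: cvgB; exact: (@rcont_x P cP).
 move=> x xq.
 have n1 := h1 (x +i* q.2) (near (x +i* q.2) xq ltac:(by rewrite /= lexx qk2)).
 have n2 := h1 (x +i* (q.2 + k)) (near (x +i* (q.2 + k)) xq ltac:(by rewrite /= lexx qk2)).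
 rewrite mulr2n; apply: le_trans (lerD n1 n2).
 apply: le_trans (ler_normB _ _); apply: le_of_eq.
 by congr `|_|; rewrite !(ReD, ImD, ReN, ImN)/=; ring.
have L2 : `|lint (fun y => Q ((q.1 + k) +i* y) - Q (q.1 +i* y)) q.2 (q.2 + k)
   - (a2 * k) * (q.2 + k - q.2)| <= (e / 9 * (2 * k) *+ 2) * (q.2 + k - q.2).
 apply: lint_near => //.
  by move=> x; apply: cvgB; exact: (@rcont_y Q cQ).
 move=> x xq.
 have n1 := h2 ((q.1 + k) +i* x) (near ((q.1 + k) +i* x) ltac:(by rewrite /= lexx qk1) xq).
 have n2 := h2 (q.1 +i* x) (near (q.1 +i* x) ltac:(by rewrite /= lexx qk1) xq).
 rewrite mulr2n; apply: le_trans (lerD n1 n2).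
 apply: le_trans (ler_normB _ _); apply: le_of_eq.
 by congr `|_|; rewrite !(ReD, ImD, ReN, ImN)/=; ring.
have L3 := @rint_near c q.1 (q.1 + k) q.2 (q.2 + k) (c p) (e / 9) tc qk1 qk2 (ltW e90).
have {}L3 : `|rint c q.1 (q.1 + k) q.2 (q.2 + k) - c p * ((q.1 + k - q.1) * (q.2 + k - q.2))|
  <= e / 9 * ((q.1 + k - q.1) * (q.2 + k - q.2)).
 apply: L3 => z [/andP[zx0 /ltW zx1] /andP[zy0 /ltW zy1]].
 have := h3 (z - p); rewrite [p + _]addrC subrK => h; apply/ltW/h.
 apply: le_lt_trans k3; apply: near; first by rewrite zx0.
 by rewrite zy0.
have LB1 : lint (fun x => P (x +i* q.2) - P (x +i* (q.2 + k))) q.1 (q.1 + k) =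
  lint (fun x => P (x +i* q.2)) q.1 (q.1 + k) - lint (fun x => P (x +i* (q.2 + k))) q.1 (q.1 + k).
 by rewrite /lint RintegralB//; apply: cont_integrable; exact: (@rcont_x P cP).
have LB2 : lint (fun y => Q ((q.1 + k) +i* y) - Q (q.1 +i* y)) q.2 (q.2 + k) =
  lint (fun y => Q ((q.1 + k) +i* y)) q.2 (q.2 + k) - lint (fun y => Q (q.1 +i* y)) q.2 (q.2 + k).
 by rewrite /lint RintegralB//; apply: cont_integrable; exact: (@rcont_y Q cQ).
rewrite /sqPhi /green_defect.
move: L1 L2 L3; rewrite LB1 LB2 cE.
set A := lint _ _ _; set B := lint _ _ _; set D := lint _ _ _; set E := lint _ _ _.
set F := rint _ _ _ _ _; rewrite !(addrAC _ k) !subrr !add0r => L1 L2 L3.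
rewrite (_ : A - B + D - E - F = (A - B - - b1 * k * k) + (D - E - a2 * k * k)
  - (F - (a2 - b1) * (k * k))); last by ring.
rewrite (le_trans (ler_normB _ _))//.
rewrite (le_trans (lerD (ler_normD _ _) (lexx _)))//.
rewrite (le_trans (lerD (lerD L1 L2) L3))//; apply: le_of_eq.
by field.
Qed.

(** Bisection as in the Cauchy-Goursat theorem: some quarter carries at least a quarter of
 the defect, and the defect of a square of side k is o(k^2). *)
Lemma green_square x y k : 0 < k -> Phi x (x + k) y (y + k) = 0.
Proof.
move=> k0.
have ex (q : R * R) (j : R) : {q' : R * R | 0 <= j ->
 [/\ q.1 <= q'.1, q'.1 <= q.1 + j / 2, q.2 <= q'.2, q'.2 <= q.2 + j / 2
  & `|sqPhi q j| <= 4 * `|sqPhi q' (j / 2)|]}.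
 apply: cid; have [j0|j0] := pselect (0 <= j); last by exists q.
 by have [q' H] := step q j0; exists q'.
pose nxt q j := sval (ex q j).
pose kn n : R := k / 2 ^+ n.
pose fix qs n : R * R := if n is n'.+1 then nxt (qs n') (kn n') else (x, y).
have kn0 n : 0 < kn n by rewrite divr_gt0// exprn_gt0.
have knS n : kn n.+1 = kn n / 2.
 by rewrite /kn exprSr invfM mulrA.
have qsP n : [/\ (qs n).1 <= (qs n.+1).1, (qs n.+1).1 + kn n.+1 <= (qs n).1 + kn n,
  (qs n).2 <= (qs n.+1).2, (qs n.+1).2 + kn n.+1 <= (qs n).2 + kn n
  & `|sqPhi (qs n) (kn n)| <= 4 * `|sqPhi (qs n.+1) (kn n.+1)|].
 have [a b a' b' d] := svalP (ex (qs n) (kn n)) (ltW (kn0 n)).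
 rewrite /= -/(nxt (qs n) (kn n)) in a b a' b' d *; rewrite knS; split => //.
  by clear -b; lra.
 by clear -b'; lra.
have mono n m : (qs n).1 <= (qs (n + m)%N).1 /\ (qs n).2 <= (qs (n + m)%N).2.
 elim: m => [|m [i1 i2]]; first by rewrite addn0.
 rewrite addnS; have [a _ b _ _] := qsP (n + m)%N.
 by split; [exact: le_trans i1 a|exact: le_trans i2 b].
have monoR n m : (qs (n + m)%N).1 + kn (n + m)%N <= (qs n).1 + kn n /\
  (qs (n + m)%N).2 + kn (n + m)%N <= (qs n).2 + kn n.
 elim: m => [|m [i1 i2]]; first by rewrite addn0.
 rewrite addnS; have [_ a _ b _] := qsP (n + m)%N.
 by split; [exact: le_trans a i1|exact: le_trans b i2].
have cross n m : (qs n).1 <= (qs m).1 + kn m /\ (qs n).2 <= (qs m).2 + kn m.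
 have [nm|/ltnW mn] := leqP n m.
  have := mono n (m - n)%N; rewrite subnKC// => -[a b].
  by split; [apply: (le_trans a)|apply: (le_trans b)]; rewrite lerDl ltW.
 have := monoR m (n - m)%N; rewrite subnKC// => -[a b].
 by split; [apply: le_trans a|apply: le_trans b]; rewrite lerDl ltW.
pose X := [set (qs n).1 | n in [set: nat]].
pose Y := [set (qs n).2 | n in [set: nat]].
have X0 : X !=set0 by exists (qs 0%N).1, 0%N.
have Y0 : Y !=set0 by exists (qs 0%N).2, 0%N.
have ubX m : ubound X ((qs m).1 + kn m) by move=> _ [n _ <-]; exact: (cross n m).1.
have ubY m : ubound Y ((qs m).2 + kn m) by move=> _ [n _ <-]; exact: (cross n m).2.
have inX m : (qs m).1 <= sup X <= (qs m).1 + kn m.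
 apply/andP; split; first by apply: ub_le_sup; [exists ((qs 0%N).1 + kn 0%N)|exists m].
 exact: ge_sup.
have inY m : (qs m).2 <= sup Y <= (qs m).2 + kn m.
 apply/andP; split; first by apply: ub_le_sup; [exists ((qs 0%N).2 + kn 0%N)|exists m].
 exact: ge_sup.
have grow n : `|sqPhi (x, y) k| <= 4 ^+ n * `|sqPhi (qs n) (kn n)|.
 elim: n => [|n ih]; first by rewrite mul1r /kn expr0 divr1.
 apply: (le_trans ih); rewrite exprSr -mulrA ler_wpM2l ?exprn_ge0//.
 by have [] := qsP n.
apply/eqP; rewrite -normr_eq0 eq_le normr_ge0 andbT; apply/ler_addgt0Pr => e e0.
rewrite add0r -[leLHS]/(`|sqPhi (x, y) k|).
have e'0 : 0 < e / k ^+ 2 by rewrite divr_gt0// exprn_gt0.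
have [d d0 hd] := local_bound (sup X +i* sup Y) e'0.
have [n nd] : exists n, kn n < d.
 have [n hn] : exists n : nat, k / d < n%:R.
  by exists (Num.bound (k / d)); rewrite archi_boundP// divr_ge0// ltW.
 exists n; rewrite /kn ltr_pdivrMr ?exprn_gt0// mulrC -ltr_pdivrMr//.
 apply: (lt_le_trans hn); rewrite -natrX ler_nat.
 by rewrite ltnW// ltn_expl.
apply: (le_trans (grow n)).
rewrite (le_trans (ler_wpM2l _ (hd _ _ (ltW (kn0 n)) nd (inX n) (inY n))))//.
rewrite /kn; apply: le_of_eq.
rewrite (_ : 4 = 2 ^+ 2); last by ring.
by rewrite -exprM mulnC exprM; field; rewrite !gt_eqF ?exprn_gt0.
Qed.

Lemma green_compact (M : R) : (forall z, M <= normc z -> P z = 0) ->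
 (forall z, M <= normc z -> Q z = 0) -> (forall z, M <= normc z -> c z = 0) ->
 int2 c = 0.
Proof.
move=> P0 Q0 c0; pose N := `|M| + 1.
have N0 : 0 < N by rewrite ltr_wpDl.
have MN : M <= N by rewrite (le_trans (ler_norm _))// lerDl.
have x_big (x y : R) : N <= `|x| -> M <= normc (x +i* y).
 by move=> h; rewrite (le_trans MN)// (le_trans h)// (normc_Re (x +i* y)).
have y_big (x y : R) : N <= `|y| -> M <= normc (x +i* y).
 by move=> h; rewrite (le_trans MN)// (le_trans h)// (normc_Im (x +i* y)).
have NN : - N + (N + N) = N by ring.
have aN : N <= `|N| by exact: ler_norm.
have aN' : N <= `|- N| by rewrite normrN.
have := @green_square (- N) (- N) (N + N) (addr_gt0 N0 N0).
rewrite /green_defect NN !lint0 ?subrr ?add0r ?subr0; first last.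
- by move=> x _; rewrite P0// y_big.
- by move=> x _; rewrite P0// y_big.
- by move=> x _; rewrite Q0// x_big.
- by move=> x _; rewrite Q0// x_big.
move/eqP; rewrite oppr0 add0r oppr_eq0 => /eqP; rewrite /rint => <-.
congr int2; apply/funext => z; case: (boolP (z \in _)) => [|]; first by rewrite mulr1.
rewrite notin_setE mulr0 => nz; apply: c0; rewrite leNgt; apply/negP => zM.
have zN : normc z < N by apply: lt_le_trans MN.
have := le_lt_trans (normc_Re z) zN; have := le_lt_trans (normc_Im z) zN.
rewrite !ltr_norml => /andP[/ltW a b] /andP[/ltW a' b'].
by apply: nz; split; apply/andP.
Qed.

End Goursat.

(** Only the continuity of the derivative with respect to the conjugate variable is asked, so
 that the formula applies to a function holomorphic on the support of a cutoff without
 knowing that complex derivatives are continuous. *)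
Theorem cint_dbar (Y q : C -> C) (M : R) :
 (forall z, exists p, wdiff Y z p (q z)) -> (forall z, ccont q z) ->
 (forall z, M <= normc z -> Y z = 0) -> ctame q -> cint q = 0.
Proof.
move=> dY cq Y0 [tq1 tq2]; have q0 z : M < normc z -> q z = 0.
 move=> Mz; have [p wY] := dY z.
 have w0 : wdiff Y z 0 0.
  apply: (wdiff_ext (d0 := normc z - M)) (wdiff_cst 0 z) => [|h hh].
   by rewrite subr_gt0.
  by symmetry; apply: Y0; have := normc_lb z h; lra.
 by have [_] := wdiff_uniq wY w0.
have half (f : C -> R) : tame f -> int2 (fun z => 2 * f z) = 0 -> int2 f = 0.
 by move=> tf /eqP; rewrite int2Z// mulf_eq0 pnatr_eq0/= => /eqP.
have Y0' z : M + 1 <= normc z -> Y z = 0.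
 by move=> h; apply: Y0; apply: le_trans h; rewrite lerDl.
have q0' z : M + 1 <= normc z -> q z = 0.
 by move=> h; apply: q0; apply: lt_le_trans h; rewrite ltrDl.
rewrite /cint; congr Complex.
- apply: half => //; apply: (@green_compact (fun z => Im (Y z))
  (fun z => Re (Y z)) _ _ _ _ (M + 1)).
 + exact: tameZ.
 + have c2 z : ccont (fun z => 2 * q z) z by apply: ccontM => //; exact: ccont_cst.
  move=> z e /(ccont_Re (c2 z))[d d0 hd]; exists d => // h /hd.
  by rewrite !mulr_natl !mulr2n !ReD.
 + move=> z; have [p wY] := dY z; do 4 eexists; split.
  * exact: wdiff_Im wY.
  * exact: wdiff_Re wY.
  * by ring.
 + by move=> z /Y0' ->.
 + by move=> z /Y0' ->.
 + by move=> z /q0' ->; rewrite mulr0.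
- apply: half => //; apply: (@green_compact (fun z => - Re (Y z))
  (fun z => Im (Y z)) _ _ _ _ (M + 1)).
 + exact: tameZ.
 + have c2 z : ccont (fun z => 2 * q z) z by apply: ccontM => //; exact: ccont_cst.
  move=> z e /(ccont_Im (c2 z))[d d0 hd]; exists d => // h /hd.
  by rewrite !mulr_natl !mulr2n !ImD.
 + move=> z; have [p wY] := dY z; do 4 eexists; split.
  * have := wdiff_Re (wdiffN wY); rewrite /rdiff => H e /H[d d0 hd].
   by exists d => // h /hd; rewrite !ReN; exact: id.
  * exact: wdiff_Im wY.
  * by rewrite !ImN; ring.
 + by move=> z /Y0' ->; rewrite oppr0.
 + by move=> z /Y0' ->.
 + by move=> z /q0' ->; rewrite mulr0.
Qed.

End GreenGoursat.

(** * Cutoff functions *)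
Section Cutoff.
Variable R : realType.
Local Notation C := R[i].
Implicit Types (x t : R).

Definition pos x : R := Num.max 0 x.

Lemma pos_le0 x : x <= 0 -> pos x = 0. Proof. by move=> h; apply/max_idPl. Qed.
Lemma pos_id x : 0 <= x -> pos x = x. Proof. by move=> h; apply/max_idPr. Qed.

Lemma pos_lip x y : `|pos x - pos y| <= `|x - y|.
Proof.
have h1 := ler_norm (x - y); have h2 := ler_norm (y - x); rewrite distrC in h2.
have [x0|x0] := leP x 0; have [y0|y0] := leP y 0.
- by rewrite !pos_le0// subrr normr0.
- by rewrite (pos_le0 x0) (pos_id (ltW y0)) sub0r normrN (gtr0_norm y0); lra.
- by rewrite (pos_le0 y0) (pos_id (ltW x0)) subr0 (gtr0_norm x0); lra.
- by rewrite (pos_id (ltW x0)) (pos_id (ltW y0)).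
Qed.

Lemma quad_pos2 : quad_diff (fun x => pos x ^+ 2) (fun x => 2 * pos x).
Proof.
exists 1 => x h; rewrite mul1r.
have [x0|x0] := leP x 0; have [y0|y0] := leP (x + h) 0.
- by rewrite !pos_le0// mulr0 mul0r expr0n/= !subr0 normr0 sqr_ge0.
- rewrite (pos_le0 x0) (pos_id (ltW y0)) mulr0 mul0r expr0n/= !subr0.
 rewrite ger0_norm ?sqr_ge0//; nra.
- rewrite (pos_le0 y0) (pos_id (ltW x0)) expr0n/= sub0r ger0_norm; nra.
- rewrite (pos_id (ltW x0)) (pos_id (ltW y0)) (_ : _ - _ - _ = h ^+ 2); last by ring.
 by rewrite ger0_norm ?sqr_ge0.
Qed.

(** A step from 0 to 1 between 0 and 1, piecewise quadratic. *)
Definition step x := 2 * pos x ^+ 2 - 4 * pos (x - 2^-1) ^+ 2 + 2 * pos (x - 1) ^+ 2.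
Definition dstep x := 4 * pos x - 8 * pos (x - 2^-1) + 4 * pos (x - 1).

Lemma quad_step : quad_diff step dstep.
Proof.
have [M hM] := quad_pos2; exists (2 * M + 4 * M + 2 * M) => x h.
have h1 := hM x h; have h2 := hM (x - 2^-1) h; have h3 := hM (x - 1) h.
rewrite /step /dstep; rewrite (_ : _ - _ - _ = 2 *
 (pos (x + h) ^+ 2 - pos x ^+ 2 - 2 * pos x * h) - 4 *
 (pos (x - 2^-1 + h) ^+ 2 - pos (x - 2^-1) ^+ 2 - 2 * pos (x - 2^-1) * h) + 2 *
 (pos (x - 1 + h) ^+ 2 - pos (x - 1) ^+ 2 - 2 * pos (x - 1) * h)); last first.
 by rewrite -!(addrAC x h); ring.
rewrite (_ : (_ + _) * _ = 2 * (M * h ^+ 2) + 4 * (M * h ^+ 2) + 2 * (M * h ^+ 2));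
 last by ring.
rewrite (le_trans (ler_normD _ _))// lerD//.
 rewrite (le_trans (ler_normB _ _))// lerD//.
  by rewrite normrM ger0_norm// ler_wpM2l.
 by rewrite normrM ger0_norm// ler_wpM2l.
by rewrite normrM ger0_norm// ler_wpM2l.
Qed.

Lemma step0 x : x <= 0 -> step x = 0.
Proof. by move=> x0; rewrite /step !pos_le0; lra. Qed.

Lemma step1 x : 1 <= x -> step x = 1.
Proof. by move=> x0; rewrite /step !pos_id; [field|lra..]. Qed.

Lemma dstep0 x : x <= 0 -> dstep x = 0.
Proof. by move=> x0; rewrite /dstep !pos_le0; lra. Qed.

Lemma dstep1 x : 1 <= x -> dstep x = 0.
Proof. by move=> x0; rewrite /dstep !pos_id; [field|lra..]. Qed.

Lemma dstep_ge0 x : 0 <= dstep x.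
Proof.
have [x0|x0] := leP x 0; first by rewrite dstep0.
have [x1|x1] := leP 1 x; first by rewrite dstep1.
rewrite /dstep (pos_id (ltW x0)) (@pos_le0 (x - 1)); last by lra.
have [x2|x2] := leP x 2^-1; [rewrite pos_le0|rewrite pos_id]; lra.
Qed.

Lemma dstep_le2 x : dstep x <= 2.
Proof.
have [x0|x0] := leP x 0; first by rewrite dstep0.
have [x1|x1] := leP 1 x; first by rewrite dstep1.
rewrite /dstep (pos_id (ltW x0)) (@pos_le0 (x - 1)); last by lra.
have [x2|x2] := leP x 2^-1; [rewrite pos_le0|rewrite pos_id]; lra.
Qed.

Lemma dstep_ge1 x : 4^-1 <= x -> x <= 3 / 4 -> 1 <= dstep x.
Proof.
move=> x0 x1; rewrite /dstep (@pos_id x) ?(@pos_le0 (x - 1)); [|lra..].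
have [x2|x2] := leP x 2^-1; [rewrite pos_le0|rewrite pos_id]; lra.
Qed.

Lemma step_01 x : 0 <= step x <= 1.
Proof.
have [x0|x0] := leP x 0; first by rewrite step0// lexx ler01.
have [x1|x1] := leP 1 x; first by rewrite step1// lexx ler01.
rewrite /step (pos_id (ltW x0)) (@pos_le0 (x - 1)); last by lra.
have [x2|x2] := leP x 2^-1; [rewrite pos_le0|rewrite pos_id]; try lra.
 by apply/andP; split; nra.
by apply/andP; split; nra.
Qed.

Lemma dstep_lip x y : `|dstep x - dstep y| <= 16 * `|x - y|.
Proof.
have h1 := pos_lip x y; have h2 := pos_lip (x - 2^-1) (y - 2^-1).
have h3 := pos_lip (x - 1) (y - 1).
have E (a : R) : x - a - (y - a) = x - y by ring.
rewrite !E in h2 h3; rewrite /dstep.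
rewrite (_ : _ - _ = 4 * (pos x - pos y) - 8 * (pos (x - 2^-1) - pos (y - 2^-1))
 + 4 * (pos (x - 1) - pos (y - 1))); last by ring.
rewrite (le_trans (ler_normD _ _))//.
rewrite (_ : 16 * _ = 4 * `|x - y| + 8 * `|x - y| + 4 * `|x - y|); last by ring.
rewrite lerD//; last by rewrite normrM ger0_norm// ler_wpM2l.
rewrite (le_trans (ler_normB _ _))// lerD//.
 by rewrite normrM ger0_norm// ler_wpM2l.
by rewrite normrM ger0_norm// ler_wpM2l.
Qed.

Lemma quad_affine (K k : R -> R) (a b : R) : quad_diff K k ->
 quad_diff (fun t => K (a * t + b)) (fun t => a * k (a * t + b)).
Proof.
move=> [M hM]; exists (M * a ^+ 2) => x h.
have := hM (a * x + b) (a * h).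
rewrite (_ : M * _ = M * a ^+ 2 * h ^+ 2); last by ring.
rewrite (_ : k _ * _ = a * k (a * x + b) * h); last by ring.
by rewrite (_ : a * x + b + _ = a * (x + h) + b); last by ring.
Qed.

Lemma wdiff_modulus2 (a z : C) :
 wdiff (fun z => (normc (z - a) ^+ 2)%:C) z (z - a)^* (z - a).
Proof.
have w : wdiff (fun z => z - a) z 1 0.
 by apply: (wdiff_eq (wdiffB (wdiff_id z) (wdiff_cst a z))); rewrite subr0.
apply: (wdiff_ext (@ltr01 R) _ (wdiff_eq (wdiffM w (wdiffJ w)) _ _)).
- by move=> h _; rewrite mul_conjc.
- by rewrite conjc0; ring.
- by rewrite conjc1; ring.
Qed.

End Cutoff.

(** * Continuous functions on compact sets of the plane *)
Section Compactness.
Variable R : realType.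
Local Notation C := R[i].

Lemma rcont_toC (f : C -> R) (p : R * R) : rcont f (toC p) ->
 {for p, continuous (fun p => f (toC p))}.
Proof.
move=> cf; apply/cvgrPdist_lt => e e0; have [d d0 hd] := cf e e0.
have d20 : 0 < d / 2 by rewrite divr_gt0.
exists (ball p.1 (d / 2), ball p.2 (d / 2)); first by split; exact: nbhsx_ballx.
move=> [x y] [/=]; rewrite /ball/= distrC => px; rewrite distrC => py.
rewrite distrC.
have -> : toC (x, y) = toC p + ((x - p.1) +i* (y - p.2)).
 by apply/eqP; rewrite eq_complex/=; apply/andP; split; apply/eqP; ring.
apply: hd; apply: (le_lt_trans (normc_leD _)) => /=.
by rewrite [ltRHS]splitr ltrD.
Qed.

Lemma plane_EVT (f : C -> R) (K : set C) (M : R) : plane_open (~` K) ->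
 (forall z, K z -> normc z <= M) -> K !=set0 ->
 (forall z, K z -> rcont f z) -> exists2 c, K c & forall z, K z -> f z <= f c.
Proof.
move=> oK bK [z0 Kz0] cf; pose A := @toC R @^-1` K.
have cA : compact A.
 apply: (@subclosed_compact _ A (`[- M, M]%classic `*` `[- M, M]%classic)).
 - rewrite -[A]setCK; apply: open_closedC.
  rewrite openE => p np; have [d d0 hd] := oK (toC p) np.
  have d20 : 0 < d / 2 by rewrite divr_gt0.
  exists (ball p.1 (d / 2), ball p.2 (d / 2)); first by split; exact: nbhsx_ballx.
  move=> [x y] [/=]; rewrite /ball/= distrC => px; rewrite distrC => py.
  have E : toC (x, y) = toC p + ((x - p.1) +i* (y - p.2)).
   by apply/eqP; rewrite eq_complex/=; apply/andP; split; apply/eqP; ring.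
  rewrite /A/= E; apply: hd; apply: (le_lt_trans (normc_leD _)) => /=.
  by rewrite [ltRHS]splitr ltrD.
 - by apply: compact_setX; exact: segment_compact.
 - move=> [x y] /bK h; split; rewrite /= in_itv/= -ler_norml.
   by rewrite (le_trans _ h)// (normc_Re (x +i* y)).
  by rewrite (le_trans _ h)// (normc_Im (x +i* y)).
have A0 : A !=set0 by exists (Re z0, Im z0); rewrite /A/= /toC; case: z0 Kz0.
have [|c cin cmax] := @compact_EVT_max _ R (fun p => f (toC p)) A A0 cA.
 by apply: continuous_in_subspaceT => p /set_mem Ap; apply: rcont_toC; exact: cf.
exists (toC c); first exact: set_mem cin.
move=> z Kz; have := cmax (Re z, Im z); rewrite /toC.
by case: z Kz => a b Kz /=; apply; exact: mem_set.
Qed.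

Lemma rcont_normc (f : C -> C) z : ccont f z -> rcont (fun z => normc (f z)) z.
Proof.
move=> cf e /cf[d d0 hd]; exists d => // h /hd; apply: le_lt_trans.
rewrite ler_norml; apply/andP; split.
 have := normc_lb (f z) (f (z + h) - f z).
 by rewrite [f z + _]addrC subrK; lra.
by have := le_normcD (f z) (f (z + h) - f z); rewrite [f z + _]addrC subrK; lra.
Qed.

Lemma closed_disc_closed (a : C) (d : R) : plane_open (~` [set z | normc (z - a) <= d]).
Proof.
move=> z /= /negP; rewrite -ltNge => dz; exists (normc (z - a) - d).
 by rewrite subr_gt0.
move=> h hh; apply/negP; rewrite -ltNge.
by have := normc_lb (z - a) h; rewrite addrAC; lra.
Qed.

Lemma ball_bound (a z : C) (d : R) : normc (z - a) <= d -> normc z <= d + normc a.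
Proof.
by move=> h; rewrite -[z](subrK a) (le_trans (le_normcD _ _))// lerD2r.
Qed.

Lemma ctame_compact (F : C -> C) (M : R) : (forall z, ccont F z) ->
 (forall z, M <= normc z -> F z = 0) -> ctame F.
Proof.
move=> cF F0.
have [|z /= h|||c _ hc] := @plane_EVT (fun z => normc (F z))
 [set z | normc (z - 0) <= `|M|] `|M|.
- exact: closed_disc_closed.
- by move: h; rewrite subr0.
- by exists 0; have : normc (0 - 0 : C) <= `|M| by rewrite subrr normc0.
- by move=> z _; apply: rcont_normc.
pose N := Num.max (`|M| + 1) (normc (F c)).
apply: (@ctame_cont _ [set z | normc z < `|M| + 1] _ N).
- move=> z /= zM; exists (`|M| + 1 - normc z); first by rewrite subr_gt0.
 by move=> h hh /=; have := le_normcD z h; lra.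
- by [].
- move=> z /= /negP; rewrite -leNgt => h; apply: F0; apply: le_trans h.
 by rewrite (le_trans (ler_norm _))// lerDl.
- move=> z; rewrite /N le_max; have [h|h] := leP (normc z) `|M|.
  by rewrite hc ?orbT//= subr0.
 rewrite F0 ?normc0; last by rewrite (le_trans (ler_norm _))// ltW.
 by rewrite addr_ge0.
- by move=> z /= /ltW h; rewrite /N le_max h.
Qed.

Lemma sphere_closed (a : C) (d : R) : plane_open (~` [set z | normc (z - a) = d]).
Proof.
move=> z /= /eqP ne.
exists `|normc (z - a) - d|; first by rewrite normr_gt0 subr_eq0.
move=> h hh e.
move: hh; rewrite -e ltNge => /negP; apply.
rewrite addrAC distrC; have l1 := normc_lb (z - a) h; have l2 := le_normcD (z - a) h.
by rewrite ler_norml; apply/andP; split; lra.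
Qed.

End Compactness.

(** * Cutoffs in the modulus of a holomorphic function *)
Section ModulusCutoff.
Variable R : realType.
Local Notation C := R[i].
Implicit Types (z w h : C) (f : C -> C).

Lemma wdiff_sqmod1 f z p : cdiff f z p ->
 wdiff (fun z => (normc (f z) ^+ 2)%:C) z (p * (f z)^*) (f z * p^*).
Proof.
move=> df; have d := wdiffM df (wdiffJ df).
apply: (wdiff_ext (@ltr01 R) (Y1 := fun z => f z * (f z)^*)) => [h _|].
 by rewrite mul_conjc.
have c0 : (0 : C)^* = 0 by exact: rmorph0.
by apply: (wdiff_eq d); rewrite ?c0 ?mulr0 ?mul0r ?addr0 ?add0r.
Qed.

Lemma wdiff_sqmod (K k : R -> R) f z p : quad_diff K k -> cdiff f z p ->
 wdiff (fun z => (K (normc (f z) ^+ 2))%:C) z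
  ((k (normc (f z) ^+ 2))%:C * (p * (f z)^*)) ((k (normc (f z) ^+ 2))%:C * (f z * p^*)).
Proof. by move=> qK df; apply: wdiff_quad qK (wdiff_sqmod1 df). Qed.

Lemma wdiff_near0 (Y : C -> C) z (d : R) : 0 < d ->
 (forall h, normc h < d -> Y (z + h) = 0) -> wdiff Y z 0 0.
Proof.
move=> d0 h0; apply: (wdiff_ext d0 (Y1 := fun=> 0)) (wdiff_cst 0 z) => h hd.
by rewrite h0.
Qed.

Lemma ccont_near0 (Y : C -> C) z (d : R) : 0 < d ->
 (forall h, normc h < d -> Y (z + h) = 0) -> ccont Y z.
Proof. by move=> d0 h0; apply: wdiff_ccont (wdiff_near0 d0 h0). Qed.

Lemma rcont_lip (k : R -> R) (t : C -> R) z (M : R) : 0 < M ->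
 (forall x y, `|k x - k y| <= M * `|x - y|) -> rcont t z -> ccont (fun z => (k (t z))%:C) z.
Proof.
move=> M0 lk ct e e0; have [d d0 hd] := ct _ (divr_gt0 e0 M0).
exists d => // h /hd; rewrite -rmorphB normc_real ltr_pdivlMr// mulrC.
by apply: le_lt_trans.
Qed.

Lemma dstep_affine_lip (a b x y : R) : 0 < a ->
 `|dstep (a * x + b) - dstep (a * y + b)| <= (16 * a) * `|x - y|.
Proof.
move=> a0; apply: (le_trans (dstep_lip _ _)); rewrite opprD addrACA subrr addr0 -mulrBr.
by rewrite normrM (gtr0_norm a0) mulrA.
Qed.

Lemma rcont_sqmod f z : ccont f z -> rcont (fun z => normc (f z) ^+ 2) z.
Proof.
move=> cf e e0; have c2 : ccont (fun z => f z * (f z)^*) z by apply: ccontM (ccontJ cf).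
have [d d0 hd] := c2 e e0; exists d => // h /hd.
by rewrite !mul_conjc -rmorphB normc_real.
Qed.

Lemma rcont_lt (t : C -> R) z (T : R) : rcont t z -> t z < T ->
 exists2 d : R, 0 < d & forall h, normc h < d -> t (z + h) < T.
Proof.
move=> ct; rewrite -subr_gt0 => /ct[d d0 hd]; exists d => // h /hd.
by rewrite ltr_norml => /andP[_]; rewrite ltrD2r.
Qed.

Lemma rcont_gt (t : C -> R) z (T : R) : rcont t z -> T < t z ->
 exists2 d : R, 0 < d & forall h, normc h < d -> T < t (z + h).
Proof.
move=> ct; rewrite -subr_gt0 => /ct[d d0 hd]; exists d => // h /hd.
by rewrite ltr_norml => /andP[+ _]; rewrite opprB ltrD2r.
Qed.

(** The affine rescalings of the cutoff: [stepA] passes from 0 to 1 between [t0] and [t1]. *)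
Variables (t0 t1 : R).
Hypothesis t01 : t0 < t1.
Let a : R := (t1 - t0)^-1.
Let a0 : 0 < a. Proof. by rewrite invr_gt0 subr_gt0. Qed.

Definition stepA (t : R) : R := step ((t1 - t0)^-1 * t + - (t0 / (t1 - t0))).
Definition dstepA (t : R) : R := (t1 - t0)^-1 * dstep ((t1 - t0)^-1 * t + - (t0 / (t1 - t0))).

Lemma stepA_arg t : (t1 - t0)^-1 * t + - (t0 / (t1 - t0)) = (t - t0) / (t1 - t0).
Proof. by rewrite mulrBl mulrC. Qed.

Lemma quad_stepA : quad_diff stepA dstepA.
Proof. exact: quad_affine (@quad_step R). Qed.

Lemma stepA_lt t : t <= t0 -> stepA t = 0 /\ dstepA t = 0.
Proof.
move=> tt0; have n : (t - t0) / (t1 - t0) <= 0.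
 by rewrite pmulr_lle0 ?invr_gt0 ?subr_gt0// subr_le0.
by rewrite /stepA /dstepA stepA_arg step0// dstep0// mulr0.
Qed.

Lemma stepA_gt t : t1 <= t -> stepA t = 1 /\ dstepA t = 0.
Proof.
move=> tt1; have n : 1 <= (t - t0) / (t1 - t0).
 by rewrite ler_pdivlMr ?subr_gt0// mul1r lerD2r.
by rewrite /stepA /dstepA stepA_arg step1// dstep1// mulr0.
Qed.

Lemma stepA_01 t : 0 <= stepA t <= 1. Proof. exact: step_01. Qed.
Lemma dstepA_ge0 t : 0 <= dstepA t. Proof. by rewrite mulr_ge0 ?dstep_ge0// ltW. Qed.
Lemma dstepA_le t : dstepA t <= 2 / (t1 - t0).
Proof. by rewrite /dstepA mulrC ler_wpM2r ?dstep_le2// ltW. Qed.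

Lemma ccont_dstepA (t : C -> R) z : rcont t z -> ccont (fun z => (dstepA (t z))%:C) z.
Proof.
move=> ct; apply: (rcont_lip (k := dstepA) (M := a * (16 * a))) ct => [|x y].
 by rewrite !mulr_gt0.
by rewrite /dstepA -mulrBr normrM (gtr0_norm a0) -mulrA ler_wpM2l ?(ltW a0)// dstep_affine_lip.
Qed.

Lemma ccont_radial z : ccont (fun z => (dstepA (normc z ^+ 2))%:C) z.
Proof.
apply: (ccont_dstepA (t := fun z : C => normc z ^+ 2)).
exact: (rcont_sqmod (wdiff_ccont (wdiff_id z))).
Qed.

Lemma tame_radial : tame (fun z => dstepA (normc z ^+ 2)).
Proof.
suff : ctame (fun z => (dstepA (normc z ^+ 2))%:C) by case.
apply: (ctame_compact (M := Num.max 1 t1)) => [z|z]; first exact: ccont_radial.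
rewrite ge_max => /andP[z1 zt]; rewrite (stepA_gt (le_trans zt _)).2//.
by rewrite expr2 ler_peMr ?normc_ge0.
Qed.

(** The logarithmic derivative f'/f, cut off near the zeros of [f]. *)
Lemma wdiff_log_pole f f' z p : 0 < t0 -> cdiff f z (f' z) -> cdiff f' z p ->
 exists p', wdiff (fun z => (stepA (normc (f z) ^+ 2))%:C * (f' z / f z)) z p'
  ((dstepA (normc (f z) ^+ 2) * normc (f' z) ^+ 2)%:C).
Proof.
move=> t00 df df'; have [f0|f0] := eqVneq (f z) 0.
 have z0 : normc (f z) ^+ 2 < t0 by rewrite f0 normc0 expr0n.
 have [d d0 hd] := rcont_lt (rcont_sqmod (wdiff_ccont df)) z0.
 exists 0; have := wdiff_near0 (Y := fun z => (stepA (normc (f z) ^+ 2))%:C * (f' z / f z)) d0.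
 rewrite (stepA_lt (ltW z0)).2 mul0r; apply => h /hd/ltW/stepA_lt[-> _].
 by rewrite mul0r.
have d1 := wdiff_sqmod quad_stepA df; have d2 := cdiffM df' (cdiffV df f0).
have d3 := wdiffM d1 d2; eexists; apply: (wdiff_eq d3) => //.
rewrite mulr0 addr0 (rmorphM _ (dstepA _)) /= -(mul_conjc (f' z)).
move: ((dstepA _)%:C) => k; move: (f z) (f' z) ((f' z)^*) f0 => x y y' x0; by field.
Qed.

End ModulusCutoff.

(** * The mean value property and the maximum principle *)
Section MeanValue.
Variable R : realType.
Local Notation C := R[i].
Implicit Types (f : C -> C) (a z : C) (T : R).

Definition sqdist a z : R := normc (z - a) ^+ 2.

(** Radial cutoffs centred at [a]: averaging against [mweight] plays the role of a circle
 mean, but requires area integrals only. *)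
Definition mweight a T z : R := dstepA (T / 2) T (sqdist a z).
Definition mcut a T z : R := stepA (T / 2) T (sqdist a z).

Lemma half_lt T : 0 < T -> T / 2 < T. Proof. by move=> T0; lra. Qed.

Lemma sqdist_ge0 a z : 0 <= sqdist a z. Proof. by rewrite sqr_ge0. Qed.

Lemma wdiff_mcut a T z : wdiff (fun z => (mcut a T z)%:C) z
 ((mweight a T z)%:C * (z - a)^*) ((mweight a T z)%:C * (z - a)).
Proof.
exact: (wdiff_quad (@quad_stepA R _ _) (wdiff_modulus2 a z)).
Qed.

Lemma mcut_small a T z : 0 < T -> sqdist a z <= T / 2 ->
 mcut a T z = 0 /\ mweight a T z = 0.
Proof. by move=> T0; exact: stepA_lt (half_lt T0) _. Qed.

Lemma mcut_large a T z : 0 < T -> T <= sqdist a z ->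
 mcut a T z = 1 /\ mweight a T z = 0.
Proof. by move=> T0; exact: stepA_gt (half_lt T0) _. Qed.

Lemma mweight_ge0 a T z : 0 < T -> 0 <= mweight a T z.
Proof. by move=> T0; exact: dstepA_ge0 (half_lt T0) _. Qed.

Lemma rcont_sqdist a z : rcont (sqdist a) z.
Proof. exact: (rcont_sqmod (wdiff_ccont (wdiffB (wdiff_id z) (wdiff_cst a z)))). Qed.

Lemma ccont_mweight a T z : 0 < T -> ccont (fun z => (mweight a T z)%:C) z.
Proof. by move=> T0; exact: (ccont_dstepA (half_lt T0) (@rcont_sqdist a z)). Qed.

Lemma bounded_sqdist a z (T : R) : sqdist a z < T -> normc z < T + 1 + normc a.
Proof.
move=> h; rewrite -[z](subrK a) (le_lt_trans (le_normcD _ _))// ltrD2r.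
by have : 0 <= (normc (z - a) - 1) ^+ 2 by [rewrite sqr_ge0]; move: h;
 rewrite /sqdist; have := normc_ge0 (z - a); nra.
Qed.

Section MV.
Variables (f : C -> C) (a : C) (d : R).
Hypothesis df : forall z, 0 < sqdist a z -> sqdist a z < d -> exists p, cdiff f z p.

Let fW T z := f z * (mweight a T z)%:C.

Lemma mweight_ctame T : 0 < T -> T < d -> ctame (fW T).
Proof.
move=> T0 Td; apply: (@ctame_compact _ _ (d + 1 + normc a)).
 move=> z; have [z0|z0] := leP (sqdist a z) 0.
  have [|e e0 he] := rcont_lt (@rcont_sqdist a z) (T := (T / 2)).
   by rewrite (le_lt_trans z0)// divr_gt0.
  apply: (ccont_ext e0 _ (ccont_cst 0 z)) => h /he /ltW /(mcut_small T0)[_].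
  by rewrite /fW => ->; rewrite mulr0.
 have [zd|dz] := ltP (sqdist a z) d.
  have [p /wdiff_ccont cf] := df z0 zd.
  exact: ccontM cf (ccont_mweight a z T0).
 have [|e e0 he] := rcont_gt (@rcont_sqdist a z) (T := T); first by rewrite (lt_le_trans Td).
 apply: (ccont_ext e0 _ (ccont_cst 0 z)) => h /he /ltW /(mcut_large T0)[_].
 by rewrite /fW => ->; rewrite mulr0.
move=> z hz; rewrite /fW (mcut_large T0 _).2 ?mulr0// leNgt; apply/negP => zT.
by have := bounded_sqdist (lt_trans zT Td); rewrite ltNge hz.
Qed.

(** The difference of the integrands is the conjugate derivative of
 f(z) (mcut T - mcut T') / (z - a), which has compact support and vanishes near [a]. *)
Lemma mean_radius T T' : 0 < T -> T < d -> 0 < T' -> T' < d ->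
 cint (fW T) = cint (fW T').
Proof.
move=> T0 Td T'0 T'd; apply/eqP; rewrite -subr_eq0.
rewrite -cintB; [|exact: mweight_ctame..]; apply/eqP.
pose Y z := f z * ((mcut a T z)%:C - (mcut a T' z)%:C) / (z - a).
have Tm0 : 0 < Num.min T T' / 2 by rewrite divr_gt0// lt_min T0.
have TMd : Num.max T T' < d by rewrite gt_max Td.
have Ysmall z : sqdist a z <= Num.min T T' / 2 -> Y z = 0 /\ fW T z - fW T' z = 0.
 move=> h; have h1 : sqdist a z <= T / 2.
  by rewrite (le_trans h)// ler_pM2r// ge_min lexx.
 have h2 : sqdist a z <= T' / 2.
  by rewrite (le_trans h)// ler_pM2r// ge_min lexx orbT.
 have [a1 a2] := mcut_small T0 h1; have [b1 b2] := mcut_small T'0 h2.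
 by rewrite /Y /fW a1 a2 b1 b2 !(subrr, mulr0, mul0r).
have Ylarge z : Num.max T T' <= sqdist a z -> Y z = 0 /\ fW T z - fW T' z = 0.
 move=> h; have h1 : T <= sqdist a z by rewrite (le_trans _ h)// le_max lexx.
 have h2 : T' <= sqdist a z by rewrite (le_trans _ h)// le_max lexx orbT.
 have [a1 a2] := mcut_large T0 h1; have [b1 b2] := mcut_large T'0 h2.
 by rewrite /Y /fW a1 a2 b1 b2 !(subrr, mulr0, mul0r).
have cfW z : ccont (fun z => fW T z - fW T' z) z.
 have [z0|z0] := leP (sqdist a z) 0.
  have [|e e0 he] := rcont_lt (@rcont_sqdist a z) (T := (Num.min T T' / 2)); first exact: le_lt_trans Tm0.
  by apply: (ccont_ext e0 _ (ccont_cst 0 z)) => h /he /ltW /Ysmall[_ ->].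
 have [zd|dz] := ltP (sqdist a z) d.
  have [p /wdiff_ccont cf] := df z0 zd.
  have c1 t (t0 : 0 < t) : ccont (fW t) z := ccontM cf (ccont_mweight a z t0).
  have c2 := ccontM (ccont_cst (-1) z) (c1 T' T'0).
  have := ccontD (c1 T T0) c2; congr ccont; apply/funext => w.
  by rewrite mulN1r.
 have [|e e0 he] := rcont_gt (@rcont_sqdist a z) (T := (Num.max T T')); first exact: lt_le_trans dz.
 by apply: (ccont_ext e0 _ (ccont_cst 0 z)) => h /he /ltW /Ylarge[_ ->].
have big z : d + 1 + normc a <= normc z -> Num.max T T' <= sqdist a z.
 move=> hz; rewrite leNgt; apply/negP => zT.
 by have := bounded_sqdist (lt_trans zT TMd); rewrite ltNge hz.
apply: (@cint_dbar _ Y _ (d + 1 + normc a)) => //.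
- move=> z; have [z0|z0] := leP (sqdist a z) 0.
  have [|e e0 he] := rcont_lt (@rcont_sqdist a z) (T := (Num.min T T' / 2)); first exact: le_lt_trans Tm0.
  exists 0; rewrite (Ysmall z _).2; last by rewrite (le_trans z0)// ltW.
  by apply: (wdiff_ext e0 _ (wdiff_cst 0 z)) => h /he /ltW /Ysmall[->].
 have [zd|dz] := ltP (sqdist a z) d.
  have [p df'] := df z0 zd.
  have za : z - a != 0.
   by apply/eqP => e; move: z0; rewrite /sqdist e normc0 expr0n ltxx.
  have w1 := wdiffB (wdiff_mcut a T z) (wdiff_mcut a T' z).
  have w2 := wdiffV (wdiffB (wdiff_id z) (wdiff_cst a z)) za.
  have := wdiffM (wdiffM df' w1) w2.
  set p' := (X in wdiff _ _ X _); set q' := (X in wdiff _ _ _ X) => w.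
  exists p'; apply: (wdiff_eq w) => //.
  by rewrite /q' /fW; field.
 have [|e e0 he] := rcont_gt (@rcont_sqdist a z) (T := (Num.max T T')); first exact: lt_le_trans dz.
 exists 0; rewrite (Ylarge z _).2; last by rewrite ltW// (lt_le_trans TMd).
 by apply: (wdiff_ext e0 _ (wdiff_cst 0 z)) => h /he /ltW /Ylarge[->].
- by move=> z /big /Ylarge[->].
- by apply: ctameB; exact: mweight_ctame.
Qed.

End MV.

Definition mconst a : R := int2 (mweight a 8).

Lemma mweight_tame a T : 0 < T -> tame (mweight a T).
Proof.
move=> T0; have dc z : 0 < sqdist a z -> sqdist a z < T + 1 ->
  exists p, cdiff (fun=> 1) z p by move=> _ _; exists 0; exact: wdiff_cst.
have T1 : T < T + 1 by rewrite ltrDl.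
have [tt _] := mweight_ctame dc T0 T1.
by apply: tame_ext tt => z; rewrite mul1r.
Qed.

Lemma mconstE a T : 0 < T -> int2 (mweight a T) = mconst a.
Proof.
move=> T0; have E t : cint (fun z => 1 * (mweight a t z)%:C) = (int2 (mweight a t))%:C.
 by rewrite -cint_real; apply: cint_ext => z; rewrite mul1r.
have dc z : 0 < sqdist a z -> sqdist a z < Num.max T 8 + 1 ->
  exists p, cdiff (fun=> 1) z p by move=> _ _; exists 0; exact: wdiff_cst.
have T1 : T < Num.max T 8 + 1 by rewrite ltr_pwDr// le_max lexx.
have T2 : 8 < Num.max T 8 + 1 by rewrite ltr_pwDr// le_max lexx orbT.
have := mean_radius dc T0 T1 (ltr0n _ 8) T2; rewrite !E; exact: complexI.
Qed.

Lemma mconst_ge a : 40^-1 <= mconst a.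
Proof.
pose r := rect (Re a + 23 / 10) (Re a + 25 / 10)
 (Im a) (Im a + 2^-1).
have : int2 (fun z => 4^-1 * (z \in r)%:R) <= mconst a.
 apply: int2_le => [||z].
 - by apply: tameZ; exact: tame_rect.
 - exact: mweight_tame.
 - case: (boolP (z \in r)) => [|_]; last by rewrite mulr0 mweight_ge0.
  rewrite inE mulr1 => -[/andP[x0 x1] /andP[y0 y1]].
  have t0 : 5 <= sqdist a z <= 7.
   rewrite /sqdist normc_sqr !(ReD, ImD, ReN, ImN).
   by apply/andP; split; nra.
  case/andP: t0 => t0 t1; rewrite /mweight /dstepA (_ : 8 - 8 / 2 = 4); last by lra.
  have : 1 <= dstep (4^-1 * sqdist a z + - (8 / 2 / 4)) by apply: dstep_ge1; lra.
  by move: (dstep _) => q q1; lra.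
apply: le_trans; rewrite int2Z; last exact: tame_rect.
rewrite int2_rect ?lerDl//; last by lra.
by rewrite !(addrAC _ _ (- _)) subrr; lra.
Qed.

Lemma mconst_gt0 a : 0 < mconst a.
Proof. by apply: lt_le_trans (mconst_ge a); rewrite invr_gt0. Qed.

Lemma mean_value f a d T :
 (forall z, 0 < sqdist a z -> sqdist a z < d -> exists p, cdiff f z p) ->
 ccont f a -> 0 < T -> T < d ->
 cint (fun z => f z * (mweight a T z)%:C) = f a * (mconst a)%:C.
Proof.
move=> df cf T0 Td; apply/eqP; rewrite -subr_eq0 -normc_eq0 eq_le normc_ge0 andbT.
apply/ler_addgt0Pr => e e0; rewrite add0r.
have K0 : 0 < 2 * mconst a by rewrite mulr_gt0// mconst_gt0.
have [r r0 hr] := cf _ (divr_gt0 e0 K0).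
pose T' := Num.min T (r ^+ 2) / 2.
have T'0 : 0 < T' by rewrite divr_gt0// lt_min T0 exprn_gt0.
have T'T : T' < T.
 by rewrite ltr_pdivrMr// gt_min mulr_natr mulr2n ltrDl T0.
have T'r : T' < r ^+ 2.
 by rewrite ltr_pdivrMr// gt_min mulr_natr mulr2n ltrDl exprn_gt0// orbT.
rewrite (mean_radius df T0 Td T'0 (lt_trans T'T Td)) -(mconstE a T'0) -cint_real.
have tW : ctame (fun z => (mweight a T' z)%:C) by apply: ctame_real; exact: mweight_tame.
rewrite -cintZ// -cintB; last 2 first.
- exact: mweight_ctame (lt_trans T'T Td).
- exact: ctameZ.
have tg : tame (fun z => e / (2 * mconst a) * mweight a T' z).
 by apply: tameZ; exact: mweight_tame.
apply: (le_trans (cint_le _ tg _)).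
- apply: ctameB; last exact: ctameZ.
 exact: mweight_ctame (lt_trans T'T Td).
- move=> z; rewrite -mulrBl normcM normc_real ger0_norm ?mweight_ge0//.
 have [zT|zT] := leP T' (sqdist a z); first by rewrite (mcut_large T'0 zT).2 !mulr0.
 rewrite ler_wpM2r ?mweight_ge0// ltW//.
 have -> : z = a + (z - a) by rewrite addrC subrK.
 apply: hr; rewrite -(@ltr_pXn2r _ 2) ?nnegrE ?normc_ge0// ?ltW//.
 exact: lt_trans T'r.
- rewrite int2Z; last exact: mweight_tame.
 rewrite mconstE//; apply: le_of_eq; field.
 by rewrite gt_eqF// mconst_gt0.
Qed.

(** At an interior maximum of |f|^2 + eps |z - a|^2 the averages against [mweight] contradict
 the mean value property. One exceptional point [c] is allowed, for difference quotients. *)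
Theorem max_modulus f a c (d M : R) : 0 < d ->
 (forall z, normc (z - a) <= d -> ccont f z) ->
 (forall z, normc (z - a) < d -> z != c -> exists p, cdiff f z p) ->
 (forall z, normc (z - a) = d -> normc (f z) <= M) ->
 forall z, normc (z - a) <= d -> normc (f z) <= M.
Proof.
move=> d0 cf df bd z0 z0d; rewrite leNgt; apply/negP => Mz0.
have M0 : 0 <= M by rewrite (le_trans (normc_ge0 _) (bd (a + d%:C) _))//
 addrAC subrr add0r normc_real ger0_norm// ltW.
pose eps := (normc (f z0) ^+ 2 - M ^+ 2) / (2 * d ^+ 2).
have gap : 0 < normc (f z0) ^+ 2 - M ^+ 2.
 by rewrite subr_gt0 ltr_pXn2r// nnegrE normc_ge0.
have eps0 : 0 < eps by rewrite divr_gt0// mulr_gt0// exprn_gt0.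
pose h z := normc (f z) ^+ 2 + eps * sqdist a z.
have ch z : normc (z - a) <= d -> rcont h z.
 move=> /cf cz; have c1 := ccontM cz (ccontJ cz).
 have c2 := ccontM (ccont_cst eps%:C z) (wdiff_ccont (wdiff_modulus2 a z)).
 have := ccont_Re (ccontD c1 c2); congr rcont; apply/funext => w.
 by rewrite mul_conjc -rmorphM -rmorphD.
have [z /= zd|||p pd pmax] := @plane_EVT _ h [set z | normc (z - a) <= d] (d + normc a)
  (@closed_disc_closed R a d).
- exact: ball_bound.
- by exists a; rewrite /= subrr normc0 ltW.
- by [].
have pin : normc (p - a) < d.
 rewrite lt_neqAle pd andbT; apply/eqP => pe.
 have : h z0 <= h p by exact: pmax.
 have b1 : normc (f p) ^+ 2 <= M ^+ 2 by rewrite ler_pXn2r// ?nnegrE ?normc_ge0// bd.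
 have b2 : eps * d ^+ 2 = (normc (f z0) ^+ 2 - M ^+ 2) / 2.
  by rewrite /eps; field; rewrite gt_eqF.
 have b3 : 0 <= eps * sqdist a z0 by rewrite mulr_ge0 ?sqdist_ge0// ltW.
 by rewrite /h {2}/sqdist pe; lra.
(* a radius on which [f] is differentiable, except perhaps at [p] *)
have [r r0 [rd rc]] : exists2 r : R, 0 < r & r <= d - normc (p - a) /\
  (forall z, z != p -> normc (z - p) < r -> z != c).
 have [pc|pc] := eqVneq p c.
  exists (d - normc (p - a)); first by rewrite subr_gt0.
  by split => // z; rewrite pc.
 exists (Num.min (d - normc (p - a)) (normc (c - p))).
  by rewrite lt_min subr_gt0 pin normc_gt0 subr_eq0 eq_sym.
 split; first by rewrite ge_min lexx.
 by move=> z _; rewrite lt_min => /andP[_ +]; apply: contraTneq => ->; rewrite ltxx.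
have inr z : sqdist p z < r ^+ 2 -> normc (z - p) < r.
 by rewrite ltr_pXn2r// ?nnegrE ?normc_ge0// ltW.
have ind z : normc (z - p) < r -> normc (z - a) < d.
 move=> hz; rewrite (_ : z - a = (z - p) + (p - a)); last by ring.
 by apply: (le_lt_trans (le_normcD _ _)); lra.
have dfp z : 0 < sqdist p z -> sqdist p z < r ^+ 2 -> exists q, cdiff f z q.
 move=> zp /inr zr; apply: df; first exact: ind.
 by apply: rc zr; apply: contraTneq zp => ->; rewrite /sqdist subrr normc0 expr0n ltxx.
pose T := r ^+ 2 / 2.
have T0 : 0 < T by rewrite divr_gt0// exprn_gt0.
have Tr : T < r ^+ 2 by rewrite ltr_pdivrMr// mulr_natr mulr2n ltrDl exprn_gt0.
pose G z := (f p)^* * (f z - f p) + eps%:C * (p - a)^* * (z - p).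
have dG z : 0 < sqdist p z -> sqdist p z < r ^+ 2 -> exists q, cdiff G z q.
 move=> z1 z2; have [q dq] := dfp z z1 z2; eexists.
 apply: cdiffD; first by apply: cdiffZ; exact: cdiffB dq (wdiff_cst _ _).
 by apply: cdiffZ; exact: cdiffB (wdiff_id _) (wdiff_cst _ _).
have cG : ccont G p.
 apply: ccontD; apply: ccontM; do ?exact: ccont_cst.
  by apply: ccontD (ccont_cst _ _); apply: cf; exact: ltW.
 exact: wdiff_ccont (wdiffB (wdiff_id _) (wdiff_cst _ _)).
have := mean_value dG cG T0 Tr.
rewrite {2}/G !subrr !mulr0 addr0 mul0r => G0.
have tG := mweight_ctame dG T0 Tr.
have tW := mweight_tame p T0.
have : int2 (fun z => 2 * Re (G z * (mweight p T z)%:C) + eps * (T / 2) * mweight p T z) <= int2 (fun=> 0).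
 apply: int2_le => [||z].
 - by apply: tameD; apply: tameZ => //; case: tG.
 - exact: tame0.
 - have [zT|zT] := leP T (sqdist p z).
   by rewrite (mcut_large T0 zT).2 !mulr0 addr0.
  have [Tz|Tz] := leP (sqdist p z) (T / 2).
   by rewrite (mcut_small T0 Tz).2 !mulr0 addr0.
  rewrite ReM/= mulr0 subr0 mulrA -mulrDl mulr_le0_ge0 ?mweight_ge0//.
  have hz : h z <= h p by apply: pmax => /=; apply/ltW/ind/inr; exact: lt_trans Tr.
  have E1 := Re_mul_conj (f p) (f z - f p); rewrite [f p + _]addrC subrK in E1.
  have E2 := Re_mul_conj (p - a) (z - p).
  rewrite (_ : p - a + (z - p) = z - a) in E2; last by ring.
  have s1 : 0 <= normc (f z - f p) ^+ 2 by exact: sqr_ge0.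
  have ER : Re (G z) = Re ((f p)^* * (f z - f p))
    + eps * Re ((p - a)^* * (z - p)).
   by rewrite /G ReD -mulrA [Re (eps%:C * _)]ReM/= mul0r subr0.
  move: hz; rewrite /h /sqdist E1 E2 ER.
  have : eps * (T / 2) <= eps * normc (z - p) ^+ 2 by rewrite ler_wpM2l// ltW.
  by rewrite !mulrDr; lra.
rewrite int2_0 int2D; [|apply: tameZ; by [case: tG]|exact: tameZ].
have tR : tame (fun z => Re (G z * (mweight p T z)%:C)) by case: tG.
rewrite (int2Z 2 tR) (int2Z (eps * (T / 2)) tW).
move: G0; rewrite /cint => -[-> _]; rewrite mulr0 add0r mconstE// leNgt.
by rewrite mulr_gt0 ?mconst_gt0// mulr_gt0// divr_gt0.
Qed.

End MeanValue.

(** * Injective holomorphic functions and the Schwarz lemma *)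
Section Injective.
Variable R : realType.
Local Notation C := R[i].
Implicit Types (f g : C -> C) (a b z w : C) (d M : R).

Lemma is_derive_segment f (u a h : C) (t : R) (p : C) : cdiff f (a + t%:C * h) p ->
 is_derive t 1 (fun t : R => Re (u * f (a + t%:C * h)))
  (Re (u * p * h)).
Proof.
move=> df; set g := (fun _ => _).
have cv : (fun k : R => k^-1 *: (g (k *: 1 + t) - g t)) @ 0^' -->
  (Re (u * p * h) : R).
 apply/cvgrPdist_le => e e0.
 pose M := (normc u + 1) * (normc h + 1).
 have M0 : 0 < M by rewrite mulr_gt0// ltr_wpDl// normc_ge0.
 have [d d0 hd] := df _ (divr_gt0 e0 M0).
 have h1 : 0 < normc h + 1 by rewrite ltr_wpDl// normc_ge0.
 near=> k.
 have k0 : k != 0 by near: k; exact: nbhs_dnbhs_neq.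
 have kd : `|k| < d / (normc h + 1).
  near: k; apply: dnbhs0_lt; exact: divr_gt0.
 have khd : normc (k%:C * h) < d.
  rewrite normcM normc_real (le_lt_trans (ler_wpM2l _ (_ : _ <= normc h + 1)))//.
   by rewrite lerDl.
  by rewrite -ltr_pdivlMr.
 have := hd _ khd; rewrite mul0r addr0 => H.
 rewrite distrC /g.
 have -> : k *: 1 + t = t + k by rewrite addrC -[k *: 1]/(k * 1) mulr1.
 rewrite rmorphD mulrDl addrA.
 rewrite (_ : _ - _ = k^-1 * Re (u * (f (a + t%:C * h + k%:C * h) -
   f (a + t%:C * h) - p * (k%:C * h)))); last first.
  rewrite !(ReM, ReD, ReN, ImM, ImD, ImN)/= -[_ *: _]/(_ * _); field; exact: k0.
 rewrite normrM normfV ler_pdivrMl ?normr_gt0//.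
 rewrite (le_trans (normc_Re _))// normcM (le_trans (ler_wpM2l (normc_ge0 _) H))//.
 rewrite normcM normc_real.
 rewrite (_ : _ * _ = (`|k| * e) * (normc u * normc h / M)); last by ring.
 rewrite ler_piMr ?mulr_ge0 ?(ltW e0)// ler_pdivrMr// mul1r /M.
 by rewrite ler_pM ?normc_ge0// lerDl.
by apply: DeriveDef; [exact: cvgP cv|exact: cvg_lim cv].
Unshelve. all: by end_near. Qed.

Lemma mean_value_ineq f (f' : C -> C) (a b : C) (M : R) :
 (forall t : R, 0 <= t <= 1 -> cdiff f (a + t%:C * (b - a)) (f' (a + t%:C * (b - a)))) ->
 (forall t : R, 0 <= t <= 1 -> normc (f' (a + t%:C * (b - a))) <= M) ->
 normc (f b - f a) <= M * normc (b - a).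
Proof.
move=> df bf; pose u := (f b - f a)^*.
pose g t := Re (u * f (a + t%:C * (b - a))).
pose g' t := Re (u * f' (a + t%:C * (b - a)) * (b - a)).
have dg (t : R) : 0 <= t <= 1 -> is_derive t 1 g (g' t).
 by move=> /df; exact: is_derive_segment.
have [|||t tin gE] := @MVT _ g g' 0 1.
- exact: ltr01.
- by move=> t; rewrite in_itv/= => /andP[/ltW ? /ltW ?]; apply: dg; apply/andP.
- apply: derivable_within_continuous => t; rewrite in_itv/= => /dg dgt.
 by apply: ex_derive.
have E : normc (f b - f a) ^+ 2 = g 1 - g 0.
 rewrite /g rmorph1 rmorph0 mul1r mul0r addr0 [a + _]addrC subrK.
 rewrite -ReN -ReD -mulrBr /u mulrC mul_conjc.
 by [].
have t01 : 0 <= t <= 1.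
 by move: tin; rewrite in_itv/= => /andP[/ltW -> /ltW ->].
have le : normc (f b - f a) ^+ 2 <= normc (f b - f a) * (M * normc (b - a)).
 rewrite E gE subr0 mulr1 /g' (le_trans (ler_norm _))// (le_trans (normc_Re _))//.
 rewrite !normcM /u normcJ -mulrA ler_wpM2l ?normc_ge0// ler_wpM2r ?normc_ge0//.
 exact: bf.
have [->|nz] := eqVneq (normc (f b - f a)) 0.
 rewrite mulr_ge0 ?normc_ge0// (le_trans (normc_ge0 (f' (a + 0%:C * (b - a)))))//.
 by apply: bf; rewrite lexx ler01.
by move: le; rewrite expr2 ler_pM2l// lt_def nz normc_ge0.
Qed.

Lemma ball_segment (a b : C) d t : normc (b - a) < d -> 0 <= t <= 1 ->
 normc (a + t%:C * (b - a) - a) < d.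
Proof.
move=> h /andP[t0 t1]; rewrite addrAC subrr add0r normcM normc_real ger0_norm//.
by apply: le_lt_trans h; rewrite ler_piMl ?normc_ge0.
Qed.

(** If [c] were not attained, the maximum principle for 1/(f - c) would fail at [a]. *)
Lemma open_mapping f a d (e : R) : 0 < d -> 0 < e ->
 (forall z, normc (z - a) <= d -> exists p, cdiff f z p) ->
 (forall z, normc (z - a) = d -> e <= normc (f z - f a)) ->
 forall c, normc (c - f a) < e / 2 -> exists2 z, normc (z - a) < d & f z = c.
Proof.
move=> d0 e0 df he c hc; apply: contrapT => nex.
have cb z : normc (z - a) = d -> e / 2 < normc (f z - c).
 move=> /he h; have := normc_lb (f z - f a) (f a - c).
 by rewrite (_ : f z - f a + (f a - c) = f z - c); [rewrite (normcBC (f a)); lra|ring].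
have fc z : normc (z - a) <= d -> f z - c != 0.
 rewrite le_eqVlt => /orP[/eqP/cb h|h]; rewrite -?normc_gt0 ?(lt_trans _ h) ?divr_gt0//.
 by rewrite normc_gt0; apply/eqP => /eqP; rewrite subr_eq0 => /eqP fz; apply: nex; exists z.
have := @max_modulus _ (fun z => (f z - c)^-1) a a d (2 / e) d0.
move=> /(_ _ _ _ a); rewrite subrr normc0 ltW// => H.
have : normc (f a - c)^-1 <= 2 / e.
 apply: H => //.
 - move=> z zd; have [p dfz] := df z zd.
  exact: wdiff_ccont (cdiffV (cdiffB dfz (wdiff_cst c z)) (fc z zd)).
 - move=> z zd _; have [p dfz] := df z (ltW zd).
  eexists; apply: cdiffV (cdiffB dfz (wdiff_cst c z)) (fc z (ltW zd)).
 - move=> z zd; rewrite normcV -[leRHS]invf_div lef_pV2 ?posrE ?divr_gt0//.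
   by rewrite ltW// cb.
  by rewrite (lt_trans _ (cb z zd))// divr_gt0.
rewrite normcV -[leRHS]invf_div lef_pV2 ?posrE ?divr_gt0//.
 by rewrite leNgt (normcBC (f a)) hc.
by rewrite normc_gt0 fc// subrr normc0 ltW.
Qed.

Definition slope f b (p : C) z := if z == b then p else (f z - f b) / (z - b).

Lemma slope_ccont f b p : cdiff f b p -> ccont (slope f b p) b.
Proof.
move=> df eps eps0; have e20 : 0 < eps / 2 by rewrite divr_gt0.
have [r r0 hr] := df _ e20; exists r => // h /hr.
rewrite mul0r addr0 /slope eqxx; case: eqP => [_|/eqP hb]; first by rewrite subrr normc0.
have h0 : h != 0 by apply: contraNneq hb => ->; rewrite addr0.
have -> : b + h - b = h by ring.
rewrite (_ : _ / h - p = (f (b + h) - f b - p * h) / h); last by field.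
rewrite normcM normcV ltr_pdivrMr ?normc_gt0// => /le_lt_trans; apply.
by rewrite ltr_pM2r ?normc_gt0// ltr_pdivrMr// mulr_natr mulr2n ltrDl.
Qed.

Lemma slope_cdiff f b p z q : cdiff f z q -> z != b ->
 exists p', cdiff (slope f b p) z p'.
Proof.
move=> df zb; have bz0 : 0 < normc (b - z) by rewrite normc_gt0 subr_eq0 eq_sym.
have zb' : z - b != 0 by rewrite subr_eq0.
have w := cdiffM (cdiffB df (wdiff_cst (f b) z))
 (cdiffV (cdiffB (wdiff_id z) (wdiff_cst b z)) zb').
eexists; apply: (wdiff_ext bz0 _ w) => h hh.
rewrite /slope; case: eqP => // e1.
by move: hh; rewrite -e1 addrAC subrr add0r ltxx.
Qed.
Arguments slope_cdiff {f b} p {z q}.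

Section InjectiveOnOpen.
Variables (U : set C) (f f' : C -> C).
Hypothesis oU : plane_open U.
Hypothesis df : forall z, U z -> cdiff f z (f' z).
Hypothesis inj : forall z w, U z -> U w -> f z = f w -> z = w.

Lemma small_disc a : U a -> exists d : R, exists e : R,
 [/\ 0 < d, 0 < e, forall z, normc (z - a) <= d -> U z
  & forall z, normc (z - a) = d -> e <= normc (f z - f a)].
Proof.
move=> Ua; have [r r0 hr] := oU Ua.
pose d := r / 2; have d0 : 0 < d by rewrite divr_gt0.
have UD z : normc (z - a) <= d -> U z.
 move=> h; rewrite -[z](subrK a) addrC; apply: hr; apply: (le_lt_trans h).
 by rewrite ltr_pdivrMr// mulr_natr mulr2n ltrDl.
have [z /= zd|||c /= cd cmin] := @plane_EVT _ (fun z => - normc (f z - f a))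
  [set z | normc (z - a) = d] (d + normc a) (@sphere_closed R a d).
- by apply: ball_bound; rewrite zd.
- by exists (a + d%:C); rewrite /= addrAC subrr add0r normc_real ger0_norm// ltW.
- move=> z /= zd e e0.
 have cz : ccont (fun z => f z - f a) z.
  by apply: wdiff_ccont (wdiffB (df _) (wdiff_cst (f a) z)); apply: UD; rewrite zd.
 have [d1 d10 hd] := rcont_normc cz e0; exists d1 => // h /hd.
 by rewrite (_ : - _ - _ = - (normc (f (z + h) - f a) - normc (f z - f a)));
  [rewrite normrN|ring].
exists d, (normc (f c - f a)); split => //.
 rewrite normc_gt0 subr_eq0; apply/eqP => /inj E.
 have Uc : U c by apply: UD; rewrite cd.
 by move: cd; rewrite (E Uc Ua) subrr normc0 => e; rewrite -e ltxx in d0.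
by move=> z zd; rewrite -lerN2; exact: cmin.
Qed.

(** This is the maximum principle for (z - b) / (f z - f b), continuous at [b] when f' b is
 not 0. The constant does not depend on [b]. *)
Lemma inverse_lipschitz a d (e : R) : 0 < d -> 0 < e ->
 (forall z, normc (z - a) <= d -> U z) ->
 (forall z, normc (z - a) = d -> e <= normc (f z - f a)) ->
 forall b, normc (b - a) < d -> normc (f b - f a) < e / 2 -> f' b != 0 ->
 forall z, normc (z - a) <= d -> normc (z - b) <= 4 * d / e * normc (f z - f b).
Proof.
move=> d0 e0 UD he b bd fb f'b z0 z0d.
have Ub : U b by apply/UD/ltW.
have fz0 z : normc (z - a) <= d -> z != b -> f z - f b != 0.
 by move=> /UD Uz; rewrite subr_eq0; apply: contraNneq => /(inj Uz Ub) ->.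
pose F z := (slope f b (f' b) z)^-1.
have s0 z : normc (z - a) <= d -> slope f b (f' b) z != 0.
 move=> zd; rewrite /slope; case: (eqVneq z b) => [//|zb].
 by rewrite mulf_neq0// ?invr_eq0 ?fz0// subr_eq0.
have sd z : normc (z - a) <= d -> z != b -> exists p, cdiff F z p.
 move=> zd zb; have [p dp] := slope_cdiff (f' b) (df (UD z zd)) zb.
 by eexists; exact: cdiffV dp (s0 z zd).
have [z0b|z0b] := eqVneq z0 b.
 by rewrite z0b !subrr normc0 mulr0.
have : normc (F z0) <= 4 * d / e.
 apply: (@max_modulus _ F a b d) => //.
 - move=> z zd; have [->|zb] := eqVneq z b; last first.
   by have [p /wdiff_ccont] := sd z zd zb.
  have := @ccont_comp _ (fun x => x^-1) (slope f b (f' b)) b.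
  apply; last exact: slope_ccont (df Ub).
  by apply: wdiff_ccont (cdiff_inv _); apply: s0; exact: ltW.
 - by move=> z /ltW; exact: sd.
 - move=> z zd; rewrite /F /slope; case: (eqVneq z b) => [zb|zb].
   by move: bd; rewrite -zb zd ltxx.
  rewrite invf_div normcM normcV.
  have h1 : normc (z - b) <= 2 * d.
   rewrite (_ : z - b = (z - a) - (b - a)); last by ring.
   by apply: (le_trans (normcB _ _)); lra.
  have h2 : e / 2 <= normc (f z - f b).
   have := normc_lb (f z - f a) (f a - f b).
   rewrite (_ : f z - f a + (f a - f b) = f z - f b); last by ring.
   by have := he z zd; rewrite (normcBC (f a)); lra.
  have h3 : (normc (f z - f b))^-1 <= 2 / e.
   rewrite -[leRHS]invf_div lef_pV2// posrE ?divr_gt0//.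
   by rewrite (lt_le_trans _ h2)// divr_gt0.
  rewrite (_ : 4 * d / e = (2 * d) * (2 / e)); last by field; rewrite gt_eqF.
  by rewrite ler_pM ?normc_ge0// invr_ge0 normc_ge0.
rewrite /F /slope (negbTE z0b) invf_div normcM normcV => H.
rewrite -ler_pdivrMr// normc_gt0 fz0//.
Qed.

(** If f' a = 0, then f z - f a = o(z - a), so that the uniform Lipschitz bound fails at points
 near [a] where f' is not 0; hence there are none, and [f] is constant near [a]. *)
Lemma injective_deriv_neq0 a : U a -> f' a != 0.
Proof.
move=> Ua; have [d [e [d0 e0 UD he]]] := small_disc Ua.
apply/eqP => f'a.
have eps0 : 0 < e / (8 * d) by rewrite divr_gt0// mulr_gt0.
have [r1 r10 h1] := df Ua eps0.
have e20 : 0 < e / 2 by rewrite divr_gt0.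
have [r2 r20 h2] := wdiff_ccont (df Ua) e20.
pose r := Num.min (Num.min r1 r2) d.
have r0 : 0 < r by rewrite !lt_min r10 r20.
have der0 z : normc (z - a) < r -> f' z = 0.
 move=> zr; apply/eqP; apply: contraT => f'z.
 have [zr1 zr2 zd] : [/\ normc (z - a) < r1, normc (z - a) < r2 & normc (z - a) < d].
  by move: zr; rewrite !lt_min => /andP[/andP[]].
 have E : a + (z - a) = z by ring.
 have := h1 _ zr1; have := h2 _ zr2; rewrite E f'a !mul0r addr0 subr0 => b1 b2.
 have := inverse_lipschitz d0 e0 UD he zd b1 f'z.
 move=> /(_ a); rewrite subrr normc0 => /(_ (ltW d0)).
 rewrite (normcBC a) (normcBC (f a)) => H.
 have : normc (z - a) <= 2^-1 * normc (z - a).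
  apply: (le_trans H); rewrite (le_trans (ler_wpM2l _ b2))//.
   by rewrite divr_ge0// ?mulr_ge0// ltW.
  by apply: le_of_eq; field; rewrite !gt_eqF.
 have [za|za] := eqVneq z a; first by rewrite za f'a eqxx in f'z.
 have : 0 < normc (z - a) by rewrite normc_gt0 subr_eq0.
 by lra.
pose b := a + (r / 2)%:C.
have ba : normc (b - a) < r.
 rewrite /b addrAC subrr add0r normc_real ger0_norm; last by rewrite divr_ge0// ltW.
 by rewrite ltr_pdivrMr// mulr_natr mulr2n ltrDl.
have := @mean_value_ineq f (fun=> 0) a b 0.
rewrite mul0r => H.
have : normc (f b - f a) <= 0.
 apply: H => [t t01|t _]; last by rewrite normc0.
 have inr := ball_segment ba t01.
 rewrite -(der0 _ inr); apply: df; apply: UD.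
 by rewrite ltW// (lt_le_trans inr)// ge_min lexx orbT.
rewrite le_eqVlt ltNge normc_ge0 orbF normc_eq0 subr_eq0 => /eqP fba.
have Ub : U b by apply: UD; rewrite ltW// (lt_le_trans ba)// ge_min lexx orbT.
have := inj Ub Ua fba; rewrite /b -[in RHS](addr0 a) => /addrI/complexI.
by apply/eqP; rewrite gt_eqF// divr_gt0.
Qed.

Lemma cdiff_inverse g a : (forall z, U z -> g (f z) = z) -> U a ->
 cdiff g (f a) (f' a)^-1.
Proof.
move=> gK Ua; have f'a := injective_deriv_neq0 Ua.
have [d [e [d0 e0 UD he]]] := small_disc Ua.
have e20 : 0 < e / 2 by rewrite divr_gt0.
pose K := 4 * d / e; have K0 : 0 < K by rewrite divr_gt0// mulr_gt0.
have nf' : 0 < normc (f' a) by rewrite normc_gt0.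
move=> eps eps0; have [r r0 hr] := df Ua (divr_gt0 (mulr_gt0 eps0 nf') K0).
exists (Num.min (e / 2) (r / K)); first by rewrite lt_min e20 divr_gt0.
move=> k; rewrite lt_min => /andP[ke kr].
have dfd z : normc (z - a) <= d -> exists p, cdiff f z p.
 by move=> /UD /df; exists (f' z).
have [|z zd fz] := @open_mapping f a d e d0 e0 dfd he (f a + k).
 by rewrite addrAC subrr add0r.
have Uz : U z by apply/UD/ltW.
have aa : normc (a - a) < d by rewrite subrr normc0.
have ff : normc (f a - f a) < e / 2 by rewrite subrr normc0.
have := inverse_lipschitz d0 e0 UD he aa ff f'a (ltW zd).
have kE : f z - f a = k by rewrite fz; ring.
rewrite kE -/K => zK.
have zr : normc (z - a) < r.
 by apply: (le_lt_trans zK); rewrite mulrC -ltr_pdivlMr.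
rewrite -fz !gK//.
rewrite (_ : _ - _ - _ = - ((f (a + (z - a)) - f a - (f' a * (z - a) + 0 * (z - a)^*)) / f' a)).
 rewrite normcN normcM normcV ler_pdivrMr//.
 apply: (le_trans (hr _ zr)).
 rewrite (_ : _ / K * _ = eps * normc (f' a) * (normc (z - a) / K)); last by ring.
 rewrite [leRHS](_ : _ = eps * normc (f' a) * normc k); last by ring.
 rewrite ler_wpM2l ?mulr_ge0 ?normc_ge0 ?(ltW eps0)// ler_pdivrMr//.
 by rewrite mulrC.
rewrite (_ : a + (z - a) = z); last by ring.
by rewrite -kE; field.
Qed.

End InjectiveOnOpen.

(** ** The Schwarz lemma *)
Lemma schwarz f : (forall z, normc z < 1 -> exists p, cdiff f z p) ->
 (forall z, normc z < 1 -> normc (f z) <= 1) -> f 0 = 0 ->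
 forall z, normc z < 1 -> normc (f z) <= normc z.
Proof.
move=> df bf f0 z0 z01; rewrite leNgt; apply/negP => zf.
have n0 : normc (0 : C) < 1 by rewrite normc0.
have [p0 dp0] := df 0 n0.
have fz0 : 0 < normc (f z0) by apply: le_lt_trans zf; exact: normc_ge0.
have q1 : normc z0 / normc (f z0) < 1 by rewrite ltr_pdivrMr// mul1r.
have z0q : normc z0 <= normc z0 / normc (f z0).
 by rewrite ler_peMr ?normc_ge0// invf_ge1// bf.
pose rho := (normc z0 / normc (f z0) + 1) / 2.
have rho1 : rho < 1 by rewrite /rho; lra.
have qrho : normc z0 / normc (f z0) < rho by rewrite /rho; lra.
have rho0 : 0 < rho by apply: le_lt_trans qrho; rewrite divr_ge0 ?normc_ge0.
have z00 : z0 != 0 by apply: contraTneq fz0 => ->; rewrite f0 normc0 ltxx.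
have sd z : normc (z - 0) <= rho -> z != 0 -> exists p, cdiff (slope f 0 p0) z p.
 rewrite subr0 => zr zn0; have [p dp] := df z (le_lt_trans zr rho1).
 by have [p' dp'] := slope_cdiff p0 dp zn0; exists p'.
have : normc (slope f 0 p0 z0) <= rho^-1.
 apply: (@max_modulus _ _ 0 0 rho) => //.
 - move=> z zr; have [->|zn0] := eqVneq z 0; first exact: slope_ccont.
  by have [p /wdiff_ccont] := sd z zr zn0.
 - by move=> z /ltW; exact: sd.
 - move=> z; rewrite subr0 => zr.
  rewrite /slope f0 !subr0; case: (eqVneq z 0) => [z_0|_].
   by move: zr; rewrite z_0 normc0 => e; rewrite e ltxx in rho0.
  rewrite normcM normcV zr ler_piMl ?invr_ge0 ?(ltW rho0)//; apply: bf.
  by rewrite zr.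
 - by rewrite subr0 ltW// (le_lt_trans z0q).
rewrite /slope (negbTE z00) f0 !subr0 normcM normcV => H.
move: qrho; rewrite ltr_pdivrMr// ltNge => /negP; apply.
by rewrite mulrC -ler_pdivlMr// -ler_pdivrMl ?normc_gt0// mulrC.
Qed.

(** F = f(z)/z has modulus 1, so the Wirtinger derivatives of F conj(F) vanish and F' = 0. *)
Lemma schwarz_eq f : (forall z, normc z < 1 -> exists p, cdiff f z p) ->
 f 0 = 0 -> (forall z, normc z < 1 -> normc (f z) = normc z) ->
 exists2 c : C, c != 0 & forall z, normc z < 1 -> f z = c * z.
Proof.
move=> df f0 nf; have n0 : normc (0 : C) < 1 by rewrite normc0.
have [p0 dp0] := df 0 n0.
pose F := slope f 0 p0.
have FE z : z != 0 -> F z = f z / z by move=> /negbTE h; rewrite /F /slope h f0 !subr0.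
have dF z : normc z < 1 -> z != 0 -> cdiff F z 0.
 move=> z1 zn0; have [p dp] := df z z1; have [q dq] := slope_cdiff p0 dp zn0.
 have r0 : 0 < Num.min (1 - normc z) (normc z) by rewrite lt_min subr_gt0 z1 normc_gt0.
 have w1 : wdiff (fun z => F z * (F z)^*) z 0 0.
  apply: (wdiff_ext r0 _ (wdiff_cst 1 z)) => h; rewrite lt_min => /andP[hh1 hh2].
  have zh1 : normc (z + h) < 1 by apply: (le_lt_trans (le_normcD _ _)); lra.
  have zh0 : z + h != 0 by rewrite -normc_gt0; have := normc_lb z h; lra.
  rewrite mul_conjc FE// normcM normcV nf// divff ?expr1n// normc_eq0//.
 have [E _] := wdiff_uniq (wdiffM dq (wdiffJ dq)) w1.
 move: E; rewrite conjc0 mulr0 addr0 => /eqP; rewrite mulf_eq0 => /orP[/eqP <-//|].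
 rewrite conjc_eq0 -/F FE// mulf_eq0 invr_eq0 (negbTE zn0) orbF.
 by rewrite -normc_eq0 nf// normc_eq0 (negbTE zn0).
have FC z : normc z < 1 -> z != 0 -> F z = p0.
 move=> z1 zn0; apply/eqP; rewrite -subr_eq0 -normc_eq0 eq_le normc_ge0 andbT.
 apply/ler_addgt0Pr => e e0; rewrite add0r.
 have [r r_0 hr] := slope_ccont dp0 e0.
 pose t := Num.min 1 (r / 2).
 have t0 : 0 < t by rewrite lt_min ltr01 divr_gt0.
 have t1 : t <= 1 by rewrite ge_min lexx.
 have tr : t < r by rewrite gt_min [r / 2 < r]ltr_pdivrMr// mulr_natr mulr2n ltrDl r_0 orbT.
 have tzr : normc (t%:C * z) < r.
  rewrite normcM normc_real gtr0_norm//; apply: lt_trans tr.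
  by rewrite gtr_pMr.
 have := @mean_value_ineq F (fun=> 0) (t%:C * z) z 0; rewrite mul0r => H.
 have {}H : normc (F z - F (t%:C * z)) <= 0.
  apply: H => [x /andP[x0 x1]|x _]; last by rewrite normc0.
  have -> : t%:C * z + x%:C * (z - t%:C * z) = (t + x * (1 - t))%:C * z.
   by rewrite rmorphD rmorphM rmorphB rmorph1; ring.
  have y0 : 0 < t + x * (1 - t) by rewrite ltr_wpDr// mulr_ge0// subr_ge0.
  have y1 : t + x * (1 - t) <= 1 by nra.
  apply: dF.
   rewrite normcM normc_real gtr0_norm// (le_lt_trans _ z1)// ler_piMl ?normc_ge0//.
  by rewrite mulf_neq0// -normc_gt0 normc_real gtr0_norm.
 have {}H : F z = F (t%:C * z).
  by apply/eqP; rewrite -subr_eq0 -normc_eq0 eq_le H normc_ge0.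
 have F0 : F 0 = p0 by rewrite /F /slope eqxx.
 by have := hr _ tzr; rewrite add0r -/F -H F0; exact: ltW.
exists p0; last first.
 move=> z z1; have [->|zn0] := eqVneq z 0; first by rewrite f0 mulr0.
 by rewrite -(FC z z1 zn0) FE// divfK.
have h1 : normc (2^-1 : C) < 1.
 by rewrite normcV normc_nat invf_lt1// ltr1n.
have h0 : (2^-1 : C) != 0 by rewrite invr_eq0 pnatr_eq0.
rewrite -(FC _ h1 h0) FE// mulf_neq0 ?invr_eq0// -normc_eq0 nf// normc_eq0//.
Qed.

(** ** Moebius transformations of the disc *)
Definition mob a w := (w - a) / (1 - a^* * w).

Lemma mob_den a w : normc a < 1 -> normc w < 1 -> 1 - a^* * w != 0.
Proof.
move=> a1 w1; rewrite subr_eq0; apply/eqP => e.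
have : normc (a^* * w) < 1.
 rewrite normcM normcJ (le_lt_trans (ler_wpM2l (normc_ge0 _) (ltW w1)))//.
 by rewrite mulr1.
by rewrite -e normc1 ltxx.
Qed.

Lemma mob_lt1 a w : normc a < 1 -> normc w < 1 -> normc (mob a w) < 1.
Proof.
move=> a1 w1; have d0 := mob_den a1 w1.
rewrite normcM normcV ltr_pdivrMr ?normc_gt0// mul1r.
rewrite -(@ltr_pXn2r _ 2) ?nnegrE ?normc_ge0// -subr_gt0.
have E : normc (1 - a^* * w) ^+ 2 - normc (w - a) ^+ 2 =
  (1 - normc a ^+ 2) * (1 - normc w ^+ 2).
 rewrite !normc_sqr !(ReD, ImD, ReN, ImN, ReM, ImM).
 by case: (a) => a2 a3; case: (w) => w2 w3 /=; ring.
rewrite E mulr_gt0// subr_gt0 expr_lt1//; exact: normc_ge0.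
Qed.

Lemma mobK a w : normc a < 1 -> normc w < 1 -> mob (- a) (mob a w) = w.
Proof.
move=> a1 w1; have d0 := mob_den a1 w1; have d1 := mob_den a1 (mob_lt1 a1 w1).
have d2 : 1 - a^* * a != 0 by apply: mob_den.
have na1 : normc (- a) < 1 by rewrite normcN.
have := mob_den na1 (mob_lt1 a1 w1); rewrite /mob => d3.
rewrite rmorphN in d3 *; have E : 1 - - a^* * ((w - a) / (1 - a^* * w)) =
  (1 - a^* * a) / (1 - a^* * w) by field.
rewrite E; field; rewrite d0; exact: d2.
Qed.

Lemma mob0 a : mob a a = 0. Proof. by rewrite /mob subrr mul0r. Qed.

Lemma cdiff_mob a w : normc a < 1 -> normc w < 1 ->
 cdiff (mob a) w ((1 - a^* * a) / (1 - a^* * w) ^+ 2).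
Proof.
move=> a1 w1; have d0 := mob_den a1 w1.
have w2 := cdiffM (cdiffB (wdiff_id w) (wdiff_cst a w))
 (cdiffV (cdiffB (wdiff_cst 1 w) (cdiffZ a^* (wdiff_id w))) d0).
by apply: (wdiff_eq w2) => //; field.
Qed.

(** ** Uniqueness of the kernel *)
Section TwoConformalMaps.
Variable G : set C.
Hypothesis oG : plane_open G.

Definition disc_map (f f' : C -> C) :=
 [/\ forall z, G z -> cdiff f z (f' z), forall z, G z -> normc (f z) < 1,
   forall z w, G z -> G w -> f z = f w -> z = w
  & forall w, normc w < 1 -> exists2 z, G z & f z = w].

Lemma disc_map_inverse g g' : disc_map g g' -> exists gi : C -> C,
 [/\ forall w, normc w < 1 -> G (gi w), forall w, normc w < 1 -> g (gi w) = w,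
   forall z, G z -> gi (g z) = z
  & forall w, normc w < 1 -> exists p, cdiff gi w p].
Proof.
move=> [dg g1 ginj gsurj].
have ex w : {z | normc w < 1 -> G z /\ g z = w}.
 apply: cid; have [w1|w1] := pselect (normc w < 1); last by exists 0.
 by have [z Gz gz] := gsurj w w1; exists z.
pose gi w := sval (ex w).
have giP w : normc w < 1 -> G (gi w) /\ g (gi w) = w by exact: (svalP (ex w)).
have giK z : G z -> gi (g z) = z.
 by move=> Gz; have [G1 e1] := giP _ (g1 z Gz); exact: ginj e1.
exists gi; split => //.
- by move=> w /giP[].
- by move=> w /giP[].
- move=> w w1; have [G1 e1] := giP w w1; exists (g' (gi w))^-1.
 by rewrite -{1}e1; exact: (cdiff_inverse oG dg ginj giK G1).
Qed.

(** Both maps are normalized to vanish at [z], so the Schwarz lemma applies to [H] and to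
 its counterpart in the other direction. *)
Lemma transition f f' g g' z : disc_map f f' -> disc_map g g' -> G z ->
 exists H : C -> C, [/\ forall w, normc w < 1 -> exists p, cdiff H w p,
  forall w, normc w < 1 -> normc (H w) < 1, H 0 = 0
  & forall w, G w -> H (mob (g z) (g w)) = mob (f z) (f w)].
Proof.
move=> [df f1 finj fsurj] dmg Gz.
have [gi [giG gKi giK dgi]] := disc_map_inverse dmg.
have [dg g1 ginj gsurj] := dmg.
pose H w := mob (f z) (f (gi (mob (- g z) w))).
have ng : normc (- g z) < 1 by rewrite normcN g1.
exists H; split.
- move=> w w1; have m1 := mob_lt1 ng w1.
 have [p dp] := dgi _ m1.
 have c1 := cdiff_comp dp (cdiff_mob ng w1).
 have c2 := cdiff_comp (df _ (giG _ m1)) c1.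
 by eexists; exact: cdiff_comp (cdiff_mob (f1 z Gz) (f1 _ (giG _ m1))) c2.
- by move=> w w1; apply: mob_lt1; apply: f1 => //; apply: giG; exact: mob_lt1.
- have E0 : mob (- g z) 0 = g z by rewrite /mob mulr0 subr0 divr1 sub0r opprK.
 by rewrite /H E0 giK// mob0.
- by move=> w Gw; rewrite /H mobK ?g1// giK.
Qed.

(** By the Schwarz lemma both ways, the transition between the normalized maps is a
 rotation, which leaves the kernel unchanged. *)
Theorem disc_map_kernel f f' g g' z w : disc_map f f' -> disc_map g g' ->
 G z -> G w -> z != w ->
 f' w * f' z / (f w - f z) ^+ 2 = g' w * g' z / (g w - g z) ^+ 2.
Proof.
move=> mf mg Gz Gw zw.
have [H [dH H1 H0 HE]] := transition mf mg Gz.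
have [K [dK K1 K0 KE]] := transition mg mf Gz.
have [df f1 finj fsurj] := mf; have [dg g1 ginj gsurj] := mg.
have nH v : normc v < 1 -> normc (H v) = normc v.
 move=> v1; apply/eqP; rewrite eq_le (schwarz dH _ H0)//=; last first.
  by move=> x /H1 /ltW.
 have ng : normc (- g z) < 1 by rewrite normcN g1.
 have [y Gy yE] := gsurj _ (mob_lt1 ng v1).
 have vE : v = mob (g z) (g y).
  by have := mobK ng v1; rewrite opprK yE.
 rewrite vE HE// -KE//; apply: (schwarz dK _ K0); first by move=> x /K1 /ltW.
 by apply: mob_lt1; exact: f1.
have [c c0 Hc] := schwarz_eq dH H0 nH.
have eqm v : G v -> mob (f z) (f v) = c * mob (g z) (g v).
 by move=> Gv; rewrite -HE// Hc//; apply: mob_lt1; exact: g1.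
have der v : G v -> (1 - (f z)^* * f z) / (1 - (f z)^* * f v) ^+ 2 * f' v =
  c * ((1 - (g z)^* * g z) / (1 - (g z)^* * g v) ^+ 2 * g' v).
 move=> Gv; have [r r0 hr] := oG Gv.
 have d1 := cdiff_comp (cdiff_mob (f1 z Gz) (f1 v Gv)) (df v Gv).
 have d2 := cdiffZ c (cdiff_comp (cdiff_mob (g1 z Gz) (g1 v Gv)) (dg v Gv)).
 have d3 : cdiff (fun x => mob (f z) (f x)) v
   (c * ((1 - (g z)^* * g z) / (1 - (g z)^* * g v) ^+ 2 * g' v)).
  by apply: (wdiff_ext r0 _ d2) => h /hr Gh; rewrite eqm.
 exact: cdiff_uniq d1 d3.
have e1 := der w Gw; have e2 := der z Gz; have e3 := eqm w Gw.
have fd : 1 - (f z)^* * f w != 0 by apply: mob_den; exact: f1.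
have gd : 1 - (g z)^* * g w != 0 by apply: mob_den; exact: g1.
have fd2 : 1 - (f z)^* * f z != 0 by apply: mob_den; exact: f1.
have gd2 : 1 - (g z)^* * g z != 0 by apply: mob_den; exact: g1.
have fzw : f w - f z != 0.
 by rewrite subr_eq0; apply: contraNneq zw => /(finj _ _ Gw Gz) ->.
have gzw : g w - g z != 0.
 by rewrite subr_eq0; apply: contraNneq zw => /(ginj _ _ Gw Gz) ->.
(* the kernel is m'(w) m'(z) / m(w)^2 where m is a Moebius image of the map *)
have inv (h h' : C -> C) : 1 - (h z)^* * h w != 0 -> 1 - (h z)^* * h z != 0 ->
  h w - h z != 0 -> h' w * h' z / (h w - h z) ^+ 2 =
  ((1 - (h z)^* * h z) / (1 - (h z)^* * h w) ^+ 2 * h' w) *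
  ((1 - (h z)^* * h z) / (1 - (h z)^* * h z) ^+ 2 * h' z) / mob (h z) (h w) ^+ 2.
 by move=> h1 h2 h3; rewrite /mob; field; rewrite h1 h2 h3.
rewrite (inv f f')// (inv g g')// e1 e2 e3.
have m0 : mob (g z) (g w) != 0 by rewrite mulf_neq0 ?invr_eq0.
set A := _ / _ * g' w; set B := _ / _ * g' z.
by field; rewrite m0.
Qed.

End TwoConformalMaps.
End Injective.

(** * The binomial series *)
Lemma normc_le2 (R : realType) (z w : R[i]) (x y : R) :
 normc z <= x -> normc w <= y -> normc (z + w) <= x + y.
Proof. by move=> zx wy; apply: le_trans (le_normcD _ _) _; exact: lerD. Qed.

Section Binomial.
Variable R : realType.
Local Notation C := R[i].
Implicit Types (c d e : R) (x y : C) (k n N : nat).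

Definition gbin c k : R := \prod_(i < k) ((c - i%:R) / i.+1%:R).

Lemma gbin0 c : gbin c 0 = 1. Proof. by rewrite /gbin big_ord0. Qed.

Lemma gbinS c k : gbin c k.+1 = gbin c k * ((c - k%:R) / k.+1%:R).
Proof. by rewrite /gbin big_ord_recr. Qed.

Lemma gbinS_mul c k : k.+1%:R * gbin c k.+1 = (c - k%:R) * gbin c k.
Proof.
have k0 : k.+1%:R != 0 :> R by rewrite pnatr_eq0.
by rewrite gbinS mulrCA [_ / _]mulrC mulVKf// mulrC.
Qed.

Lemma gbin_absorb c k : k.+1%:R * gbin (c + 1) k.+1 = (c + 1) * gbin c k.
Proof.
elim: k => [|k ih]; first by rewrite gbinS !gbin0 mul1r subr0 divr1 mulr1 mul1r.
rewrite gbinS_mul; have -> : c + 1 - k.+1%:R = c - k%:R by rewrite -natr1; ring.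
apply: (@mulfI _ k.+1%:R); first by rewrite pnatr_eq0.
by rewrite mulrCA ih mulrCA [in RHS]mulrCA gbinS_mul; ring.
Qed.

Lemma gbin_pascal c k : gbin c k.+1 + gbin c k = gbin (c + 1) k.+1.
Proof.
apply: (@mulfI _ k.+1%:R); first by rewrite pnatr_eq0.
by rewrite mulrDr gbinS_mul gbin_absorb -natr1; ring.
Qed.

Lemma gbin_bound c k : -1 <= c <= 1 -> `|gbin c k| <= 1.
Proof.
move=> /andP[c0 c1]; elim: k => [|k ih]; first by rewrite gbin0 normr1.
rewrite gbinS normrM -[leRHS]mulr1 ler_pM//.
rewrite normrM normfV [`|k.+1%:R|]ger0_norm// ler_pdivrMr// mul1r ler_norml.
have : 0 <= k%:R :> R by [].
by rewrite -natr1 => k0; apply/andP; split; lra.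
Qed.

Definition bpoly c N x : C := \sum_(k < N) (gbin c k)%:C * x ^+ k.
Definition dbpoly c N x : C := \sum_(k < N) (k%:R * gbin c k)%:C * x ^+ k.-1.

Lemma bpolyS c N x : bpoly c N.+1 x = bpoly c N x + (gbin c N)%:C * x ^+ N.
Proof. by rewrite /bpoly big_ord_recr. Qed.

Lemma cdiff_bpoly c N x : cdiff (bpoly c N) x (dbpoly c N x).
Proof.
elim: N => [|N ih].
 rewrite /dbpoly big_ord0; apply: (wdiff_ext (@ltr01 R) _ (wdiff_cst 0 x)) => h _.
 by rewrite /bpoly big_ord0.
have d2 := cdiffD ih (cdiffZ (gbin c N)%:C (cdiffX N (wdiff_id x))).
rewrite (_ : dbpoly c N.+1 x = dbpoly c N x + (gbin c N)%:C * (N%:R * x ^+ N.-1 * 1)).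
 by apply: (wdiff_ext (@ltr01 R) _ d2) => h _; rewrite bpolyS.
rewrite /dbpoly big_ord_recr/= rmorphM rmorph_nat; ring.
Qed.

(** The differential equation (1 + x) A' = c A, up to a term of high degree. *)
Lemma dbpolyE c N x : (1 + x) * dbpoly c N x =
 c%:C * bpoly c N x - (N%:R * gbin c N)%:C * x ^+ N.-1.
Proof.
elim: N => [|N ih].
 by rewrite /dbpoly /bpoly !big_ord0 !mul0r !mulr0 subr0.
rewrite bpolyS (_ : dbpoly c N.+1 x =
 dbpoly c N x + (N%:R * gbin c N)%:C * x ^+ N.-1); last by rewrite /dbpoly big_ord_recr.
rewrite mulrDr ih gbinS_mul /=.
rewrite !rmorphM rmorphB !rmorph_nat; case: N {ih} => [|N]; first by rewrite gbin0/=; ring.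
by rewrite (exprS x N) /=; ring.
Qed.

Lemma pow_series (t : R) m N : 0 <= t < 1 ->
 \sum_(m <= k < m + N) t ^+ k <= t ^+ m / (1 - t).
Proof.
move=> /andP[t0 t1]; have q0 : 0 < 1 - t by rewrite subr_gt0.
rewrite ler_pdivlMr//; suff -> : (\sum_(m <= k < m + N) t ^+ k) * (1 - t) = t ^+ m - t ^+ (m + N).
 by rewrite gerBl exprn_ge0.
elim: N => [|N ih]; first by rewrite addn0 big_geq// mul0r subrr.
by rewrite addnS big_nat_recr ?leq_addr//= mulrDl ih exprS; ring.
Qed.

Lemma bpoly_cauchy c x m N : -1 <= c <= 1 -> normc x < 1 ->
 normc (bpoly c (m + N) x - bpoly c m x) <= normc x ^+ m / (1 - normc x).
Proof.
move=> cb x1; have x01 : 0 <= normc x < 1 by rewrite normc_ge0.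
apply: le_trans (pow_series m N x01).
elim: N => [|N ih]; first by rewrite addn0 subrr normc0 big_geq.
rewrite addnS bpolyS big_nat_recr ?leq_addr//=.
rewrite addrAC (le_trans (le_normcD _ _))// lerD// normcM normcX normc_real.
by rewrite ler_piMl ?exprn_ge0 ?normc_ge0 ?gbin_bound.
Qed.

(** The limit is taken in each coordinate, where the order of the reals is available. *)
Fact bser_key : unit. Proof. exact: tt. Qed.
Definition bser : R -> C -> C := locked_with bser_key (fun c x =>
 limn (fun n => Re (bpoly c n x)) +i* limn (fun n => Im (bpoly c n x))).

Lemma cauchy_limit (u : nat -> R) (e : nat -> R) :
 (forall m N, `|u (m + N)%N - u m| <= e m) -> e @ \oo --> (0 : R) ->
 forall m, `|limn u - u m| <= e m.
Proof.
move=> hu e0; have cu : cvgn u.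
 apply/cauchy_cvgP/cauchy_exP => r r0.
 have /cvgr0Pnorm_lt/(_ _ r0)[m _ hm] := e0.
 exists (u m); exists m => // n /= mn; rewrite /ball/= distrC -(subnKC mn).
 apply: le_lt_trans (hu _ _) _; apply: le_lt_trans (hm m (leqnn m)); exact: ler_norm.
move=> m; have cv : (fun n => `|u n - u m|) @ \oo --> `|limn u - u m|.
 by apply: cvg_norm; apply: cvgB => //; exact: cvg_cst.
apply: (@cvgr_to_le _ _ _ _ _ _ _ cv); exists m => // n /= mn.
by rewrite -(subnKC mn).
Qed.

Lemma pow_cvg0 (t : R) : 0 <= t < 1 -> (fun n => t ^+ n) @ \oo --> (0 : R).
Proof.
by move=> /andP[t0 t1]; apply: cvg_expr; rewrite ger0_norm.
Qed.

Lemma bser_tail c x m : -1 <= c <= 1 -> normc x < 1 ->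
 normc (bser c x - bpoly c m x) <= 2 * (normc x ^+ m / (1 - normc x)).
Proof.
move=> cb x1; have x01 : 0 <= normc x < 1 by rewrite normc_ge0.
have e0 : (fun m => normc x ^+ m / (1 - normc x)) @ \oo --> (0 : R).
 by rewrite -(mul0r (1 - normc x)^-1); apply: cvgMl; exact: pow_cvg0.
rewrite /bser unlock (le_trans (normc_leD _))// mulr_natl mulr2n lerD//.
 rewrite ReD ReN; apply: (cauchy_limit _ e0) => n N.
 by rewrite -ReN -ReD (le_trans (normc_Re _))// bpoly_cauchy.
rewrite ImD ImN; apply: (cauchy_limit _ e0) => n N.
by rewrite -ImN -ImD (le_trans (normc_Im _))// bpoly_cauchy.
Qed.

Lemma linear_pow_bound (t : R) n : 0 <= t < 1 -> n%:R * t ^+ n <= (1 - t)^-1.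
Proof.
move=> t01; have /andP[t0 t1] := t01.
have := pow_series 0 n t01; rewrite expr0 mul1r add0n; apply: le_trans.
rewrite mulr_natl -[X in _ *+ X]subn0 -sumr_const_nat; apply: ler_sum_nat => k /andP[_ kn].
exact: ler_wiXn2l t0 (ltW t1) _ _ (ltnW kn).
Qed.

Lemma pow4_bound (t : R) : 0 <= t < 1 -> exists2 M : R, 0 < M &
 forall n, n%:R ^+ 4 * t ^+ n <= M.
Proof.
move=> /andP[t0 t1]; pose q := Num.sqrt (Num.sqrt t).
have q0 : 0 <= q by exact: sqrtr_ge0.
have qt : q ^+ 4 = t by rewrite (exprM q 2 2) !sqr_sqrtr// sqrtr_ge0.
have q1 : q < 1 by rewrite -(@expr_lt1 _ 4)// qt.
exists ((1 - q)^-1 ^+ 4); first by rewrite exprn_gt0// invr_gt0 subr_gt0.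
move=> n; rewrite -qt -exprM mulnC exprM -exprMn ler_pXn2r// ?nnegrE.
- by rewrite linear_pow_bound// q0.
- by rewrite mulr_ge0// exprn_ge0.
- by rewrite invr_ge0 subr_ge0 ltW.
Qed.

Lemma linear_pow_cvg0 (t : R) : 0 <= t < 1 -> (fun n => n%:R * t ^+ n) @ \oo --> (0 : R).
Proof.
move=> t01; have /andP[t0 t1] := t01; pose q := Num.sqrt t.
have q0 : 0 <= q by exact: sqrtr_ge0.
have qt : q ^+ 2 = t by rewrite sqr_sqrtr.
have q1 : q < 1 by rewrite -(@expr_lt1 _ 2)// qt.
have q01 : 0 <= q < 1 by rewrite q0.
have c0 : (fun n => (1 - q)^-1 * q ^+ n) @ \oo --> (0 : R).
 by rewrite -(mulr0 (1 - q)^-1); apply: cvgMr; exact: pow_cvg0.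
apply: (squeeze_cvgr _ (cvg_cst 0) c0); near=> n.
rewrite mulr_ge0 ?exprn_ge0//= -qt -exprM mul2n -addnn exprD mulrA.
by rewrite ler_wpM2r ?exprn_ge0// linear_pow_bound.
Unshelve. all: by end_near. Qed.

Lemma one_plus_neq0 x : normc x < 1 -> 1 + x != 0.
Proof.
move=> x1; rewrite -normc_gt0; have := normc_lb 1 x; rewrite normc1; lra.
Qed.

Lemma segment_le (x y : C) (t tau : R) : normc x <= t -> normc y <= t -> 0 <= tau <= 1 ->
 normc (y + tau%:C * (x - y)) <= t.
Proof.
move=> xt yt /andP[ta tb].
rewrite (_ : _ + _ = (1 - tau)%:C * y + tau%:C * x); last by rewrite rmorphB rmorph1; ring.
rewrite (_ : t = (1 - tau) * t + tau * t); last by ring.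
by apply: normc_le2; rewrite normcM normc_real ger0_norm ?subr_ge0// ler_wpM2l// subr_ge0.
Qed.

Section Exponent.
Variable c : R.
Hypothesis cb : -1 <= c <= 1.

Lemma bser_bound x : normc x < 1 -> normc (bser c x) <= 2 / (1 - normc x).
Proof.
move=> x1; have := bser_tail 0 cb x1.
by rewrite /bpoly big_ord0 subr0 expr0 mul1r.
Qed.

Lemma bser_0 : bser c 0 = 1.
Proof.
have n0 : normc (0 : C) < 1 by rewrite normc0.
have := bser_tail 1 cb n0; rewrite normc0 expr1 mul0r mulr0 => h.
have : normc (bser c 0 - bpoly c 1 0) == 0 by rewrite eq_le h normc_ge0.
rewrite normc_eq0 subr_eq0 => /eqP ->.
by rewrite /bpoly big_ord1 gbin0 expr0 mulr1.
Qed.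

Definition btail N x := bser c x - bpoly c N x.
Definition dbtail N x :=
 (c%:C * btail N x + (N%:R * gbin c N)%:C * x ^+ N.-1) / (1 + x).

Lemma btail_bound (t : R) N x : t < 1 -> normc x <= t ->
 normc (btail N x) <= 2 * (t ^+ N / (1 - t)).
Proof.
move=> t1 xt; have x1 : normc x < 1 by apply: le_lt_trans t1.
have t0 : 0 <= t by apply: le_trans xt; exact: normc_ge0.
rewrite (le_trans (bser_tail N cb x1))// ler_wpM2l// ler_pM//.
- by rewrite exprn_ge0// normc_ge0.
- by rewrite invr_ge0 subr_ge0 ltW.
- by rewrite lerXn2r// ?nnegrE ?normc_ge0.
- by rewrite lef_pV2 ?posrE ?subr_gt0// lerB.
Qed.

Lemma btail_cvg0 (t e : R) : 0 <= t < 1 -> 0 < e ->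
 exists N, forall n, (N <= n)%N -> forall x, normc x <= t -> normc (btail n x) < e.
Proof.
move=> t01 e0; have [_ t1] := andP t01.
have lim0 : (fun m => 2 * (t ^+ m / (1 - t))) @ \oo --> (0 : R).
 rewrite -(mulr0 2); apply: cvgMr; rewrite -(mul0r (1 - t)^-1).
 by apply: cvgMl; exact: pow_cvg0.
have /cvgr0Pnorm_lt/(_ _ e0)[N _ hN] := lim0; exists N => n nN x xt.
apply: le_lt_trans (btail_bound n t1 xt) _.
by apply: le_lt_trans (hN n nN); exact: ler_norm.
Qed.

Lemma bser_continuous x : normc x < 1 -> ccont (bser c) x.
Proof.
move=> x1 e e0; pose t := (1 + normc x) / 2.
have xt : normc x < t by rewrite /t; lra.
have t1 : t < 1 by rewrite /t; lra.
have t01 : 0 <= t < 1 by rewrite t1 (le_trans (normc_ge0 x))// ltW.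
have e30 : 0 < e / 3 by rewrite divr_gt0.
have [m /(_ m (leqnn m)) unif] := btail_cvg0 t01 e30.
have [d d0 hd] := wdiff_ccont (cdiff_bpoly c m x) e30.
exists (Num.min d (t - normc x)); first by rewrite lt_min d0 subr_gt0.
move=> h; rewrite lt_min => /andP[/hd a b].
have xh : normc (x + h) <= t by apply: (le_trans (le_normcD _ _)); lra.
have u1 := unif _ xh; have u2 := unif _ (ltW xt); rewrite /btail in u1 u2.
have {}u2 : normc (bpoly c m x - bser c x) < e / 3 by rewrite normcBC.
move: u1 u2 a; move: (bser c (x + h)) (bser c x) (bpoly c m (x + h)) (bpoly c m x) => p q p' q' u1 u2 u3.
rewrite (_ : p - q = (p - p') + ((p' - q') + (q' - q))); last by ring.
apply: le_lt_trans (normc_le2 (lexx _) (normc_le2 (lexx _) (lexx _))) _.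
rewrite (_ : e = e / 3 + (e / 3 + e / 3)); last by field.
by rewrite ltrD// ltrD.
Qed.

Lemma dbpoly_btail N x : normc x < 1 ->
 c%:C * bser c x / (1 + x) - dbpoly c N x = dbtail N x.
Proof.
move=> x1; have x0 := one_plus_neq0 x1.
apply: (mulIf x0); rewrite mulrBl divfK// [dbpoly _ _ _ * _]mulrC dbpolyE /dbtail divfK//.
by rewrite /btail; ring.
Qed.

Lemma dbtail_bound (t : R) N x : t < 1 -> normc x <= t ->
 normc (dbtail N x) <= (2 * (t ^+ N / (1 - t)) + N%:R * t ^+ N.-1) / (1 - t).
Proof.
move=> t1 xt; have x1 : normc x < 1 by apply: le_lt_trans t1.
have t0 : 0 <= t by apply: le_trans xt; exact: normc_ge0.
have q0 : 0 < 1 - t by rewrite subr_gt0.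
have den : 1 - t <= normc (1 + x).
 by have := normc_lb 1 x; rewrite normc1; lra.
rewrite normcM normcV ler_pM ?invr_ge0 ?normc_ge0//; last first.
 by rewrite lef_pV2 ?posrE// (lt_le_trans q0).
rewrite (le_trans (le_normcD _ _))// lerD// normcM normc_real.
 rewrite -[leRHS]mul1r ler_pM ?normc_ge0 ?normr_ge0 ?btail_bound//.
 by rewrite ler_norml.
rewrite normrM ger0_norm// normcX ler_pM ?mulr_ge0 ?normr_ge0 ?exprn_ge0 ?normc_ge0//.
 by rewrite ler_piMr// gbin_bound.
by rewrite lerXn2r// ?nnegrE ?normc_ge0.
Qed.

Lemma dbtail_cvg0 (t e : R) : 0 <= t < 1 -> 0 < e ->
 exists N, forall n, (N <= n)%N -> forall x, normc x <= t -> normc (dbtail n x) < e.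
Proof.
move=> t01 e0; have /andP[t0 t1] := t01.
have q0 : 0 < 1 - t by rewrite subr_gt0.
pose v n := (2 * (t ^+ n.+1 / (1 - t)) + n.+1%:R * t ^+ n) / (1 - t).
have v0 : v @ \oo --> (0 : R).
 rewrite (_ : v = fun n => (2 * (t / (1 - t)) * t ^+ n + n%:R * t ^+ n + t ^+ n) / (1 - t)).
  rewrite -(mul0r (1 - t)^-1); apply: cvgMl.
  rewrite (_ : 0 = 2 * (t / (1 - t)) * 0 + 0 + 0 :> R); last by rewrite mulr0 !addr0.
  apply: cvgD; last exact: pow_cvg0.
  apply: cvgD; last exact: linear_pow_cvg0.
  by apply: cvgMr; exact: pow_cvg0.
 by apply/funext => n; rewrite /v exprS -natr1; ring.
have /cvgr0Pnorm_lt/(_ _ e0)[N _ hN] := v0.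
exists N.+1 => -[//|n] nN x xt; apply: le_lt_trans (hN n nN); apply: le_trans (ler_norm _).
exact: dbtail_bound.
Qed.

(** The derivatives of the partial sums converge uniformly on discs, and the mean value
 inequality transfers the convergence to the difference quotients. *)
Theorem cdiff_bser x : normc x < 1 -> cdiff (bser c) x (c%:C * bser c x / (1 + x)).
Proof.
move=> x1 e e0; pose B y := c%:C * bser c y / (1 + y).
pose t := (1 + normc x) / 2.
have xt : normc x < t by rewrite /t; lra.
have t1 : t < 1 by rewrite /t; lra.
have t01 : 0 <= t < 1 by rewrite t1 (le_trans (normc_ge0 x))// ltW.
have cB : ccont B x.
 apply: ccontM; first by apply: ccontM (ccont_cst _ _) (bser_continuous x1).
 exact: wdiff_ccont (wdiffV (wdiffD (wdiff_cst 1 x) (wdiff_id x)) (one_plus_neq0 x1)).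
have e20 : 0 < e / 2 by rewrite divr_gt0.
have [d d0 hd] := cB _ e20.
exists (Num.min d (t - normc x)); first by rewrite lt_min d0 subr_gt0.
move=> h; rewrite lt_min => /andP[hd1 ht]; rewrite mul0r addr0.
have xht : normc (x + h) <= t by apply: (le_trans (le_normcD _ _)); lra.
(* the bound holds for every partial sum, up to an arbitrarily small error *)
apply/ler_addgt0Pr => r r0.
have r40 : 0 < r / 4 by rewrite divr_gt0.
have [N1 hN1] := dbtail_cvg0 t01 e20.
have [N2 hN2] := btail_cvg0 t01 r40.
pose n := maxn N1 N2.
have small y : normc y <= t -> normc (btail n y) <= r / 4.
 by move=> yt; apply/ltW/hN2 => //; exact: leq_maxr.
pose g y := bpoly c n y - B x * y.
have gE : normc (g (x + h) - g x) <= e * normc (x + h - x).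
 apply: (@mean_value_ineq _ g (fun y => dbpoly c n y - B x * 1)) => tau tau01.
  by apply: cdiffB; [exact: cdiff_bpoly | exact: cdiffZ (wdiff_id _)].
 rewrite (addrAC x h) subrr add0r mulr1; set k := tau%:C * h.
 have kh : normc k <= normc h.
  rewrite normcM normc_real; case/andP: tau01 => tau0 tau1.
  by rewrite ger0_norm// ler_piMl// normc_ge0.
 have xkt : normc (x + k) <= t.
  by rewrite (le_trans (le_normcD _ _))// -lerBrDl (le_trans kh)// ltW.
 rewrite (_ : dbpoly c n (x + k) - B x = - dbtail n (x + k) + (B (x + k) - B x)).
  rewrite (_ : e = e / 2 + e / 2); last by field.
  apply: normc_le2; last by apply: ltW (hd k _); exact: le_lt_trans hd1.
  by rewrite normcN; apply: ltW (hN1 n _ _ xkt); exact: leq_maxl.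
 rewrite -(@dbpoly_btail n (x + k)); last exact: le_lt_trans t1.
 by rewrite -/(B (x + k)) opprB addrA subrK.
rewrite (_ : bser c (x + h) - bser c x - c%:C * bser c x / (1 + x) * h =
 (g (x + h) - g x) + (btail n (x + h) + - btail n x)).
 apply: normc_le2; first by move: gE; rewrite [x + h - x]addrAC subrr add0r.
 rewrite (_ : r = r / 2 + r / 2); last by field.
 have r42 : r / 4 <= r / 2 by clear -r0; lra.
 apply: normc_le2; first exact: le_trans (small _ xht) r42.
 by rewrite normcN; exact: le_trans (small _ (ltW xt)) r42.
rewrite /g /btail /B; move: (bser c (x + h)) (bser c x) (bpoly c n (x + h)) (bpoly c n x) (1 + x).
by move=> ? ? ? ? ?; ring.
Qed.

(** Derivative of [dbtail], so the second derivative of the tail. *)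
Definition ddbtail N x := (c%:C * dbtail N x
 + (N%:R * gbin c N)%:C * (N.-1%:R * x ^+ N.-2) - dbtail N x) / (1 + x).

Lemma cdiff_btail N x : normc x < 1 -> cdiff (btail N) x (dbtail N x).
Proof.
move=> x1; rewrite -dbpoly_btail//.
exact: cdiffB (cdiff_bser x1) (cdiff_bpoly c N x).
Qed.

Lemma cdiff_dbtail N x : normc x < 1 -> cdiff (dbtail N) x (ddbtail N x).
Proof.
move=> x1; have x0 := one_plus_neq0 x1.
have d1 := cdiffD (cdiffZ c%:C (cdiff_btail N x1))
 (cdiffZ (N%:R * gbin c N)%:C (cdiffX N.-1 (wdiff_id x))).
have d2 := cdiffV (cdiffD (wdiff_cst 1 x) (wdiff_id x)) x0.
have d12 := cdiffM d1 d2; apply: (wdiff_eq d12) => //.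
rewrite /ddbtail /dbtail; move: (btail N x) => T; field; exact: x0.
Qed.

Lemma pred_pow_le (t : R) N : 0 < t <= 1 -> t ^+ N.-1 <= t ^+ N / t.
Proof.
move=> /andP[t0 t1]; case: N => [|N] /=; first by rewrite expr0 mul1r invf_ge1.
by rewrite exprS mulrC mulKf// gt_eqF.
Qed.

Lemma btail_second_order (t : R) : 0 < t -> t < 1 -> exists2 K : R, 0 < K &
 forall N x x0, normc x <= t -> normc x0 <= t ->
 normc (btail N x - btail N x0 - dbtail N x0 * (x - x0)) <=
  K * (N.+1%:R ^+ 2 * t ^+ N) * normc (x - x0) ^+ 2.
Proof.
move=> t0 t1; have q0 : 0 < 1 - t by rewrite subr_gt0.
have t01 : 0 < t <= 1 by rewrite t0 ltW.
pose K1 := (2 / (1 - t) + t^-1) / (1 - t).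
have K1p : 0 < K1 by rewrite divr_gt0// addr_gt0 ?divr_gt0 ?invr_gt0.
have den x : normc x <= t -> (normc (1 + x))^-1 <= (1 - t)^-1.
 move=> xt; have := normc_lb 1 x; rewrite normc1 => h.
 have le1 : 1 - t <= normc (1 + x) by apply: le_trans h; rewrite lerB.
 by rewrite lef_pV2 ?posrE// (lt_le_trans q0).
have pw n : 0 <= t ^+ n by rewrite exprn_ge0 ?ltW.
have ti : 0 <= t^-1 by rewrite invr_ge0 ltW.
have qi : 0 <= (1 - t)^-1 by rewrite invr_ge0 ltW.
have xp x n : normc x <= t -> normc x ^+ n <= t ^+ n.
 by move=> xt; rewrite lerXn2r// ?nnegrE ?normc_ge0// ltW.
have d1 N x : normc x <= t -> normc (dbtail N x) <= K1 * (N.+1%:R * t ^+ N).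
 move=> xt; apply: le_trans (dbtail_bound N t1 xt) _.
 have := pred_pow_le N t01; have := pw N; have n0 : 0 <= N%:R :> R by [].
 rewrite (_ : N.+1%:R = N%:R + 1); last by rewrite natr1.
 move: (t ^+ N) (t ^+ N.-1) (N%:R : R) n0 => p P n n0 p0 pP.
 rewrite /K1 (mulrAC _ _ ((n + 1) * p)) ler_wpM2r//.
 have h1 : n * P <= n * (p / t) by rewrite ler_wpM2l.
 have h2 : 0 <= n * p * (1 - t)^-1 by rewrite !mulr_ge0.
 have h3 : 0 <= p * t^-1 by rewrite mulr_ge0.
 by move: ((1 - t)^-1) (t^-1) h1 h2 h3 => a b h1 h2 h3; lra.
pose K := (2 * K1 + t^-1 ^+ 2) / (1 - t).
have Kp : 0 < K.
 by rewrite divr_gt0// addr_gt0//; [exact: mulr_gt0 | rewrite exprn_gt0// invr_gt0].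
have d2 N x : normc x <= t -> normc (ddbtail N x) <= K * (N.+1%:R ^+ 2 * t ^+ N).
 move=> xt; rewrite normcM normcV /K mulrAC ler_pM ?invr_ge0 ?normc_ge0 ?den//.
 have n1 : N.+1%:R * t ^+ N <= N.+1%:R ^+ 2 * t ^+ N.
  by rewrite ler_wpM2r ?exprn_ge0 ?(ltW t0)// expr2 ler_peMl ?ler1n// ler0n.
 have b1 := le_trans (d1 N x xt) (ler_wpM2l (ltW K1p) n1).
 rewrite (_ : _ + _ - _ = c%:C * dbtail N x + (- dbtail N x
  + (N%:R * gbin c N)%:C * (N.-1%:R * x ^+ N.-2))); last by ring.
 rewrite mulrDl (mulr_natl _ 2) mulr2n mulrDl -addrA; apply: normc_le2.
  rewrite normcM normc_real; apply: le_trans b1; rewrite ler_piMl ?normc_ge0//.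
  by rewrite ler_norml.
 apply: normc_le2; first by rewrite normcN.
 rewrite !normcM normc_real normc_nat normcX normrM ger0_norm ?ler0n//.
 have p2 : t ^+ N.-2 <= t^-1 ^+ 2 * t ^+ N.
  apply: le_trans (pred_pow_le N.-1 t01) _.
  rewrite expr2 -mulrA mulrC ler_wpM2l ?invr_ge0 ?(ltW t0)// mulrC.
  exact: pred_pow_le.
 have c1 : N.-1%:R <= N.+1%:R :> R by rewrite ler_nat; case: (N) => // n; rewrite /= ltnW.
 have c2 : N%:R <= N.+1%:R :> R by rewrite ler_nat.
 rewrite (_ : t^-1 ^+ 2 * _ = N.+1%:R * 1 * (N.+1%:R * (t^-1 ^+ 2 * t ^+ N))); last by ring.
 rewrite ler_pM ?mulr_ge0 ?exprn_ge0 ?normc_ge0//.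
  by rewrite ler_pM ?gbin_bound.
 by rewrite ler_pM ?exprn_ge0 ?normc_ge0// (le_trans (xp _ _ xt)).
exists K => // N x x0 xt x0t; pose W := K * (N.+1%:R ^+ 2 * t ^+ N).
have seg y tau (yt : normc y <= t) := @segment_le y x0 t tau yt x0t.
have lip y : normc y <= t -> normc (dbtail N y - dbtail N x0) <= W * normc (y - x0).
 move=> yt; apply: (@mean_value_ineq _ _ (ddbtail N)) => tau htau.
  by apply: cdiff_dbtail; apply: le_lt_trans (seg _ _ yt htau) t1.
 exact: d2 (seg _ _ yt htau).
pose g y := btail N y - dbtail N x0 * y.
have -> : btail N x - btail N x0 - dbtail N x0 * (x - x0) = g x - g x0.
 by rewrite /g; move: (btail N x) (btail N x0) (dbtail N x0) => ? ? ?; ring.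
rewrite -/W (expr2 (normc _)) mulrA; apply: (@mean_value_ineq _ g (fun y => dbtail N y - dbtail N x0 * 1)) => tau htau.
 apply: cdiffB; last exact: cdiffZ (wdiff_id _).
 by apply: cdiff_btail; apply: le_lt_trans (seg _ _ xt htau) t1.
rewrite mulr1 (le_trans (lip _ (seg _ _ xt htau)))//.
have W0 : 0 <= W by apply: mulr_ge0 (ltW Kp) (mulr_ge0 _ (pw N)); rewrite exprn_ge0.
apply: ler_wpM2l W0 _ _ _.
rewrite addrAC subrr add0r normcM normc_real; case/andP: htau => ta tb.
by rewrite ger0_norm// ler_piMl ?normc_ge0.
Qed.

End Exponent.

(** ** The functional equation *)

Lemma cdiff_zero_constant (F : C -> C) : (forall x, normc x < 1 -> cdiff F x 0) ->
 forall x, normc x < 1 -> F x = F 0.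
Proof.
move=> dF x x1; apply/eqP; rewrite -subr_eq0 -normc_eq0 eq_le normc_ge0 andbT.
have h := @mean_value_ineq _ F (fun=> 0) 0 x 0.
rewrite mul0r in h; apply: h => tau /andP[ta tb]; last by rewrite normc0.
apply: dF; rewrite add0r subr0 normcM normc_real ger0_norm//.
by rewrite (le_lt_trans _ x1)// ler_piMl ?normc_ge0.
Qed.

(** The initial value problem (1 + x) F' = e F, F(0) = 1 determines [F]: multiply by
  the solution for [- e] and differentiate. *)
Lemma bser_inverse (F : C -> C) e : -1 <= e <= 1 ->
 (forall x, normc x < 1 -> cdiff F x (e%:C * F x / (1 + x))) -> F 0 = 1 ->
 forall x, normc x < 1 -> F x * bser (- e) x = 1.
Proof.
move=> eb dF F0 x x1; have neb : -1 <= - e <= 1 by rewrite lerN2 lerNl andbC.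
have := @cdiff_zero_constant (fun x => F x * bser (- e) x).
rewrite F0 bser_0// mulr1; apply => // y y1.
have y0 := one_plus_neq0 y1.
apply: (wdiff_eq (cdiffM (dF y y1) (cdiff_bser neb y1))) => //.
move: (bser (- e) y) (F y) y0 => a b y0; rewrite rmorphN; field; exact: y0.
Qed.

Lemma bser_mulN e x : -1 <= e <= 1 -> normc x < 1 -> bser e x * bser (- e) x = 1.
Proof.
move=> eb; apply: bser_inverse => //; last exact: bser_0.
by move=> y y1; exact: cdiff_bser.
Qed.

Lemma bser_neq0 e x : -1 <= e <= 1 -> normc x < 1 -> bser e x != 0.
Proof.
move=> eb x1; apply/eqP => b0; have := bser_mulN eb x1.
by rewrite b0 mul0r => /eqP; rewrite eq_sym oner_eq0.
Qed.

Lemma bser_unique (F : C -> C) e : -1 <= e <= 1 ->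
 (forall x, normc x < 1 -> cdiff F x (e%:C * F x / (1 + x))) -> F 0 = 1 ->
 forall x, normc x < 1 -> F x = bser e x.
Proof.
move=> eb dF F0 x x1; have neb : -1 <= - e <= 1 by rewrite lerN2 lerNl andbC.
by apply: (mulIf (bser_neq0 neb x1)); rewrite bser_inverse// bser_mulN.
Qed.

Lemma bser_add c d x : -1 <= c <= 1 -> -1 <= d <= 1 -> -1 <= c + d <= 1 -> normc x < 1 ->
 bser c x * bser d x = bser (c + d) x.
Proof.
move=> cb db cdb; apply: (bser_unique (F := fun x => bser c x * bser d x)) => //; last first.
 by rewrite !bser_0// mulr1.
move=> y y1; apply: (wdiff_eq (cdiffM (cdiff_bser cb y1) (cdiff_bser db y1))) => //.
move: (bser c y) (bser d y) (one_plus_neq0 y1) => a b y0; rewrite rmorphD; field; exact: y0.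
Qed.

Lemma bser_1 x : normc x < 1 -> bser 1 x = 1 + x.
Proof.
move=> x1; have b1 : -1 <= (1 : R) <= 1 by rewrite lexx andbT (le_trans _ ler01)// lerN10.
symmetry; apply: (bser_unique (F := fun x => 1 + x)) => //; last by rewrite addr0.
move=> y y1; apply: (wdiff_eq (cdiffD (wdiff_cst 1 y) (wdiff_id y))) => //.
by rewrite add0r mul1r divff ?one_plus_neq0.
Qed.

Lemma bser_pow c n x : -1 <= c <= 1 -> -1 <= n%:R * c <= 1 -> normc x < 1 ->
 bser c x ^+ n = bser (n%:R * c) x.
Proof.
move=> cb ncb; apply: (bser_unique (F := fun x => bser c x ^+ n)) => //; last first.
 by rewrite bser_0// expr1n.
move=> y y1; apply: (wdiff_eq (cdiffX n (cdiff_bser cb y1))) => //.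
move: (bser c y) (one_plus_neq0 y1) => a y0; rewrite rmorphM rmorph_nat.
by case: n {ncb} => [|n]; rewrite ?exprS /=; field; exact: y0.
Qed.

Lemma bpolyJ c N x : bpoly c N (x^*) = (bpoly c N x)^*.
Proof.
rewrite /bpoly rmorph_sum; apply: eq_bigr => k _.
by rewrite rmorphM rmorphXn; congr (_ * _); rewrite /= oppr0.
Qed.

Lemma bserJ c x : -1 <= c <= 1 -> normc x < 1 -> bser c (x^*) = (bser c x)^*.
Proof.
move=> cb x1; apply/eqP; rewrite -subr_eq0 -normc_eq0 eq_le normc_ge0 andbT.
have xJ : normc (x^*) < 1 by rewrite normcJ.
have x01 : 0 <= normc x < 1 by rewrite normc_ge0.
have e0 : (fun m => 4 * (normc x ^+ m / (1 - normc x))) @ \oo --> (0 : R).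
 rewrite -(mulr0 4); apply: cvgMr; rewrite -(mul0r (1 - normc x)^-1).
 by apply: cvgMl; exact: pow_cvg0.
apply: (cvgr_to_ge e0); exists 0%N => // m _ /=.
rewrite (_ : _ - _ = (bser c x^* - bpoly c m x^*) + - (bser c x - bpoly c m x)^*); last first.
 by rewrite bpolyJ rmorphB; ring.
rewrite (_ : 4 * _ = 2 * (normc x ^+ m / (1 - normc x)) + 2 * (normc x ^+ m / (1 - normc x))); last by ring.
by apply: normc_le2; rewrite ?normcN ?normcJ ?bser_tail// (le_trans (bser_tail m cb xJ))// normcJ.
Qed.

End Binomial.

(** * Jets at the origin *)
Section Jets.
Variable R : realType.
Local Notation C := R[i].
Implicit Types (f g : C -> C) (z h : C).

Lemma gt0_complex (e : C) : 0 < e -> exists2 d : R, 0 < d & e = d%:C.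
Proof.
case: e => a b; rewrite ltcE /= => /andP[/eqP -> a0]; by exists a.
Qed.

Lemma cdiff_quotient f z p : cdiff f z p <->
 (h^-1 *: ((f : C^o -> C^o) (h + z) - f z)) @[h --> (0 : C^o)^'] --> (p : C^o).
Proof.
split.
 move=> df; apply/cvgrPdist_lt => _ /gt0_complex[e e0 ->].
 have [d d0 hd] := df _ (divr_gt0 e0 (ltr0n R 2)).
 have d0' : 0 < d%:C by rewrite ltcR.
 exists d%:C => //= h; rewrite /ball/= sub0r normrN normrE ltcR => hd' h0.
 rewrite normrE ltcR; have n0 : 0 < normc h by rewrite normc_gt0.
 have := hd h hd'; rewrite mul0r addr0 (addrC z h) => hb.
 rewrite -(ltr_pM2r n0) -normcM.
 apply: le_lt_trans (_ : e / 2 * normc h < _); last first.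
  by rewrite ltr_pM2r// ltr_pdivrMr// ltr_pMr// ltr1n.
 rewrite -normcN; rewrite (_ : - ((p - _) * h) = f (h + z) - f z - p * h)//.
 rewrite /GRing.scale/=; move: (f (h + z) - f z) => q; field; exact: h0.
move=> /cvgrPdist_lt cf e e0.
have e0' : 0 < e%:C by rewrite ltcR.
have [_ /= /gt0_complex[d d0 ->] hd] := cf _ e0'.
exists d => // h hdl; rewrite mul0r addr0.
have [->|h0] := eqVneq h 0; first by rewrite addr0 subrr mulr0 subr0 normc0 mulr0.
have : ball (0 : C^o) d%:C h by rewrite /ball/= sub0r normrN normrE ltcR.
move=> /hd/(_ h0); rewrite normrE ltcR => hb.
have n0 : 0 < normc h by rewrite normc_gt0.
apply: ltW; move: hb; rewrite -(ltr_pM2r n0) -normcM; apply: le_lt_trans.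
rewrite -[leRHS]normcN (_ : - ((p - _) * h) = f (z + h) - f z - p * h)//.
rewrite /GRing.scale/= (addrC h z); move: (f (z + h) - f z) => q; field; exact: h0.
Qed.

Lemma cdiff_derive1 f z p : cdiff f z p -> derive1 (f : C^o -> C^o) z = p.
Proof. by move=> /cdiff_quotient/cvg_lim; apply; exact: norm_hausdorff. Qed.

Lemma derivable_cdiff f z : derivable (f : C^o -> C^o) z 1 ->
 cdiff f z (derive1 (f : C^o -> C^o) z).
Proof.
move=> df; apply/cdiff_quotient.
rewrite /derivable in df; rewrite derive1E /derive.
have -> : (fun h => h^-1 *: ((f : C^o -> C^o) (h + z) - f z)) =
 (fun h => h^-1 *: (((f : C^o -> C^o) \o shift z) (h *: (1 : C^o)) - f z)).
 by apply/funext => h /=; rewrite /GRing.scale/= mulr1.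
exact: df.
Qed.

(** [f] is [n] times complex differentiable near the origin and the polynomial
  [p] has the same derivatives as [f] at the origin up to order [n]. *)
Fixpoint has_jet n f (p : {poly C}) : Prop :=
 f 0 = p.[0] /\
 if n is n'.+1 then exists f' : C -> C, exists2 d : R, 0 < d &
  (forall z, normc z < d -> cdiff f z (f' z)) /\ has_jet n' f' p^`() else True.

Lemma has_jet0 n f p : has_jet n f p -> f 0 = p.[0].
Proof. by case: n => [|n] []. Qed.

Lemma has_jet_le n f p : has_jet n.+1 f p -> has_jet n f p.
Proof.
elim: n f p => [|n ih] f p [f0 [f' [d d0 [df jf]]]]; first by split.
by split => //; exists f', d => //; split => //; apply: ih.
Qed.

Lemma near_ball z (d : R) : normc z < d -> exists2 e : R, 0 < e &
 forall h, normc h < e -> normc (z + h) < d.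
Proof.
move=> zd; exists (d - normc z); first by rewrite subr_gt0.
by move=> h hd; rewrite (le_lt_trans (le_normcD _ _))// -ltrBrDl.
Qed.

Lemma cdiff_near f g z (d : R) p : normc z < d ->
 (forall z, normc z < d -> f z = g z) -> cdiff f z p -> cdiff g z p.
Proof.
move=> zd fg; have [e e0 he] := near_ball zd.
by apply: (wdiff_ext e0) => h /he; exact: fg.
Qed.

Lemma has_jet_near n f g p (d : R) : 0 < d -> (forall z, normc z < d -> f z = g z) ->
 has_jet n f p -> has_jet n g p.
Proof.
move=> d0 fg; have f0 : f 0 = g 0 by apply: fg; rewrite normc0.
case: n => [|n] /=; first by rewrite f0.
rewrite f0 => -[g0 [f' [e e0 [df jf]]]]; split => //.
exists f', (Num.min d e); first by rewrite lt_min d0.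
split => // z; rewrite lt_min => /andP[zd ze].
exact: cdiff_near zd fg (df _ ze).
Qed.

Lemma has_jet_uniq n f p (f' : C -> C) (d : R) : 0 < d ->
 (forall z, normc z < d -> cdiff f z (f' z)) -> has_jet n.+1 f p -> has_jet n f' p^`().
Proof.
move=> d0 df [_ [g [e e0 [dg jg]]]].
apply: (has_jet_near (d := Num.min d e)) jg; first by rewrite lt_min d0.
move=> z; rewrite lt_min => /andP[zd ze].
exact: cdiff_uniq (dg _ ze) (df _ zd).
Qed.

Lemma has_jet_mod n f p q r : has_jet n f p -> q = p + 'X^(n.+1) * r -> has_jet n f q.
Proof.
elim: n f p q r => [|n ih] f p q r; last first.
 move=> [f0 [f' [d d0 [df jf]]]] ->; split.
  by rewrite f0 hornerD hornerM hornerXn expr0n /= mul0r addr0.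
 exists f', d => //; split => //; apply: (ih _ _ _ (n.+2%:R *: r + 'X * r^`())) jf _.
 by rewrite derivD derivM derivXn scaler_nat /= (exprS 'X n.+1); ring.
by case=> f0 _ ->; split => //; rewrite f0 hornerD hornerM hornerX mul0r addr0.
Qed.

Lemma has_jetD n f g p q : has_jet n f p -> has_jet n g q ->
 has_jet n (fun z => f z + g z) (p + q).
Proof.
elim: n f g p q => [|n ih] f g p q; first by move=> [f0 _] [g0 _]; rewrite /= f0 g0 hornerD.
move=> [f0 [f' [d d0 [df jf]]]] [g0 [g' [e e0 [dg jg]]]].
split; first by rewrite f0 g0 hornerD.
exists (fun z => f' z + g' z), (Num.min d e); first by rewrite lt_min d0.
split; last by rewrite derivD; exact: ih.
by move=> z; rewrite lt_min => /andP[zd ze]; apply: cdiffD; [exact: df | exact: dg].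
Qed.

Lemma has_jetM n f g p q : has_jet n f p -> has_jet n g q ->
 has_jet n (fun z => f z * g z) (p * q).
Proof.
elim: n f g p q => [|n ih] f g p q; first by move=> [f0 _] [g0 _]; rewrite /= f0 g0 hornerM.
move=> jf jg; have jf1 := has_jet_le jf; have jg1 := has_jet_le jg.
move: jf jg => [f0 [f' [d d0 [df jf]]]] [g0 [g' [e e0 [dg jg]]]].
split; first by rewrite f0 g0 hornerM.
exists (fun z => f' z * g z + f z * g' z), (Num.min d e); first by rewrite lt_min d0.
split; last by rewrite derivM; apply: has_jetD; exact: ih.
by move=> z; rewrite lt_min => /andP[zd ze]; apply: cdiffM; [exact: df | exact: dg].
Qed.

Lemma has_jet_cst n (c : C) : has_jet n (fun=> c) c%:P.
Proof.
elim: n c => [|n ih] c; first by rewrite /= hornerC.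
split; first by rewrite hornerC.
exists (fun=> 0), 1 => //; split; last by rewrite derivC -polyC0; exact: ih.
by move=> z _; exact: wdiff_cst.
Qed.

Lemma has_jetX n : has_jet n id 'X.
Proof.
case: n => [|n] /=; rewrite hornerX; split => //.
exists (fun=> 1), 1 => //; split; last by rewrite derivX -polyC1; exact: has_jet_cst.
by move=> z _; exact: wdiff_id.
Qed.

Lemma has_jet_exp n f p k : has_jet n f p -> has_jet n (fun z => f z ^+ k) (p ^+ k).
Proof.
move=> jf; elim: k => [|k ih]; first by rewrite expr0 -polyC1; exact: has_jet_cst.
rewrite exprS; apply: (has_jet_near (ltr01 : 0 < (1 : R)) _ (has_jetM jf ih)).
by move=> z _; rewrite exprS.
Qed.

Lemma has_jetZ n f p c : has_jet n f p -> has_jet n (fun z => c * f z) (c%:P * p).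
Proof. by move=> jf; apply: has_jetM => //; exact: has_jet_cst. Qed.

Lemma has_jetV n f p q r (e : R) : 0 < e -> (forall z, normc z < e -> f z != 0) ->
 has_jet n f p ->
 p * q = 1 + 'X^(n.+1) * r -> has_jet n (fun z => (f z)^-1) q.
Proof.
move=> e0 f_neq0; elim: n p q r => [|n ih] p q r jf pq.
 have [f0 _] := jf; split => //; have n0 : f 0 != 0 by rewrite f_neq0 ?normc0.
 apply: (mulfI n0); by rewrite divff// f0 -hornerM pq hornerD hornerM hornerX mul0r addr0 hornerC.
have jf1 := has_jet_le jf.
have jV : has_jet n (fun z => (f z)^-1) q.
 by apply: (ih p q ('X * r)) => //; rewrite pq exprS; ring.
move: jf => [f0 [f' [d d0 [df jf]]]]; split; first exact: has_jet0 jV.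
exists (fun z => -1 * f' z * ((f z)^-1 ^+ 2)), (Num.min d e); first by rewrite lt_min d0.
split.
 move=> z; rewrite lt_min => /andP[zd ze].
 apply: (wdiff_eq (cdiffV (df z zd) (f_neq0 z ze))) => //.
 by rewrite exprVn; ring.
have jd := has_jetM (has_jetZ (-1) jf) (has_jet_exp 2 jV).
have dpq : p^`() * q + p * q^`() = 'X^(n.+1) * (n.+2%:R *: r + 'X * r^`()).
 rewrite -derivM pq derivD derivM derivXn -polyC1 derivC add0r /=.
 by rewrite scaler_nat (exprS 'X n.+1); ring.
apply: (has_jet_mod jd (r := (n.+2%:R *: r + 'X * r^`()) * q - 'X * r * q^`())).
set A := n.+2%:R *: r + 'X * r^`() in dpq *.
have -> : 'X^(n.+1) * (A * q - 'X * r * q^`()) = 'X^(n.+1) * A * q - 'X^(n.+2) * r * q^`().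
 by rewrite (exprS 'X n.+1); ring.
have -> : 'X^(n.+2) * r = p * q - 1 by rewrite pq; ring.
by rewrite -dpq rmorphN1; ring.
Qed.

(** Iterated derivatives are read off the jet, so that they can be computed with
 polynomials modulo a power of X. *)
Lemma derive1n_jet n f p : has_jet n f p -> derive1n n (f : C^o -> C^o) 0 = n`!%:R * p`_n.
Proof.
elim: n f p => [|n ih] f p jf.
 by rewrite /derive1n /= (has_jet0 jf) fact0 mul1r horner_coef0.
have [_ [f' [d d0 [df _]]]] := jf.
have jf' : has_jet n (derive1 (f : C^o -> C^o)) p^`().
 by apply: (has_jet_uniq d0) jf => z zd; rewrite (cdiff_derive1 (df z zd)); exact: df.
by rewrite derive1Sn (ih _ _ jf') coef_deriv factS mulnC natrM -mulr_natr; ring.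
Qed.

(** An initial value problem lifts the order of the jet by one. *)
Lemma has_jet_ode n f p (f' : C -> C) (d : R) : 0 < d -> f 0 = p.[0] ->
 (forall z, normc z < d -> cdiff f z (f' z)) -> has_jet n f' p^`() -> has_jet n.+1 f p.
Proof. by move=> d0 f0 df jf; split => //; exists f', d. Qed.

End Jets.

(** * The lemniscate and its conformal map *)
Section Lemniscate.
Variables (R : realType) (s : nat) (r : R).
Hypotheses (s2 : (2 <= s)%N) (r1 : 1 < r).
Local Notation C := R[i].
Implicit Types (z w h : C) (c : R).

Let s0 : (0 < s)%N := ltnW s2.
Let r0 : 0 < r := lt_trans ltr01 r1.
Let sR : (s%:R : R) != 0. Proof. by rewrite pnatr_eq0 -lt0n. Qed.

Fact lock_key : unit. Proof. exact: tt. Qed.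
Definition rs : R := r ^+ s.
Definition B : R := locked_with lock_key (rs ^+ 2).
Lemma BE : B = rs ^+ 2. Proof. by rewrite /B unlock. Qed.
Definition uu : C -> C := locked_with lock_key (fun z => z ^+ s - 1).
Lemma uuE z : uu z = z ^+ s - 1. Proof. by rewrite /uu unlock. Qed.
Definition tt : C -> R := locked_with lock_key (fun z => normc (uu z) ^+ 2).
Lemma ttE z : tt z = normc (uu z) ^+ 2. Proof. by rewrite /tt unlock. Qed.
Definition lem : set C := [set z | tt z < B].
Local Notation BC := (B%:C).

Lemma rs_gt1 : 1 < rs. Proof. by rewrite /rs exprn_egt1 // -lt0n. Qed.
Lemma rs_gt0 : 0 < rs. Proof. exact: lt_trans rs_gt1. Qed.
Lemma B_gt1 : 1 < B. Proof. by rewrite BE exprn_egt1// rs_gt1. Qed.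
Lemma B_gt0 : 0 < B. Proof. exact: lt_trans B_gt1. Qed.
Lemma BC_neq0 : BC != 0. Proof. by rewrite (inj_eq (@complexI R)) gt_eqF ?B_gt0. Qed.
Lemma B1_neq0 : BC - 1 != 0.
Proof. by rewrite -(rmorph1 (real_complex R)) -rmorphB (inj_eq (@complexI R)) gt_eqF ?subr_gt0 ?B_gt1. Qed.
Lemma rC_neq0 : r%:C != 0. Proof. by rewrite (inj_eq (@complexI R)) gt_eqF. Qed.
Lemma sC_neq0 : (s%:R : C) != 0. Proof. by rewrite pnatr_eq0 -lt0n. Qed.
Hint Resolve rs_gt1 rs_gt0 B_gt1 B_gt0 BC_neq0 B1_neq0 rC_neq0 sC_neq0 : core.

Lemma tt_ge0 z : 0 <= tt z. Proof. by rewrite ttE exprn_ge0// normc_ge0. Qed.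

Lemma lemE z : lem z <-> normc (uu z) < rs.
Proof. by rewrite /lem /= ttE BE ltr_pXn2r// nnegrE ?normc_ge0// ltW. Qed.

Lemma lem_interior : lemniscate_interior s rs = lem.
Proof.
by apply/seteqP; split => z; rewrite lemE uuE /lemniscate_interior /= normrE ltcR.
Qed.

Lemma lem0 : lem 0.
Proof.
by apply/lemE; have -> : uu 0 = -1; [rewrite uuE expr0n gtn_eqF//= sub0r | rewrite normcN normc1].
Qed.

(** The argument of the binomial series stays in the disc of radius [rho]. *)
Definition rho : R := rs^-1.
Lemma rho_gt0 : 0 < rho. Proof. by rewrite invr_gt0. Qed.
Lemma rho_lt1 : rho < 1. Proof. by rewrite invf_lt1. Qed.
Definition xx z : C := uu z / BC.

Lemma normc_xx z : normc (xx z) = normc (uu z) / B.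
Proof. by rewrite normcM normcV normc_real ger0_norm// ltW. Qed.

Lemma xx_lt z : lem z -> normc (xx z) < rho.
Proof.
move=> /lemE h; rewrite normc_xx ltr_pdivrMr//.
by rewrite /rho BE expr2 mulKf// gt_eqF.
Qed.

Lemma xx_lt1 z : lem z -> normc (xx z) < 1.
Proof. by move=> /xx_lt h; apply: lt_trans h rho_lt1. Qed.

Lemma one_plus_xx z : 1 + xx z = (BC + uu z) / BC.
Proof. by rewrite mulrDl divff. Qed.

Lemma Bu_neq0 z : lem z -> BC + uu z != 0.
Proof.
move=> /xx_lt1 /one_plus_neq0; rewrite one_plus_xx; apply: contra => /eqP ->.
by rewrite mul0r.
Qed.

(** On the circle |u|^2 = B this reads |B + u|^2 = B |1 + u|^2. *)
Lemma level_identity_u u :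
 normc (BC + u) ^+ 2 - B * normc (1 + u) ^+ 2 = (B - 1) * (B - normc u ^+ 2).
Proof.
rewrite !normc_sqr !ReD !ImD Re_real Im_real.
have -> : Re (1 : C) = 1 by [].
have -> : Im (1 : C) = 0 by [].
by ring.
Qed.

Lemma level_identity z :
 normc (BC + uu z) ^+ 2 - B * normc (z ^+ s) ^+ 2 = (B - 1) * (B - tt z).
Proof. by rewrite ttE -level_identity_u [1 + _]addrC uuE subrK. Qed.

Lemma plane_open_lem : plane_open lem.
Proof.
move=> z /lemE zG.
have e0 : 0 < rs - normc (uu z) by rewrite subr_gt0.
have [d d0 hd] := wdiff_ccont (cdiffX s (wdiff_id z)) e0.
exists d => // h /hd hh; apply/lemE.
rewrite (_ : uu (z + h) = uu z + ((z + h) ^+ s - z ^+ s)); last by rewrite !uuE; ring.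
by apply: le_lt_trans (le_normcD _ _) _; rewrite -ltrBrDl.
Qed.

Lemma cdiff_uu z : cdiff uu z (s%:R * z ^+ s.-1).
Proof.
apply: (wdiff_ext (@ltr01 R) (Y1 := fun z => z ^+ s - 1)) => [h _|]; first by rewrite uuE.
apply: (wdiff_eq (cdiffB (cdiffX s (wdiff_id z)) (wdiff_cst 1 z))) => //.
by rewrite mulr1 subr0.
Qed.

(** ** Powers of 1 + u/B *)
Definition Ax c z := bser c (xx z).

Lemma cdiff_Ax c z : -1 <= c <= 1 -> normc (xx z) < 1 ->
 cdiff (Ax c) z (c%:C * s%:R * z ^+ s.-1 * Ax c z / (BC + uu z)).
Proof.
move=> cb x1.
have d1 : cdiff xx z (s%:R * z ^+ s.-1 / BC).
 apply: (wdiff_ext (@ltr01 R) (Y1 := fun z => BC^-1 * uu z)) => [h _|]; first by rewrite mulrC.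
 by apply: (wdiff_eq (cdiffZ BC^-1 (cdiff_uu z))) => //; rewrite mulrC.
apply: (wdiff_eq (cdiff_comp (cdiff_bser cb x1) d1)) => //.
have := one_plus_neq0 x1; rewrite /Ax one_plus_xx => n0.
have n1 : BC + uu z != 0 by apply: contra n0 => /eqP ->; rewrite mul0r.
have := BC_neq0; move: (bser c (xx z)) BC n1 => A b n1 b0.
by field; rewrite n1 b0.
Qed.

Definition sinv : R := (s%:R)^-1.
Lemma sinv_gt0 : 0 < sinv. Proof. by rewrite invr_gt0 ltr0n. Qed.
Lemma sinv_lt1 : sinv < 1. Proof. by rewrite invf_lt1 ?ltr0n// ltr1n. Qed.
Lemma nsinv_bound : -1 <= - sinv <= 1.
Proof. by have := sinv_gt0; have := sinv_lt1 => h1 h2; apply/andP; split; lra. Qed.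
Lemma sinv_bound : -1 <= sinv <= 1.
Proof. by have := sinv_gt0; have := sinv_lt1 => h1 h2; apply/andP; split; lra. Qed.
Hint Resolve sinv_gt0 nsinv_bound sinv_bound : core.

Lemma bser_root x : normc x < 1 -> bser sinv x ^+ s = 1 + x.
Proof.
move=> x1; have e : s%:R * sinv = 1 :> R by rewrite /sinv mulfV.
by rewrite bser_pow// e ?bser_1// lexx andbT (le_trans _ ler01) ?lerN10.
Qed.

Lemma bser_rootV x : normc x < 1 -> bser (- sinv) x = (bser sinv x)^-1.
Proof.
move=> x1; apply: (mulfI (bser_neq0 sinv_bound x1)).
by rewrite bser_mulN// mulfV// bser_neq0.
Qed.

(** The conformal map of the lemniscate onto the disc, an [s]-th root of the Moebius
  image of z^s. *)
Definition Kx z := Ax (- sinv) z.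
Lemma Kx_neq0 z : lem z -> Kx z != 0.
Proof. by move=> zG; rewrite bser_neq0// xx_lt1. Qed.

Lemma Kx_pow z : lem z -> Kx z ^+ s = BC / (BC + uu z).
Proof.
move=> zG; rewrite /Kx /Ax bser_rootV ?xx_lt1// exprVn bser_root ?xx_lt1//.
by rewrite one_plus_xx invfM invrK mulrC.
Qed.

Lemma cdiff_Kx z : lem z -> cdiff Kx z (- (z ^+ s.-1 * Kx z / (BC + uu z))).
Proof.
move=> zG; apply: (wdiff_eq (cdiff_Ax nsinv_bound (xx_lt1 zG))) => //.
rewrite /Kx rmorphN /sinv fmorphV rmorph_nat.
have := sC_neq0; move: (s%:R : C) => S S0; have := Bu_neq0 zG.
by move: (BC + uu z) => b b0; field; rewrite b0 S0.
Qed.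

Definition dzK z := Kx z * (BC - 1) / (BC + uu z).

Lemma cdiff_zK z : lem z -> cdiff (fun z => z * Kx z) z (dzK z).
Proof.
move=> zG; apply: (wdiff_eq (cdiffM (wdiff_id z) (cdiff_Kx zG))) => //.
have e : z * z ^+ s.-1 = 1 + uu z by rewrite -exprS prednK// uuE; ring.
rewrite /dzK mul1r mulrN !mulrA e; have := Bu_neq0 zG.
by move: (uu z) (Kx z) => u k n0; field.
Qed.

Definition phi0 z := r%:C^-1 * (z * Kx z).
Definition dphi0 z := r%:C^-1 * dzK z.

Lemma phi0_pow z : lem z -> phi0 z ^+ s = rs%:C * z ^+ s / (BC + uu z).
Proof.
move=> zG; have rs0 : rs%:C != 0 by rewrite (inj_eq (@complexI R)) gt_eqF.
have rsC : rs%:C = r%:C ^+ s by rewrite -rmorphXn.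
have BE2 : BC = rs%:C * rs%:C by rewrite -rmorphM /= BE expr2.
have n0 := Bu_neq0 zG; rewrite /phi0 2!exprMn Kx_pow// exprVn -rsC.
rewrite {1}BE2; move: (BC + uu z) n0 (rs%:C) rs0 (z ^+ s) => b b0 q q0 w.
by field; rewrite b0 q0.
Qed.

Lemma normc_lt1 n z : (0 < n)%N -> (normc (z ^+ n) < 1) = (normc z < 1).
Proof. by move=> n0; rewrite normcX expr_lt1// normc_ge0. Qed.

(** Surjectivity: the equation phi0 z = y determines z^s as a Moebius image of y^s, and then
 z itself as a multiple of y by a value of the binomial series. *)
Lemma phi0_disc : disc_map lem phi0 dphi0.
Proof.
split=> [z zG|z zG|z w zG wG e|y y1].
- exact: cdiffZ (cdiff_zK zG).
- rewrite -(normc_lt1 _ s0) phi0_pow// -(@expr_lt1 _ 2) ?normc_ge0// !normcM normcV normc_real.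
 rewrite (ger0_norm (ltW rs_gt0)) 2!exprMn exprVn -BE ltr_pdivrMr; last first.
  by rewrite exprn_gt0// normc_gt0 Bu_neq0.
 by rewrite mul1r -subr_gt0 level_identity mulr_gt0// subr_gt0.
- have n1 := Bu_neq0 zG; have n2 := Bu_neq0 wG.
 have ws : z ^+ s = w ^+ s.
  have := phi0_pow zG; rewrite e phi0_pow// !uuE in n1 n2 * => /eqP.
  rewrite eqr_div// => /eqP.
  have rs0 : rs%:C != 0 by rewrite (inj_eq (@complexI R)) gt_eqF.
  rewrite -!mulrA => /(mulfI rs0) h; apply: (mulfI B1_neq0).
  by apply/eqP; rewrite -subr_eq0; move/eqP: h; rewrite eq_sym -subr_eq0 => /eqP h;
    apply/eqP; rewrite -[RHS]h; ring.
 move: e; rewrite /phi0 => /(mulfI (invr_neq0 rC_neq0)).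
 have -> : Kx w = Kx z by rewrite /Kx /Ax /xx !uuE ws.
 by move/(mulIf (Kx_neq0 zG)).
have rs0 : rs%:C != 0 by rewrite (inj_eq (@complexI R)) gt_eqF.
have ys1 : normc (y ^+ s) < 1 by rewrite normc_lt1.
have d0 : rs%:C - y ^+ s != 0.
 rewrite -normc_gt0; have := normc_lb rs%:C (- y ^+ s).
 rewrite normcN normc_real (ger0_norm (ltW rs_gt0)) => h.
 by apply: lt_le_trans h; rewrite subr_gt0 (lt_trans ys1).
pose W := (BC - 1) * y ^+ s / (rs%:C - y ^+ s).
have BW : BC + (W - 1) = (BC - 1) * rs%:C / (rs%:C - y ^+ s).
 by rewrite /W; move: (BC) (rs%:C) d0 => b q d0; field.
have BW0 : BC + (W - 1) != 0 by rewrite BW !mulf_neq0 ?invr_eq0.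
(* membership of the solution in the lemniscate is read off the level identity *)
have small : normc (W - 1) ^+ 2 < B.
 have e : rs%:C * W = y ^+ s * (BC + (W - 1)).
  by rewrite BW /W; move: (BC) (rs%:C) d0 => b q d0; field.
 have n2 : B * normc W ^+ 2 = normc (y ^+ s) ^+ 2 * normc (BC + (W - 1)) ^+ 2.
  rewrite -exprMn -normcM -e (normcM rs%:C W); move: (normc W) => ww.
  by rewrite exprMn normc_real real_normK ?num_real// BE.
 have := level_identity_u (W - 1); rewrite [1 + _]addrC subrK.
 rewrite n2 -{1}[normc (BC + _) ^+ 2]mul1r -mulrBl => h.
 rewrite -subr_gt0 -(pmulr_rgt0 _ (_ : 0 < B - 1)) ?subr_gt0// -h.
 by rewrite mulr_gt0 ?exprn_gt0 ?normc_gt0// subr_gt0 expr_lt1// normc_ge0.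
pose x := (W - 1) / BC.
have x1 : normc x < 1.
 rewrite normcM normcV normc_real ger0_norm ?(ltW B_gt0)// ltr_pdivrMr// mul1r.
 rewrite (lt_trans _ (_ : rs < B)) //; last by rewrite BE expr2 ltr_pMl.
 by rewrite -(@ltr_pXn2r _ 2) ?nnegrE ?normc_ge0 -?BE// (ltW rs_gt0).
pose z := r%:C * y * bser sinv x.
have zs : z ^+ s = W.
 rewrite !exprMn bser_root// -rmorphXn /= -/rs /x.
 rewrite (_ : 1 + (W - 1) / BC = (BC + (W - 1)) / BC); last by rewrite [RHS]mulrDl divff.
 rewrite BW /W (_ : BC = rs%:C ^+ 2); last by rewrite BE rmorphXn.
 by move: (rs%:C) rs0 d0 => q q0 d0; field; rewrite d0 q0.
have uW : uu z = W - 1 by rewrite uuE zs.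
exists z; first by rewrite /lem /= ttE uW.
have -> : phi0 z = r%:C^-1 * (z * bser (- sinv) x) by rewrite /x -uW.
rewrite bser_rootV// /z.
have b0 := bser_neq0 sinv_bound x1; have := rC_neq0.
by move: (bser sinv x) (r%:C) b0 => b q b0 q0; field; rewrite b0 q0.
Qed.

(** ** The normalized map mu = z kappa *)
Definition kap : C -> C := locked_with lock_key (fun z => Kx z / Kx 0).
Lemma kapE z : kap z = Kx z / Kx 0. Proof. by rewrite /kap unlock. Qed.
Definition mu z := z * kap z.
Definition dmu z := kap z * (BC - 1) / (BC + uu z).

Lemma kap_neq0 z : lem z -> kap z != 0.
Proof. by move=> zG; rewrite kapE mulf_neq0 ?invr_eq0 ?Kx_neq0//; exact: lem0. Qed.

Lemma kap0 : kap 0 = 1. Proof. by rewrite kapE divff// Kx_neq0//; exact: lem0. Qed.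

Lemma uu0 : uu 0 = -1. Proof. by rewrite uuE expr0n gtn_eqF//= sub0r. Qed.

Lemma kap_pow z : lem z -> kap z ^+ s = (BC - 1) / (BC + uu z).
Proof.
move=> zG; rewrite kapE exprMn exprVn (Kx_pow zG) (Kx_pow lem0).
rewrite uu0; have := Bu_neq0 zG; have := B1_neq0; have := BC_neq0.
by move: (BC) (uu z) => b u b0 b1 bu; field; rewrite bu b0 b1.
Qed.

Lemma dmuE z : lem z -> dmu z = kap z ^+ s.+1.
Proof. by move=> zG; rewrite exprS kap_pow// /dmu mulrA. Qed.

Lemma cdiff_kap z : lem z -> cdiff kap z (- (z ^+ s.-1 * kap z / (BC + uu z))).
Proof.
move=> zG; have d1 := cdiffZ (Kx 0)^-1 (cdiff_Kx zG).
apply: (wdiff_ext (@ltr01 R) (Y1 := fun z => (Kx 0)^-1 * Kx z)) => [h _|]; first by rewrite kapE mulrC.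
by apply: (wdiff_eq d1) => //; rewrite kapE; ring.
Qed.

Lemma mu_phi0 z : phi0 z = Kx 0 / r%:C * mu z.
Proof.
have := Kx_neq0 lem0; rewrite /phi0 /mu kapE => k0; have := rC_neq0.
by move: (Kx 0) (r%:C) k0 => k q k0 q0; field; rewrite q0 k0.
Qed.

Lemma dmu_dphi0 z : dphi0 z = Kx 0 / r%:C * dmu z.
Proof.
have := Kx_neq0 lem0; rewrite /dphi0 /dzK /dmu !kapE => k0; have := rC_neq0.
by move: (Kx 0) (r%:C) ((BC + uu z)^-1) k0 => k q b k0 q0; field; rewrite q0 k0.
Qed.

Lemma cdiff_mu z : lem z -> cdiff mu z (dmu z).
Proof.
move=> zG; apply: (wdiff_eq (cdiffM (wdiff_id z) (cdiff_kap zG))) => //.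
have e : z * z ^+ s.-1 = 1 + uu z by rewrite -exprS prednK// uuE; ring.
rewrite /dmu mul1r mulrN !mulrA e; have := Bu_neq0 zG.
by move: (uu z) (kap z) => u k n0; field.
Qed.

Lemma mu_inj z w : lem z -> lem w -> mu z = mu w -> z = w.
Proof. move=> zG wG e; case: phi0_disc => _ _ inj _; apply: (inj z w zG wG).
by rewrite (mu_phi0 z) (mu_phi0 w) e. Qed.

Lemma mu_neq0 z : lem z -> z != 0 -> mu z != 0.
Proof. by move=> zG z0; rewrite /mu mulf_neq0 ?kap_neq0. Qed.

Lemma conformal_disc_map phi : conformal_onto_disk lem phi ->
 disc_map lem phi (derive1 (phi : C^o -> C^o)).
Proof.
move=> [dphi [fphi iphi sphi]]; split.
- by move=> z zG; apply: derivable_cdiff; exact: dphi.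
- by move=> z /fphi /=; rewrite normrE ltcR.
- by move=> z w zG wG; apply: iphi; rewrite inE.
- move=> w w1; have : [set w : C | `|w| < 1] w by rewrite /= normrE ltcR.
 by move=> /sphi[z zG <-]; exists z.
Qed.

(** All conformal maps onto the disc have the same kernel, and mu is a multiple of one. *)
Lemma Lker_mu phi z w : conformal_onto_disk lem phi -> lem z -> lem w -> w != z ->
 Lker phi w z = dmu w * dmu z / (mu z - mu w) ^+ 2.
Proof.
move=> /conformal_disc_map dphi zG wG wz.
rewrite /Lker (disc_map_kernel plane_open_lem dphi phi0_disc zG wG); last by rewrite eq_sym.
rewrite !dmu_dphi0 !mu_phi0 -mulrBr.
have k0 : Kx 0 / r%:C != 0 by rewrite mulf_neq0 ?invr_eq0 ?Kx_neq0//; exact: lem0.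
have m0 : mu z - mu w != 0.
 by rewrite subr_eq0; apply: contra wz => /eqP/(mu_inj zG wG) ->.
have m1 : mu w - mu z != 0 by rewrite -opprB oppr_eq0.
move: (Kx 0 / r%:C) k0 (mu w) (mu z) (dmu w) (dmu z) m0 m1 => k k0 a b p q m0 m1.
by field; rewrite k0 m0 m1.
Qed.

(** ** Taylor coefficients of the kernel *)

Definition gam : C := (s%:R * (BC - 1))^-1.

Lemma lem_ball : exists2 d : R, 0 < d & forall z, normc z < d -> lem z.
Proof.
have [d d0 hd] := plane_open_lem lem0; exists d => // z /hd; by rewrite add0r.
Qed.

(** The equation kappa' = - z^(s-1) kappa^(s+1) / (B - 1) determines the jet. *)
Lemma jet_kap n : (n < 2 * s)%N -> has_jet n kap (1 - gam%:P * 'X^s).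
Proof.
have v0 : (1 - gam%:P * 'X^s).[0] = 1.
 by rewrite hornerD hornerN hornerM !hornerC hornerXn expr0n gtn_eqF//= mulr0 subr0.
elim: n => [|n ih] ns; first by split => //; rewrite kap0 v0.
have [d d0 dG] := lem_ball.
apply: (has_jet_ode (d := d) (f' := fun z => - (BC - 1)^-1 * (z ^+ s.-1 * kap z ^+ s.+1))) => //.
- by rewrite kap0 v0.
- move=> z /dG zG; apply: (wdiff_eq (cdiff_kap zG)) => //.
 have := kap_pow zG; rewrite exprS => ->; have := Bu_neq0 zG; have := B1_neq0.
 by move: (BC) (uu z) (kap z) (z ^+ s.-1) => b u k p b1 bu; field; rewrite bu b1.
have jz := has_jetM (has_jet_exp s.-1 (@has_jetX R n)) (has_jet_exp s.+1 (ih (ltnW ns))).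
have [q hq] : exists q, (1 - gam%:P * 'X^s) ^+ s.+1 = 1 + 'X^s * q.
 elim: {jz ih ns}(s.+1) => [|k [q hq]]; first by exists 0; rewrite expr0 mulr0 addr0.
 exists (q - gam%:P * (1 + 'X^s * q)); rewrite exprS hq; ring.
have [e he] : exists e, (s.-1 + s = n.+1 + e)%N.
 by exists (s.-1 + s - n.+1)%N; rewrite subnKC// -ltnS -addSn prednK// addnn -mul2n.
apply: (has_jet_mod (has_jetZ _ jz) (r := (BC - 1)^-1%:P * 'X^e * q)).
have -> : (1 - gam%:P * 'X^s)^`() = - (gam%:P * ('X^(s.-1) *+ s)).
 by rewrite derivB -[X in X^`() - _]polyC1 derivM !derivC derivXn mul0r !add0r.
rewrite hq mulrDr mulr1.
have -> : 'X^(s.-1) * ('X^s * q) = 'X^(n.+1) * ('X^e * q) by rewrite !mulrA -!exprD he.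
have -> : gam%:P * ('X^(s.-1) *+ s) = (BC - 1)^-1%:P * 'X^(s.-1).
 rewrite -mulr_natl mulrA; congr (_ * _); rewrite mulrC.
 by rewrite -polyC_natr -polyCM /gam invfM mulrA mulfV// mul1r.
by rewrite polyCN; ring.
Qed.

Lemma jet_mu n : (n < 2 * s)%N -> has_jet n mu ('X - gam%:P * 'X^(s.+1)).
Proof.
move=> /jet_kap jk; have := has_jetM (@has_jetX R n) jk.
by rewrite mulrBr mulr1 mulrCA -exprS.
Qed.

(** The reciprocal of M - X + gam X^(s+1) up to order 2 s. *)
Definition inv_jet (M : C) : {poly C} :=
 \poly_(i < 2 * s) (M ^- i.+1) - gam%:P * ('X^s * \poly_(i < 2 * s) (i%:R * M ^- i.+1)).

Lemma inv_jetP (M : C) : M != 0 -> exists q,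
 (M%:P - ('X - gam%:P * 'X^(s.+1))) * inv_jet M = 1 + 'X^(2 * s) * q.
Proof.
move=> M0.
have geo k : (M%:P - 'X) * (\poly_(i < k) (M ^- i.+1)) = 1 - (M ^- k)%:P * 'X^k.
 rewrite poly_def; elim: k => [|k ih].
  by rewrite big_ord0 mulr0 expr0 invr1 polyC1 mul1r subrr.
 rewrite big_ord_recr /= mulrDr ih -mul_polyC mulrBl.
 have -> : M%:P * ((M ^- k.+1)%:P * 'X^k) = (M ^- k)%:P * 'X^k.
  by rewrite mulrA -polyCM exprS invfM mulVKf.
 by rewrite (exprS 'X k); ring.
have geo1 k : (M%:P - 'X) * (\poly_(i < k.+1) (i%:R * M ^- i.+1)) =
  'X * (\poly_(i < k.+1) (M ^- i.+1)) - (k.+1%:R * M ^- k.+1)%:P * 'X^(k.+1).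
 rewrite !poly_def; elim: k => [|k ih].
  by rewrite !big_ord1 !mul0r scale0r mulr0 mul1r -mul_polyC mulr1 expr1 mulrC subrr.
 rewrite [in LHS]big_ord_recr [in RHS]big_ord_recr /= mulrDr ih mulrDr -!mul_polyC mulrBl.
 have -> : M%:P * ((k.+1%:R * M ^- k.+2)%:P * 'X^(k.+1)) = (k.+1%:R * M ^- k.+1)%:P * 'X^(k.+1).
  by rewrite mulrA -polyCM mulrCA (exprS M k.+1) invfM mulVKf.
 have -> : (k.+2%:R * M ^- k.+2)%:P = (k.+1%:R * M ^- k.+2)%:P + (M ^- k.+2)%:P.
  by rewrite -polyCD -natr1 mulrDl mul1r.
 by rewrite (exprS 'X k.+1); ring.
have [k hk] : exists k, (2 * s = k.+1)%N by exists (2 * s).-1; rewrite prednK// muln_gt0.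
have := geo k.+1; have := geo1 k; rewrite /inv_jet hk.
move: (\poly_(i < _) _) (\poly_(i < _) _) => S1 S2 h2 h1.
exists (- (M ^- k.+1)%:P - gam%:P ^+ 2 * 'X * S2 + gam%:P * 'X^s * (k.+1%:R * M ^- k.+1)%:P).
have e2 : 'X^s * 'X^s = 'X^(k.+1) :> {poly C} by rewrite -exprD addnn -mul2n hk.
have -> : (M%:P - ('X - gam%:P * 'X^(s.+1))) * (S1 - gam%:P * ('X^s * S2)) =
 (M%:P - 'X) * S1 - gam%:P * 'X^s * ((M%:P - 'X) * S2) + gam%:P * ('X * 'X^s) * S1
 - gam%:P ^+ 2 * 'X * ('X^s * 'X^s) * S2 by rewrite exprS; ring.
by rewrite h1 h2 e2; ring.
Qed.

Lemma dLker0_coef phi z j : conformal_onto_disk lem phi -> lem z -> z != 0 ->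
 (j.+1 < 2 * s)%N ->
 dLker0 phi j z = dmu z * (j.+1`!%:R * (inv_jet (mu z))`_j.+1).
Proof.
move=> hphi zG z0 js; have M0 := mu_neq0 zG z0.
have [q hq] := inv_jetP M0.
have [d d0 dG] := lem_ball.
pose e := Num.min d (normc z); have e0 : 0 < e by rewrite lt_min d0 normc_gt0.
have eG w : normc w < e -> lem w /\ w != z.
 rewrite lt_min => /andP[/dG wG wz]; split => //; apply/eqP => wz'.
 by rewrite wz' ltxx in wz.
have nz w : normc w < e -> mu z - mu w != 0.
 move=> /eG[wG wz]; rewrite subr_eq0; apply: contra wz => /eqP/(mu_inj zG wG) ->; exact: eqxx.
have [k hk] : exists k, (2 * s = j.+2 + k)%N by exists (2 * s - j.+2)%N; rewrite subnKC.
have jT : has_jet j.+1 (fun w => (mu z - mu w)^-1) (inv_jet (mu z)).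
 apply: (has_jetV e0 nz (p := (mu z)%:P - ('X - gam%:P * 'X^(s.+1))) (r := 'X^k * q)).
  have := has_jetD (has_jet_cst j.+1 (mu z)) (has_jetZ (-1) (jet_mu js)).
  rewrite polyCN polyC1 mulN1r.
  by apply: (has_jet_near (ltr01 : 0 < (1 : R))) => w _; rewrite mulN1r.
 by rewrite hq hk exprD mulrA.
have jT' : has_jet j (fun w => dmu w / (mu z - mu w) ^+ 2) (inv_jet (mu z))^`().
 apply: (has_jet_uniq e0) jT => w we; have [wG _] := eG w we.
 apply: (wdiff_eq (cdiffV (cdiffB (wdiff_cst (mu z) w) (cdiff_mu wG)) (nz w we))) => //.
 by rewrite sub0r opprK.
have jL : has_jet j (fun w => Lker phi w z) ((dmu z)%:P * (inv_jet (mu z))^`()).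
 apply: (has_jet_near e0) (has_jetZ (dmu z) jT') => w /eG[wG wz].
 by rewrite (Lker_mu hphi zG wG wz); ring.
rewrite /dLker0 (derive1n_jet jL) coefCM coef_deriv factS natrM -mulr_natl.
by move: (dmu z) ((inv_jet (mu z))`_j.+1) => a b; ring.
Qed.

(** The two kernel derivatives that occur in the asymptotics. *)
Definition ker0 k z := dmu z / mu z ^+ k.+1.
Definition ker1 k z := dmu z / mu z ^+ (s + k).+1 - gam * k%:R * ker0 k z.

Lemma dLker0_ker0 phi z k : conformal_onto_disk lem phi -> lem z -> z != 0 ->
 (0 < k)%N -> (k < s)%N -> dLker0 phi k.-1 z = k`!%:R * ker0 k z.
Proof.
move=> hphi zG z0 k0 ks; have ks2 : (k < 2 * s)%N by rewrite (leq_trans ks)// leq_pmull.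
rewrite (dLker0_coef hphi zG z0) prednK//.
rewrite /inv_jet coefB coefCM coefXnM ks mulr0 subr0 coef_poly ks2 /ker0.
by move: (dmu z) => a; ring.
Qed.

Lemma dLker0_ker1 phi z k : conformal_onto_disk lem phi -> lem z -> z != 0 ->
 (0 < k)%N -> (k < s)%N -> dLker0 phi (s + k).-1 z = (s + k)`!%:R * ker1 k z.
Proof.
move=> hphi zG z0 k0 ks.
have ks2 : (s + k < 2 * s)%N by rewrite mul2n -addnn ltn_add2l.
have ks3 : (k < 2 * s)%N by rewrite (leq_trans ks)// leq_pmull.
rewrite (dLker0_coef hphi zG z0) prednK ?addn_gt0 ?s0//.
rewrite /inv_jet coefB coefCM coefXnM ltnNge leq_addr /= addKn !coef_poly ks2 ks3 /ker1 /ker0.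
by move: (dmu z) => a; ring.
Qed.

End Lemniscate.

(** * Convergence and rotation invariance of planar integrals *)
Section PlanarMeasure.
Variable R : realType.
Local Notation C := R[i].
Local Notation mR := (measurableTypeR R).
Local Notation mu1 := (@lebesgue_measure R).
Local Notation mu2 := (@lebesgue_measure R \x @lebesgue_measure R)%E.
Implicit Types (f g : C -> R) (z w h : C).

Lemma int2_cvg (F : nat -> C -> R) f g : (forall n, plane_mfun (F n)) -> plane_mfun f ->
 mu2.-integrable setT (EFin \o (fun p => g (toC p))) ->
 (forall n z, `|F n z| <= g z) -> (forall z, F n z @[n --> \oo] --> f z) ->
 int2 (F n) @[n --> \oo] --> int2 f.
Proof.
move=> mF mf ig Fg Ff.
have mE (h : C -> R) : plane_mfun h -> measurable_fun setT (EFin \o (fun p : mR * mR => h (toC p))).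
 by move=> mh; exact/measurable_EFinP.
have bd n (p : mR * mR) : (`|(F n (toC p))%:E| <= (g (toC p))%:E)%E by rewrite lee_fin.
have ae1 : {ae mu2, forall p : mR * mR, setT p ->
  (F n (toC p))%:E @[n --> \oo] --> (f (toC p))%:E}.
 by apply: aeW => p _; apply/cvg_EFin; [exact: nearW | exact: Ff].
have ae2 : {ae mu2, forall (p : mR * mR) n, setT p ->
  (`|(F n (toC p))%:E| <= (EFin \o (fun p => g (toC p))) p)%E}.
 by apply: aeW => p n _; exact: bd.
have [if_ _ cv] := dominated_convergence measurableT (fun n => mE _ (mF n)) (mE _ mf) ae1 ig ae2.
rewrite {2}/int2 /Rintegral; apply: fine_cvg.
by rewrite fineK //; exact: integrable_fin_num if_.
Qed.

Lemma translation_invariant (g : R -> \bar R) (c : R) :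
 measurable_fun (setT : set mR) g -> (forall x, 0 <= g x)%E ->
 (\int[mu1]_x g (x + c)%R = \int[mu1]_x g x)%E.
Proof.
move=> mg g0; pose phi : mR -> mR := fun x => x + c.
have mphi : measurable_fun setT phi by apply: measurable_funD.
have pE A : measurable A -> pushforward mu1 phi A = mu1 A.
 pose mx := isMeasurableFun.Build _ _ _ _ _ mphi.
 pose pk : {mfun mR >-> mR} := HB.pack phi mx.
 move=> mA; apply/esym/(@lebesgue_measure_unique _ (pushforward mu1 pk)) => //= _ [[a b]] _ <-.
 rewrite /pushforward (_ : phi @^-1` _ = `]a - c, b - c]%classic); last first.
  by apply/seteqP; split => x /=; rewrite !in_itv/= /phi ltrBlDr lerBrDr.
 rewrite !lebesgue_measure_itv/= !lte_fin ltrD2r.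
 by case: ifP => // _; rewrite -!EFinB; congr EFin; ring.
have := @ge0_integral_pushforward _ _ _ _ _ phi mphi mu1 setT g measurableT mg (fun y _ => g0 y).
rewrite preimage_setT => <-; apply: eq_measure_integral => A mA _ /=.
exact: pE.
Qed.

(** Shears preserve area, and a rotation is a product of three shears. *)
Definition shx (t : R) z : C := z + (t * Im z)%:C.
Definition shy (t : R) z : C := z + (0 +i* (t * Re z)).

Lemma shxK t z : shx (- t) (shx t z) = z.
Proof. by case: z => x y; rewrite /shx /=; apply/eqP; rewrite eq_complex /=; apply/andP; split; apply/eqP; ring. Qed.
Lemma shyK t z : shy (- t) (shy t z) = z.
Proof. by case: z => x y; rewrite /shy /=; apply/eqP; rewrite eq_complex /=; apply/andP; split; apply/eqP; ring. Qed.

Lemma normc_shx t z : normc (shx t z) <= (1 + `|t|) * normc z.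
Proof.
rewrite mulrDl mul1r; apply: normc_le2 => //.
by rewrite normc_real normrM ler_wpM2l ?normc_Im.
Qed.
Lemma normc_shy t z : normc (shy t z) <= (1 + `|t|) * normc z.
Proof.
rewrite mulrDl mul1r; apply: normc_le2 => //.
by rewrite normc_im normrM ler_wpM2l ?normc_Re.
Qed.

Lemma tame_comp f (k k' : C -> C) (N : R) : tame f -> plane_mfun (fun z => f (k z)) ->
 (forall z, k' (k z) = z) -> (forall z, normc (k' z) <= N * normc z) -> 0 <= N ->
 tame (fun z => f (k z)).
Proof.
move=> [mf [M hM]] mk kK kN N0; split => //; exists (Num.max M (N * M)) => z; split.
 by rewrite (le_trans (hM _).1)// le_max lexx.
rewrite gt_max => /andP[_ zM]; apply: (hM _).2; rewrite ltNge; apply/negP => kz.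
have := kN (k z); rewrite kK leNgt => /negP; apply.
by apply: le_lt_trans zM; rewrite ler_wpM2l.
Qed.

Lemma plane_mfun_shx f t : plane_mfun f -> plane_mfun (fun z => f (shx t z)).
Proof.
move=> mf; pose k (p : mR * mR) : mR * mR := (p.1 + t * p.2, p.2).
have mk : measurable_fun setT k.
 apply/measurable_fun_pairP; split => /=; last exact: measurable_snd.
 by apply: measurable_funD; [exact: measurable_fst | apply: measurable_funM => //; exact: measurable_snd].
rewrite /plane_mfun (_ : (fun p => _) = (fun p : mR * mR => f (toC p)) \o k).
 exact: measurableT_comp.
apply/funext => -[x y] /=; congr f; rewrite /shx /toC /=.
by apply/eqP; rewrite eq_complex /= addr0 !eqxx.
Qed.

Lemma plane_mfun_shy f t : plane_mfun f -> plane_mfun (fun z => f (shy t z)).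
Proof.
move=> mf; pose k (p : mR * mR) : mR * mR := (p.1, p.2 + t * p.1).
have mk : measurable_fun setT k.
 apply/measurable_fun_pairP; split => /=; first exact: measurable_fst.
 by apply: measurable_funD; [exact: measurable_snd | apply: measurable_funM => //; exact: measurable_fst].
rewrite /plane_mfun (_ : (fun p => _) = (fun p : mR * mR => f (toC p)) \o k).
 exact: measurableT_comp.
apply/funext => -[x y] /=; congr f; rewrite /shy /toC /=.
by apply/eqP; rewrite eq_complex /= ?addr0 !eqxx.
Qed.

Lemma tame_shx f t : tame f -> tame (fun z => f (shx t z)).
Proof.
move=> tf; apply: (tame_comp (k' := shx (- t)) (N := 1 + `|- t|) tf).
- exact: plane_mfun_shx tf.1.
- exact: shxK.
- exact: normc_shx.
- by rewrite addr_ge0.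
Qed.

Lemma tame_shy f t : tame f -> tame (fun z => f (shy t z)).
Proof.
move=> tf; apply: (tame_comp (k' := shy (- t)) (N := 1 + `|- t|) tf).
- exact: plane_mfun_shy tf.1.
- exact: shyK.
- exact: normc_shy.
- by rewrite addr_ge0.
Qed.

(** Positive functions suffice for an invariance property. *)
Lemma int2_invariance (k : C -> C) : (forall f, tame f -> tame (fun z => f (k z))) ->
 (forall f, tame f -> (forall z, 0 <= f z) -> int2 (fun z => f (k z)) = int2 f) ->
 forall f, tame f -> int2 (fun z => f (k z)) = int2 f.
Proof.
move=> tk inv f tf; have ta := tame_abs tf; have tp := tameD tf ta.
have fE (g : C -> R) : g = (fun z => (g z + `|g z|) - `|g z|).
 by apply/funext => z; rewrite addrK.
rewrite {1}(fE f) [in RHS](fE f) (int2B tp ta) (int2B (tk _ tp) (tk _ ta)).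
rewrite (inv (fun z => `|f z|))// (inv (fun z => f z + `|f z|))// => z.
by rewrite -lerBlDl sub0r -normrN ler_norm.
Qed.

Lemma int2_shx f t : tame f -> int2 (fun z => f (shx t z)) = int2 f.
Proof.
apply: int2_invariance f => [f|f tf f0]; first exact: tame_shx.
rewrite /int2 /Rintegral; congr fine.
have m1 : measurable_fun setT (fun p : mR * mR => (f (toC p))%:E) by case: tf => mf _; exact/measurable_EFinP.
have m2 : measurable_fun setT (fun p : mR * mR => (f (shx t (toC p)))%:E).
 by case: (tame_shx t tf) => mf _; exact/measurable_EFinP.
rewrite (@fubini_tonelli2 _ _ _ _ _ mu1 mu1 _ m1) => [|p]; last by rewrite lee_fin.
rewrite (@fubini_tonelli2 _ _ _ _ _ mu1 mu1 _ m2) => [|p]; last by rewrite lee_fin.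
apply: eq_integral => y _; rewrite /fubini_G.
have := @translation_invariant (fun x => (f (toC (x, y)))%:E) (t * y).
move=> <-; last by move=> x; rewrite lee_fin.
 apply: eq_integral => x _; congr (f _)%:E; rewrite /shx /toC /=.
 by apply/eqP; rewrite eq_complex /= addr0 !eqxx.
apply: (measurableT_comp m1 (_ : measurable_fun (setT : set mR) (fun x : mR => (x, y) : mR * mR))).
by apply/measurable_fun_pairP; split; [exact: measurable_id | exact: measurable_cst].
Qed.

Lemma int2_shy f t : tame f -> int2 (fun z => f (shy t z)) = int2 f.
Proof.
apply: int2_invariance f => [f|f tf f0]; first exact: tame_shy.
rewrite /int2 /Rintegral; congr fine.
have m1 : measurable_fun setT (fun p : mR * mR => (f (toC p))%:E) by case: tf => mf _; exact/measurable_EFinP.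
have m2 : measurable_fun setT (fun p : mR * mR => (f (shy t (toC p)))%:E).
 by case: (tame_shy t tf) => mf _; exact/measurable_EFinP.
rewrite (@fubini_tonelli1 _ _ _ _ _ mu1 mu1 _ m1) => [|p]; last by rewrite lee_fin.
rewrite (@fubini_tonelli1 _ _ _ _ _ mu1 mu1 _ m2) => [|p]; last by rewrite lee_fin.
apply: eq_integral => x _; rewrite /fubini_F.
have := @translation_invariant (fun y => (f (toC (x, y)))%:E) (t * x).
move=> <-; last by move=> y; rewrite lee_fin.
 apply: eq_integral => y _; congr (f _)%:E; rewrite /shy /toC /=.
 by apply/eqP; rewrite eq_complex /= ?addr0 !eqxx.
apply: (measurableT_comp m1 (_ : measurable_fun (setT : set mR) (fun y : mR => (x, y) : mR * mR))).
by apply/measurable_fun_pairP; split; [exact: measurable_cst | exact: measurable_id].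
Qed.

Lemma rotation_shears w z : normc w = 1 -> Im w != 0 ->
 w * z = let p := (Re w - 1) / Im w in
     shx p (shy (Im w) (shx p z)).
Proof.
case: w => a b; case: z => x y /= w1 b0.
have ab : a ^+ 2 + b ^+ 2 = 1.
 by have := normc_sqr (a +i* b); rewrite /= w1 expr1n => <-.
apply/eqP; rewrite eq_complex /=; apply/andP; split; apply/eqP; last by field.
have -> : a * x - b * y = a * x - b ^+ 2 / b * y by field.
have -> : b ^+ 2 = 1 - a ^+ 2 by rewrite -ab; ring.
by field.
Qed.

Lemma rotation_invariant w f : normc w = 1 -> tame f ->
 tame (fun z => f (w * z)) /\ int2 (fun z => f (w * z)) = int2 f.
Proof.
have im w0 f0 : normc w0 = 1 -> Im w0 != 0 -> tame f0 ->
  tame (fun z => f0 (w0 * z)) /\ int2 (fun z => f0 (w0 * z)) = int2 f0.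
 move=> w1 i0 tf; have t1 := tame_shx ((Re w0 - 1) / Im w0) tf.
 have t2 := tame_shy (Im w0) t1.
 have t3 := tame_shx ((Re w0 - 1) / Im w0) t2.
 rewrite (_ : (fun z => f0 (w0 * z)) = fun z => f0 (shx ((Re w0 - 1) / Im w0)
  (shy (Im w0) (shx ((Re w0 - 1) / Im w0) z)))).
  by split => //; rewrite (int2_shx _ t2) (int2_shy _ t1) (int2_shx _ tf).
 by apply/funext => z; rewrite rotation_shears.
move=> w1 tf; have [i0|] := eqVneq (Im w) 0; last by move=> i0; exact: im.
pose I : C := 0 +i* 1; have i1 : normc I = 1 by rewrite normc_im normr1.
have [ta ia] := im I _ i1 (oner_neq0 _) tf.
have [tb ib] := im I _ i1 (oner_neq0 _) ta.
have : w = 1 \/ w = -1.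
 have : Re w ^+ 2 = 1 by rewrite -[RHS](expr1n _ 2) -w1 normc_sqr i0 expr0n addr0.
 move/eqP; rewrite sqrf_eq1 => /orP[] /eqP e; [left|right]; apply/eqP;
  by rewrite eq_complex /= e i0 ?oppr0 !eqxx.
case=> ->; first by rewrite (_ : (fun z => f (1 * z)) = f)//; apply/funext => z; rewrite mul1r.
rewrite (_ : (fun z => f (-1 * z)) = fun z => f (I * (I * z))); first by split => //; rewrite ib ia.
by apply/funext => z; rewrite mulrA; congr (f (_ * z)); apply/eqP; rewrite eq_complex /= !mul0r !mulr1 ?mulr0 ?mul1r ?sub0r ?addr0 oppr0 !eqxx.
Qed.

Lemma cint_rotation w (F : C -> C) : normc w = 1 -> ctame F ->
 cint (fun z => F (w * z)) = cint F.
Proof.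
by move=> w1 [tr ti]; congr (_ +i* _); apply: (rotation_invariant w1 _).2.
Qed.

(** ** The Gaussian integral over the plane *)
Definition gauss2 z : R := expR (- normc z ^+ 2).

Lemma gauss2_toC (p : R * R) : gauss2 (toC p) = gauss_fun p.1 * gauss_fun p.2.
Proof. by rewrite /gauss2 normc_sqr /gauss_fun -expRD opprD. Qed.

Lemma gauss2_integral : (\int[mu2]_p (gauss2 (toC p))%:E)%E = (pi : R)%:E /\
 plane_mfun gauss2.
Proof.
have mg : plane_mfun gauss2.
 rewrite /plane_mfun (_ : (fun p => _) = fun p : mR * mR => gauss_fun p.1 * gauss_fun p.2).
  by apply: measurable_funM; apply: measurableT_comp measurable_gauss_fun _;
   [exact: measurable_fst | exact: measurable_snd].
 by apply/funext => p; exact: gauss2_toC.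
split => //; have m1 : measurable_fun setT (fun p : mR * mR => (gauss2 (toC p))%:E).
 exact/measurable_EFinP.
rewrite (@fubini_tonelli1 _ _ _ _ _ mu1 mu1 _ m1) => [|p]; last by rewrite lee_fin expR_ge0.
have mG : measurable_fun (setT : set mR) (fun x => (gauss_fun x)%:E : \bar R).
 by apply/measurable_EFinP; exact: measurable_gauss_fun.
have g0 (x : R) : (0 <= (gauss_fun x)%:E)%E by rewrite lee_fin gauss_fun_ge0.
transitivity (\int[mu1]_x ((Num.sqrt pi)%:E * (gauss_fun x)%:E))%E.
 apply: eq_integral => x _; rewrite /fubini_F.
 rewrite (eq_integral (fun y : mR => ((gauss_fun x)%:E * (gauss_fun y)%:E)%E)); last first.
  by move=> y _; rewrite gauss2_toC EFinM.
 by rewrite ge0_integralZl//; rewrite integralT_gauss muleC.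
rewrite ge0_integralZl ?lee_fin ?sqrtr_ge0//.
by rewrite integralT_gauss -EFinM -expr2 sqr_sqrtr// pi_ge0.
Qed.

Lemma gauss2_integrable : mu2.-integrable setT (EFin \o (fun p => gauss2 (toC p))).
Proof.
have [ig mg] := gauss2_integral; apply/integrableP; split; first exact/measurable_EFinP.
rewrite (eq_integral (fun p : mR * mR => (gauss2 (toC p))%:E)) ?ig ?ltry//.
by move=> p _ /=; rewrite ger0_norm// expR_ge0.
Qed.

Lemma int2_gauss : int2 gauss2 = pi.
Proof. by rewrite /int2 /Rintegral (gauss2_integral).1. Qed.

End PlanarMeasure.

(** * Total mass of a radial cutoff derivative *)
Section RadialMass.
Variable R : realType.
Local Notation C := R[i].
Implicit Types (z w h : C).

Lemma expR_quad (x : R) : `|x| <= 2^-1 -> `|expR x - 1 - x| <= 2 * x ^+ 2.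
Proof.
rewrite ler_norml => /andP[xa xb].
have h1 := expR_ge1Dx x; have h2 := expR_ge1Dx (- x).
have h3 : expR x * expR (- x) = 1 by rewrite -expRD subrr expR0.
have h4 : 0 < expR x by exact: expR_gt0.
have h5 : expR x * (1 - x) <= 1 by rewrite -[leRHS]h3 ler_wpM2l ?expR_ge0.
move: (expR x) h1 h4 h5 => e h1 h4 h5; rewrite ger0_norm; last by lra.
have : e <= 1 + x + 2 * x ^+ 2.
 have p : 0 < 1 - x by lra.
 rewrite -(ler_pM2r p); apply: (le_trans h5).
 have q : 0 <= x ^+ 2 * (1 - 2 * x) by rewrite mulr_ge0 ?sqr_ge0//; lra.
 nra.
lra.
Qed.

Definition gaussC z : C := (gauss2 z)%:C.

Lemma wdiff_gauss z : wdiff gaussC z (- (gaussC z * z^*)) (- (gaussC z * z)).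
Proof.
pose L : R := 2 * normc z + 1.
have L1 : 1 <= L by rewrite lerDr mulr_ge0// normc_ge0.
have L0 : 0 < L by apply: lt_le_trans L1.
apply: (@little_o_quad _ _ (2 * L ^+ 2 + 1) (2^-1 / L)); first by rewrite divr_gt0.
move=> h; rewrite ltr_pdivlMr// => hL.
have n0 := normc_ge0 h.
pose d : R := normc (z + h) ^+ 2 - normc z ^+ 2.
have dE : d%:C = z^* * h + z * h^* + (normc h ^+ 2)%:C.
 by rewrite rmorphB /= -!mul_conjc rmorphD /=; ring.
have dL : `|d| <= L * normc h.
 rewrite -normc_real dE /L mulrDl mul1r; apply: normc_le2.
  rewrite (_ : 2 * normc z * normc h = normc z * normc h + normc z * normc h); last by ring.
  by apply: normc_le2; rewrite normcM normcJ.
 rewrite normc_real ger0_norm ?exprn_ge0// expr2 ler_piMl//.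
 apply: le_trans (_ : normc h * L <= _); first by rewrite ler_peMr.
 by rewrite (le_trans (ltW hL))// invf_le1 ?ler1n.
have e2 := expR_quad (_ : `|- d| <= 2^-1).
rewrite normrN in e2; have {}e2 := e2 (le_trans dL _).
have {}e2 : `|expR (- d) - 1 - - d| <= 2 * (- d) ^+ 2.
 by apply: e2; rewrite mulrC ltW.
have gE : gauss2 (z + h) = gauss2 z * expR (- d).
 by rewrite /gauss2 -expRD; congr expR; rewrite /d; ring.
rewrite /gaussC gE rmorphM.
have -> : (gauss2 z)%:C * (expR (- d))%:C - (gauss2 z)%:C -
  (- ((gauss2 z)%:C * z^*) * h + - ((gauss2 z)%:C * z) * h^*) =
  (gauss2 z)%:C * ((expR (- d) - 1 - - d)%:C + - (normc h ^+ 2)%:C).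
 have -> : (expR (- d) - 1 - - d)%:C = (expR (- d))%:C - 1 + d%:C.
  by rewrite opprK rmorphD rmorphB rmorph1.
 by rewrite dE; ring.
rewrite normcM normc_real ger0_norm ?expR_ge0// -[leRHS]mul1r.
apply: ler_pM; rewrite ?expR_ge0 ?normc_ge0//.
 by rewrite -expR0 ler_expR oppr_le0 exprn_ge0// normc_ge0.
rewrite mulrDl mul1r; apply: normc_le2.
 rewrite normc_real (le_trans e2)// -mulrA ler_wpM2l// sqrrN -exprMn.
 by rewrite -[leLHS]real_normK ?num_real// lerXn2r// nnegrE ?mulr_ge0// ltW.
by rewrite normcN normc_real ger0_norm// exprn_ge0.
Qed.

Variables (t0 t1 : R).
Hypotheses (t00 : 0 < t0) (t01 : t0 < t1).

Let nn1 (n : nat) : (n%:R : R) < n.+1%:R. Proof. by rewrite ltr_nat. Qed.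

(** Every cutoff profile in |z|^2 has the same mass; comparing with a truncated Gaussian
  identifies it. *)
Lemma radial_mass_gauss n : int2 (fun z => dstepA t0 t1 (normc z ^+ 2)) =
 int2 (fun z => gauss2 z * ((1 - stepA n.+1%:R n.+2%:R (normc z ^+ 2))
  + dstepA n.+1%:R n.+2%:R (normc z ^+ 2))).
Proof.
set k := fun z : C => dstepA t0 t1 (normc z ^+ 2).
pose a : R := n.+1%:R; pose b : R := n.+2%:R; have ab : a < b := nn1 n.+1.
rewrite -/a -/b; set F := fun z : C => _.
pose J z : C := 1 - (stepA t0 t1 (normc z ^+ 2))%:C - gaussC z * (1 - (stepA a b (normc z ^+ 2))%:C).
pose Y z : C := J z * z^-1; pose q z : C := (F z - k z)%:C.
have dJ z : exists p, wdiff J z p (q z * z).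
 have d1 := wdiffB (wdiff_cst 1 z) (wdiff_sqmod (@quad_stepA R t0 t1) (wdiff_id z)).
 have d2 := wdiffB (wdiff_cst 1 z) (wdiff_sqmod (@quad_stepA R a b) (wdiff_id z)).
 have d3 := wdiffB d1 (wdiffM (wdiff_gauss z) d2).
 eexists; apply: (wdiff_eq d3) => //.
 have -> : (1 : C)^* = 1 by exact: rmorph1.
 rewrite /q /F /k /gaussC.
 by move: (gauss2 z) (stepA a b _) (dstepA a b _) (dstepA t0 t1 _) => x1 x2 x3 x4; ring.
have dY z : exists p, wdiff Y z p (q z).
 have [->|z0] := eqVneq z 0; last first.
  have [p d1] := dJ z; eexists; apply: (wdiff_eq (wdiffM d1 (cdiff_inv z0))) => //.
  by rewrite mulr0 addr0 mulfK.
 (* near 0, Y = (1 - exp(-|z|^2)) / z = conj(z) + O(|z|^3) *)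
 exists 0; pose m : R := Num.min t0 2^-1; have m0 : 0 < m by rewrite lt_min t00 invr_gt0 ltr0n.
 have mt z' : normc z' < m -> [/\ normc z' ^+ 2 < t0, normc z' ^+ 2 < a & normc z' ^+ 2 < 2^-1].
  rewrite lt_min => /andP[h1 h2].
  have h3 : normc z' ^+ 2 <= normc z'.
   by rewrite expr2 ler_piMr ?normc_ge0// ltW// (lt_trans h2)// invf_lt1// ltr1n.
  split; [exact: le_lt_trans h1 | | exact: le_lt_trans h2].
  apply: le_lt_trans (h3) _; apply: (lt_trans h2); apply: lt_le_trans (_ : 1 <= a).
   by rewrite invf_lt1// ltr1n.
  by rewrite ler1n.
 have Jh h : normc h < m -> J h = (1 - gauss2 h)%:C.
  move=> /mt[/ltW/(stepA_lt t01)[s1 _] /ltW/(stepA_lt ab)[s3 _] _].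
  by rewrite /J s1 s3 /gaussC rmorphB rmorph1 /=; ring.
 have q0 : q 0 = 1.
  rewrite /q /F /k normc0 expr0n /= (stepA_lt t01 (ltW t00)).2.
  have a0 : 0 <= a by rewrite ler0n.
  have [-> ->] := stepA_lt ab a0.
  by rewrite /gauss2 normc0 expr0n oppr0 expR0 !addr0 mulr1.
 apply: (@little_o_quad _ _ 2 m) => // h hm; rewrite add0r.
 have [->|h0] := eqVneq h 0.
  by rewrite /Y Jh ?normc0 // /gauss2 normc0 expr0n oppr0 expR0 subrr !mul0r rmorph0;
    rewrite mulr0 !addr0 subrr normc0 mulr0.
 have -> : Y 0 = 0 by rewrite /Y invr0 mulr0.
 have [h1 h2 h3] := mt h hm; have n0 : 0 < normc h by rewrite normc_gt0.
 have e : Y h - 0 - (0 * h + q 0 * h^*) = (1 - gauss2 h - normc h ^+ 2)%:C * h^-1.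
  have -> : (1 - gauss2 h - normc h ^+ 2)%:C = (1 - gauss2 h)%:C - h * h^*.
   by rewrite mul_conjc -rmorphB.
  rewrite q0 /Y Jh//; move: (1 - gauss2 h)%:C => x.
  by move: (h^*) => y; field.
 rewrite e normcM normcV normc_real ler_pdivrMr// /gauss2.
 have := expR_quad (_ : `|- normc h ^+ 2| <= 2^-1).
 rewrite normrN ger0_norm ?exprn_ge0 ?normc_ge0// => /(_ (ltW h3)); rewrite -normrN.
 move=> hh; rewrite (_ : 1 - _ - _ = - (expR (- normc h ^+ 2) - 1 - - normc h ^+ 2)); last by ring.
 apply: (le_trans hh); rewrite sqrrN -mulrA ler_wpM2l// -exprSr -exprM.
 by rewrite ler_wiXn2l// ?normc_ge0// ltW// (lt_trans hm)// gt_min invf_lt1 ?ltr1n ?orbT.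
pose Mb : R := Num.max t1 b + 1.
have Jfar z : Mb <= normc z -> J z = 0 /\ q z = 0.
 move=> zM; have zz : Num.max t1 b <= normc z ^+ 2.
  have Mb1 : 1 <= Mb by rewrite lerDr le_max (ltW (lt_trans t00 t01)).
  apply: le_trans (_ : Mb <= _); first by rewrite lerDl.
  apply: (le_trans zM); rewrite expr2 ler_peMr ?normc_ge0//; exact: le_trans zM.
 move: zz; rewrite ge_max => /andP[/(stepA_gt t01)[s1 s2] /(stepA_gt ab)[s3 s4]].
 rewrite /J /q /F /k s1 s2 s3 s4 rmorph1 subrr mulr0 subr0; split => //.
 by rewrite subrr add0r mulr0 subr0.
have cq z : ccont q z.
 have cs c d : c < d -> ccont (fun z : C => (stepA c d (normc z ^+ 2))%:C) z.
  by move=> _; exact: wdiff_ccont (wdiff_sqmod (@quad_stepA R c d) (wdiff_id z)).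
 have cd c d : c < d -> ccont (fun z : C => (dstepA c d (normc z ^+ 2))%:C) z.
  by move=> cd; exact: ccont_radial.
 have c1 := ccontD (ccontM (wdiff_ccont (wdiff_gauss z))
  (ccontD (ccontD (ccont_cst 1 z) (ccontM (ccont_cst (-1) z) (cs a b ab))) (cd a b ab)))
  (ccontM (ccont_cst (-1) z) (cd t0 t1 t01)).
 apply: (ccont_ext (@ltr01 R) _ c1) => h _.
 rewrite /q /F /k /gaussC.
 by move: (gauss2 _) (stepA a b _) (dstepA a b _) (dstepA t0 t1 _) => x1 x2 x3 x4; ring.
have tq : ctame q by apply: (ctame_compact (M := Mb)) => // z /Jfar[].
have q0 : cint q = 0.
 by apply: (cint_dbar (M := Mb) dY cq) => // z /Jfar[h _]; rewrite /Y h mul0r.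
have tk : tame k := tame_radial t01.
have tFk : tame (fun z => F z - k z) by case: tq.
have tF : tame F by apply: tame_ext (tameD tFk tk) => z; rewrite subrK.
have : (int2 (fun z => F z - k z))%:C = 0 by rewrite -cint_real.
by rewrite int2B// => /complexI/eqP; rewrite subr_eq0 => /eqP.
Qed.

Lemma radial_mass : int2 (fun z => dstepA t0 t1 (normc z ^+ 2)) = pi.
Proof.
pose F n z : R := gauss2 z * ((1 - stepA n.+1%:R n.+2%:R (normc z ^+ 2))
  + dstepA n.+1%:R n.+2%:R (normc z ^+ 2)).
have cv : int2 (F n) @[n --> \oo] --> int2 (@gauss2 R).
 have [gi mg] := gauss2_integral R.
 apply: (int2_cvg (g := fun z => 3 * gauss2 z)) => //.
 - move=> n; suff mh : plane_mfun (fun z : C => 1 - stepA n.+1%:R n.+2%:R (normc z ^+ 2)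
    + dstepA n.+1%:R n.+2%:R (normc z ^+ 2)) by exact: measurable_funM mg mh.
  have oT : plane_open (setT : set C) by move=> z _; exists 1.
  apply: (plane_mfun_cont oT) => z zT; last by case: zT.
  have c1 := wdiff_ccont (wdiff_sqmod (@quad_stepA R n.+1%:R n.+2%:R) (wdiff_id z)).
  have c2 := ccont_radial (nn1 n.+1) z.
  have c : ccont (fun z => (1 - stepA n.+1%:R n.+2%:R (normc z ^+ 2)
    + dstepA n.+1%:R n.+2%:R (normc z ^+ 2))%:C) z.
   apply: (ccont_ext (@ltr01 R) _ (ccontD (ccontD (ccont_cst 1 z) (ccontM (ccont_cst (-1) z) c1)) c2)).
   by move=> h _; move: (stepA _ _ _) (dstepA _ _ _) => x y; ring.
  exact: (ccont_Re c).
 - have := integrableZl measurableT 3 (gauss2_integrable R).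
  by apply: eq_integrable => // p _ /=; rewrite EFinM.
 - move=> n z; rewrite /F normrM ger0_norm ?expR_ge0// mulrC ler_wpM2r ?expR_ge0//.
  have /andP[h1 h2] := stepA_01 n.+1%:R n.+2%:R (normc z ^+ 2).
  have h3 := dstepA_ge0 (nn1 n.+1) (normc z ^+ 2).
  have h4 := dstepA_le (nn1 n.+1) (normc z ^+ 2).
  rewrite (_ : 2 / (n.+2%:R - n.+1%:R) = 2 :> R) in h4; last first.
   by rewrite -[n.+2%:R]natr1 addrAC subrr add0r divr1.
  rewrite ger0_norm; lra.
 - move=> z; apply: cvg_near_cst; exists (Num.truncn (normc z ^+ 2)).+1 => // n /= hn.
  have zn : normc z ^+ 2 <= n.+1%:R.
   have := truncnS_gt (normc z ^+ 2); move=> /ltW/le_trans; apply.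
   by rewrite ler_nat leqW.
  by rewrite /F; have [-> ->] := stepA_lt (nn1 n.+1) zn; rewrite subr0 addr0 mulr1.
have E n : int2 (F n) = int2 (fun z => dstepA t0 t1 (normc z ^+ 2)).
 by rewrite (radial_mass_gauss n).
have : (fun=> int2 (fun z => dstepA t0 t1 (normc z ^+ 2))) @ \oo --> int2 (@gauss2 R).
 by apply: cvg_trans cv; apply: near_eq_cvg; apply: nearW => n; rewrite E.
move=> h; rewrite -int2_gauss.
have e1 := cvg_lim (@norm_hausdorff _ _) h.
have e2 := cvg_lim (@norm_hausdorff _ _) (cvg_cst (F := \oo) (int2 (fun z : C => dstepA t0 t1 (normc z ^+ 2)))).
by rewrite -e1 -[LHS]e2.
Qed.
End RadialMass.

(** * Integration over the lemniscate *)
Section LemniscateIntegral.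
Variables (R : realType) (s : nat) (r : R).
Hypotheses (s2 : (2 <= s)%N) (r1 : 1 < r).
Local Notation C := R[i].
Implicit Types (z w h : C) (c : R).
Local Notation uu := (@uu R s).
Local Notation tt := (@tt R s).
Local Notation lem := (lem s r).
Local Notation B := (B s r).
Local Notation rs := (rs s r).

Definition duu z : C := s%:R * z ^+ s.-1.

Lemma cdiff_duu z : exists p, cdiff duu z p.
Proof. by eexists; apply: cdiffZ (cdiffX s.-1 (wdiff_id z)). Qed.

Lemma ccont_uu z : ccont uu z. Proof. exact: wdiff_ccont (cdiff_uu s z). Qed.
Lemma ccont_duu z : ccont duu z. Proof. by have [p /wdiff_ccont] := cdiff_duu z. Qed.

Lemma wdiff_level (K k : R -> R) z : quad_diff K k ->
 wdiff (fun z => (K (tt z))%:C) z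
  ((k (tt z))%:C * (duu z * (uu z)^*)) ((k (tt z))%:C * (uu z * (duu z)^*)).
Proof.
move=> qK; have := wdiff_sqmod qK (cdiff_uu s z); rewrite -ttE.
by apply: (wdiff_ext (@ltr01 R)) => h _; rewrite ttE.
Qed.

Lemma rcont_tt z : rcont tt z.
Proof. by move=> e /(rcont_sqmod (@ccont_uu z))[d d0 hd]; exists d => // h /hd; rewrite !ttE. Qed.

Lemma level_bounded z (T : R) : tt z < T -> normc z <= T + 2.
Proof.
move=> zT; have T0 : 0 < T := le_lt_trans (tt_ge0 s z) zT.
have [z1|z1] := leP (normc z) 1; first by rewrite (le_trans z1)//; lra.
have zs : normc z <= normc (z ^+ s) by rewrite normcX ler_eXnr// ?(ltnW s2)// ltW.
apply: le_trans zs _.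
have -> : z ^+ s = uu z + 1 by rewrite uuE subrK.
apply: le_trans (normc_le2 (lexx _) (lexx _)) _; rewrite normc1.
have : normc (uu z) <= 1 + normc (uu z) ^+ 2.
 have := sqr_ge0 (normc (uu z) - 1); have := normc_ge0 (uu z).
 by move: (normc (uu z)) => a a0 h; nra.
by rewrite -ttE; lra.
Qed.

Lemma lem_bounded z : lem z -> normc z <= B + 2.
Proof. exact: level_bounded. Qed.

Lemma lem_plane_measurable : plane_measurable lem.
Proof. exact: open_plane_measurable (plane_open_lem s2 r1). Qed.

Definition shell (e : R) : set C := [set z | B - e < tt z /\ tt z < B].

Lemma shell_open e : plane_open (shell e).
Proof.
move=> z [/(rcont_gt (@rcont_tt z))[d d0 hd] /(rcont_lt (@rcont_tt z))[d' d0' hd']].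
exists (Num.min d d'); first by rewrite lt_min d0.
by move=> h; rewrite lt_min => /andP[/hd a /hd' b].
Qed.

Lemma tame_shell e : tame (fun z => (z \in shell e)%:R : R).
Proof.
have mS := open_plane_measurable (@shell_open e).
by apply: (tame_indic (M := B + 2) mS) => z [_]; exact: lem_bounded.
Qed.

Lemma int2_shell_le e e' : e' <= e ->
 int2 (fun z => (z \in shell e')%:R) <= int2 (fun z => (z \in shell e)%:R : R).
Proof.
move=> ee; apply: int2_le => [||z]; try exact: tame_shell.
have [|_] := boolP (z \in shell e'); last by rewrite ler0n.
rewrite !inE => -[h1 h2]; rewrite mem_set//; split => //.
by apply: le_lt_trans h1; rewrite lerD2l lerN2.
Qed.

(** The shells decrease to the empty set, so their areas tend to 0 by dominated convergence. *)
Lemma shell_small (a : R) : 0 < a -> exists2 e : R, 0 < e &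
 forall e', e' <= e -> int2 (fun z => (z \in shell e')%:R) <= a.
Proof.
move=> a0.
have cv : int2 (fun z => (z \in shell n.+1%:R^-1)%:R) @[n --> \oo] --> int2 (fun=> 0 : R).
 apply: (int2_cvg (g := fun z => (z \in lem)%:R)).
 - by move=> n; have [] := tame_shell n.+1%:R^-1.
 - by have [] := @tame0 R.
 - have tl : tame (fun z => (z \in lem)%:R : R) by exact: tame_indic lem_plane_measurable lem_bounded.
  exact: tame_integrable tl.
 - move=> n z; have [|_] := boolP (z \in shell _); last by rewrite normr0 ler0n.
  by rewrite inE normr1 => -[_ h2]; rewrite mem_set.
 - move=> z; have [zB|zB] := ltP (tt z) B; last first.
   rewrite (_ : (fun n => _) = fun=> 0); first exact: cvg_cst.
   by apply/funext => n; rewrite memNset// => -[_]; rewrite ltNge zB.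
  apply: cvg_near_cst.
  have d0 : 0 < B - tt z by rewrite subr_gt0.
  have := @cvg_harmonic R; move=> /cvgr0Pnorm_lt/(_ _ d0)[N _ hN].
  exists N => // n /hN /=; rewrite ger0_norm ?invr_ge0// => hn.
  by rewrite memNset// => -[]; rewrite ltrBlDr -ltrBlDl ltNge (ltW hn).
rewrite int2_0 in cv; move/cvgr0Pnorm_lt: cv => /(_ _ a0)[N _ /(_ N (leqnn N)) /= hN].
exists N.+1%:R^-1; first by rewrite invr_gt0 ltr0n.
move=> e' /int2_shell_le h; apply: (le_trans h); apply: le_trans (ltW hN).
exact: ler_norm.
Qed.

Lemma ctame_lem (F : C -> C) (M : R) : (forall z, lem z -> ccont F z) ->
 (forall z, lem z -> normc (F z) <= M) -> ctame (fun z => F z * (z \in lem)%:R).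
Proof.
move=> cF FM; have G2 z : F z * (z \in lem)%:R = if z \in lem then F z else 0.
 by case: ifP => _; rewrite ?mulr1 ?mulr0.
apply: (ctame_cont (U := lem) (M := Num.max (Num.max M 0) (B + 2))).
- exact: plane_open_lem.
- move=> z zG; have [d d0 hd] := plane_open_lem s2 r1 zG.
 apply: (ccont_ext d0 _ (cF z zG)) => h /hd hG.
 by rewrite mem_set// mulr1.
- by move=> z zG; rewrite memNset// mulr0.
- move=> z; rewrite G2; case: ifP => [|_]; last by rewrite normc0 !le_max lexx orbT.
 by rewrite inE => /FM h; rewrite !le_max h.
- by move=> z /lem_bounded h; rewrite le_max h orbT.
Qed.

(** Stokes' theorem for functions vanishing on the lemniscate: cut off near the boundary,
  where the contribution of the cutoff is at most the area of a thin shell. *)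
Theorem lem_stokes (Y q : C -> C) (t1 M K : R) : t1 < B ->
 (forall z, lem z -> exists p, wdiff Y z p (q z)) -> (forall z, lem z -> ccont q z) ->
 (forall z, lem z -> normc (q z) <= M) ->
 (forall z, lem z -> t1 <= tt z -> normc (Y z) <= K * (B - tt z)) ->
 cint (fun z => q z * (z \in lem)%:R) = 0.
Proof.
move=> t1B dY cq qM YK.
have M0 : 0 <= M := le_trans (normc_ge0 _) (qM 0 (lem0 s2 r1)).
pose D := s%:R * (B + 2) ^+ s.-1 * (B + 2).
have b20 : 0 <= B + 2 by rewrite addr_ge0// ltW// (B_gt0 s2 r1).
have D0 : 0 <= D by rewrite !mulr_ge0 ?exprn_ge0.
have duuD z : lem z -> normc (uu z * (duu z)^*) <= D.
 move=> zG; rewrite normcM normcJ /duu normcM normc_nat normcX mulrC.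
 have zb := lem_bounded zG.
 rewrite ler_pM ?mulr_ge0 ?exprn_ge0 ?normc_ge0//.
  by rewrite ler_wpM2l// lerXn2r// ?nnegrE ?normc_ge0.
 move: zG => /(lemE s2 r1) h; apply: ltW; apply: lt_trans h _.
 have := rs_gt1 s2 r1; rewrite BE; move: (rs) => x x1; nra.
have MKD : 0 <= M + 4 * `|K| * D by rewrite addr_ge0// mulr_ge0// mulr_ge0.
have bound (e : R) : 0 < e -> B - 2 * e >= t1 ->
  normc (cint (fun z => q z * (z \in lem)%:R)) <=
  2 * ((M + 4 * `|K| * D) * int2 (fun z => (z \in shell (2 * e))%:R)).
 move=> e0 et1; pose a := B - 2 * e; pose b := B - e.
 have ab : a < b by rewrite /a /b ltrD2l ltrN2 ltr_pMl// ltr1n.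
 have bB : b < B by rewrite /b gtrBl.
 have ba : b - a = e by rewrite /a /b; ring.
 pose et z : C := 1 - (stepA a b (tt z))%:C.
 pose de z : C := - ((dstepA a b (tt z))%:C * (uu z * (duu z)^*)).
 have et0 z : b <= tt z -> et z = 0 /\ de z = 0.
  by move=> /(stepA_gt ab)[h1 h2]; rewrite /et /de h1 h2 subrr mul0r oppr0.
 have etout z : ~ lem z -> exists2 d : R, 0 < d & forall h, normc h < d ->
   et (z + h) = 0 /\ de (z + h) = 0.
  move=> /negP; rewrite -leNgt => zB.
  have [d d0 hd] := rcont_gt (@rcont_tt z) (lt_le_trans bB zB).
  by exists d => // h /hd/ltW/et0.
 have det z : exists p, wdiff et z p (de z).
  have d1 := wdiffB (wdiff_cst 1 z) (wdiff_level z (@quad_stepA R a b)).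
  by eexists; apply: (wdiff_eq d1) => //; rewrite sub0r.
 pose Q z := de z * Y z + et z * q z.
 have dQ z : exists p, wdiff (fun z => et z * Y z) z p (Q z).
  have [zG|zG] := pselect (lem z).
   have [p d1] := det z; have [p' d2] := dY z zG.
   by eexists; exact: wdiffM d1 d2.
  have [d d0 hd] := etout z zG; exists 0.
  have -> : Q z = 0.
   by have := hd 0; rewrite normc0 addr0 => /(_ d0)[h1 h2]; rewrite /Q h1 h2 !mul0r addr0.
  by apply: (wdiff_near0 d0) => h /hd[-> _]; rewrite mul0r.
 have cQ z : ccont Q z.
  have [zG|zG] := pselect (lem z).
   have [p /wdiff_ccont c1] := det z; have [p' /wdiff_ccont c2] := dY z zG.
   apply: ccontD; last exact: ccontM c1 (cq z zG).
   apply: ccontM c2; rewrite /de.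
   have c3 := ccont_dstepA ab (@rcont_tt z).
   have c4 := ccontM c3 (ccontM (@ccont_uu z) (ccontJ (@ccont_duu z))).
   have := ccontM (ccont_cst (-1) z) c4.
   by apply: (ccont_ext (@ltr01 R)) => h _; rewrite mulN1r.
  have [d d0 hd] := etout z zG; apply: (ccont_near0 d0) => h /hd[h1 h2].
  by rewrite /Q h1 h2 !mul0r addr0.
 have far z : B + 3 <= normc z -> ~ lem z.
  by move=> zb /lem_bounded zb'; have := le_trans zb zb'; rewrite lerD2l ler_nat.
 have out z : ~ lem z -> et z = 0 /\ de z = 0.
  by move=> /etout[d d0 /(_ 0)]; rewrite normc0 addr0; apply.
 have tQ : ctame Q.
  by apply: (ctame_compact (M := B + 3)) => // z /far/out[h1 h2]; rewrite /Q h1 h2 !mul0r addr0.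
 have Q0 : cint Q = 0.
  apply: (cint_dbar (M := B + 3) dQ cQ) => // z /far/out[h1 _]; by rewrite h1 mul0r.
 have tq := ctame_lem cq qM.
 rewrite -[X in normc X]subr0 -Q0 -(cintB tq tQ).
 have tS := tame_shell (2 * e).
 rewrite -(int2Z _ tS); apply: cint_le; [exact: ctameB | exact: tameZ |] => z.
 have [zG|zG] := pselect (lem z); last first.
  by have [h1 h2] := out z zG; rewrite /Q h1 h2 memNset// !mul0r mulr0 addr0 subrr normc0;
    exact: mulr_ge0.
 rewrite mem_set// mulr1 /Q; have [za|za] := leP (tt z) a.
  have [h1 h2] := stepA_lt ab za.
  rewrite /et /de h1 h2 subr0 mul1r mul0r oppr0 mul0r add0r subrr normc0.
  exact: mulr_ge0.
 rewrite (mem_set (_ : shell (2 * e) z)); last by split.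
 rewrite mulr1 (_ : q z - _ = (1 - et z) * q z + - (de z * Y z)); last by ring.
 apply: normc_le2.
  rewrite /et opprB addrC subrK normcM normc_real -[leRHS]mul1r.
  have /andP[h1 h2] := stepA_01 a b (tt z).
  by rewrite ger0_norm// ler_pM ?normc_ge0// qM.
 rewrite normcN /de mulNr normcN normcM normcM normc_real ger0_norm; last exact: dstepA_ge0.
 have YB : normc (Y z) <= `|K| * (2 * e).
  have h : 0 <= B - tt z by rewrite subr_ge0 ltW.
  apply: le_trans (YK z zG (le_trans et1 (ltW za))) _.
  apply: le_trans (_ : `|K| * (B - tt z) <= _); first by rewrite ler_wpM2r// ler_norm.
  by rewrite ler_wpM2l// lerBlDl -lerBlDr ltW.
 have kB : dstepA a b (tt z) <= 2 / e by rewrite -ba; exact: dstepA_le.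
 rewrite (_ : 4 * `|K| * D = 2 / e * D * (`|K| * (2 * e))); last first.
  by field; rewrite gt_eqF.
 have d0 := dstepA_ge0 ab (tt z).
 apply: ler_pM (normc_ge0 _) _ YB; first exact: mulr_ge0 d0 (normc_ge0 _).
 exact: ler_pM d0 (normc_ge0 _) kB (duuD z zG).
apply/eqP; rewrite -normc_eq0 eq_le normc_ge0 andbT; apply/ler_addgt0Pr => d d0.
rewrite add0r; pose W := M + 4 * `|K| * D + 1.
have W0 : 0 < W by rewrite ltr_wpDl.
have [e e0 he] := shell_small (divr_gt0 d0 (mulr_gt0 (ltr0n R 2) W0)).
pose e1 := Num.min (e / 2) ((B - t1) / 2).
have e10 : 0 < e1 by rewrite lt_min !divr_gt0 ?subr_gt0.
apply: le_trans (bound e1 e10 _) _.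
 rewrite lerBrDl -lerBrDr; apply: le_trans (_ : 2 * ((B - t1) / 2) <= _).
  by rewrite ler_wpM2l// ge_min lexx orbT.
 by rewrite mulrCA divff ?mulr1.
have h1 : 2 * e1 <= e.
 apply: le_trans (_ : 2 * (e / 2) <= _); first by rewrite ler_wpM2l// ge_min lexx.
 by rewrite mulrCA divff ?mulr1.
have := he _ h1; rewrite ler_pdivlMr ?mulr_gt0//; apply: le_trans.
have i0 : 0 <= int2 (fun z => (z \in shell (2 * e1))%:R : R) by apply: int2_ge0 => z.
move: (int2 _) i0 => I I0; rewrite /W mulrA (mulrC I) ler_wpM2r// ler_wpM2l//.
by rewrite lerDl.
Qed.

(** The map z -> z^s - 1 has degree s: its logarithmic derivative is s / z + O(|z|^(-3)) at
  infinity, so a level cutoff of u has s times the mass of a level cutoff of z. *)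
Lemma level_mass (t0 t1 : R) : 0 < t0 -> t0 < t1 ->
 tame (fun z => dstepA t0 t1 (tt z) * normc (duu z) ^+ 2) /\
 int2 (fun z => dstepA t0 t1 (tt z) * normc (duu z) ^+ 2) = s%:R * pi.
Proof.
move=> t00 t01; set k := fun z : C => _.
pose k0 z : R := dstepA t0 t1 (normc z ^+ 2).
have ck z : ccont (fun z => (k z)%:C) z.
 have c1 := ccontM (ccont_dstepA t01 (@rcont_tt z)) (ccontM (@ccont_duu z) (ccontJ (@ccont_duu z))).
 by apply: (ccont_ext (@ltr01 R) _ c1) => h _; rewrite mul_conjc -rmorphM.
have ck0 z : ccont (fun z => (k0 z)%:C) z by exact: ccont_radial.
have kfar z : t1 + 3 <= normc z -> k z = 0.
 move=> zb; have [h|h] := ltP (tt z) t1; last by rewrite /k (stepA_gt t01 h).2 mul0r.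
 by have := le_trans zb (level_bounded h); rewrite lerD2l ler_nat.
have sq_ge z (T : R) : 1 <= T -> T <= normc z -> T <= normc z ^+ 2.
 move=> T1 zT; apply: (le_trans zT); rewrite expr2 ler_peMr ?normc_ge0//.
 exact: le_trans zT.
have t11 : 1 <= t1 + 3 by rewrite -lerBlDr (le_trans _ (ltW (lt_trans t00 t01)))//; lra.
have tk : tame k.
 have : ctame (fun z => (k z)%:C) by apply: (ctame_compact (M := t1 + 3)) => // z /kfar ->.
 by case.
have tk0 : tame k0 := tame_radial t01.
split => //; rewrite -(radial_mass t00 t01) -/k0.
pose Y1 z : C := (stepA t0 t1 (normc (uu z) ^+ 2))%:C * (duu z / uu z).
pose Y2 z : C := (stepA t0 t1 (normc z ^+ 2))%:C * (1 / z).
pose Y z : C := Y1 z - s%:R * Y2 z.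
pose q z : C := (k z - s%:R * k0 z)%:C.
have dY z : exists p, wdiff Y z p (q z).
 have [p0 dd] := cdiff_duu z.
 have [p1 d1] := wdiff_log_pole t01 t00 (cdiff_uu s z) dd.
 have [p2 d2] := wdiff_log_pole t01 t00 (wdiff_id z) (wdiff_cst 1 z).
 eexists; apply: (wdiff_eq (wdiffB d1 (wdiffZ s%:R d2))) => //.
 rewrite normc1 /q /k /k0 ttE; move: (dstepA _ _ (normc (uu z) ^+ 2)) (dstepA _ _ (normc z ^+ 2)).
 by move: (normc (duu z)) => x y w; ring.
have tq : ctame q by apply: ctame_real; apply: tameB tk (tameZ _ tk0).
pose L (T : R) z : C := 1 - (stepA T (2 * T) (normc z ^+ 2))%:C.
pose kT (T : R) z : R := dstepA T (2 * T) (normc z ^+ 2).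
have est (T : R) : t1 + 3 <= T -> normc (cint q) <= 2 * (2 * s%:R * (T - 1)^-1 * pi).
 move=> Tb; have T1 : 1 <= T := le_trans t11 Tb.
 have T0 : 0 < T by apply: lt_le_trans T1.
 have TT : T < 2 * T by rewrite ltr_pMl// ltr1n.
 have T21 : 1 < T.
  by apply: lt_le_trans Tb; have := lt_trans t00 t01 => t10; lra.
 (* cut off at infinity, where z Y is O(1/u) *)
 pose Q z := - (kT T z)%:C * (z * Y z) + L T z * q z.
 have dL z : exists p, wdiff (L T) z p (- (kT T z)%:C * z).
  have d1 := wdiffB (wdiff_cst 1 z) (wdiff_sqmod (@quad_stepA R T (2 * T)) (wdiff_id z)).
  have c1 : (1 : C)^* = 1 by exact: rmorph1.
  by eexists; apply: (wdiff_eq d1) => //; rewrite c1 mulr1 sub0r mulNr.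
 have dQ z : exists p, wdiff (fun z => L T z * Y z) z p (Q z).
  have [p d1] := dL z; have [p' d2] := dY z.
  by eexists; apply: (wdiff_eq (wdiffM d1 d2)) => //; rewrite /Q mulrA.
 have ckT z : ccont (fun z => (kT T z)%:C) z by exact: ccont_radial.
 have cQ z : ccont Q z.
  have [p /wdiff_ccont cL] := dL z; have [p' /wdiff_ccont cY] := dY z.
  have cq : ccont q z.
   apply: (ccont_ext (@ltr01 R) _ (ccontD (ck z) (ccontM (ccont_cst (- s%:R) z) (ck0 z)))) => h _.
   by rewrite /q; move: (k _) (k0 _) => x y; ring.
  apply: ccontD (ccontM cL cq); apply: ccontM (ccontM (wdiff_ccont (wdiff_id z)) cY).
  by apply: (ccont_ext (@ltr01 R) _ (ccontM (ccont_cst (-1) z) (ckT z))) => h _; rewrite mulN1r.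
 have Lfar z : 2 * T <= normc z -> L T z = 0 /\ kT T z = 0.
  move=> zb; have h : 2 * T <= normc z ^+ 2 by apply: sq_ge => //; lra.
  by have [h1 h2] := stepA_gt TT h; rewrite /L /kT h1 h2 subrr.
 have tQ : ctame Q.
  by apply: (ctame_compact (M := 2 * T)) => // z /Lfar[h1 h2]; rewrite /Q h1 h2 oppr0 !mul0r addr0.
 have Q0 : cint Q = 0 by apply: (cint_dbar (M := 2 * T) dQ cQ) => // z /Lfar[h1 _]; rewrite h1 mul0r.
 have tkT : tame (kT T) := tame_radial TT.
 rewrite -[X in normc X]subr0 -Q0 -(cintB tq tQ) -(radial_mass T0 TT) -(int2Z _ tkT).
 apply: cint_le; [exact: ctameB | exact: tameZ |] => z.
 have s2T : 0 <= 2 * s%:R * (T - 1)^-1 by rewrite !mulr_ge0 ?invr_ge0 ?subr_ge0.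
 have kT0 : 0 <= kT T z by exact: dstepA_ge0.
 have [zT|zT] := leP (normc z ^+ 2) T.
  have [h1 h2] := stepA_lt TT zT; rewrite /Q /L /kT h1 h2 subr0 oppr0 !mul0r add0r mul1r subrr normc0.
  exact: mulr_ge0.
 have zT' : T <= normc z ^+ 2 by exact: ltW.
 have bigz : 1 < normc z.
  by rewrite -(@ltr_pXn2r _ 2) ?nnegrE ?normc_ge0// expr1n (lt_trans T21).
 have us : T - 1 <= normc (uu z).
  have := normc_lb (z ^+ s) (-1); rewrite normcN normc1 -uuE; apply: le_trans.
  rewrite lerD2r (le_trans zT')// normcX; have [j hj] : exists j, s = (2 + j)%N by exists (s - 2)%N; rewrite subnKC.
  by rewrite hj exprD ler_peMr ?exprn_ge0 ?normc_ge0// exprn_ege1// ltW.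
 have T10 : 0 < T - 1 by rewrite subr_gt0.
 have u0 : uu z != 0 by rewrite -normc_gt0; apply: lt_le_trans us.
 have z0 : z != 0 by rewrite -normc_gt0; apply: lt_trans bigz.
 have ut : t1 <= tt z.
  rewrite ttE; apply: le_trans (_ : T - 1 <= _); first by lra.
  apply: (le_trans us); rewrite expr2 ler_peMr ?normc_ge0//; apply: le_trans us.
  by have := lt_trans t00 t01 => t10; lra.
 have zt1 : t1 <= normc z ^+ 2 by apply: le_trans zT'; lra.
 have q0 : q z = 0.
  by rewrite /q /k /k0 (stepA_gt t01 ut).2 (stepA_gt t01 zt1).2 mul0r mulr0 subr0.
 have zY : z * Y z = s%:R / uu z.
  rewrite /Y /Y1 /Y2 -ttE (stepA_gt t01 ut).1 (stepA_gt t01 zt1).1 !mul1r.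
  rewrite (_ : z * (duu z / uu z - s%:R * z^-1) = z * duu z / uu z - s%:R * (z / z)); last by ring.
  rewrite divff// mulr1; have e : z * duu z = s%:R * (uu z + 1) by rewrite /duu mulrCA -exprS prednK ?(ltnW s2)// uuE subrK.
  by rewrite e; move: (uu z) u0 => u u0; field.
 rewrite q0 /Q q0 mulr0 addr0 sub0r zY mulNr opprK normcM normc_real ger0_norm// mulrC.
 rewrite ler_wpM2r// normcM normcV normc_nat.
 apply: le_trans (_ : s%:R * (T - 1)^-1 <= _).
  by rewrite ler_wpM2l// lef_pV2 ?posrE// (lt_le_trans T10).
 by rewrite -mulrA ler_peMl ?ler1n// mulr_ge0// invr_ge0 ltW.
have cq0 : cint q = 0.
 apply/eqP; rewrite -normc_eq0 eq_le normc_ge0 andbT; apply/ler_addgt0Pr => e e0.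
 rewrite add0r; pose D : R := 2 * (2 * s%:R * pi).
 have D0 : 0 <= D by rewrite !mulr_ge0// pi_ge0.
 pose T : R := t1 + 3 + D / e.
 have De : 0 <= D / e by rewrite divr_ge0// ltW.
 have TT : t1 + 3 <= T by rewrite lerDl.
 apply: (le_trans (est T TT)).
 have T10 : 0 < T - 1 by rewrite /T; have := lt_trans t00 t01 => t10; lra.
 rewrite (_ : 2 * _ = D / (T - 1)); last by rewrite /D; ring.
 rewrite ler_pdivrMr// mulrC -ler_pdivrMr// /T.
 by have := lt_trans t00 t01 => t10; lra.
have : (int2 (fun z => k z - s%:R * k0 z))%:C = 0 by rewrite -cint_real.
rewrite (int2B tk (tameZ _ tk0)) (int2Z _ tk0) => /complexI/eqP.
by rewrite subr_eq0 => /eqP.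
Qed.
End LemniscateIntegral.

(** * The inner product of the lemniscate *)
Section InnerProduct.
Variables (R : realType) (s : nat) (r : R).
Hypotheses (s2 : (2 <= s)%N) (r1 : 1 < r).
Local Notation C := R[i].
Implicit Types (z w h : C) (p q : {poly C}).
Local Notation uu := (@uu R s).
Local Notation tt := (@tt R s).
Local Notation lem := (lem s r).
Local Notation B := (B s r).
Local Notation rs := (rs s r).

Lemma area_integralE (f : C -> C) :
 area_integral lem f = cint (fun z => f z * (z \in lem)%:R).
Proof.
have E (g : C -> R) : Rintegral (@lebesgue_measure R \x @lebesgue_measure R)%E
  (@toC R @^-1` lem) (fun v : R * R => g (toC v)) = int2 (fun z => g z * (z \in lem)%:R).
 rewrite Rintegral_mkcond /int2; congr Rintegral; apply/funext => v; rewrite patchE.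
 have -> : (v \in @toC R @^-1` lem) = (toC v \in lem) by apply/idP/idP; rewrite !inE.
 by case: ifP => _; rewrite ?mulr1 ?mulr0.
rewrite /area_integral -[(fun v : R * R => v.1 +i* v.2)]/(@toC R).
rewrite (E (fun z => Re (f z))) (E (fun z => Im (f z))).
congr (_ +i* _); congr int2; apply/funext => z;
 by case: (z \in lem); rewrite ?mulr1 ?mulr0.
Qed.

Lemma ccont_horner p z : ccont (horner p) z.
Proof. exact: wdiff_ccont (cdiff_poly p z). Qed.

Lemma bounded_poly p : exists2 K : R, 0 <= K & forall z, lem z -> normc p.[z] <= K.
Proof.
elim/poly_ind: p => [|p c [K K0 hK]].
 by exists 0 => // z _; rewrite horner0 normc0.
exists (K * (B + 2) + normc c) => [|z zG].
 by rewrite addr_ge0 ?normc_ge0// mulr_ge0// addr_ge0// ltW// (B_gt0 s2 r1).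
rewrite hornerMXaddC; apply: normc_le2 => //.
rewrite normcM ler_pM ?normc_ge0 ?hK//; exact: (lem_bounded s2).
Qed.

Definition ip (F G : C -> C) : C := cint (fun z => F z * (G z)^* * (z \in lem)%:R).
Definition pip p q : C := ip (horner p) (horner q).
Definition pnorm p : R := int2 (fun z => normc p.[z] ^+ 2 * (z \in lem)%:R).

Lemma ctame_pip p q : ctame (fun z => p.[z] * (q.[z])^* * (z \in lem)%:R).
Proof.
have [K K0 hK] := bounded_poly p; have [K' K0' hK'] := bounded_poly q.
apply: (ctame_lem s2 r1 (F := fun z => p.[z] * (q.[z])^*) (M := K * K')) => z zG.
 by apply: ccontM; [exact: ccont_horner | apply: ccontJ; exact: ccont_horner].
by rewrite normcM normcJ ler_pM ?normc_ge0 ?hK ?hK'.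
Qed.

Lemma pipDl p p' q : pip (p + p') q = pip p q + pip p' q.
Proof.
rewrite /pip /ip -cintD; [|exact: ctame_pip|exact: ctame_pip].
by apply: cint_ext => z; rewrite hornerD; ring.
Qed.

Lemma pipZl c p q : pip (c *: p) q = c * pip p q.
Proof.
rewrite /pip /ip -cintZ; last exact: ctame_pip.
by apply: cint_ext => z; rewrite hornerZ; ring.
Qed.

Lemma pipJ p q : pip q p = (pip p q)^*.
Proof.
rewrite /pip /ip -cintJ; last exact: ctame_pip.
apply: cint_ext => z; case: (z \in lem); rewrite ?mulr1 ?mulr0 ?rmorph0//.
by rewrite rmorphM /= conjcK mulrC.
Qed.

Lemma pipNl p q : pip (- p) q = - pip p q.
Proof. by rewrite -scaleN1r pipZl mulN1r. Qed.
Lemma pipBl p p' q : pip (p - p') q = pip p q - pip p' q.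
Proof. by rewrite pipDl pipNl. Qed.
Lemma pip0l q : pip 0 q = 0.
Proof. by rewrite -(scale0r 0) pipZl mul0r. Qed.
Lemma pip0r q : pip q 0 = 0.
Proof. by rewrite pipJ pip0l rmorph0. Qed.
Lemma pipDr p q q' : pip p (q + q') = pip p q + pip p q'.
Proof. by rewrite (pipJ (q + q')) pipDl rmorphD; congr (_ + _); rewrite [RHS]pipJ. Qed.
Lemma pipZr c p q : pip p (c *: q) = c^* * pip p q.
Proof. by rewrite (pipJ (c *: q)) pipZl rmorphM; congr (_ * _); rewrite [RHS]pipJ. Qed.
Lemma pip_norm p : pip p p = (pnorm p)%:C.
Proof.
rewrite /pip /ip /pnorm -cint_real; apply: cint_ext => z.
by rewrite mul_conjc; case: (z \in lem); rewrite ?mulr1 ?mulr0.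
Qed.

Lemma tame_pnorm p : tame (fun z => normc p.[z] ^+ 2 * (z \in lem)%:R).
Proof.
have [+ _] := ctame_pip p p; apply: tame_ext => z; rewrite mul_conjc.
by case: (z \in lem); rewrite ?mulr1 ?mulr0.
Qed.

Lemma pnorm_ge0 p : 0 <= pnorm p.
Proof. by apply: int2_ge0 => z; rewrite mulr_ge0// exprn_ge0// normc_ge0. Qed.

(** Cauchy-Schwarz with a parameter, to be optimized at the end, in place of square roots. *)
Lemma pip_bound p q (lam : R) : 0 < lam ->
 normc (pip p q) <= lam * pnorm p + lam^-1 * pnorm q.
Proof.
move=> l0; pose a := lam / 2; pose b := (lam^-1) / 2.
have h : normc (pip p q) <= 2 * int2 (fun z => a * (normc p.[z] ^+ 2 * (z \in lem)%:R)
  + b * (normc q.[z] ^+ 2 * (z \in lem)%:R)).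
 apply: cint_le; first exact: ctame_pip.
  by apply: tameD; apply: tameZ; exact: tame_pnorm.
 move=> z; case: (z \in lem); last by rewrite !mulr0 normc0 addr0.
 rewrite !mulr1 normcM normcJ; move: (normc p.[z]) (normc q.[z]) => x y.
 have : 0 <= lam^-1 * (lam * x - y) ^+ 2 by rewrite mulr_ge0 ?sqr_ge0// invr_ge0 ltW.
 have e : lam^-1 * (lam * x - y) ^+ 2 = lam * x ^+ 2 - 2 * (x * y) + lam^-1 * y ^+ 2.
  by field; rewrite gt_eqF.
 by rewrite e /a /b; move: (lam^-1) => k; nra.
apply: (le_trans h); rewrite int2D; try exact: tameZ (tame_pnorm _).
rewrite !int2Z; try exact: tame_pnorm.
apply: le_of_eq; rewrite /pnorm /a /b.
by move: (int2 _) (int2 _) => x y; field; rewrite gt_eqF.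
Qed.

(** ** Point evaluation *)
Lemma uniform_disc (t1 : R) : t1 < B -> exists2 d : R, 0 < d &
 forall a z, tt a <= t1 -> normc (z - a) < d -> lem z.
Proof.
move=> t1B; pose D : R := s%:R * (B + 3) ^+ s.-1.
have B0 := B_gt0 s2 r1.
have D0 : 0 < D by rewrite mulr_gt0 ?ltr0n ?(ltnW s2)// exprn_gt0// addr_gt0.
pose q : R := Num.sqrt (Num.max t1 0).
have q0 : 0 <= q by exact: sqrtr_ge0.
have q2 : q ^+ 2 = Num.max t1 0 by rewrite sqr_sqrtr// le_max lexx orbT.
have qrs : q < rs.
 rewrite -(@ltr_pXn2r _ 2) ?nnegrE ?(ltW (rs_gt0 s2 r1))// q2 -BE.
 by rewrite gt_max t1B.
exists (Num.min 1 ((rs - q) / D)); first by rewrite lt_min ltr01 divr_gt0// subr_gt0.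
move=> a z at1; rewrite lt_min => /andP[za1 zaD].
have aG : lem a by apply: le_lt_trans at1 t1B.
have ab := lem_bounded s2 aG.
have au : normc (uu a) <= q.
 rewrite -(@ler_pXn2r _ 2) ?nnegrE ?normc_ge0// q2 -ttE.
 by rewrite le_max at1.
have mv : normc (uu z - uu a) <= D * normc (z - a).
 apply: (@mean_value_ineq _ uu (@duu R s)) => t t01; first exact: cdiff_uu.
 rewrite /duu normcM normc_nat normcX ler_wpM2l// lerXn2r ?nnegrE ?normc_ge0//.
  by rewrite addr_ge0// ltW.
 rewrite (_ : B + 3 = B + 2 + 1); last by ring.
 apply: normc_le2 => //; rewrite normcM normc_real; case/andP: t01 => t0 t1'.
 by rewrite ger0_norm// (le_trans _ (ltW za1))// ler_piMl// normc_ge0.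
apply/(lemE s2 r1); rewrite -[uu z](subrK (uu a)).
apply: le_lt_trans (normc_le2 mv au) _; rewrite -ltrBrDr.
by rewrite mulrC -ltr_pdivlMr.
Qed.

(** Mean value property of p^2 on a disc inside G_1 of fixed radius. *)
Lemma point_evaluation (t1 : R) : t1 < B -> exists2 K : R, 0 < K &
 forall p a, tt a <= t1 -> normc p.[a] ^+ 2 <= K * pnorm p.
Proof.
move=> /uniform_disc[d d0 hd]; pose T := d ^+ 2 / 2.
have T0 : 0 < T by rewrite divr_gt0// exprn_gt0.
have Td : T < d ^+ 2 by rewrite gtr_pMr ?exprn_gt0// invf_lt1// ltr1n.
exists (40 * (2 * (4 / T))); first by rewrite !mulr_gt0// invr_gt0.
move=> p a at1; have sq z : sqdist a z < d ^+ 2 -> lem z.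
 by rewrite /sqdist ltr_pXn2r ?nnegrE ?normc_ge0 ?(ltW d0)//; exact: hd.
have mv := @mean_value R (horner (p ^+ 2)) a (d ^+ 2) T
 (fun z _ _ => ex_intro _ _ (cdiff_poly (p ^+ 2) z)) (ccont_horner _ _) T0 Td.
have mw z : mweight a T z <= 4 / T.
 apply: le_trans (dstepA_le (half_lt T0) _) _; rewrite (_ : T - T / 2 = T / 2); last by field.
 by apply: le_of_eq; field; rewrite gt_eqF.
have mw0 z : 0 <= mweight a T z by exact: mweight_ge0.
have tp : ctame (fun z => (p ^+ 2).[z] * (mweight a T z)%:C).
 apply: (ctame_compact (M := T + 1 + normc a)) => z.
  by apply: ccontM; [exact: ccont_horner | exact: ccont_mweight].
 move=> zb; have [h|h] := ltP (sqdist a z) T.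
  by have := bounded_sqdist h; rewrite ltNge zb.
 by rewrite (mcut_large T0 h).2 mulr0.
have bd : normc ((p ^+ 2).[a] * (mconst a)%:C) <= 2 * ((4 / T) * pnorm p).
 rewrite -mv -(int2Z _ (tame_pnorm p)); apply: (cint_le tp); first exact: tameZ (tame_pnorm p).
 move=> z; rewrite normcM normc_real ger0_norm// horner_exp normcX.
 have [h|h] := ltP (sqdist a z) T; last first.
  rewrite (mcut_large T0 h).2 mulr0 mulr_ge0//; first by rewrite divr_ge0// ltW.
  by rewrite mulr_ge0// exprn_ge0// normc_ge0.
 rewrite mem_set; last by apply: sq; exact: lt_trans h Td.
 by rewrite mulr1 mulrC ler_wpM2r// exprn_ge0// normc_ge0.
rewrite horner_exp normcM normcX normc_real (ger0_norm (ltW (mconst_gt0 a))) in bd.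
have mc := mconst_ge a; move: (normc p.[a] ^+ 2) (exprn_ge0 2 (normc_ge0 p.[a])) bd mc => x x0 bd mc.
have : x * 40^-1 <= x * mconst a by rewrite ler_wpM2l.
have -> : 40 * (2 * (4 / T)) * pnorm p = 40 * (2 * (4 / T * pnorm p)) by ring.
by move: (4 / T * _) bd => y; lra.
Qed.

(** ** Orthogonal polynomials *)
Section Orthogonal.
Variable P : nat -> {poly C}.
Hypothesis hP : orthonormal_polynomials lem P.

Lemma size_P n : size (P n) = n.+1. Proof. by case: hP. Qed.
Lemma lead_P n : 0 < lead_coef (P n). Proof. by case: hP. Qed.

Lemma piC_neq0 : (pi : R)%:C != 0.
Proof. by rewrite (inj_eq (@complexI R)) gt_eqF// pi_gt0. Qed.

Lemma pip_P n m : pip (P n) (P m) = (n == m)%:R * (pi : R)%:C.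
Proof.
have [_ _ h] := hP; have := h n m; rewrite area_integralE /pip /ip => <-.
by rewrite mulrC mulrA -rmorphM mulfV ?mul1r// gt_eqF// pi_gt0.
Qed.

Lemma span_P N p : (size p <= N)%N -> exists c : nat -> C, p = \sum_(k < N) c k *: P k.
Proof.
elim: N p => [|N ih] p sp.
 by exists (fun=> 0); rewrite big_ord0; apply/eqP; rewrite -size_poly_leq0.
have lN : lead_coef (P N) != 0 by rewrite gt_eqF// lead_P.
pose a := p`_N / lead_coef (P N).
have [|c hc] := ih (p - a *: P N).
 apply/leq_sizeP => j; rewrite leq_eqVlt => /orP[/eqP <-|Nj].
  by rewrite coefB coefZ /a lead_coefE size_P divfK ?subrr// -[X in (P N)`_X]/(N.+1.-1) -(size_P N) -lead_coefE.
 rewrite coefB coefZ [p`_j]nth_default ?(leq_trans sp)// [(P N)`_j]nth_default ?size_P// mulr0 subr0//.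
exists (fun k => if k == N then a else c k); rewrite big_ord_recr /= eqxx.
rewrite (eq_bigr (fun k : 'I_N => c k *: P k)); last by move=> k _; rewrite ltn_eqF.
by rewrite -hc subrK.
Qed.

Lemma pip_sumr p N (c : nat -> C) :
 pip p (\sum_(k < N) c k *: P k) = \sum_(k < N) (c k)^* * pip p (P k).
Proof.
elim: N => [|N ih]; first by rewrite !big_ord0 pip0r.
by rewrite !big_ord_recr /= pipDr pipZr ih.
Qed.

Lemma P_orth n q : (size q <= n)%N -> pip (P n) q = 0.
Proof.
move=> /span_P[c ->]; rewrite pip_sumr big1// => k _.
by rewrite pip_P (gtn_eqF (ltn_ord k)) mul0r mulr0.
Qed.

Lemma orth_zero N p : (size p <= N)%N -> (forall k, (k < N)%N -> pip (P k) p = 0) -> p = 0.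
Proof.
move=> /span_P[c pE] h; rewrite pE big1// => k _.
have := h k (ltn_ord k); rewrite pE pip_sumr (bigD1 k)//= pip_P eqxx mul1r big1 ?addr0.
 move/eqP; rewrite mulf_eq0 (negbTE piC_neq0) orbF => /eqP e.
 by rewrite -[c k]conjcK e rmorph0 scale0r.
by move=> j jk; rewrite pip_P eq_sym (negbTE (_ : (j : nat) != k)) ?mul0r ?mulr0.
Qed.

(** ** Rotational symmetry *)
Lemma prim_root_exists : exists2 w : C, s.-primitive_root w & normc w = 1.
Proof.
have s0 : (0 < s)%N := ltnW s2.
have [rts hr] := closed_field_poly_normal ('X^s - 1 : {poly C}).
have l1 : lead_coef ('X^s - 1 : {poly C}) = 1 by apply/eqP; rewrite -monicE -polyC1 monicXnsubC.
rewrite l1 scale1r in hr.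
have ur : uniq rts.
 rewrite -separable.separable_prod_XsubC -hr.
 exact: cyclotomic.separable_Xn_sub_1 (sC_neq0 _ s2).
have sr : size rts = s.
 have : size ('X^s - 1 : {poly C}) = (size rts).+1 by rewrite hr size_prod_XsubC.
 by rewrite -polyC1 size_XnsubC// => -[].
have ar : all s.-unity_root rts.
 apply/allP => w wr; rewrite unity_rootE -subr_eq0.
 have : root (\prod_(z <- rts) ('X - z%:P)) w by rewrite root_prod_XsubC.
 by rewrite -hr rootE !hornerE.
have /hasP[w _ pw] := cyclic.has_prim_root s0 ar ur (eq_leq (esym sr)).
exists w => //; apply/eqP; rewrite -(@pexpr_eq1 _ _ s)// ?normc_ge0//.
by rewrite -normcX (prim_expr_order pw) normc1.
Qed.

Lemma lem_rotate (w z : C) : w ^+ s = 1 -> lem (w * z) <-> lem z.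
Proof. by move=> w1; rewrite !(lemE s2 r1) !uuE exprMn w1 mul1r. Qed.

Definition rotate (w : C) p : {poly C} := p \Po (w *: 'X).

Lemma pip_rotate w p q : normc w = 1 -> w ^+ s = 1 ->
 pip (rotate w p) (rotate w q) = pip p q.
Proof.
move=> w1 ws; rewrite /pip /ip -(cint_rotation w1 (ctame_pip p q)).
apply: cint_ext => z; rewrite !horner_comp !hornerE.
have -> : (w * z \in lem) = (z \in lem) by apply/idP/idP; rewrite !inE => /(lem_rotate _ ws).
by [].
Qed.

Lemma coef_rotate w p k : (rotate w p)`_k = w ^+ k * p`_k.
Proof.
rewrite /rotate comp_polyE coef_sum.
have [kp|kp] := ltnP k (size p); last first.
 rewrite (nth_default 0 kp) mulr0 big1// => i _.
 rewrite coefZ exprZn coefZ coefXn gtn_eqF ?mulr0//.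
 exact: leq_trans (ltn_ord i) kp.
rewrite (bigD1 (Ordinal kp))//= coefZ exprZn coefZ coefXn eqxx mulr1 big1 ?addr0 1?mulrC// => i ik.
rewrite coefZ exprZn coefZ coefXn (_ : (k == i) = false) ?mulr0//.
by apply/negbTE; rewrite eq_sym; exact: ik.
Qed.

Lemma size_rotate w p n : (size p <= n)%N -> (size (rotate w p) <= n)%N.
Proof.
by move=> sp; apply/leq_sizeP => j nj; rewrite coef_rotate nth_default ?mulr0// (leq_trans sp).
Qed.

(** The rotated polynomial has the same orthogonality relations, so P_n(wz) = w^n P_n(z). *)
Lemma P_class n k : (P n)`_k != 0 -> k = n %[mod s].
Proof.
have [w pw w1] := prim_root_exists; have ws := prim_expr_order pw.
have w0 : w != 0 by rewrite -normc_gt0 w1.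
have ws' : w^-1 ^+ s = 1 by rewrite exprVn ws invr1.
have w1' : normc w^-1 = 1 by rewrite normcV w1 invr1.
have d0 : rotate w (P n) - w ^+ n *: P n = 0.
 apply: (@orth_zero n).
  apply/leq_sizeP => j; rewrite leq_eqVlt => /orP[/eqP <-|nj].
   by rewrite coefB coefZ coef_rotate subrr.
  by rewrite coefB coefZ coef_rotate !nth_default ?size_P// !mulr0 subrr.
 move=> j jn; have sj : (size (P j) <= n)%N by rewrite size_P.
 have Pj : P j = rotate w (rotate w^-1 (P j)).
  by apply/polyP => i; rewrite !coef_rotate mulrA -exprMn mulfV// expr1n mul1r.
 rewrite pipJ pipBl pipZl P_orth// mulr0 subr0 Pj pip_rotate// P_orth ?rmorph0//.
 exact: size_rotate.
move=> pk; have : (rotate w (P n) - w ^+ n *: P n)`_k = 0 by rewrite d0 coef0.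
rewrite coefB coefZ coef_rotate -mulrBl => /eqP; rewrite mulf_eq0 (negbTE pk) orbF subr_eq0.
by rewrite (eq_prim_root_expr pw) => /eqP.
Qed.

(** Rotations by [s]-th roots of unity split the polynomials into [s] such classes. *)
Definition upoly l (q : {poly C}) : {poly C} := 'X^l * (q \Po ('X^s - 1)).

Lemma horner_upoly l q z : (upoly l q).[z] = z ^+ l * q.[uu z].
Proof. by rewrite /upoly hornerM hornerXn horner_comp uuE !hornerE. Qed.

Lemma P_upoly m l : (l < s)%N -> exists q : {poly C},
 [/\ P (s * m + l)%N = upoly l q, size q = m.+1 & lead_coef q = lead_coef (P (s * m + l)%N)].
Proof.
move=> ls; set n := (s * m + l)%N; have s0 : (0 < s)%N := ltnW s2.
pose h : {poly C} := \poly_(j < m.+1) (P n)`_(s * j + l).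
have sz1 : size ('X + 1 : {poly C}) = 2 by rewrite -polyC1 size_XaddC.
have l0 : (P n)`_n != 0 by have := lead_P n; rewrite lead_coefE size_P /= => /gt_eqF ->.
have hm : h`_m = lead_coef (P n) by rewrite coef_poly ltnSn lead_coefE size_P.
have sh : size h = m.+1 by apply: size_poly_eq.
exists (h \Po ('X + 1)); split.
- rewrite /upoly -comp_polyA comp_polyD comp_polyX -polyC1 comp_polyC subrK.
 rewrite comp_polyE sh big_distrr /=; apply/polyP => k; rewrite coef_sum.
 have E (i : 'I_m.+1) : ('X^l * (h`_i *: 'X^s ^+ i))`_k =
   (P n)`_(s * i + l) * (k == (s * i + l)%N)%:R.
  rewrite -exprM -scalerAr -exprD coefZ coefXn coef_poly ltn_ord addnC.
  by case: eqP.
 rewrite (eq_bigr _ (fun i _ => E i)).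
 have [pk0|pk] := eqVneq ((P n)`_k) 0.
  rewrite pk0.
  rewrite big1// => i _; have [<-|_] := eqVneq k (s * i + l)%N; last by rewrite mulr0.
  by rewrite pk0 mul0r.
 have km : k = (s * (k %/ s) + l)%N.
  rewrite {1}(divn_eq k s) mulnC (P_class pk); congr (_ + _)%N.
  by rewrite /n mulnC modnMDl modn_small.
 have kn : (k < n.+1)%N.
  by rewrite ltnNge; apply: contra pk => nk; rewrite nth_default// size_P.
 have i0 : (k %/ s < m.+1)%N.
  by rewrite ltnS -(leq_pmul2l s0) -(leq_add2r l) -km -ltnS.
 rewrite (bigD1 (Ordinal i0))//= -km eqxx mulr1 big1 ?addr0// => i ii.
 rewrite (_ : (k == _) = false) ?mulr0//; apply/negbTE; apply: contra ii => /eqP ki.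
 apply/eqP/val_inj => /=; apply/eqP; rewrite -(eqn_pmul2l s0) -(eqn_add2r l) -ki.
 by rewrite -km.
- by rewrite size_comp_poly2.
- by rewrite lead_coef_comp ?sz1// -polyC1 lead_coefXaddC expr1n mulr1 lead_coefE sh -hm.
Qed.

End Orthogonal.
End InnerProduct.

(** * Pairing functions on the outer annulus with polynomials *)
Lemma normcM_le (R : realType) (z w : R[i]) (x y : R) :
 normc z <= x -> normc w <= y -> normc (z * w) <= x * y.
Proof. by move=> zx wy; rewrite normcM ler_pM ?normc_ge0. Qed.

Section Annulus.
Variables (R : realType) (s : nat) (r : R).
Hypotheses (s2 : (2 <= s)%N) (r1 : 1 < r).
Local Notation C := R[i].
Implicit Types (z w h : C) (g : {poly C}) (F Z : C -> C).
Local Notation uu := (@uu R s).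
Local Notation duu := (@duu R s).
Local Notation tt := (@tt R s).
Local Notation lem := (lem s r).
Local Notation B := (B s r).
Local Notation rs := (rs s r).
Local Notation BC := (B%:C).

Let B1 : 1 < B := B_gt1 s2 r1.

Definition tA : R := (2 + B) / 3.
Definition tB : R := (1 + 2 * B) / 3.
Lemma tA_gt1 : 1 < tA. Proof. by move: B1; rewrite /tA; move: (B) => b; lra. Qed.
Lemma tAB : tA < tB. Proof. by move: B1; rewrite /tA /tB; move: (B) => b; lra. Qed.
Lemma tB_ltB : tB < B. Proof. by move: B1; rewrite /tB; move: (B) => b; lra. Qed.

Definition eta z : C := (stepA tA tB (tt z))%:C.
Definition deta z : C := (dstepA tA tB (tt z))%:C * (uu z * (duu z)^*).

Lemma eta_inner z : tt z <= tA -> eta z = 0 /\ deta z = 0.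
Proof. by move=> /(stepA_lt tAB)[h1 h2]; rewrite /eta /deta h1 h2 mul0r. Qed.
Lemma eta_outer z : tB <= tt z -> eta z = 1 /\ deta z = 0.
Proof. by move=> /(stepA_gt tAB)[h1 h2]; rewrite /eta /deta h1 h2 mul0r. Qed.

Lemma wdiff_eta z : exists p, wdiff eta z p (deta z).
Proof. have d := @wdiff_level R s _ _ z (@quad_stepA R tA tB); by eexists; exact: d. Qed.
Lemma ccont_deta z : ccont deta z.
Proof.
have c := ccont_dstepA tAB (@rcont_tt R s z).
exact: ccontM c (ccontM (@ccont_uu R s z) (ccontJ (@ccont_duu R s z))).
Qed.

Lemma normc_eta z : normc (eta z) <= 1.
Proof.
by rewrite normc_real; have /andP[h1 h2] := stepA_01 tA tB (tt z); rewrite ger0_norm.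
Qed.

Lemma bounded_deta : exists2 K : R, 0 <= K & forall z, lem z -> normc (deta z) <= K.
Proof.
pose up : {poly C} := 'X^s - 1; have [K K0 hK] := bounded_poly s2 r1 up.
have [K' K0' hK'] := bounded_poly s2 r1 (s%:R *: 'X^(s.-1)).
exists (2 / (tB - tA) * (K * K')).
 by rewrite mulr_ge0 ?divr_ge0 ?subr_ge0 ?mulr_ge0// ltW// tAB.
move=> z zG; rewrite /deta normcM normc_real ger0_norm ?dstepA_ge0 ?tAB//.
rewrite ler_pM ?dstepA_ge0 ?normc_ge0 ?dstepA_le ?tAB//.
rewrite normcM normcJ ler_pM ?normc_ge0//.
 by have := hK z zG; rewrite /up hornerD hornerN hornerXn hornerC -uuE.
by have := hK' z zG; rewrite hornerZ hornerXn.
Qed.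

(** Nothing is asked near the zeros of [uu], where the main term is not defined. *)
Definition annular F := (forall z, lem z -> 1 < tt z -> exists p, cdiff F z p) /\
 exists M : R, 0 <= M /\ forall z, lem z -> tA <= tt z -> normc (F z) <= M.

(** The conjugate derivative of eta F conj(g). *)
Definition Dint F g z : C := deta z * (F z * (g.[z])^*) + eta z * (F z * (g^`().[z])^*).
Definition Dfun F g : C := cint (fun z => Dint F g z * (z \in lem)%:R).

Lemma near_inner z : tt z < tA -> exists2 d : R, 0 < d & forall h, normc h < d ->
 eta (z + h) = 0 /\ deta (z + h) = 0.
Proof.
move=> /(rcont_lt (@rcont_tt R s z))[d d0 hd].
by exists d => // h /hd/ltW/eta_inner.
Qed.

Lemma Dint_wdiff F g z : annular F -> lem z ->
 exists p, wdiff (fun z => eta z * (F z * (g.[z])^*)) z p (Dint F g z).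
Proof.
move=> [dF _] zG; have [zA|zA] := ltP (tt z) tA.
 have [h1 h2] := eta_inner (ltW zA); have [d d0 hd] := near_inner zA.
 exists 0; rewrite /Dint h1 h2 !mul0r addr0; apply: (wdiff_near0 d0) => h /hd[-> _].
 by rewrite mul0r.
have [p dp] := wdiff_eta z; have [q dq] := dF z zG (lt_le_trans tA_gt1 zA).
eexists; apply: (wdiff_eq (wdiffM dp (wdiffM dq (wdiffJ (cdiff_poly g z))))) => //.
by rewrite /Dint mul0r add0r.
Qed.

Lemma Dint_ccont F g z : annular F -> lem z -> ccont (Dint F g) z.
Proof.
move=> [dF _] zG; have [zA|zA] := ltP (tt z) tA.
 have [d d0 hd] := near_inner zA.
 by apply: (ccont_near0 d0) => h /hd[h1 h2]; rewrite /Dint h1 h2 !mul0r addr0.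
have [p /wdiff_ccont cp] := wdiff_eta z.
have [q /wdiff_ccont cq] := dF z zG (lt_le_trans tA_gt1 zA).
apply: ccontD; first exact: ccontM (@ccont_deta z) (ccontM cq (ccontJ (@ccont_horner _ g z))).
exact: ccontM cp (ccontM cq (ccontJ (@ccont_horner _ g^`() z))).
Qed.

Lemma Dint_bounded F g : annular F -> exists2 K : R, 0 <= K & forall z, lem z -> normc (Dint F g z) <= K.
Proof.
move=> [_ [M [M0 hM]]]; have [K1 K10 h1] := bounded_deta.
have [K2 K20 h2] := bounded_poly s2 r1 g; have [K3 K30 h3] := bounded_poly s2 r1 g^`().
have S0 : 0 <= K1 * (M * K2) + 1 * (M * K3) by rewrite addr_ge0 ?mulr_ge0.
exists (K1 * (M * K2) + 1 * (M * K3)) => // z zG; have [zA|zA] := ltP (tt z) tA.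
 by rewrite /Dint (eta_inner (ltW zA)).1 (eta_inner (ltW zA)).2 !mul0r addr0 normc0.
apply: normc_le2.
 by apply: normcM_le (h1 z zG) (normcM_le (hM z zG zA) _); rewrite normcJ h2.
by apply: normcM_le (normc_eta z) (normcM_le (hM z zG zA) _); rewrite normcJ h3.
Qed.

Lemma Dint_ctame F g : annular F -> ctame (fun z => Dint F g z * (z \in lem)%:R).
Proof.
move=> aF; have [K _ hK] := Dint_bounded g aF.
exact: (ctame_lem s2 r1 (fun z zG => Dint_ccont g aF zG) hK).
Qed.

(** All the pairings below follow from this comparison: [F conj(g)] may be replaced by any
  [Z] with the same boundary values. *)
Lemma D_compare F g Z (qz : C -> C) (M K : R) : annular F ->
 (forall z, lem z -> exists p, wdiff Z z p (qz z)) -> (forall z, lem z -> ccont qz z) ->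
 (forall z, lem z -> normc (qz z) <= M) ->
 (forall z, lem z -> tB <= tt z -> normc (F z * (g.[z])^* - Z z) <= K * (B - tt z)) ->
 Dfun F g = cint (fun z => qz z * (z \in lem)%:R).
Proof.
move=> aF dZ cq qM FZ; apply/eqP; rewrite -subr_eq0 -cintB; last 2 first.
- exact: Dint_ctame.
- exact: (ctame_lem s2 r1 cq qM).
have [K' _ hK'] := Dint_bounded g aF.
have h := @lem_stokes R s r s2 r1 (fun z => eta z * (F z * (g.[z])^*) - Z z)
 (fun z => Dint F g z - qz z) tB (K' + M) K tB_ltB.
rewrite (_ : cint _ = cint (fun z => (Dint F g z - qz z) * (z \in lem)%:R)); last first.
 by apply: cint_ext => z; rewrite mulrBl.
apply/eqP/h => z zG.
- have [p d1] := Dint_wdiff g aF zG; have [p' d2] := dZ z zG.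
 by eexists; exact: wdiffB d1 d2.
- apply: (ccont_ext (@ltr01 R) _ (ccontD (Dint_ccont g aF zG) (ccontM (ccont_cst (-1) z) (cq z zG)))).
 by move=> k _; rewrite mulN1r.
- by apply: normc_le2; rewrite ?normcN ?hK' ?qM.
- by move=> zB; rewrite (eta_outer zB).1 mul1r; exact: FZ.
Qed.

(** ** Agreement on the boundary *)
Definition close F F' := exists2 K : R, 0 <= K &
 forall z, lem z -> tB <= tt z -> normc (F z - F' z) <= K * (B - tt z).
Definition bnd F := exists2 M : R, 0 <= M &
 forall z, lem z -> tB <= tt z -> normc (F z) <= M.

Lemma closeM F F' Z Z' : close F F' -> close Z Z' -> bnd F -> bnd Z' ->
 close (fun z => F z * Z z) (fun z => F' z * Z' z).
Proof.
move=> [K K0 h] [K' K0' h'] [M M0 b] [M' M0' b'].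
exists (M * K' + K * M'); first by rewrite addr_ge0 ?mulr_ge0.
move=> z zG zB; rewrite (_ : _ - _ = F z * (Z z - Z' z) + (F z - F' z) * Z' z); last by ring.
rewrite [leRHS]mulrDl; apply: normc_le2; rewrite normcM.
 by rewrite -mulrA ler_pM ?normc_ge0 ?b ?h'.
by rewrite mulrAC ler_pM ?normc_ge0 ?b' ?h.
Qed.

Lemma bndM F Z : bnd F -> bnd Z -> bnd (fun z => F z * Z z).
Proof.
move=> [M M0 b] [M' M0' b']; exists (M * M'); first exact: mulr_ge0.
by move=> z zG zB; rewrite normcM ler_pM ?normc_ge0 ?b ?b'.
Qed.

Lemma bndX F n : bnd F -> bnd (fun z => F z ^+ n).
Proof.
move=> [M M0 b]; exists (M ^+ n); first exact: exprn_ge0.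
by move=> z zG zB; rewrite normcX lerXn2r ?nnegrE ?normc_ge0 ?b.
Qed.

Lemma closeX F F' n : close F F' -> bnd F -> bnd F' -> close (fun z => F z ^+ n) (fun z => F' z ^+ n).
Proof.
move=> cF bF bF'; elim: n => [|n ih].
 by exists 0 => // z _ _; rewrite subrr normc0 mul0r.
have [K K0 h] := closeM cF ih bF (bndX n bF').
by exists K => // z zG zB; rewrite !exprS h.
Qed.

Lemma close_refl F : close F F.
Proof. by exists 0 => // z _ _; rewrite subrr normc0 mul0r. Qed.

Lemma bndJ F : bnd F -> bnd (fun z => (F z)^*).
Proof. by move=> [M M0 b]; exists M => // z zG zB; rewrite normcJ b. Qed.

Lemma close_bnd F F' : close F F' -> bnd F -> bnd F'.
Proof.
move=> [K K0 h] [M M0 b]; exists (K * (B - tB) + M) => [|z zG zB].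
 by rewrite addr_ge0// mulr_ge0// subr_ge0 ltW// tB_ltB.
rewrite (_ : F' z = - (F z - F' z) + F z); last by ring.
apply: normc_le2; rewrite ?b// normcN (le_trans (h z zG zB))// ler_wpM2l//.
by rewrite lerD2l lerN2.
Qed.

Lemma close_ext F F' Z Z' : (forall z, lem z -> tB <= tt z -> F z = Z z) ->
 (forall z, lem z -> tB <= tt z -> F' z = Z' z) -> close Z Z' -> close F F'.
Proof. by move=> h h' [K K0 hK]; exists K => // z zG zB; rewrite h// h'// hK. Qed.

Lemma root_close (a b d : R) : 0 <= a -> 0 < b -> 0 <= d -> b ^+ s - a ^+ s = d ->
 `|b - a| <= d * b / b ^+ s.
Proof.
move=> a0 b0 d0 e; have ab : a <= b.
 by rewrite -(@ler_pXn2r _ s) ?nnegrE ?(ltW b0)// ?(ltnW s2)// -subr_ge0 e.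
rewrite ger0_norm ?subr_ge0// ler_pdivlMr ?exprn_gt0//.
have [k hk] : exists k, s = k.+1 by exists s.-1; rewrite prednK// ltnW.
rewrite -e hk !exprS; have : a ^+ k <= b ^+ k by rewrite lerXn2r ?nnegrE// ltW.
have : 0 <= a ^+ k by rewrite exprn_ge0.
move: (a ^+ k) (b ^+ k) => x y x0 xy.
have : 0 <= b * a * (y - x) by rewrite !mulr_ge0 ?subr_ge0// ltW.
nra.
Qed.

Lemma outer_uu z : tB <= tt z -> uu z != 0 /\ normc (uu z)^-1 <= 1.
Proof.
move=> zB; have t1 : 1 < tt z by apply: lt_le_trans zB; apply: lt_trans tA_gt1 tAB.
have u1 : 1 < normc (uu z).
 by rewrite -(@ltr_pXn2r _ 2) ?nnegrE ?normc_ge0// expr1n -ttE.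
split; first by rewrite -normc_gt0 (lt_trans ltr01).
by rewrite normcV invf_le1 ?ltW// (lt_trans ltr01).
Qed.

Lemma bnd_poly g : bnd (horner g).
Proof. by have [K K0 h] := bounded_poly s2 r1 g; exists K => // z zG _; exact: h. Qed.

Lemma bnd_uu : bnd uu.
Proof.
have [K K0 h] := bnd_poly ('X^s - 1); exists K => // z zG zB.
by have := h z zG zB; rewrite hornerD hornerN hornerXn hornerC -uuE.
Qed.

Lemma bnd_uuV : bnd (fun z => (uu z)^-1).
Proof. by exists 1 => // z _ /outer_uu[]. Qed.

Lemma close_conj_uu : close (fun z => (uu z)^*) (fun z => BC / uu z).
Proof.
exists 1 => // z zG zB; have [u0 u1] := outer_uu zB.
rewrite (_ : _ - _ = - (BC - uu z * (uu z)^*) / uu z); last by field.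
rewrite mul_conjc -rmorphB normcM normcN normc_real -ttE mul1r.
by rewrite ger0_norm ?subr_ge0 ?(ltW zG)// ler_piMr// subr_ge0 ltW.
Qed.

Lemma bnd_Ax c : -1 <= c <= 1 -> bnd (Ax s r c).
Proof.
move=> cb; exists (2 / (1 - rho s r)).
 by rewrite divr_ge0// subr_ge0 ltW// rho_lt1.
move=> z zG _; have x1 := xx_lt s2 r1 zG.
apply: (le_trans (bser_bound cb (xx_lt1 s2 r1 zG))).
rewrite ler_wpM2l// lef_pV2 ?posrE ?subr_gt0 ?rho_lt1// ?(lt_trans x1) ?rho_lt1//.
by rewrite lerD2l lerN2 ltW.
Qed.

Lemma bser_lipschitz c (t : R) : -1 <= c <= 1 -> 0 <= t < 1 -> exists2 K : R, 0 <= K &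
 forall x y : C, normc x <= t -> normc y <= t -> normc (bser c x - bser c y) <= K * normc (x - y).
Proof.
move=> cb /andP[t0 t1]; have q0 : 0 < 1 - t by rewrite subr_gt0.
exists (1 * (2 / (1 - t)) * (1 - t)^-1).
 by rewrite !mulr_ge0 ?invr_ge0 ?(ltW q0).
move=> x y xt yt; apply: (@mean_value_ineq _ (bser c) (fun x => c%:C * bser c x / (1 + x))) => tau tau01;
 set w := y + _; have wt : normc w <= t.
- exact: segment_le.
- by apply: cdiff_bser => //; exact: le_lt_trans wt t1.
- exact: segment_le.
have w1 : normc w < 1 by exact: le_lt_trans wt t1.
apply: normcM_le.
 apply: normcM_le; first by rewrite normc_real ler_norml.
 apply: (le_trans (bser_bound cb w1)); rewrite ler_wpM2l// lef_pV2 ?posrE ?subr_gt0//.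
 by rewrite lerD2l lerN2.
have := normc_lb 1 w; rewrite normc1 normcV => h.
have h2 : 1 - t <= normc (1 + w) by apply: le_trans h; rewrite lerD2l lerN2.
by rewrite lef_pV2 ?posrE// (lt_le_trans q0).
Qed.

(** 1/u = conj(u)/B on the lemniscate, and the series has real coefficients. *)
Lemma close_bserV c : -1 <= c <= 1 -> close (fun z => bser c (uu z)^-1) (fun z => (Ax s r c z)^*).
Proof.
move=> cb; pose t := Num.max (Num.sqrt tB)^-1 (rho s r).
have tB1 : 1 < tB by apply: lt_trans tA_gt1 tAB.
have sB : 1 < Num.sqrt tB by rewrite -[ltLHS]sqrtr1 ltr_sqrt// (lt_trans ltr01).
have t01 : 0 <= t < 1.
 by rewrite le_max invr_ge0 sqrtr_ge0 gt_max invf_lt1 ?sB ?rho_lt1// (lt_trans ltr01).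
have [K K0 lip] := bser_lipschitz cb t01.
exists (K * B^-1); first by rewrite mulr_ge0// invr_ge0 ltW// (lt_trans ltr01).
move=> z zG zB; have [u0 u1] := outer_uu zB.
have xb := xx_lt s2 r1 zG.
have ut : normc (uu z)^-1 <= t.
 rewrite le_max normcV lef_pV2 ?posrE ?normc_gt0// ?sqrtr_gt0 ?(lt_trans ltr01)//.
 by rewrite -(@ler_pXn2r _ 2) ?nnegrE ?normc_ge0 ?sqrtr_ge0// sqr_sqrtr -?ttE ?zB// (le_trans ler01)// ltW.
have xt : normc (xx s r z)^* <= t by rewrite normcJ le_max (ltW xb) orbT.
rewrite /Ax -bserJ//; last exact: xx_lt1.
apply: (le_trans (lip _ _ ut xt)); rewrite -mulrA ler_wpM2l//.
have BC0 := BC_neq0 s2 r1.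
have -> : (uu z)^-1 - (xx s r z)^* = (BC - uu z * (uu z)^*) / (BC * uu z).
 have -> : xx s r z = (B^-1)%:C * uu z by rewrite /xx fmorphV mulrC.
 rewrite conjc_realM fmorphV; move: ((uu z)^*) => v; field; rewrite BC0 u0//.
rewrite mul_conjc -rmorphB normcM normc_real -ttE ger0_norm ?subr_ge0 ?(ltW zG)//.
rewrite mulrC ler_wpM2r ?subr_ge0 ?(ltW zG)// normcV normcM normc_real gtr0_norm ?(lt_trans ltr01)//.
rewrite invfM; apply: ler_piMr; last by rewrite -normcV.
by rewrite invr_ge0 ltW// (lt_trans ltr01).
Qed.

(** Both sides are nonnegative reals whose s-th powers |1 + u|^2 and B |1 + u/B|^2 agree where
 |u|^2 = B. *)
Lemma close_sqmod : close (fun z => (normc z ^+ 2)%:C)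
 (fun z => (r ^+ 2)%:C * (Ax s r (sinv R s) z * (Ax s r (sinv R s) z)^*)).
Proof.
have sb := sinv_bound R s2; have r0 : 0 < r by exact: lt_trans r1.
have [M M0 hM] := bnd_Ax sb; have rs0 := rs_gt0 s2 r1; have B0 := B_gt0 s2 r1.
pose m : R := (B - rs) ^+ 2 / B.
have Brs : 0 < B - rs.
 by rewrite subr_gt0 BE expr2 ltr_pMr ?rs_gt1.
have m0 : 0 < m by rewrite divr_gt0// exprn_gt0.
exists ((B - 1) / B * (r ^+ 2 * M ^+ 2) / m) => [|z zG zB].
 by rewrite !mulr_ge0 ?invr_ge0 ?exprn_ge0 ?subr_ge0 ?(ltW B1) ?(ltW B0) ?(ltW m0) ?(ltW r0).
have x1 := xx_lt1 s2 r1 zG; have A0 : Ax s r (sinv R s) z != 0 by rewrite bser_neq0.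
rewrite mul_conjc -rmorphM -rmorphB normc_real -normrN opprB.
set b := r ^+ 2 * normc _ ^+ 2; pose d := (B - 1) * (B - tt z) / B.
have b0 : 0 < b by rewrite mulr_gt0 ?exprn_gt0 ?normc_gt0.
have bs : b ^+ s = normc (BC + uu z) ^+ 2 / B.
 have e3 (x : R) : (x ^+ 2) ^+ s = (x ^+ s) ^+ 2 by rewrite -!exprM mulnC.
 have ea : normc (Ax s r (sinv R s) z) ^+ s = normc (BC + uu z) / B.
  by rewrite -normcX /Ax bser_root// one_plus_xx// normcM normcV normc_real (gtr0_norm B0).
 rewrite /b exprMn !e3 ea -/rs -BE; move: B0 (normc _) => B00 q; move: (B) B00 => b0' b00.
 by field; rewrite gt_eqF.
have as_ : (normc z ^+ 2) ^+ s = normc (z ^+ s) ^+ 2 by rewrite normcX -!exprM mulnC.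
have d0 : 0 <= d by rewrite !mulr_ge0 ?invr_ge0 ?subr_ge0 ?(ltW B1) ?(ltW B0) ?(ltW zG).
have e : b ^+ s - (normc z ^+ 2) ^+ s = d.
 rewrite bs as_ /d -level_identity//; field; by rewrite gt_eqF.
apply: le_trans (root_close _ b0 d0 e) _; first by rewrite exprn_ge0 ?normc_ge0.
have bM : b <= r ^+ 2 * M ^+ 2.
 by rewrite ler_wpM2l ?exprn_ge0 ?(ltW r0)// lerXn2r ?nnegrE ?normc_ge0 ?hM.
have mb : m <= b ^+ s.
 rewrite bs /m ler_wpM2r ?invr_ge0 ?(ltW B0)// lerXn2r ?nnegrE ?normc_ge0 ?(ltW Brs)//.
 have := normc_lb BC (uu z); rewrite normc_real gtr0_norm//; apply: le_trans.
 by rewrite lerD2l lerN2 ltW//; apply/(lemE s2 r1).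
rewrite (_ : _ * (B - tt z) = d * (r ^+ 2 * M ^+ 2) / m); last by rewrite /d; ring.
apply: ler_pM; first exact: mulr_ge0 d0 (ltW b0).
- by rewrite invr_ge0 exprn_ge0// ltW.
- exact: ler_wpM2l d0 _ _ bM.
by rewrite lef_pV2 ?posrE ?exprn_gt0.
Qed.

(** ** The three pairings *)
Section Pairings.
Variable l : nat.
Hypothesis ls : (l < s)%N.
Definition alpha : R := l.+1%:R / s%:R.

Let sR0 : 0 < s%:R :> R. Proof. by rewrite ltr0n ltnW. Qed.

Lemma alpha_gt0 : 0 < alpha. Proof. by rewrite divr_gt0. Qed.
Lemma alpha_le1 : alpha <= 1. Proof. by rewrite ler_pdivrMr// mul1r ler_nat. Qed.
Lemma alpha_bound : -1 <= alpha <= 1.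
Proof. by rewrite alpha_le1 andbT (le_trans _ (ltW alpha_gt0)) ?lerN10. Qed.
Lemma nalpha_bound : -1 <= - alpha <= 1.
Proof. by rewrite lerN2 alpha_le1 (le_trans _ (@ler01 R))// oppr_le0 ltW// alpha_gt0. Qed.
Lemma alpha1_bound : -1 <= 1 - alpha <= 1.
Proof. by move: alpha_gt0 alpha_le1; move: alpha => a a0 a1; apply/andP; split; lra. Qed.

Definition mainF m z : C := z ^+ l * uu z ^+ m * bser (1 - alpha) (uu z)^-1.

Lemma outer_uuV z : 1 < tt z -> uu z != 0 /\ normc (uu z)^-1 < 1.
Proof.
move=> t1; have u1 : 1 < normc (uu z).
 by rewrite -(@ltr_pXn2r _ 2) ?nnegrE ?normc_ge0// expr1n -ttE.
by rewrite -normc_gt0 (lt_trans ltr01)// normcV invf_lt1// (lt_trans ltr01).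
Qed.

Lemma annular_mainF m : annular (mainF m).
Proof.
split=> [z zG t1|].
 have [u0 x1] := outer_uuV t1; have cu := cdiff_uu s z.
 have d1 := cdiff_comp (g := fun z => (uu z)^-1) (cdiff_bser alpha1_bound x1) (cdiffV cu u0).
 eexists; exact: cdiffM (cdiffM (cdiffX l (wdiff_id z)) (cdiffX m cu)) d1.
have [K K0 hK] := bounded_poly s2 r1 ('X^l * ('X^s - 1) ^+ m).
pose t : R := (Num.sqrt tA)^-1.
have tA1 : 1 < Num.sqrt tA by rewrite -[ltLHS]sqrtr1 ltr_sqrt ?tA_gt1// (lt_trans ltr01)// tA_gt1.
have t1 : t < 1 by rewrite invf_lt1// (lt_trans ltr01).
exists (K * (2 / (1 - t))); split; first by rewrite mulr_ge0// divr_ge0// subr_ge0 ltW.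
move=> z zG zA; have zt : 1 < tt z by apply: lt_le_trans zA; exact: tA_gt1.
have [u0 x1] := outer_uuV zt; apply: normcM_le.
 by have := hK z zG; rewrite hornerM hornerXn horner_exp hornerD hornerN hornerXn hornerC -uuE.
apply: (le_trans (bser_bound alpha1_bound x1)); rewrite ler_wpM2l//.
have xt : normc (uu z)^-1 <= t.
 rewrite normcV lef_pV2 ?posrE ?normc_gt0 ?(lt_trans ltr01)//.
 by rewrite -(@ler_pXn2r _ 2) ?nnegrE ?normc_ge0 ?sqrtr_ge0// sqr_sqrtr -?ttE// (le_trans ler01)// ltW// tA_gt1.
by rewrite lef_pV2 ?posrE ?subr_gt0// lerD2l lerN2.
Qed.

(** Their derivatives span the polynomials z^l V(u). *)
Definition tpoly j : {poly C} := 'X^(l.+1) * ('X^s - 1) ^+ j.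
Lemma tpolyE j z : (tpoly j).[z] = z ^+ l.+1 * uu z ^+ j.
Proof. by rewrite /tpoly hornerM hornerXn horner_exp hornerD hornerN hornerXn hornerC -uuE. Qed.

(** The boundary values of the main term. *)
Definition bvalue m j z : C :=
 z ^+ s.-1 * uu z ^+ m * (uu z)^-1 *
 ((r ^+ (2 * l.+1))%:C * Ax s r alpha z * (BC / uu z) ^+ j).

(** Replace conj(u) by B/u and |z|^2 by its expression in u/B; then (1 + 1/u)^(-alpha)
 cancels the conjugate of (1 + u/B)^alpha. *)
Lemma mainF_close m j : close (fun z => mainF m z * ((tpoly j).[z])^*) (bvalue m j).
Proof.
have na := nalpha_bound; have sb := sinv_bound R s2.
have a1 : -1 <= (1 : R) <= 1 by rewrite lexx andbT (le_trans _ ler01) ?lerN10.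
have bsq : bnd (fun z => (normc z ^+ 2)%:C).
 have [M M0 h] := bndM (bnd_poly 'X) (bndJ (bnd_poly 'X)).
 by exists M => // z zG zB; have := h z zG zB; rewrite hornerX mul_conjc.
have c1 := close_sqmod; have b1 := close_bnd c1 bsq.
have c1' := closeX l.+1 c1 bsq b1.
have c2 := close_conj_uu; have b2 := bndJ bnd_uu; have b2' := close_bnd c2 b2.
have c2' := closeX j c2 b2 b2'.
have c3 := close_bserV na; have b3' := bndJ (bnd_Ax na).
have b12 := bndM (bndX l.+1 bsq) (bndX j b2).
have c4 := closeM (closeM c1' c2' (bndX l.+1 bsq) (bndX j b2')) c3 b12 b3'.
have bf : bnd (fun z => z ^+ s.-1 * uu z ^+ m * (uu z)^-1).
 have [M M0 h] := bndM (bndM (bndX s.-1 (bnd_poly 'X)) (bndX m bnd_uu)) bnd_uuV.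
 by exists M => // z zG zB; have := h z zG zB; rewrite hornerX.
have b12' := bndM (bndM (bndX l.+1 b1) (bndX j b2')) b3'.
have c5 := closeM (close_refl _) c4 bf b12'.
apply: close_ext c5 => z zG zB.
 have [u0 x1] : uu z != 0 /\ normc (uu z)^-1 < 1.
  by apply: outer_uuV; apply: lt_le_trans zB; apply: lt_trans tA_gt1 tAB.
 have E := bser_add a1 na alpha1_bound x1; rewrite bser_1// in E.
 have e0 : (normc z ^+ 2)%:C = z * z^* by rewrite mul_conjc.
 rewrite e0 /mainF tpolyE -E rmorphM !rmorphXn exprMn.
 have zu : uu z = z * z ^+ s.-1 - 1 by rewrite uuE -exprS prednK// ltnW.
 have e1 : 1 + (uu z)^-1 = z * z ^+ s.-1 / uu z.
  by apply: (mulIf u0); rewrite mulrDl mul1r mulVf// divfK// {1}zu subrK.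
 rewrite e1 exprS; move: (uu z ^+ m) ((uu z)^-1) (bser (- alpha) _) (z ^+ s.-1) => x1' x2 x3 x4.
 by rewrite (exprS z l); ring.
have x1 := xx_lt1 s2 r1 zG.
rewrite /bvalue; congr (_ * _).
have e1 : Ax s r (sinv R s) z ^+ l.+1 = Ax s r alpha z.
 by rewrite /Ax bser_pow// -/(l.+1%:R / s%:R) -/alpha// alpha_bound.
have -> : ((r ^+ 2)%:C * (Ax s r (sinv R s) z * (Ax s r (sinv R s) z)^*)) ^+ l.+1 =
  (r ^+ (2 * l.+1))%:C * (Ax s r alpha z * (Ax s r alpha z)^*).
 by rewrite -e1 !exprMn exprM !rmorphXn.
have := bser_mulN alpha_bound x1; rewrite -!/(Ax s r _ z) => e2.
have e3 : (Ax s r alpha z)^* * (Ax s r (- alpha) z)^* = 1 by rewrite -rmorphM e2 rmorph1.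
move: e3; move: (Ax s r alpha z) (_^*) (_^*) (r ^+ _)%:C (_ ^+ j) => a b d q w bd.
rewrite -[LHS]mulr1 -bd; ring.
Qed.

(** For j < m the boundary values extend holomorphically. *)
Lemma D_main_lt m j : (j < m)%N -> Dfun (mainF m) (tpoly j) = 0.
Proof.
move=> jm; have [K K0 hK] := mainF_close m j.
pose Z z : C := z ^+ s.-1 * uu z ^+ (m - j.+1) * ((r ^+ (2 * l.+1))%:C * BC ^+ j * Ax s r alpha z).
rewrite (@D_compare (mainF m) (tpoly j) Z (fun=> 0) 0 K (annular_mainF m)).
- by rewrite (cint_ext (G := fun=> 0)) ?cint0// => z; rewrite mul0r.
- move=> z zG; eexists.
 exact: cdiffM (cdiffM (cdiffX s.-1 (wdiff_id z)) (cdiffX (m - j.+1) (cdiff_uu s z)))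
  (cdiffZ _ (cdiff_Ax s2 r1 alpha_bound (xx_lt1 s2 r1 zG))).
- by move=> z _; exact: ccont_cst.
- by move=> z _; rewrite normc0.
move=> z zG zB; have [u0 _] := outer_uu zB.
rewrite (_ : Z z = bvalue m j z); first exact: hK.
rewrite /Z /bvalue -{2}(subnK jm) addnS exprS exprD expr_div_n.
move: (uu z ^+ (m - j.+1)) (Ax s r alpha z) (BC ^+ j) => a b c; have uj : uu z ^+ j != 0 by rewrite expf_neq0.
by move: (uu z ^+ j) uj => d d0; field; rewrite d0 u0.
Qed.

Lemma slope_bser_cdiff (c : R) (x : C) : -1 <= c <= 1 -> normc x < 1 ->
 exists p, cdiff (@slope R (bser c) 0 c%:C) x p.
Proof.
move=> cb x1; have [->|x0] := eqVneq x 0; last first.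
 exact: slope_cdiff (cdiff_bser cb x1) x0.
exists (gbin c 2)%:C; apply: (@little_o_quad _ _ 4 2^-1) => // h h2.
have h1 : normc h < 1 by apply: lt_trans h2 _; rewrite invf_lt1// ltr1n.
rewrite add0r mul0r addr0; have [->|h0] := eqVneq h 0.
 by rewrite subrr sub0r normcN normcM normc0 mulr0 mulr_ge0// exprn_ge0 ?normc_ge0.
rewrite {1}/slope (negbTE h0) {1}/slope eqxx bser_0// subr0.
have -> : (bser c h - 1) / h - c%:C - (gbin c 2)%:C * h = (bser c h - bpoly c 3 h) / h.
 rewrite /bpoly !big_ord_recr big_ord0 /= gbin0 /=.
 have -> : gbin c 1 = c by rewrite gbinS gbin0 mul1r subr0 divr1.
 by move: (bser c h) (gbin c 2) => b g; field.
have n0 : 0 < normc h by rewrite normc_gt0.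
rewrite normcM normcV ler_pdivrMr//; apply: (le_trans (bser_tail 3 cb h1)).
have q : (1 - normc h)^-1 <= 2.
 by rewrite -[leRHS]invrK lef_pV2 ?posrE ?invr_gt0 ?subr_gt0//; lra.
rewrite (_ : 4 * normc h ^+ 2 * normc h = 2 * (normc h ^+ 3 * 2)); last by ring.
by rewrite ler_wpM2l// ler_wpM2l// exprn_ge0 ?normc_ge0.
Qed.

(** Against the test polynomial of the same degree only the simple pole of the boundary
  values contributes. *)
Lemma D_main_eq m : Dfun (mainF m) (tpoly m) = (r ^+ (2 * l.+1) * B ^+ m * pi)%:C.
Proof.
have [K K0 hK] := mainF_close m m.
have BC0 := BC_neq0 s2 r1; have sC0 := sC_neq0 R s2.
have tA0 : 0 < tA by apply: lt_trans tA_gt1; exact: ltr01.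
pose c : C := (r ^+ (2 * l.+1))%:C * BC ^+ m.
pose W z : C := slope (bser alpha) 0 alpha%:C (xx s r z).
pose Z z : C := c * s%:R^-1 * (duu z * W z * BC^-1 + eta z * (duu z / uu z)).
pose k z : R := dstepA tA tB (tt z) * normc (duu z) ^+ 2.
have [tk ik] := level_mass s2 tA0 tAB.
have kB z : ~ lem z -> k z = 0.
 move=> /negP; rewrite -leNgt => zB; rewrite /k (stepA_gt tAB _).2 ?mul0r//.
 exact: le_trans (ltW tB_ltB) zB.
have dW z : lem z -> exists p, cdiff W z p.
 move=> zG; have [p dp] := slope_bser_cdiff alpha_bound (xx_lt1 s2 r1 zG).
 have d1 : cdiff (xx s r) z (BC^-1 * duu z).
  apply: (wdiff_ext (@ltr01 R) (Y1 := fun z => BC^-1 * uu z)) => [h _|]; first by rewrite mulrC.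
  exact: cdiffZ (cdiff_uu s z).
 by eexists; exact: cdiff_comp dp d1.
have [K1 K10 hK1] := bounded_deta; have [K2 K20 hK2] := bounded_poly s2 r1 (s%:R *: 'X^(s.-1)).
have hduu z : lem z -> normc (duu z) <= K2.
 by move=> zG; have := hK2 z zG; rewrite hornerZ hornerXn.
rewrite (@D_compare (mainF m) (tpoly m) Z (fun z => c * s%:R^-1 * (k z)%:C)
 (normc (c / s%:R) * (2 / (tB - tA) * K2 ^+ 2)) K (annular_mainF m)).
- rewrite (cint_ext (G := fun z => c * s%:R^-1 * (k z)%:C)); last first.
  move=> z; case: (boolP (z \in lem)) => zG; first by rewrite mulr1.
  by rewrite kB ?mulr0// => h; move: zG; rewrite mem_set.
 rewrite cintZ; last exact: ctame_real.
 rewrite cint_real ik /c.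
 have -> : BC ^+ m = (B ^+ m)%:C by rewrite rmorphXn.
 have sE : (s%:R * (pi : R))%:C = (s%:R : C) * (pi : R)%:C by rewrite rmorphM rmorph_nat.
 have pE (x y : R) : (x * y * pi)%:C = x%:C * y%:C * (pi : R)%:C by rewrite !rmorphM.
 rewrite sE pE.
 move: sC0; move: (s%:R : C) => S S0; move: (r ^+ _) (B ^+ m) => x y.
 by move: (x%:C) (y%:C) (pi%:C) => X Y p; field.
- move=> z zG; have [p dp] := dW z zG; have [p0 dd] := cdiff_duu s z.
 have [p1 d1] := wdiff_log_pole tAB tA0 (cdiff_uu s z) dd.
 eexists; apply: (wdiff_eq (wdiffZ (c * s%:R^-1) (wdiffD (cdiffM (cdiffM dd dp) (wdiff_cst BC^-1 z))
  (wdiff_ext (@ltr01 R) _ d1)))) => //.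
  by move=> h _; rewrite /eta ttE.
 by rewrite add0r /k ttE.
- move=> z zG; apply: ccontM (ccont_cst _ _) _.
 have c1 := ccontM (ccont_dstepA tAB (@rcont_tt R s z)) (ccontM (@ccont_duu R s z) (ccontJ (@ccont_duu R s z))).
 by apply: (ccont_ext (@ltr01 R) _ c1) => h _; rewrite mul_conjc -rmorphM.
- move=> z zG; apply: normcM_le => //; rewrite /k normc_real ger0_norm; last first.
  by rewrite mulr_ge0 ?dstepA_ge0 ?tAB// exprn_ge0// normc_ge0.
 rewrite ler_pM ?dstepA_ge0 ?dstepA_le ?tAB ?exprn_ge0 ?normc_ge0//.
 by rewrite lerXn2r ?nnegrE ?normc_ge0 ?hduu.
move=> z zG zB; have [u0 _] := outer_uu zB.
rewrite (_ : Z z = bvalue m m z); first exact: hK.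
have x0 : xx s r z != 0 by rewrite mulf_neq0 ?invr_eq0.
rewrite /Z /bvalue (eta_outer zB).1 mul1r /W /slope (negbTE x0) bser_0 ?alpha_bound// subr0.
rewrite -/(Ax s r alpha z) /duu /xx expr_div_n /c.
move: (Ax s r alpha z) (BC ^+ m) (z ^+ s.-1) => a b d; have um : uu z ^+ m != 0 by rewrite expf_neq0.
by move: (uu z ^+ m) um => e e0; field; rewrite e0 u0 BC0 sC0.
Qed.

End Pairings.
End Annulus.

(** * Approximation of the orthogonal polynomials *)
Section Approximation.
Variables (R : realType) (s : nat) (r : R).
Hypotheses (s2 : (2 <= s)%N) (r1 : 1 < r).
Local Notation C := R[i].
Implicit Types (z w h : C) (f g V : {poly C}) (F G : C -> C).
Local Notation uu := (@uu R s).
Local Notation tt := (@tt R s).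
Local Notation lem := (lem s r).
Local Notation B := (B s r).
Local Notation rs := (rs s r).
Local Notation BC := (B%:C).
Local Notation tA := (tA s r).
Local Notation tB := (tB s r).
Local Notation Dfun := (Dfun s r).
Local Notation Dint := (Dint s r).
Local Notation annular := (annular s r).
Local Notation mu := (mu s r).
Local Notation dmu := (dmu s r).
Local Notation kap := (kap s r).

Let B1 : 1 < B := B_gt1 s2 r1.
Let B0 : 0 < B := B_gt0 s2 r1.
Let s0 : (0 < s)%N := ltnW s2.

(** ** The kernel functions pair to zero *)
Definition nice F := (forall z, lem z -> exists p, cdiff F z p) /\
 exists2 M : R, 0 <= M & forall z, lem z -> normc (F z) <= M.

Lemma nice_cst (c : C) : nice (fun=> c).
Proof.
split=> [z _|]; first by exists 0; exact: wdiff_cst.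
by exists (normc c); rewrite ?normc_ge0.
Qed.
Lemma nice_poly g : nice (horner g).
Proof. by split=> [z _|]; [eexists; exact: cdiff_poly | exact: bounded_poly s2 r1 g]. Qed.
Lemma niceM F G : nice F -> nice G -> nice (fun z => F z * G z).
Proof.
move=> [dF [M M0 hM]] [dG [N N0 hN]]; split=> [z zG|].
 by have [p dp] := dF z zG; have [q dq] := dG z zG; eexists; exact: cdiffM dp dq.
by exists (M * N); rewrite ?mulr_ge0// => z zG; rewrite normcM_le ?hM ?hN.
Qed.
Lemma niceD F G : nice F -> nice G -> nice (fun z => F z + G z).
Proof.
move=> [dF [M M0 hM]] [dG [N N0 hN]]; split=> [z zG|].
 by have [p dp] := dF z zG; have [q dq] := dG z zG; eexists; exact: cdiffD dp dq.
by exists (M + N); rewrite ?addr_ge0// => z zG; rewrite normc_le2 ?hM ?hN.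
Qed.
Lemma niceX F n : nice F -> nice (fun z => F z ^+ n).
Proof.
move=> [dF [M M0 hM]]; split=> [z zG|].
 by have [p dp] := dF z zG; eexists; exact: cdiffX dp.
exists (M ^+ n); first exact: exprn_ge0.
by move=> z zG; rewrite normcX lerXn2r ?nnegrE ?normc_ge0 ?hM.
Qed.
Lemma nice_ccont F z : nice F -> lem z -> ccont F z.
Proof. by case=> dF _ /dF[p /wdiff_ccont]. Qed.
Lemma nice_bnd F : nice F -> bnd s r F.
Proof. by case=> _ [M M0 hM]; exists M => // z zG _; exact: hM. Qed.

Lemma normc_Bu_ge z : lem z -> B - rs <= normc (BC + uu z).
Proof.
move=> zG; have := normc_lb BC (uu z); rewrite normc_real gtr0_norm//; apply: le_trans.
by rewrite lerD2l lerN2 ltW//; apply/(lemE s2 r1).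
Qed.
Lemma Brs_gt0 : 0 < B - rs.
Proof. by rewrite subr_gt0 BE expr2 ltr_pMr ?(rs_gt1 s2 r1) ?(rs_gt0 s2 r1). Qed.

Lemma nice_kap : nice kap.
Proof.
split=> [z zG|]; first by eexists; exact: (cdiff_kap s2 r1 zG).
have Brs := Brs_gt0; pose M : R := 1 + (B - 1) / (B - rs).
have q0 : 0 <= (B - 1) / (B - rs) by rewrite divr_ge0 ?(ltW Brs)// subr_ge0 ltW.
have M1 : 1 <= M by rewrite lerDl.
exists M; first exact: le_trans M1.
move=> z zG; rewrite -(@ler_pXn2r _ s) ?nnegrE ?normc_ge0 ?(le_trans _ M1)//.
have b0 : 0 < normc (BC + uu z) by apply: lt_le_trans (normc_Bu_ge zG).
have b1 : normc (BC - 1) = B - 1.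
 by rewrite -[1]/((1:R)%:C) -rmorphB normc_real ger0_norm// subr_ge0 ltW.
rewrite -normcX (kap_pow s2 r1 zG) normcM normcV b1.
apply: (@le_trans _ _ M); last by rewrite -[leLHS]expr1 ler_weXn2l.
rewrite -[leLHS]add0r lerD// ler_wpM2l ?subr_ge0 ?(ltW B1)//.
by rewrite lef_pV2 ?posrE// normc_Bu_ge.
Qed.

Lemma nice_mu : nice mu.
Proof. by have := niceM (nice_poly 'X) nice_kap; rewrite (_ : (fun z => _) = mu)//; apply/funext => z; rewrite hornerX. Qed.

Lemma nice_eq F G : (forall z, lem z -> F z = G z) -> nice F -> nice G.
Proof.
move=> FG [dF [M M0 hM]]; split=> [z zG|]; last by exists M => // z zG; rewrite -FG ?hM.
have [p dp] := dF z zG; have [d d0 hd] := plane_open_lem s2 r1 zG.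
by exists p; apply: wdiff_ext d0 _ dp => h /hd/FG.
Qed.

Lemma nice_dmu : nice dmu.
Proof. by apply: nice_eq (niceX s.+1 nice_kap) => z zG; rewrite (dmuE s2 r1 zG). Qed.

Lemma pos_root (a : R) : 0 < a -> exists2 x : R, 0 < x & x ^+ s = a.
Proof.
move=> a0; exists (a `^ (s%:R^-1)); first exact: powR_gt0.
rewrite -powR_mulrn ?powR_ge0// -powRrM mulVf ?powRr1 ?(ltW a0)// pnatr_eq0 -lt0n//.
Qed.

(** From kap^s = (B - 1) / (B + u) and |B + u|^2 = B |z^s|^2 on the lemniscate. *)
Lemma mu_sqmod : exists2 nu : R, 0 < nu &
 close s r (fun z => mu z * (mu z)^*) (fun=> nu%:C).
Proof.
have B10 : 0 < B - 1 by rewrite subr_gt0.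
have a0 : 0 < (B - 1) ^+ 2 / B by rewrite divr_gt0 ?exprn_gt0.
have [nu nu0 nuE] := pos_root a0; exists nu => //.
have Brs := Brs_gt0; exists ((B - 1) ^+ 3 / (B * (B - rs) ^+ 2) * (nu / nu ^+ s)) => [|z zG _].
 by rewrite mulr_ge0 ?divr_ge0 ?mulr_ge0 ?exprn_ge0// ltW.
have b0 : 0 < normc (BC + uu z) by apply: lt_le_trans (normc_Bu_ge zG).
have b1 : normc (BC - 1) = B - 1.
 by rewrite -[1]/((1:R)%:C) -rmorphB normc_real ger0_norm// ltW.
have d0 : 0 <= B - tt z by rewrite subr_ge0 ltW.
pose d := (B - 1) ^+ 3 * (B - tt z) / (B * normc (BC + uu z) ^+ 2).
have dd : 0 <= d by rewrite divr_ge0 ?mulr_ge0 ?exprn_ge0 ?normc_ge0 ?(ltW B0) ?(ltW B10).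
have e : nu ^+ s - (normc (mu z) ^+ 2) ^+ s = d.
 have -> : (normc (mu z) ^+ 2) ^+ s = normc (z ^+ s) ^+ 2 * ((B - 1) ^+ 2 / normc (BC + uu z) ^+ 2).
  rewrite -exprM mulnC exprM -normcX /mu exprMn (kap_pow s2 r1 zG) !normcM normcV b1.
  by rewrite !exprMn exprVn.
 rewrite nuE /d; have := level_identity s r z; move: (normc (z ^+ s)) (tt z) => y t.
 move: B0 b0; move: (B) (normc (_ + _)) => b x b00 x0 E.
 have -> : (b - 1) ^+ 3 * (b - t) = (b - 1) ^+ 2 * (x ^+ 2 - b * y ^+ 2) by rewrite E; ring.
 by field; rewrite !gt_eqF.
rewrite mul_conjc -rmorphB normc_real -normrN opprB.
have nn : 0 <= normc (mu z) ^+ 2 by rewrite exprn_ge0 ?normc_ge0.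
apply: (le_trans (root_close s2 nn nu0 dd e)).
rewrite -mulrA [leRHS]mulrAC ler_wpM2r ?divr_ge0 ?exprn_ge0 ?(ltW nu0)//.
rewrite /d -mulrAC ler_wpM2r// ler_wpM2l ?exprn_ge0 ?(ltW B10)//.
have bb : (B - rs) ^+ 2 <= normc (BC + uu z) ^+ 2.
 by rewrite lerXn2r ?nnegrE ?normc_ge0 ?(ltW Brs)// normc_Bu_ge.
by rewrite lef_pV2 ?posrE ?mulr_gt0 ?exprn_gt0// ler_wpM2l// ltW.
Qed.

Lemma outer_w z : tA <= tt z -> Num.sqrt tA - 1 <= normc (z ^+ s).
Proof.
move=> zA; have tA0 : 0 < tA by exact: lt_trans ltr01 (tA_gt1 s2 r1).
have -> : z ^+ s = uu z - (-1) by rewrite uuE opprK subrK.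
have := normc_lb (uu z) (- -1); rewrite !normcN (_ : normc 1 = 1 :> R); last exact: (normc_nat R 1).
apply: le_trans; rewrite lerD2r -(@ler_pXn2r _ 2) ?nnegrE ?normc_ge0 ?sqrtr_ge0//.
by rewrite sqr_sqrtr -?ttE// ltW.
Qed.

Lemma sqrt_tA : 0 < Num.sqrt tA - 1.
Proof.
have t1 := tA_gt1 s2 r1.
by rewrite subr_gt0 -[ltLHS]sqrtr1 ltr_sqrt// (lt_trans ltr01).
Qed.

Lemma mu_lower : exists2 e : R, 0 < e & forall z, lem z -> tA <= tt z -> e <= normc (mu z).
Proof.
have d0 := sqrt_tA; have B10 : 0 < B - 1 by rewrite subr_gt0.
pose e0 : R := (Num.sqrt tA - 1) * ((B - 1) / (2 * B)).
have e00 : 0 < e0 by rewrite mulr_gt0 ?divr_gt0 ?mulr_gt0.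
exists (Num.min e0 1); first by rewrite lt_min e00 ltr01.
move=> z zG zA; rewrite leNgt; apply/negP; rewrite lt_min => /andP[h1 h2].
have : normc (mu z) ^+ s <= normc (mu z).
 by rewrite -[leRHS]expr1 ler_wiXn2l ?normc_ge0// ltW.
apply/negP; rewrite -ltNge; apply: (lt_le_trans h1).
rewrite -normcX /mu exprMn (kap_pow s2 r1 zG) !normcM normcV.
have b1 : normc (BC - 1) = B - 1.
 by rewrite -[1]/((1:R)%:C) -rmorphB normc_real ger0_norm// ltW.
rewrite b1; apply: ler_pM; rewrite ?(ltW d0) ?outer_w ?divr_ge0 ?mulr_ge0 ?(ltW B0) ?(ltW B10)//.
have b0 : 0 < normc (BC + uu z) by apply: lt_le_trans (normc_Bu_ge zG); exact: Brs_gt0.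
rewrite ler_wpM2l ?(ltW B10)// lef_pV2 ?posrE ?mulr_gt0//.
rewrite mulr_natl mulr2n normc_le2 ?normc_real ?gtr0_norm//.
have := Brs_gt0; rewrite subr_gt0 => /ltW; apply: le_trans.
by apply: ltW; apply/(lemE s2 r1).
Qed.

Definition pole i z : C := dmu z / mu z ^+ i.+1.

Lemma outer_neq0 z : 1 < tt z -> z != 0.
Proof.
move=> t1; apply/eqP => z0; move: t1; rewrite z0 ttE uu0// normcN (normc_nat R 1).
by rewrite expr1n ltxx.
Qed.

Lemma annular_pole i : annular (pole i).
Proof.
split=> [z zG t1|].
 have m0 := mu_neq0 s2 r1 zG (outer_neq0 t1).
 have [p dp] := nice_dmu.1 z zG; have dm := cdiff_mu s2 r1 zG.
 by eexists; apply: cdiffM dp (cdiffV (cdiffX i.+1 dm) _); rewrite expf_neq0.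
have [e e0 he] := mu_lower; have [M M0 hM] := nice_dmu.2.
exists (M * e ^- i.+1); split; first by rewrite mulr_ge0// invr_ge0 exprn_ge0// ltW.
move=> z zG zA; rewrite /pole normcM_le ?hM// normcV normcX.
have m0 := lt_le_trans e0 (he z zG zA).
by rewrite lef_pV2 ?posrE ?exprn_gt0// lerXn2r ?nnegrE ?normc_ge0 ?(ltW e0) ?he.
Qed.

(** With h = mu^(i+1) g and h' = mu k, the boundary values are c mu' conj(h), whose conjugate
 derivative is, up to conjugation, that of k (|mu|^2 - nu). *)
Lemma D_pole i g : (0 < i)%N -> Dfun (pole i) g = 0.
Proof.
move=> i0; have [nu nu0 [K K0 hK]] := mu_sqmod.
have nmu := nice_mu; have ndmu := nice_dmu.
pose k z := i.+1%:R * (mu z ^+ i.-1 * dmu z * g.[z]) + mu z ^+ i * g^`().[z].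
have nk : nice k.
 apply: niceD (niceM (nice_cst _) (niceM (niceM (niceX _ nmu) ndmu) (nice_poly g))) _.
 exact: niceM (niceX _ nmu) (nice_poly _).
pose h z := mu z ^+ i.+1 * g.[z]; pose h' z := mu z * k z.
have nh' : nice h' by exact: niceM.
have dh z : lem z -> cdiff h z (h' z).
 move=> zG; have dm := cdiff_mu s2 r1 zG.
 apply: (wdiff_eq (cdiffM (cdiffX i.+1 dm) (cdiff_poly g z))) => //.
 have e : mu z ^+ i = mu z * mu z ^+ i.-1 by rewrite -exprS prednK.
 rewrite /h' /k exprS -pred_Sn e; move: (mu z ^+ _); move: (mu z) (dmu z) g.[z] g^`().[z] => a b c c'.
 by move: (i.+1%:R) => d e'; ring.
pose c : C := (nu ^- i.+1)%:C.
pose X z := h' z * (dmu z)^*.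
have cX z : lem z -> ccont X z.
 by move=> zG; apply: ccontM (nice_ccont nh' zG) (ccontJ (nice_ccont ndmu zG)).
have [M1 M10 h1] := nh'.2; have [M2 M20 h2] := ndmu.2.
have bX z : lem z -> normc (X z) <= M1 * M2.
 by move=> zG; apply: normcM_le; rewrite ?normcJ ?h1 ?h2.
have X0 : cint (fun z => X z * (z \in lem)%:R) = 0.
 have [M3 M30 h3] := nk.2.
 apply: (@lem_stokes R s r s2 r1 (fun z => k z * (mu z * (mu z)^* - nu%:C)) X tB (M1 * M2) (M3 * K)) => //.
 - exact: tB_ltB.
 - move=> z zG; have [p dk] := nk.1 z zG; have dm := cdiff_mu s2 r1 zG.
  eexists; apply: (wdiff_eq (wdiffM dk (wdiffB (wdiffM dm (wdiffJ dm)) (wdiff_cst nu%:C z)))) => //.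
  by rewrite mul0r mul0r !add0r subr0 /X /h'; ring.
 - by move=> z zG zB; rewrite -mulrA normcM_le ?h3 ?hK.
pose Z z := c * (dmu z * (h z)^*); pose qz z := c * (dmu z * (h' z)^*).
have [K' _ hK'] : close s r (fun z => pole i z * (g.[z])^*) Z.
 have bV : bnd s r (fun z => (mu z)^-1).
  have [e e0 he] := mu_lower; exists e^-1; first by rewrite invr_ge0 ltW.
  move=> z zG zB; have zA : tA <= tt z by exact: le_trans (ltW (tAB s2 r1)) zB.
  have m0 := lt_le_trans e0 (he z zG zA).
  by rewrite normcV lef_pV2 ?posrE// he.
 have [M3 M30 h3] := bV.
 have c1 : close s r (fun z => (mu z)^-1) (fun z => (mu z)^* * (nu^-1)%:C).
  exists (M3 * (nu^-1 * K)) => [|z zG zB].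
   by rewrite !mulr_ge0 ?invr_ge0 ?(ltW nu0).
  have nuC : nu%:C != 0 by rewrite -normc_gt0 normc_real normr_gt0 gt_eqF.
  have m0 : mu z != 0.
   by apply: mu_neq0 zG (outer_neq0 _) => //; apply: lt_le_trans zB; exact: lt_trans (tA_gt1 s2 r1) (tAB s2 r1).
  have -> : (mu z)^-1 - (mu z)^* * (nu^-1)%:C = (mu z)^-1 * ((nu^-1)%:C * - (mu z * (mu z)^* - nu%:C)).
   have F (x a b : C) : x != 0 -> b != 0 -> x^-1 - a * b^-1 = x^-1 * (b^-1 * - (x * a - b)).
    by move=> x0 y0; field; rewrite x0 y0.
   have -> : (nu^-1)%:C = (nu%:C)^-1 by exact: fmorphV.
   exact: F.
  rewrite -(mulrA M3) -(mulrA nu^-1); apply: normcM_le (h3 z zG zB) (normcM_le _ _).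
   by rewrite normc_real ger0_norm// invr_ge0 ltW.
  by rewrite normcN; exact: hK.
 have b2 := close_bnd s2 r1 c1 bV; have c2 := closeX i.+1 c1 bV b2.
 have bd := nice_bnd ndmu; have bg := bndJ (bnd_poly s2 r1 g).
 have c3 := closeM (close_refl s r dmu) c2 bd (bndX i.+1 b2).
 have c4 := closeM c3 (close_refl s r (fun z => (g.[z])^*)) (bndM bd (bndX i.+1 bV)) bg.
 apply: close_ext c4 => z _ _; first by rewrite /pole exprVn.
 have F (a b d e x : C) : d * (a * b) * e = b * (d * (a * e)) by ring.
 have hE : (h z)^* = (mu z)^* ^+ i.+1 * (g.[z])^* by rewrite /h rmorphM rmorphXn.
 have cE : c = ((nu^-1)%:C) ^+ i.+1 by rewrite /c -rmorphXn exprVn.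
 by rewrite /Z hE cE exprMn F.
rewrite (@D_compare R s r s2 r1 (pole i) g Z qz (normc c * (M2 * M1)) K' (annular_pole i)) => //.
- have -> : 0 = c * (cint (fun z => X z * (z \in lem)%:R))^* :> C.
  by rewrite X0 (_ : 0^* = 0) ?mulr0//; exact: rmorph0.
 have tX := ctame_lem s2 r1 cX bX.
 rewrite -cintJ// -cintZ; last exact: ctameJ.
 apply: cint_ext => z; case: (z \in lem); last by rewrite !mulr0 (_ : 0^* = 0) ?mulr0//; exact: rmorph0.
 have F (a b : C) : (a * b^*)^* = b * a^* by case: a => x y; case: b => x1 y1 /=; congr (_ +i* _); ring.
 by rewrite (_ : true%:R = 1)// !mulr1 /X F.
- move=> z zG; have [p dp] := ndmu.1 z zG; eexists.
 apply: (wdiff_eq (wdiffZ c (wdiffM dp (wdiffJ (dh z zG))))) => //.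
 by rewrite mul0r add0r.
- by move=> z zG; apply: ccontM (ccont_cst _ _) (ccontM (nice_ccont ndmu zG) (ccontJ (nice_ccont nh' zG))).
- have [M4 M40 h4] := nh'.2.
 by move=> z zG; rewrite !normcM_le ?normcJ ?h1 ?h2.
Qed.

(** ** Linearity and size of the pairing *)
Lemma DfunDl F G g : annular F -> annular G ->
 Dfun (fun z => F z + G z) g = Dfun F g + Dfun G g.
Proof.
move=> aF aG; rewrite -cintD; [|exact: Dint_ctame..].
by apply: cint_ext => z; rewrite /Dint; ring.
Qed.

Lemma DfunDr F g g' : annular F -> Dfun F (g + g') = Dfun F g + Dfun F g'.
Proof.
move=> aF; rewrite -cintD; [|exact: Dint_ctame..].
by apply: cint_ext => z; rewrite /Dint derivD !hornerD !rmorphD; ring.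
Qed.

Lemma DfunZr F g (c : C) : annular F -> Dfun F (c *: g) = c^* * Dfun F g.
Proof.
move=> aF; rewrite -cintZ; last exact: Dint_ctame.
by apply: cint_ext => z; rewrite /Dint derivZ !hornerZ !rmorphM; ring.
Qed.

Lemma Dfun0r F : annular F -> Dfun F 0 = 0.
Proof.
by move=> aF; rewrite -[0 : {poly C}](scale0r 0) DfunZr// (_ : 0^* = 0) ?mul0r//; exact: rmorph0.
Qed.

Lemma annularZ F (c : C) : annular F -> annular (fun z => c * F z).
Proof.
move=> [dF [M [M0 hM]]]; split=> [z zG t1|].
 by have [p dp] := dF z zG t1; eexists; exact: cdiffZ dp.
exists (normc c * M); split; first by rewrite mulr_ge0 ?normc_ge0.
by move=> z zG zA; rewrite normcM_le ?hM.
Qed.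

Lemma annularD F G : annular F -> annular G -> annular (fun z => F z + G z).
Proof.
move=> [dF [M [M0 hM]]] [dG [N [N0 hN]]]; split=> [z zG t1|].
 by have [p dp] := dF z zG t1; have [q dq] := dG z zG t1; eexists; exact: cdiffD dp dq.
exists (M + N); split; first exact: addr_ge0.
by move=> z zG zA; rewrite normc_le2 ?hM ?hN.
Qed.

Lemma annular_poly g : annular (horner g).
Proof.
split=> [z _ _|]; first by eexists; exact: cdiff_poly.
by have [M M0 hM] := bounded_poly s2 r1 g; exists M; split => // z zG _; exact: hM.
Qed.

Lemma DfunZl F (c : C) g : annular F -> Dfun (fun z => c * F z) g = c * Dfun F g.
Proof.
move=> aF; rewrite -cintZ; last exact: Dint_ctame.
by apply: cint_ext => z; rewrite /Dint; ring.
Qed.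

(** For polynomials eta may be replaced by 1, as both agree near the boundary. *)
Lemma D_poly f g : Dfun (horner f) g = pip s r f g^`().
Proof.
have [K K0 hK] := bounded_poly s2 r1 f; have [K' K0' hK'] := bounded_poly s2 r1 g^`().
apply: (@D_compare R s r s2 r1 (horner f) g (fun z => f.[z] * (g.[z])^*)
 (fun z => f.[z] * (g^`().[z])^*) (K * K') 0 (annular_poly f)).
- move=> z zG; eexists; apply: (wdiff_eq (wdiffM (cdiff_poly f z) (wdiffJ (cdiff_poly g z)))) => //.
 by rewrite mul0r add0r.
- by move=> z zG; exact: ccontM (@ccont_horner _ f z) (ccontJ (@ccont_horner _ g^`() z)).
- by move=> z zG; rewrite normcM_le ?normcJ ?hK ?hK'.
by move=> z zG zB; rewrite subrr normc0 mul0r.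
Qed.
End Approximation.

(** * Orthogonality defect of an approximation *)
Section Defect.
Variables (R : realType) (s : nat) (r : R).
Hypotheses (s2 : (2 <= s)%N) (r1 : 1 < r).
Local Notation C := R[i].
Implicit Types (z w h : C) (f g q V : {poly C}) (F G : C -> C).
Local Notation uu := (@uu R s).
Local Notation tt := (@tt R s).
Local Notation lem := (lem s r).
Local Notation B := (B s r).
Local Notation tA := (tA s r).
Local Notation tB := (tB s r).
Local Notation Dfun := (Dfun s r).
Local Notation annular := (annular s r).
Local Notation pnorm := (pnorm s r).
Local Notation pip := (pip s r).

Let B1 : 1 < B := B_gt1 s2 r1.
Let s0 : (0 < s)%N := ltnW s2.

(** G_1 is starlike with respect to 0, so a polynomial vanishing at 0 is controlled by
  its derivative. *)
Lemma primitive_bound : exists2 K : R, 0 < K & forall g, g.[0] = 0 ->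
 forall z, tt z <= tB -> normc g.[z] ^+ 2 <= K * pnorm g^`().
Proof.
have [K K0 hK] := point_evaluation s2 r1 (tB_ltB s2 r1).
have B20 : 0 < B + 2 by rewrite addr_gt0// (lt_trans ltr01).
exists ((B + 2) ^+ 2 * K); first by rewrite mulr_gt0 ?exprn_gt0.
move=> g g0 z zB; pose M := Num.sqrt (K * pnorm g^`()).
have N0 : 0 <= K * pnorm g^`() by rewrite mulr_ge0 ?(ltW K0)//; exact: pnorm_ge0.
have b1 : 1 <= tB by apply: ltW; exact: lt_trans (tA_gt1 s2 r1) (tAB s2 r1).
have st t : 0 <= t <= 1 -> tt (0 + t%:C * (z - 0)) <= tB.
 move=> /andP[t0 t1]; have ts : 0 <= t ^+ s <= 1 by rewrite exprn_ge0// exprn_ile1.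
 rewrite add0r subr0 ttE -[tB]sqr_sqrtr ?(le_trans ler01)// lerXn2r ?nnegrE ?normc_ge0 ?sqrtr_ge0//.
 have h1 : normc (uu z) <= Num.sqrt tB.
  by rewrite -(@ler_pXn2r _ 2) ?nnegrE ?normc_ge0 ?sqrtr_ge0// sqr_sqrtr -?ttE// (le_trans ler01).
 have h2 : normc (-1 : C) <= Num.sqrt tB.
  by rewrite normcN (normc_nat R 1) -[leLHS]sqrtr1 ler_wsqrtr.
 have := segment_le h1 h2 ts; rewrite (_ : _ + _ = uu (t%:C * z))//.
 by rewrite !uuE exprMn rmorphXn; ring.
have h : normc (g.[z] - g.[0]) <= M * normc (z - 0).
 apply: (mean_value_ineq (f' := horner g^`())) => t t01; first exact: cdiff_poly.
 by rewrite -[leLHS]ger0_norm ?normc_ge0// -sqrtr_sqr ler_wsqrtr// hK ?st.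
rewrite g0 !subr0 in h; have zl : normc z <= B + 2.
 by apply: (lem_bounded s2); exact: le_lt_trans zB (tB_ltB s2 r1).
have h2 : normc g.[z] <= M * (B + 2) by apply: le_trans h _; rewrite ler_wpM2l ?sqrtr_ge0.
have : normc g.[z] ^+ 2 <= (M * (B + 2)) ^+ 2.
 by rewrite lerXn2r ?nnegrE ?normc_ge0// mulr_ge0 ?sqrtr_ge0// ltW.
by rewrite exprMn sqr_sqrtr// mulrC -mulrA.
Qed.

Lemma linear_quadratic (lam x : R) : 0 < lam -> x <= lam * x ^+ 2 + lam^-1.
Proof.
move=> l0; rewrite -subr_ge0.
have -> : lam * x ^+ 2 + lam^-1 - x = lam^-1 * ((lam * x - 2^-1) ^+ 2 + 3 / 4).
 by field; rewrite gt_eqF.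
by rewrite mulr_ge0 ?invr_ge0 ?(ltW l0)// addr_ge0 ?sqr_ge0.
Qed.

Definition pairing_bound (K : R) := forall F g (sig lam : R), annular F -> 0 <= sig ->
 (forall z, lem z -> tA <= tt z -> normc (F z) <= sig) -> g.[0] = 0 -> 0 < lam ->
 normc (Dfun F g) <= K * sig * (lam * pnorm g^`() + lam^-1).

(** The pairing is an integral over the annulus where eta is not 0. There |g| is controlled by
 the norm of g' because g(0) = 0, except near the boundary, where only g' occurs. *)
Theorem D_bound : exists2 K : R, 0 < K & pairing_bound K.
Proof.
have [K0 K00 h0] := primitive_bound; have [K1 K10 h1] := bounded_deta s2 r1.
have tI : tame (fun z => (z \in lem)%:R : R).
 by apply: (tame_indic (lem_plane_measurable s2 r1) (M := B + 2)) => z; exact: lem_bounded.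
pose A := int2 (fun z => (z \in lem)%:R : R).
have A0 : 0 <= A by apply: int2_ge0 => z; rewrite ler0n.
pose K := K1 * K0 * A + (K1 + 1) * A + 1.
have k0 : 0 < K by rewrite ltr_wpDl// addr_ge0 ?mulr_ge0 ?addr_ge0// ltW.
exists (2 * K); first by rewrite mulr_gt0.
move=> F g sig lam aF sig0 hF g0 lam0; set N := pnorm g^`().
have N0 : 0 <= N by exact: pnorm_ge0.
have L0 : 0 <= lam^-1 by rewrite invr_ge0 ltW.
pose c1 := sig * (K1 * (lam * (K0 * N) + lam^-1) + lam^-1).
have c10 : 0 <= c1.
 by rewrite mulr_ge0// addr_ge0// mulr_ge0// addr_ge0// mulr_ge0 ?(ltW lam0)// mulr_ge0// ltW.
pose G z := c1 * (z \in lem)%:R + (sig * lam) * (normc g^`().[z] ^+ 2 * (z \in lem)%:R).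
have tN := tame_pnorm s2 r1 g^`().
have tG : tame G by apply: tameD; apply: tameZ.
have cG : int2 G = c1 * A + sig * lam * N.
 by rewrite int2D ?int2Z//; apply: tameZ.
have pt z : normc (Dint s r F g z * (z \in lem)%:R) <= G z.
 rewrite /G; have [/set_mem zG|_] := boolP (z \in lem); last by rewrite !mulr0 addr0 normc0.
 rewrite !mulr1; have [zA|zA] := ltP (tt z) tA.
  rewrite /Dint (eta_inner s2 r1 (ltW zA)).1 (eta_inner s2 r1 (ltW zA)).2 !mul0r addr0 normc0.
  by rewrite addr_ge0// mulr_ge0 ?exprn_ge0 ?normc_ge0// mulr_ge0// ltW.
 have hg : normc (deta s r z * (F z * (g.[z])^*)) <= K1 * (sig * (lam * (K0 * N) + lam^-1)).
  have [zB|zB] := leP (tB) (tt z).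
   by rewrite (eta_outer s2 r1 zB).2 mul0r normc0 !mulr_ge0 ?addr_ge0 ?mulr_ge0// ltW.
  rewrite normcM_le ?h1// normcM_le ?hF// normcJ.
  apply: (le_trans (linear_quadratic _ lam0)); rewrite lerD2r ler_wpM2l ?(ltW lam0)//.
  exact: h0 (ltW zB).
 have hg' : normc (eta s r z * (F z * (g^`().[z])^*)) <= 1 * (sig * (lam * normc g^`().[z] ^+ 2 + lam^-1)).
  by rewrite normcM_le ?normc_eta// normcM_le ?hF// normcJ linear_quadratic.
 apply: (le_trans (normc_le2 hg hg')); rewrite /c1; apply: le_of_eq; ring.
have := cint_le (Dint_ctame s2 r1 g aF) tG pt; rewrite cG => h; apply: (le_trans h).
rewrite -subr_ge0 (_ : _ - _ =
  2 * sig * ((K1 + 1) * A * (lam * N) + (K1 * K0 * A + 1) * lam^-1)); last first.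
 by rewrite /c1 /K; move: (lam^-1) => li; ring.
have K100 : 0 <= K1 * K0 * A by rewrite !mulr_ge0// ltW.
apply: mulr_ge0; first by rewrite mulr_ge0.
by rewrite addr_ge0// ?mulr_ge0// ?addr_ge0 ?mulr_ge0// ltW.
Qed.

(** ** Primitives *)
Section Pairing.
Variable l : nat.
Hypothesis ls : (l < s)%N.
Local Notation tpoly := (tpoly R s l).
Local Notation upoly := (@upoly R s l).
Local Notation mainF := (@mainF R s l).

Lemma upolyD q V : upoly (q + V) = upoly q + upoly V.
Proof. by rewrite /upoly comp_polyD mulrDr. Qed.
Lemma upolyZ (c : C) q : upoly (c *: q) = c *: upoly q.
Proof. by rewrite /upoly comp_polyZ -scalerAr. Qed.
Lemma upolyXn j : upoly 'X^j = 'X^l * ('X^s - 1) ^+ j.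
Proof. by rewrite /upoly comp_Xn_poly. Qed.

Lemma size_upoly m V : (size V <= m)%N -> (size (upoly V) <= s * m + l)%N.
Proof.
move=> Vm; have [->|V0] := eqVneq V 0; first by rewrite /upoly comp_poly0 mulr0 size_poly0.
rewrite /upoly; apply: (leq_trans (size_polyMleq _ _)); rewrite size_polyXn /=.
have sX : size ('X^s - 1 : {poly C}) = s.+1 by rewrite size_XnsubC.
have := size_comp_poly_leq V ('X^s - 1); rewrite sX /= => h.
apply: (leq_trans (n := l + ((size V).-1 * s).+1)); first by rewrite leq_add2l.
have V1 : (0 < size V)%N by rewrite size_poly_gt0.
move: Vm V1 s0; move: (size V) => [//|v] /= vm _ s00.
rewrite addnC leq_add2r mulnC (leq_trans (n := s * v + s))//.
 by rewrite -addn1 leq_add2l.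
by rewrite -mulnSr leq_mul2l vm orbT.
Qed.

Lemma tpoly_deriv j : (tpoly j)^`() =
 upoly ((s * j + l).+1%:R *: 'X^j + (s * j)%:R *: 'X^(j.-1)).
Proof.
have E a b i k : upoly (a *: 'X^i + b *: 'X^k) =
  'X^l * (a *: ('X^s - 1) ^+ i + b *: ('X^s - 1) ^+ k).
 by rewrite upolyD !upolyZ !upolyXn mulrDr !scalerAr.
rewrite E {E}.
have d : ('X^s - 1 : {poly C})^`() = s%:R * 'X^(s.-1).
 by rewrite derivB derivXn derivC subr0 mulr_natl.
have e : 'X^(l.+1) * 'X^(s.-1) = 'X^l * (('X^s - 1) + 1) :> {poly C}.
 by rewrite subrK -!exprD addSnnS prednK.
rewrite /tpoly; move: ('X^s - 1 : {poly C}) d e => v d e.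
have sc k (p : {poly C}) : k%:R *: p = k%:R * p by rewrite scaler_nat mulr_natl.
have nn k : 'X^l *+ k = k%:R * 'X^l :> {poly C} by rewrite mulr_natl.
have vn k (p : {poly C}) : p *+ k = k%:R * p by rewrite mulr_natl.
rewrite derivM derivXn deriv_exp d -pred_Sn !sc nn vn.
rewrite (_ : 'X^(l.+1) * _ = ('X^(l.+1) * 'X^(s.-1)) * (v ^+ j.-1 * (s%:R * j%:R))); last by ring.
rewrite e; case: j => [|j]; first by rewrite muln0 /= expr0 add0n; ring.
rewrite -pred_Sn exprS -addnS !natrD !natrM; move: (l.+1%:R) (j.+1%:R) => x y; ring.
Qed.

Lemma tpoly0 j : (tpoly j).[0] = 0.
Proof. by rewrite tpolyE exprS !mul0r. Qed.

Lemma peel_top m V : (size V <= m.+1)%N ->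
 (size (V - (V`_m / (s * m + l).+1%:R) *: ((s * m + l).+1%:R *: 'X^m + (s * m)%:R *: 'X^(m.-1)))%R <= m)%N.
Proof.
move=> Vm; apply/leq_sizeP => j mj; rewrite coefB coefZ coefD !coefZ !coefXn.
have n0 : (s * m + l).+1%:R != 0 :> C by rewrite pnatr_eq0.
have [->|jm] := eqVneq j m.
 have -> : (s * m)%:R * (m == m.-1)%:R = 0 :> C.
  case: (m) => [|k]; first by rewrite muln0 mul0r.
  by rewrite -pred_Sn (gtn_eqF (ltnSn k)) mulr0.
 by rewrite addr0 mulr1 divfK// subrr.
have mj' : (m < j)%N by rewrite ltn_neqAle eq_sym jm.
have -> : (j == m.-1) = false by apply: gtn_eqF; exact: leq_ltn_trans (leq_pred _) mj'.
by rewrite !mulr0 addr0 mulr0 subr0; apply/leq_sizeP: mj'.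
Qed.

(** The derivatives of the test polynomials z^(l+1) u^j, j < m, form a basis of the polynomials
 z^l V(u) of degree below z^l u^m. *)
Lemma primitive_low m V : (size V <= m)%N -> exists g,
 [/\ g.[0] = 0, g^`() = upoly V & forall F, annular F ->
   (forall j, (j < m)%N -> Dfun F (tpoly j) = 0) -> Dfun F g = 0].
Proof.
elim: m V => [|m ih] V Vm.
 exists 0; rewrite horner0 deriv0 (eqP (_ : V == 0)) -?size_poly_leq0//.
 by split => // [|F aF _]; rewrite ?Dfun0r// /upoly comp_poly0 mulr0.
have := peel_top Vm; set a := _ / _ => /= /ih[g [g0 g' hg]].
exists (a *: tpoly m + g); split.
- by rewrite hornerD hornerZ tpoly0 g0 mulr0 addr0.
- by rewrite derivD derivZ g' tpoly_deriv -upolyZ -upolyD addrC subrK.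
- move=> F aF hF; rewrite (DfunDr s2 r1)// (DfunZr s2 r1)// hF// mulr0 add0r.
 by apply: hg => // j jm; apply: hF; exact: ltnW.
Qed.

(** pi r^(2(n+1))/(n+1), the squared norm of z^l u^m up to terms of lower degree. *)
Definition mass m : R := pi * r ^+ (2 * (s * m + l).+1) / (s * m + l).+1%:R.

Lemma main_pairing m V : (size V <= m.+1)%N -> exists g,
 [/\ g.[0] = 0, g^`() = upoly V & Dfun (mainF m) g = (V`_m)^* * (mass m)%:C].
Proof.
move=> Vm; have := peel_top Vm; set a := _ / _ => /= /primitive_low[g [g0 g' hg]].
have aF := annular_mainF s2 r1 ls m.
exists (a *: tpoly m + g); split.
- by rewrite hornerD hornerZ tpoly0 g0 mulr0 addr0.
- by rewrite derivD derivZ g' tpoly_deriv -upolyZ -upolyD addrC subrK.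
rewrite (DfunDr s2 r1)// (DfunZr s2 r1)// hg//; last by move=> j jm; exact: D_main_lt.
rewrite addr0 D_main_eq//.
have -> : r ^+ (2 * l.+1) * B ^+ m = r ^+ (2 * (s * m + l).+1).
 by rewrite BE -!exprM -exprD; congr (_ ^+ _); lia.
have a' : a^* = (V`_m)^* / (s * m + l).+1%:R by rewrite /a rmorphM fmorphV rmorph_nat.
have -> : (mass m)%:C = (r ^+ (2 * (s * m + l).+1) * pi)%:C / (s * m + l).+1%:R.
 by rewrite /mass [pi * _]mulrC rmorphM fmorphV rmorph_nat.
by rewrite a' mulrAC mulrA.
Qed.

(** ** Comparison with the orthonormal polynomial *)
Section Compare.
Variables (P : nat -> {poly C}) (hP : orthonormal_polynomials lem P).
Variable K : R.
Hypothesis hK : pairing_bound K.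
Variables (m : nat) (q : {poly C}) (N : C -> C) (sig : R).
Hypotheses (sq : size q = m.+1) (lq : lead_coef q = 1).
Hypotheses (aN : annular N) (N0 : forall g, Dfun N g = 0) (sig0 : 0 <= sig).
Hypothesis hq : forall z, lem z -> tA <= tt z ->
 normc ((upoly q).[z] - mainF m z - N z) <= sig.
Let n := (s * m + l)%N.

(** Integrate [V] to a polynomial [g] with g(0) = 0: on [mainF] the pairing with [g] sees only
 the top coefficient, on [N] it is 0, and on the remainder it is bounded by [hK]. *)
Lemma defect V (lam : R) : (size V <= m.+1)%N -> 0 < lam ->
 normc (pip (upoly q) (upoly V) - (V`_m)^* * (mass m)%:C) <=
  K * sig * (lam * pnorm (upoly V) + lam^-1).
Proof.
move=> Vm lam0; have [g [g0 g' hg]] := main_pairing Vm.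
have aF := annular_mainF s2 r1 ls m.
have aM := annularZ (-1) aF; have aN' := annularZ (-1) aN.
pose rem z := (upoly q).[z] + (-1) * mainF m z + (-1) * N z.
have aR : annular rem by apply: annularD aN'; apply: annularD aM; exact: annular_poly.
have e : Dfun rem g = pip (upoly q) (upoly V) - (V`_m)^* * (mass m)%:C.
 rewrite /rem (DfunDl s2 r1)//; last by apply: annularD aM; exact: annular_poly.
 rewrite (DfunDl s2 r1)//; last exact: annular_poly.
 by rewrite !(DfunZl s2 r1)// hg N0 mulr0 addr0 (D_poly s2 r1) g' mulN1r.
rewrite -e -g'; apply: hK => // z zG zA.
by rewrite /rem !mulN1r hq.
Qed.

Local Notation kappa := (lead_coef (P n)).
Definition gap : {poly C} := upoly q - kappa^-1 *: P n.

Lemma kappa_real : exists2 k : R, 0 < k & kappa = k%:C.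
Proof. exact: gt0_complex (lead_P hP n). Qed.

(** [gap] has degree below [n], so [P n] is orthogonal to it and its squared norm is the inner
 product of [upoly q] with it, a defect. *)
Lemma gap_bound (lam : R) : 0 < lam -> pnorm gap <= K * sig * (lam * pnorm gap + lam^-1).
Proof.
move=> lam0; have [q' [Pq sq' lq']] := P_upoly s2 r1 hP m ls.
have k0 : kappa != 0 by have := lead_P hP n; exact: lt0r_neq0.
pose V := q - kappa^-1 *: q'.
have VE : upoly V = gap by rewrite /V -scaleNr upolyD upolyZ /gap Pq scaleNr.
have Vs : (size V <= m.+1)%N.
 apply: (leq_trans (size_polyD _ _)); rewrite size_polyN geq_max sq leqnn /=.
 by apply: (leq_trans (size_scale_leq _ _)); rewrite sq'.
have Vm : V`_m = 0.
 have := lq; have := lq'; rewrite !lead_coefE sq sq' -pred_Sn => h1 h2.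
 by rewrite /V coefB coefZ h2 h1 -lead_coefE mulVf// subrr.
have := defect Vs lam0; rewrite VE Vm (_ : 0^* = 0) ?mul0r ?subr0; last exact: rmorph0.
have Vs' : (size V <= m)%N.
 by apply/leq_sizeP => j; rewrite leq_eqVlt => /orP[/eqP<-//|]; apply/leq_sizeP.
have Po : pip (P n) gap = 0 by apply: (P_orth s2 r1 hP); rewrite -VE; exact: size_upoly.
rewrite (_ : pip (upoly q) gap = pip gap gap); last first.
 by rewrite {2}/gap pipBl// pipZl// Po mulr0 subr0.
by rewrite pip_norm// normc_real ger0_norm// pnorm_ge0.
Qed.

(** The inner product of [upoly q] with P_n / kappa is exactly pi / kappa^2, and is [mass m] up
 to the defect. *)
Lemma kappa_bound (lam k : R) : 0 < lam -> kappa = k%:C ->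
 `|pi / k ^+ 2 - mass m| <= K * sig * (lam * (pi / k ^+ 2) + lam^-1).
Proof.
move=> lam0 kE; have [q' [Pq sq' lq']] := P_upoly s2 r1 hP m ls.
have k0 : kappa != 0 by have := lead_P hP n; exact: lt0r_neq0.
pose V := kappa^-1 *: q'.
have VE : upoly V = kappa^-1 *: P n by rewrite /V upolyZ Pq.
have Vs : (size V <= m.+1)%N by apply: (leq_trans (size_scale_leq _ _)); rewrite sq'.
have Vm : V`_m = 1.
 by have := lq'; rewrite lead_coefE sq' -pred_Sn => h1; rewrite /V coefZ h1 mulVf.
have := defect Vs lam0; rewrite VE Vm (_ : 1^* = 1) ?mul1r; last exact: rmorph1.
have gs : (size gap <= n)%N.
 rewrite /gap -VE -scaleN1r -upolyZ -upolyD size_upoly//; apply/leq_sizeP => j.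
 rewrite coefD coefZ leq_eqVlt => /orP[/eqP<-|mj].
  by rewrite Vm; have := lq; rewrite lead_coefE sq -pred_Sn => ->; rewrite mulN1r subrr.
 have -> : V`_j = 0 by apply/leq_sizeP: mj.
 by rewrite mulr0 addr0; have /leq_sizeP := leqnn (size q); rewrite sq; apply.
have go : pip gap (P n) = 0 by rewrite pipJ// (P_orth s2 r1 hP gs) (_ : 0^* = 0)//; exact: rmorph0.
have PP : pip (kappa^-1 *: P n) (kappa^-1 *: P n) = (pi / k ^+ 2)%:C.
 rewrite pipZl// pipZr// (pip_P hP) eqxx mul1r kE.
 have -> : (k%:C^-1)^* = (k^-1)%:C by rewrite -fmorphV; exact: conjc_real.
 by rewrite -fmorphV mulrA -!rmorphM; congr (_%:C); rewrite -expr2 exprVn mulrC.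
have -> : pip (upoly q) (kappa^-1 *: P n) = (pi / k ^+ 2)%:C.
 by rewrite -PP -[upoly q](subrK (kappa^-1 *: P n)) pipDl// [X in X + _]pipZr// go mulr0 add0r.
have -> : pnorm (kappa^-1 *: P n) = pi / k ^+ 2.
 by have := PP; rewrite pip_norm// => /(congr1 (@Re R)); rewrite !Re_real.
by rewrite -rmorphB normc_real.
Qed.
End Compare.
End Pairing.
End Defect.

(** * Explicit approximants *)
Section ReversedPartialSums.
Variable R : realType.
Local Notation C := R[i].
Implicit Types (c d : R) (u x : C).

(** u^m times the m-th partial sum of the binomial series at 1/u. *)
Fixpoint rpoly c m : {poly C} :=
 if m is m'.+1 then rpoly c m' * 'X + ((gbin c m)%:C)%:P else 1.

Lemma rpolyS c m u : (rpoly c m.+1).[u] = (rpoly c m).[u] * u + (gbin c m.+1)%:C.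
Proof. by rewrite /= hornerMXaddC. Qed.
Lemma rpoly0 c u : (rpoly c 0).[u] = 1.
Proof. by rewrite hornerC. Qed.

Lemma rpoly_monic c m : size (rpoly c m) = m.+1 /\ lead_coef (rpoly c m) = 1.
Proof.
elim: m => [|m [s1 l1]] /=; first by rewrite size_poly1 lead_coef1.
have n0 : rpoly c m != 0 by rewrite -size_poly_eq0 s1.
have sX : size (rpoly c m * 'X) = m.+2 by rewrite size_mulX// s1.
have h : (size ((gbin c m.+1)%:C%:P : {poly C}) < size (rpoly c m * 'X)%R)%N.
 by rewrite sX; apply: leq_ltn_trans (size_polyC_leq1 _) _.
by rewrite size_polyDl// lead_coefDl// lead_coefMX sX.
Qed.

Lemma rpoly_mul c m u :
 (1 + u) * (rpoly c m).[u] = (rpoly (c + 1) m.+1).[u] - (gbin c m.+1)%:C.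
Proof.
elim: m => [|m ih].
 rewrite rpolyS !rpoly0 -gbin_pascal gbin0.
 have -> : (gbin c 1 + 1)%:C = (gbin c 1)%:C + 1 by rewrite rmorphD rmorph1.
 by ring.
rewrite !rpolyS mulrDr mulrA ih -(gbin_pascal c m.+1) rpolyS rmorphD.
by move: (rpoly _ _).[u] => a; ring.
Qed.

Lemma rpoly_mul2 c m u : (1 + u) ^+ 2 * (rpoly c m).[u] =
 (rpoly (c + 2) m.+2).[u] - (gbin (c + 1) m.+2)%:C - (1 + u) * (gbin c m.+1)%:C.
Proof.
by rewrite expr2 -mulrA rpoly_mul mulrBr rpoly_mul (_ : c + 1 + 1 = c + 2)//; ring.
Qed.

Lemma rpoly_bpoly c m u : u != 0 -> (rpoly c m).[u] = u ^+ m * bpoly c m.+1 u^-1.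
Proof.
move=> u0; elim: m => [|m ih].
 by rewrite rpoly0 bpolyS /bpoly big_ord0 gbin0 expr0 add0r !mulr1.
rewrite rpolyS ih [in RHS]bpolyS; move: (bpoly _ _ _) => b.
rewrite mulrDr mulrCA -exprMn divff// expr1n mulr1; congr (_ + _).
by rewrite exprS; ring.
Qed.

Lemma gbin_le c (N k : nat) : 2 <= c <= 3 -> (3 <= N)%N -> (N <= k)%N ->
 `|gbin c k| <= `|gbin c N|.
Proof.
move=> /andP[c2 c3] N3; elim: k => [|k ih]; first by rewrite leqn0 => /eqP->.
rewrite leq_eqVlt => /orP[/eqP->//|]; rewrite ltnS => Nk.
rewrite gbinS normrM; apply: le_trans _ (ih Nk); rewrite -[leRHS]mulr1 ler_wpM2l//.
have k3 : 3 <= k%:R :> R by rewrite (ler_nat R 3) (leq_trans N3).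
rewrite normrM normfV [`|k.+1%:R|]ger0_norm// ler_pdivrMr ?ltr0n// mul1r -natr1.
by rewrite ler_norml; apply/andP; split; lra.
Qed.

Lemma le_limit (a b K t : R) : 0 <= t < 1 -> (forall n : nat, a <= b + K * t ^+ n) -> a <= b.
Proof.
move=> /andP[t0 t1] h; rewrite leNgt; apply/negP => ba.
have K0 : 0 < K by have := h 0%N; rewrite expr0 mulr1 => ?; lra.
pose x := K * (1 - t)^-1 / (a - b).
have := truncnS_gt x; set n := (Num.truncn x).+1 => xn.
have n0 : 0 < n%:R :> R by rewrite ltr0n.
have ab : 0 < a - b by rewrite subr_gt0.
have h1 : n%:R * (a - b) <= K * (1 - t)^-1.
 apply: (@le_trans _ _ (K * (n%:R * t ^+ n))).
  by rewrite mulrCA ler_wpM2l ?(ltW n0)//; have := h n; lra.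
 by rewrite ler_wpM2l ?(ltW K0)// linear_pow_bound// t0.
by move: xn; rewrite /x ltr_pdivrMr// => /lt_le_trans/(_ h1); rewrite ltxx.
Qed.

Lemma bpoly_tail_le d x N M : 2 <= d <= 3 -> (3 <= N)%N -> normc x < 1 ->
 normc (bpoly d (N + M) x - bpoly d N x) <= `|gbin d N| * (normc x ^+ N / (1 - normc x)).
Proof.
move=> d23 N3 x1.
have h : normc (bpoly d (N + M) x - bpoly d N x) <=
  `|gbin d N| * \sum_(N <= k < N + M) normc x ^+ k.
 elim: M => [|M ih].
  by rewrite addn0 subrr normc0 mulr_ge0// sumr_ge0// => i _; rewrite exprn_ge0 ?normc_ge0.
 rewrite addnS bpolyS addrAC big_nat_recr ?leq_addr// mulrDr; apply: normc_le2 => //.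
 by rewrite normcM normc_real normcX ler_wpM2r ?exprn_ge0 ?normc_ge0 ?gbin_le ?leq_addr.
apply: (le_trans h); rewrite ler_wpM2l// pow_series// normc_ge0//.
Qed.

(** (1+x)^2 times the series of exponent c is the series of exponent c + 2, whose
  coefficients decay faster. *)
Lemma bser_mul2_tail c x N : 0 <= c <= 1 -> (3 <= N)%N -> normc x < 1 ->
 normc ((1 + x) ^+ 2 * bser c x - bpoly (c + 2) N x) <=
  `|gbin (c + 2) N| * (normc x ^+ N / (1 - normc x)).
Proof.
move=> /andP[c0 c1] N3 x1; have cb : -1 <= c <= 1 by rewrite c1 (le_trans _ c0)// lerN10.
have d23 : 2 <= c + 2 <= 3 by apply/andP; split; lra.
have t01 : 0 <= normc x < 1 by rewrite normc_ge0.
have bm k e : (1 + x) * bpoly e k x = bpoly (e + 1) k.+1 x - (gbin e k)%:C * x ^+ k.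
 elim: k => [|k ih]; first by rewrite /bpoly !big_ord_recl !big_ord0 !gbin0 mulr0 addr0 subrr.
 rewrite [in LHS]bpolyS mulrDr ih [bpoly (e + 1) k.+2 x]bpolyS -gbin_pascal rmorphD exprS.
 by move: (bpoly _ _ _) => b; ring.
apply: (@le_limit _ _ (4 * (2 / (1 - normc x)) + 4) (normc x)) => // n.
pose M := (N + n)%N.
have t0 : 0 <= normc x by exact: normc_ge0.
have tM : normc x ^+ M <= normc x ^+ n.
 by rewrite ler_wiXn2l// ?ltW// leq_addl.
rewrite (_ : _ - _ = (bpoly (c + 2) (N + (n.+2)) x - bpoly (c + 2) N x) +
 ((1 + x) ^+ 2 * (bser c x - bpoly c M x) - ((gbin (c + 1) M.+1)%:C * x ^+ M.+1
  + (1 + x) * ((gbin c M)%:C * x ^+ M)))); last first.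
 have e2 : (1 + x) ^+ 2 * bpoly c M x = bpoly (c + 2) M.+2 x
  - (gbin (c + 1) M.+1)%:C * x ^+ M.+1 - (1 + x) * ((gbin c M)%:C * x ^+ M).
  by rewrite expr2 -mulrA bm mulrBr bm (_ : c + 1 + 1 = c + 2)//; ring.
 rewrite mulrBr e2 (_ : (N + n.+2)%N = M.+2); last by rewrite !addnS.
 by move: (bpoly _ _ _) (bser _ _) (gbin _ _)%:C (gbin _ _)%:C => a b e f; ring.
apply: normc_le2; first exact: bpoly_tail_le.
have x2 : normc (1 + x) <= 2.
 by rewrite (_ : 2 = 1 + 1)//; apply: normc_le2 (ltW x1); rewrite (normc_nat R 1).
have g1 : `|gbin (c + 1) M.+1| <= 2.
 rewrite -gbin_pascal (le_trans (ler_normD _ _))// (_ : 2 = 1 + 1)// lerD// gbin_bound//.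
have n0 : 0 <= normc x ^+ n by exact: exprn_ge0.
rewrite [leRHS]mulrDl; apply: normc_le2.
 rewrite -(mulrA 4) normcM_le//.
  by rewrite normcX (_ : 4 = 2 ^+ 2); [rewrite lerXn2r ?nnegrE ?normc_ge0|rewrite expr2; lra].
 apply: (le_trans (bser_tail M cb x1)); rewrite -mulrA ler_wpM2l// mulrC ler_wpM2l//.
 by rewrite invr_ge0 subr_ge0 ltW.
rewrite normcN (_ : 4 = 2 + 2); last by lra.
rewrite [leRHS]mulrDl; apply: normc_le2.
 rewrite normcM normc_real normcX ler_pM ?normr_ge0 ?exprn_ge0// exprS.
 by rewrite -[leRHS]mul1r ler_pM ?exprn_ge0// ltW.
rewrite normcM_le// -[leRHS]mul1r normcM normc_real normcX ler_pM ?exprn_ge0//.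
exact: gbin_bound.
Qed.

Lemma gbin_neq0 d k : (forall i : nat, d != i%:R) -> gbin d k != 0.
Proof.
move=> h; elim: k => [|k ih]; first by rewrite gbin0 oner_neq0.
by rewrite gbinS mulf_neq0// mulf_neq0 ?subr_eq0 ?h// invr_eq0 pnatr_eq0.
Qed.

(** Inside the disc the last coefficients dominate, since their ratio tends to 1. *)
Lemma rpoly_inner d (q : R) : 2 < d < 3 -> 0 <= q < 1 -> exists K M0, 0 < K /\
 forall M, (M0 <= M)%N -> forall u, normc u <= q -> normc (rpoly d M).[u] <= K * `|gbin d M|.
Proof.
move=> /andP[d2 d3] /andP[q0 q1]; pose p := (1 + q) / 2.
have qp : q < p by rewrite /p; lra. have p1 : p < 1 by rewrite /p; lra.
have p0 : 0 < p by rewrite /p; lra.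
have dn i : d != i%:R.
 have [i2|i3] := leqP i 2.
  by rewrite gt_eqF//; apply: le_lt_trans d2; rewrite (ler_nat R i 2).
 by rewrite lt_eqF//; apply: lt_le_trans d3 _; rewrite (ler_nat R 3).
pose M0 := maxn 3 (Num.truncn (8 / (1 - q))).+1.
have ratio M : (M0 <= M)%N -> p * `|gbin d M| <= `|gbin d M.+1|.
 rewrite geq_max => /andP[M3 hM]; rewrite gbinS normrM mulrC ler_wpM2l//.
 have x8 : 8 / (1 - q) < M%:R by apply: lt_le_trans (truncnS_gt _) _; rewrite ler_nat.
 have q10 : 0 < 1 - q by rewrite subr_gt0.
 rewrite ltr_pdivrMr// in x8; have m3 : 3 <= M%:R :> R by rewrite (ler_nat R 3).
 have -> : `|(d - M%:R) / M.+1%:R| = (M%:R - d) / (M%:R + 1).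
  rewrite normrM normfV [`|M.+1%:R|]ger0_norm// natr1 -normrN opprB ger0_norm// subr_ge0.
  by rewrite (le_trans (ltW d3)).
 by rewrite ler_pdivlMr /p; nra.
have crude M u : normc u <= q -> normc (rpoly d M).[u] <= \sum_(k < M.+1) `|gbin d k|.
 move=> uq; elim: M => [|M ih].
  by rewrite rpoly0 big_ord_recl big_ord0 gbin0 addr0 normr1 (normc_nat R 1).
 rewrite rpolyS big_ord_recr; apply: normc_le2; last by rewrite normc_real.
 rewrite normcM; apply: le_trans ih; rewrite -[leRHS]mulr1 ler_wpM2l ?normc_ge0//.
 by rewrite (le_trans uq)// ltW.
have g0 : 0 < `|gbin d M0| by rewrite normr_gt0 gbin_neq0.
pose K := (\sum_(k < M0.+1) `|gbin d k|) / `|gbin d M0| + p / (p - q).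
have Ka : (\sum_(k < M0.+1) `|gbin d k|) / `|gbin d M0| <= K.
 by rewrite lerDl divr_ge0 ?subr_ge0// ltW.
have S0 : 0 <= (\sum_(k < M0.+1) `|gbin d k|) / `|gbin d M0|.
 by rewrite divr_ge0// sumr_ge0.
have Kb : p / (p - q) <= K by rewrite lerDr.
have K0 : 0 < K by apply: lt_le_trans Kb; rewrite divr_gt0// subr_gt0.
exists K, M0; split => // M MM u uq; rewrite -(subnKC MM); elim: (M - M0)%N => [|j ih].
 rewrite addn0; apply: (le_trans (crude M0 u uq)).
 by rewrite -ler_pdivrMr.
rewrite addnS rpolyS.
have hr := ratio (M0 + j)%N (leq_addr _ _).
apply: (@le_trans _ _ (K * (q / p) * `|gbin d (M0 + j).+1| + `|gbin d (M0 + j).+1|)).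
 apply: normc_le2; last by rewrite normc_real.
 apply: (le_trans (normcM_le ih uq)).
 rewrite (_ : K * _ * q = K * (q / p) * (p * `|gbin d (M0 + j)|)); last by field; rewrite gt_eqF.
 by apply: ler_wpM2l hr; rewrite mulr_ge0 ?(ltW K0)// divr_ge0// ltW.
rewrite -[X in _ + X]mul1r -mulrDl ler_wpM2r//.
have := Kb; rewrite ler_pdivrMr ?subr_gt0// => h.
rewrite -subr_ge0 (_ : _ - _ = (K * (p - q) - p) / p); last by field; rewrite gt_eqF.
by rewrite divr_ge0 ?subr_ge0// ltW.
Qed.

Lemma factor_out (f : {poly C}) (a : C) : exists2 g, f = f.[a]%:P + g * ('X - a%:P) &
 (size g <= (size f).-1)%N.
Proof.
have /factor_theorem[g gE] : root (f - f.[a]%:P) a by rewrite rootE hornerD hornerN hornerC subrr.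
exists g; first by rewrite -gE addrC subrK.
have [->|g0] := eqVneq g 0; first by rewrite size_poly0.
have := congr1 (fun p : {poly C} => size p) gE; rewrite size_Mmonic ?monicXsubC// size_XsubC addn2 /= => e.
have := size_polyD f (- f.[a]%:P); rewrite size_polyN e => h.
rewrite -ltnS (leq_trans h)// geq_max; apply/andP; split; first exact: leqSpred.
by apply: leq_trans (size_polyC_leq1 _) _.
Qed.

Lemma taylor2 (f : {poly C}) (a : C) : exists2 g,
 f = f.[a]%:P + f^`().[a] *: ('X - a%:P) + g * ('X - a%:P) ^+ 2 & (size g <= (size f).-2)%N.
Proof.
have [g gE gs] := factor_out f a; have [h hE hs] := factor_out g a.
have d : f^`().[a] = g.[a].
 by rewrite gE derivD derivC add0r derivM derivXsubC mulr1 hornerD hornerM hornerXsubC subrr mulr0 add0r.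
exists h; last by rewrite (leq_trans hs)// -!subn1 leq_sub2r// subn1.
rewrite d {1}gE {1}hE -mul_polyC expr2 mulrA -addrA; congr (_ + _); ring.
Qed.
End ReversedPartialSums.

Section Approximant.
Variables (R : realType) (s : nat) (r : R).
Hypotheses (s2 : (2 <= s)%N) (r1 : 1 < r).
Local Notation C := R[i].
Implicit Types (z w : C) (f g h q V : {poly C}).
Local Notation uu := (@uu R s).
Local Notation tt := (@tt R s).
Local Notation lem := (lem s r).
Local Notation B := (B s r).
Local Notation BC := (B%:C).
Local Notation rs := (rs s r).
Local Notation tA := (tA s r).
Local Notation xx := (xx s r).
Local Notation kap := (kap s r).
Local Notation pole := (pole s r).
Local Notation gam := (gam s r).
Variable l : nat.
Hypothesis l1s : (l.+1 < s)%N.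
Local Notation mainF := (@mainF R s l).
Local Notation al := (alpha R s l).

Let ls : (l < s)%N := ltnW l1s.
Let B1 : 1 < B := B_gt1 s2 r1.
Let B0 : 0 < B := B_gt0 s2 r1.
Let s0 : (0 < s)%N := ltnW s2.
Let BC0 : BC != 0 := BC_neq0 s2 r1.
Let B10 : BC - 1 != 0 := B1_neq0 s2 r1.
Let sC0 : (s%:R : C) != 0 := sC_neq0 R s2.

Lemma al_gt0 : 0 < al.
Proof. by rewrite divr_gt0 ?ltr0n. Qed.
Lemma al_lt1 : al < 1.
Proof. by rewrite ltr_pdivrMr ?ltr0n// mul1r ltr_nat. Qed.
Let nal : -1 <= - al <= 1.
Proof. by have := al_gt0; have := al_lt1 => h1 h2; apply/andP; split; lra. Qed.

Definition delta : C := al%:C / (BC - 1).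
Definition yc : C := (bser (- al) (xx 0))^-1.

Lemma xx0 : xx 0 = - BC^-1.
Proof. by rewrite /xx uu0// mulN1r. Qed.

Lemma kap_power z : lem z -> kap z ^+ l.+1 = yc * bser (- al) (xx z).
Proof.
move=> zG; have e : l.+1%:R * - sinv R s = - al by rewrite mulrN.
rewrite kapE expr_div_n /Kx /Ax !bser_pow ?e ?nsinv_bound//; last 2 first.
- exact: xx_lt1 (lem0 s2 r1).
- exact: xx_lt1.
by rewrite mulrC.
Qed.

Definition ypoly N : {poly C} := \poly_(k < N) ((gbin (- al) k)%:C / BC ^+ k).
Lemma ypolyE N u : (ypoly N).[u] = bpoly (- al) N (u / BC).
Proof.
rewrite /ypoly horner_poly; apply: eq_bigr => k _.
by rewrite -mulrA [_^-1 * _]mulrC -expr_div_n.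
Qed.
Lemma dypolyE N : (ypoly N)^`().[-1] = dbpoly (- al) N (xx 0) / BC.
Proof.
have d1 := cdiff_poly (ypoly N) (-1).
have e : -1 / BC = xx 0 by rewrite xx0 mulN1r.
have d2 : cdiff (fun u => BC^-1 * u) (-1) (BC^-1 * 1) by exact: cdiffZ (wdiff_id _).
have d3 : cdiff (fun u => bpoly (- al) N (BC^-1 * u)) (-1) (dbpoly (- al) N (BC^-1 * -1) * (BC^-1 * 1)).
 exact: cdiff_comp (cdiff_bpoly _ _ _) d2.
have d4 : cdiff (horner (ypoly N)) (-1) (dbpoly (- al) N (BC^-1 * -1) * (BC^-1 * 1)).
 by apply: (wdiff_ext (@ltr01 R) _ d3) => h _; rewrite ypolyE mulrC.
by rewrite (cdiff_uniq d1 d4) mulr1 mulrC [_ * -1]mulrC e mulrC.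
Qed.

Local Notation T N x := (btail (- al) N x).
Local Notation T' N x := (dbtail (- al) N x).

(** The partial sum of the binomial series of kap^(l+1) in u/B, corrected by its value and
 derivative at u = -1 so that division by z^(2s) = (1 + u)^2 is possible. *)
Lemma yhat N : exists2 h : {poly C}, (size h <= N.-2)%N & forall z, lem z ->
 1 - delta * z ^+ s + z ^+ s ^+ 2 * h.[uu z] - kap z ^+ l.+1 =
 - (yc * (T N (xx z) - T N (xx 0) - T' N (xx 0) * (xx z - xx 0))).
Proof.
have [h hE hs] := taylor2 (ypoly N) (-1).
have x01 : normc (xx 0) < 1 by exact: xx_lt1 (lem0 s2 r1).
have by0 := bser_neq0 nal x01.
exists (yc *: h).
 apply: (leq_trans (size_scale_leq _ _)); apply: (leq_trans hs).
 by rewrite -!subn2 leq_sub2r// size_poly.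
move=> z zG; rewrite (kap_power zG) hornerZ.
have zs : z ^+ s = uu z + 1 by rewrite uuE subrK.
have e0 : uu z - -1 = z ^+ s by rewrite opprK zs.
have := congr1 (fun f : {poly C} => f.[uu z]) hE.
rewrite !hornerD hornerC hornerZ hornerM horner_exp hornerXsubC e0 !ypolyE dypolyE.
rewrite -/(xx z) mulN1r -xx0 => E.
have := dbpoly_btail (- al) N x01; have dx : xx z - xx 0 = z ^+ s / BC.
 by rewrite xx0 /xx zs opprK mulrDl mul1r.
have q0 : 1 + xx 0 = (BC - 1) / BC by rewrite xx0 mulrBl divff// mul1r.
rewrite dx q0 /btail; move: E; move: (bpoly _ _ (xx z)) (bpoly _ _ (xx 0)) => a b.
have -> : (- al)%:C = - al%:C by exact: rmorphN.
have yc0 : yc != 0 by rewrite invr_eq0.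
have ycb : bser (- al) (xx 0) = yc^-1 by rewrite invrK.
rewrite ycb /delta; move: (bser _ _) (dbpoly _ _ _) (dbtail _ _ _) => f d d' -> <-.
move: (z ^+ s) (h.[_]) (al%:C) => W H A.
by move: (BC) BC0 B10 => b' b0 b1; field; rewrite b0 yc0 b1.
Qed.

Lemma yhat_bound : exists2 K : R, 0 < K & forall N, exists2 h : {poly C}, (size h <= N.-2)%N &
 forall z, lem z -> normc (1 - delta * z ^+ s + z ^+ s ^+ 2 * h.[uu z] - kap z ^+ l.+1) <=
  K * (N.+1%:R ^+ 2 * rho s r ^+ N) * normc (z ^+ s) ^+ 2.
Proof.
have [K K0 hK] := btail_second_order nal (rho_gt0 s2 r1) (rho_lt1 s2 r1).
have yc0 : 0 < normc yc by rewrite normc_gt0 invr_eq0 bser_neq0// xx_lt1//; exact: lem0.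
exists (normc yc * K / B ^+ 2); first by rewrite divr_gt0 ?mulr_gt0 ?exprn_gt0.
move=> N; have [h hs hE] := yhat N; exists h => // z zG; rewrite hE// normcN normcM.
have zs : z ^+ s = uu z + 1 by rewrite uuE subrK.
have dx : xx z - xx 0 = z ^+ s / BC.
 by rewrite xx0 /xx zs opprK mulrDl mul1r.
have := hK N (xx z) (xx 0) (ltW (xx_lt s2 r1 zG)) (ltW (xx_lt s2 r1 (lem0 s2 r1))).
move=> h1; apply: (le_trans (ler_wpM2l (ltW yc0) h1)).
have nx : normc (xx z - xx 0) = normc (z ^+ s) / B.
 by rewrite dx normcM normcV normc_real (gtr0_norm B0).
rewrite nx.
move: B0 => b0; move: (_ ^+ 2 * _) => x; move: (normc yc) (normc _) => a b.
apply: le_of_eq; move: (B) b0 => b' b0; field.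
by rewrite gt_eqF.
Qed.

(** ** Closed forms of the kernel functions *)
Local Notation k0 := (s - l - 1)%N.

Lemma pole_first z : lem z -> z != 0 -> pole k0 z = z ^+ l * kap z ^+ l.+1 / z ^+ s.
Proof.
move=> zG z0; have e1 : k0.+1 = (s - l)%N by rewrite subn1 prednK// subn_gt0.
have es : s = ((s - l) + l)%N by rewrite subnK// ltnW.
rewrite /pole (dmuE s2 r1 zG) /mu exprMn e1.
have -> : kap z ^+ s.+1 = kap z ^+ (s - l) * kap z ^+ l.+1 by rewrite -exprD addnS -es.
have -> : z ^+ s = z ^+ (s - l) * z ^+ l by rewrite -exprD -es.
have : kap z ^+ (s - l) != 0 by rewrite expf_neq0// (kap_neq0 s2 r1).
have : z ^+ (s - l) != 0 by rewrite expf_neq0.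
have : z ^+ l != 0 by rewrite expf_neq0.
move: (z ^+ _) (z ^+ _) (kap z ^+ _) (kap z ^+ _) => a b d e a0 b0 d0.
by field; rewrite a0 b0 d0.
Qed.

Lemma pole_second z : lem z -> z != 0 ->
 pole (s + k0) z - gam * k0%:R * pole k0 z = z ^+ l * kap z ^+ l.+1 * (1 + delta * z ^+ s) / z ^+ s ^+ 2.
Proof.
move=> zG z0; have ws : z ^+ s != 0 by rewrite expf_neq0.
have bu := Bu_neq0 s2 r1 zG.
have e : pole (s + k0) z = pole k0 z * ((BC + uu z) / (z ^+ s * (BC - 1))).
 rewrite /pole -addnS exprD /mu [(z * _) ^+ s]exprMn (kap_pow s2 r1 zG).
 have : (z * kap z) ^+ k0.+1 != 0 by rewrite expf_neq0// mulf_neq0// (kap_neq0 s2 r1).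
 move: ((z * _) ^+ _) (z ^+ s) ws => a b b0 a0.
 by field; rewrite a0 b0 bu B10.
have zs : BC + uu z = (BC - 1) + z ^+ s by rewrite uuE; ring.
have kk : k0%:R = s%:R - l.+1%:R :> C by rewrite -subnDA addn1 natrB.
have alE : al%:C = l.+1%:R / s%:R :> C by rewrite /alpha rmorphM fmorphV !rmorph_nat.
rewrite e (pole_first zG z0) zs /delta /gam kk alE.
move: (kap z ^+ _) (z ^+ l) (z ^+ s) ws (l.+1%:R) => a b d d0 L.
by move: (s%:R) sC0 (BC) B10 => S S0 b' b0; field; rewrite d0 S0 b0.
Qed.

Local Notation c := (1 - al).
Definition cf1 m : R := gbin c m.+1.
Definition cf2 m : R := gbin (c + 1) m.+2.

(** Replacing kap^(l+1) in the two kernels by 1 - delta z^s + z^(2s) h leaves the polynomials in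
 parentheses and polar terms at z^s = 1 + u = 0, which [rpoly_mul2] finds in [rpoly c m]. *)
Definition approx m h : {poly C} := rpoly c m + ((cf1 m)%:C *: (delta%:P - (1 + 'X) * h)
 + (cf2 m)%:C *: ((delta ^+ 2)%:P - h * (1 + delta *: (1 + 'X)))).

Lemma approx_monic m h : (1 < m)%N -> (size h <= m.-2)%N ->
 size (approx m h) = m.+1 /\ lead_coef (approx m h) = 1.
Proof.
move=> m1 hm; have [s1 l1] := rpoly_monic c m.
have sX : (size (1 + 'X : {poly C})%R <= 2)%N by rewrite addrC -polyC1 size_XaddC.
have sc (a : C) : (size a%:P <= m)%N by rewrite (leq_trans (size_polyC_leq1 _))// ltnW.
have hX (f : {poly C}) : (size f <= 2)%N -> (size (h * f)%R <= m)%N.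
 move=> f2; have [->|hn] := eqVneq h 0; first by rewrite mul0r size_poly0.
 apply: (leq_trans (size_polyMleq _ _)).
 apply: (@leq_trans (size h + 2).-1); first by rewrite -!subn1 leq_sub2r// leq_add2l.
 by rewrite addn2 /=; apply: (leq_ltn_trans hm); move: m1; case: (m) => [|[|k]].
have dX (f g : {poly C}) : (size f <= m)%N -> (size g <= m)%N -> (size (f - g)%R <= m)%N.
 by move=> fm gm; rewrite (leq_trans (size_polyD _ _))// size_polyN geq_max fm gm.
have h1 : (size (approx m h - rpoly c m)%R <= m)%N.
 rewrite /approx addrC addKr; apply: (leq_trans (size_polyD _ _)); rewrite geq_max.
 apply/andP; split; apply: (leq_trans (size_scale_leq _ _)); apply: dX => //.
  by rewrite mulrC hX.
 apply: hX; apply: (leq_trans (size_polyD _ _)); rewrite geq_max size_poly1 /=.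
 by apply: leq_trans (size_scale_leq _ _) _.
rewrite -[approx m h](subrK (rpoly c m)) addrC.
have h2 : (size (approx m h - rpoly c m)%R < size (rpoly c m))%N by rewrite s1 ltnS.
by rewrite size_polyDl// lead_coefDl.
Qed.

Definition err h z : C := 1 - delta * z ^+ s + z ^+ s ^+ 2 * h.[uu z] - kap z ^+ l.+1.
Definition kernels m z : C := - ((cf1 m)%:C * pole k0 z
 + (cf2 m)%:C * (pole (s + k0) z - gam * k0%:R * pole k0 z)).

(** The poles at z = 0 cancel. What is left is the reversed partial sum for the exponent c + 2,
 whose coefficients are smaller by a factor m^(-2), and the error of the approximation. *)
Lemma approx_eval m h z : lem z -> z != 0 ->
 (upoly s l (approx m h)).[z] - kernels m z =
 z ^+ l * (rpoly (c + 2) m.+2).[uu z] / z ^+ s ^+ 2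
 - z ^+ l * ((cf1 m)%:C * z ^+ s + (cf2 m)%:C * (1 + delta * z ^+ s)) * (err h z / z ^+ s ^+ 2).
Proof.
move=> zG z0; have ws : z ^+ s != 0 by rewrite expf_neq0.
have zs : z ^+ s = 1 + uu z by rewrite uuE addrC subrK.
have E := rpoly_mul2 c m (uu z); rewrite -zs in E.
have {}E : (rpoly (c + 2) m.+2).[uu z] = z ^+ s ^+ 2 * (rpoly c m).[uu z]
  + (cf2 m)%:C + z ^+ s * (cf1 m)%:C by rewrite E /cf1 /cf2; ring.
rewrite E /kernels (pole_second zG z0) (pole_first zG z0) horner_upoly /approx /err.
rewrite !(hornerD, hornerN, hornerM, hornerZ, hornerC, hornerX) -zs.
move: (h.[_]) (rpoly _ _).[_] (kap z ^+ _) (z ^+ l) (z ^+ s) ws => H A Y L W W0.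
by move: (cf1 m)%:C (cf2 m)%:C delta => a b d; field.
Qed.

Lemma cf2_cf1 m : cf2 m = (2 - al) / m.+2%:R * cf1 m.
Proof.
have := gbin_absorb c m.+1; rewrite -/(cf1 m) -/(cf2 m) => E.
apply: (@mulfI _ m.+2%:R); first by rewrite pnatr_eq0.
by rewrite E (_ : c + 1 = 2 - al) 1?mulrA 1?[m.+2%:R * _]mulrC 1?divfK ?pnatr_eq0//; ring.
Qed.

Lemma cf2_le m : `|cf2 m| <= `|cf1 m|.
Proof.
have a0 := al_gt0; have a1 := al_lt1.
rewrite cf2_cf1 normrM -[leRHS]mul1r ler_wpM2r// normrM normfV [`|m.+2%:R|]ger0_norm//.
rewrite ler_pdivrMr ?ltr0n// mul1r ger0_norm; last by lra.
by apply: (@le_trans _ _ 2); [lra | rewrite (ler_nat R 2)].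
Qed.

Lemma coef_decay m : (3 <= m)%N ->
 `|gbin (c + 2) m.+3| <= 12 * (`|cf1 m| / m.+1%:R ^+ 2) /\
 `|gbin (c + 2) m.+2| <= 12 * (`|cf1 m| / m.+1%:R ^+ 2).
Proof.
move=> m3; have a0 := al_gt0; have a1 := al_lt1.
have c2 : c + 2 = c + 1 + 1 by ring.
have m3' : 3 <= m%:R :> R by rewrite (ler_nat R 3).
have m0 : 0 < m%:R + 1 :> R by lra.
have e1 := gbin_absorb c m.+1; have e2 := gbin_absorb (c + 1) m.+2.
have f1 := gbin_absorb c m; have f2 := gbin_absorb (c + 1) m.+1; have f0 := gbinS_mul c m.
rewrite -c2 in e2 f2; rewrite /cf1.
have na (x y a b : R) : 0 < a -> a * x = b * y -> `|x| = `|b| / a * `|y|.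
 by move=> a00 E; rewrite mulrAC -normrM -E normrM (gtr0_norm a00) mulrAC divff ?mul1r// gt_eqF.
have p k : 0 < k.+1%:R :> R by rewrite ltr0n.
have g x : 0 <= `|x| :> R by exact: normr_ge0.
have G1 := na _ _ _ _ (p _) e1; have G2 := na _ _ _ _ (p _) e2.
have F1 := na _ _ _ _ (p _) f1; have F2 := na _ _ _ _ (p _) f2.
have F0 : `|gbin c m| = m.+1%:R / (m%:R - c) * `|gbin c m.+1|.
 have mc : 0 < m%:R - c by lra.
 have := na (gbin c m) (gbin c m.+1) (m%:R - c) (- m.+1%:R) mc; rewrite normrN (ger0_norm (ltW (p _))).
 by apply; rewrite mulNr f0; ring.
have ab1 : `|c + 1| <= 2 by rewrite ger0_norm; lra.
have ab2 : `|c + 2| <= 3 by rewrite ger0_norm; lra.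
have n1 : m.+1%:R = m%:R + 1 :> R by rewrite natr1.
have n2 : m.+2%:R = m%:R + 2 :> R by rewrite -[m.+2]addn2 natrD.
have n3 : m.+3%:R = m%:R + 3 :> R by rewrite -[m.+3]addn3 natrD.
have q2 : (m%:R + 2)^-1 <= (m%:R + 1)^-1 :> R by rewrite lef_pV2 ?posrE; lra.
have q3 : (m%:R + 3)^-1 <= (m%:R + 1)^-1 :> R by rewrite lef_pV2 ?posrE; lra.
have i0 x : 0 <= x -> 0 <= (m%:R + x)^-1 :> R by move=> x0; rewrite invr_ge0; lra.
have r0 : (m%:R + 1) / (m%:R - c) <= 2 by rewrite ler_pdivrMr; lra.
have r00 : 0 <= (m%:R + 1) / (m%:R - c) by rewrite divr_ge0; lra.
rewrite n1; split.
 rewrite G2 G1 n2 n3 (_ : 12 * _ = 12 / (m%:R + 1) ^+ 2 * `|gbin c m.+1|); last by rewrite mulrA mulrAC.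
 rewrite mulrA ler_wpM2r// (_ : 12 / _ = (3 / (m%:R + 1)) * (4 / (m%:R + 1))); last by field; rewrite gt_eqF.
 apply: ler_pM; rewrite ?mulr_ge0 ?i0//; last by apply: ler_pM; rewrite ?i0//; lra.
 by apply: ler_pM; rewrite ?i0//; lra.
rewrite F2 F1 F0 n1 n2 (_ : 12 * _ = 12 / (m%:R + 1) ^+ 2 * `|gbin c m.+1|); last by rewrite mulrA mulrAC.
rewrite !mulrA ler_wpM2r// -!mulrA mulrA.
rewrite (_ : 12 / _ = (3 / (m%:R + 1)) * (2 / (m%:R + 1) * 2)); last by field; rewrite gt_eqF.
have i1 : 0 <= (m%:R + 1)^-1 :> R by exact: i0.
have i2 : 0 <= (m%:R + 2)^-1 :> R by exact: i0.
have X1 : `|c + 2| / (m%:R + 2) <= 3 / (m%:R + 1) by exact: ler_pM.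
have X0 : `|c + 1| / (m%:R + 1) <= 2 / (m%:R + 1) by exact: ler_wpM2r.
rewrite [X in _ * X]mulrA; apply: ler_pM => //; first exact: mulr_ge0.
by apply: ler_pM => //; exact: mulr_ge0.
Qed.

(** The size of the defects: 1/n^2 relative to the leading coefficient. *)
Definition small m : R := `|cf1 m| / m.+1%:R ^+ 2.

Lemma small_ge0 m : 0 <= small m.
Proof. by rewrite divr_ge0// exprn_ge0. Qed.

Lemma normc_zl : exists2 K : R, 0 < K & forall z, lem z -> normc (z ^+ l) <= K.
Proof.
have [K K0 hK] := bounded_poly s2 r1 ('X^l); exists (K + 1); first by rewrite ltr_wpDl.
by move=> z zG; have := hK z zG; rewrite hornerXn => h; apply: le_trans h _; rewrite lerDl.
Qed.

Lemma correction_bound : exists2 K : R, 0 < K & forall m, exists2 h : {poly C}, (size h <= m.-2)%N &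
 forall z, lem z -> z != 0 ->
 normc (z ^+ l * ((cf1 m)%:C * z ^+ s + (cf2 m)%:C * (1 + delta * z ^+ s)) * (err h z / z ^+ s ^+ 2))
  <= K * small m.
Proof.
have [K K0 hK] := yhat_bound; have [L L0 hL] := normc_zl.
have t0 := rho_gt0 s2 r1; have t1 := rho_lt1 s2 r1.
have [M M0 hM] : exists2 M : R, 0 < M & forall n, n%:R ^+ 4 * rho s r ^+ n <= M.
 by apply: pow4_bound; rewrite ltW.
pose W : R := rs + 1; have W0 : 0 < W by rewrite addr_gt0// (rs_gt0 s2 r1).
pose D : R := W + (1 + normc delta * W).
have D0 : 0 < D by rewrite addr_gt0// ltr_pwDl// mulr_ge0 ?normc_ge0// ltW.
exists (L * D * (K * (M / rho s r))); first by rewrite !mulr_gt0// invr_gt0.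
move=> m; have [h hs hE] := hK m; exists h => // z zG z0.
have wW : normc (z ^+ s) <= W.
 have -> : z ^+ s = uu z + 1 by rewrite uuE subrK.
 apply: normc_le2; last by rewrite (normc_nat R 1).
 by apply: ltW; apply/(lemE s2 r1).
have h1 : normc (err h z / z ^+ s ^+ 2) <= K * (M / rho s r) / m.+1%:R ^+ 2.
 have w0 : 0 < normc (z ^+ s) by rewrite normc_gt0 expf_neq0.
 rewrite normcM normcV normcX ler_pdivrMr ?exprn_gt0//; apply: (le_trans (hE z zG)).
 rewrite ler_wpM2r ?exprn_ge0 ?normc_ge0// -mulrA ler_wpM2l ?(ltW K0)//.
 rewrite ler_pdivlMr ?exprn_gt0 ?ltr0n// ler_pdivlMr//.
 have E : m.+1%:R ^+ 2 * rho s r ^+ m * m.+1%:R ^+ 2 * rho s r = m.+1%:R ^+ 4 * rho s r ^+ m.+1.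
  by rewrite (exprSr (rho s r)); move: (m.+1%:R) (rho s r ^+ m) (rho s r) => x y x'; ring.
 by rewrite E hM.
have h2 : normc ((cf1 m)%:C * z ^+ s + (cf2 m)%:C * (1 + delta * z ^+ s)) <= `|cf1 m| * D.
 rewrite [leRHS]mulrDr; apply: normc_le2; apply: normcM_le => //; rewrite ?normc_real ?cf2_le//.
 by apply: normc_le2; [rewrite (normc_nat R 1) | rewrite normcM_le].
rewrite (_ : _ * small m = L * (`|cf1 m| * D) * (K * (M / rho s r) / m.+1%:R ^+ 2)); last first.
 by rewrite /small; move: (_^-1) (_^-1) => a b; ring.
exact: normcM_le (normcM_le (hL z zG) h2) h1.
Qed.

Lemma kernels_annular m : annular s r (kernels m) /\ forall g, Dfun s r (kernels m) g = 0.
Proof.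
have k00 : (0 < k0)%N by rewrite subn_gt0 ltn_subRL addn1.
have a1 := annular_pole s2 r1 k0; have a2 := annular_pole s2 r1 (s + k0).
pose d1 : C := - (cf1 m)%:C + (cf2 m)%:C * (gam * k0%:R).
have E z : kernels m z = d1 * pole k0 z + (- (cf2 m)%:C) * pole (s + k0) z.
 by rewrite /kernels /d1; move: (pole _ _) (pole _ _) => a b; ring.
have -> : kernels m = fun z => d1 * pole k0 z + (- (cf2 m)%:C) * pole (s + k0) z by exact/funext.
have b1 := annularZ d1 a1; have b2 := annularZ (- (cf2 m)%:C) a2.
split; first exact: annularD.
by move=> g; rewrite (DfunDl s2 r1)// !(DfunZl s2 r1)// !(D_pole s2 r1) ?addn_gt0 ?k00 ?s0// !mulr0 addr0.
Qed.

Theorem approximant (q0 : R) : 0 <= q0 < 1 -> exists K M0, 0 < K /\ forall m, (M0 <= m)%N ->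
 exists q, [/\ size q = m.+1, lead_coef q = 1,
  forall z, lem z -> tA <= tt z ->
   normc ((upoly s l q).[z] - mainF m z - kernels m z) <= K * small m &
  forall z, normc (uu z) <= q0 -> normc ((upoly s l q).[z] - kernels m z) <= K * small m].
Proof.
move=> q01; have /andP[q00 q11] := q01.
have a0 := al_gt0; have a1 := al_lt1.
have [K1 K10 hK1] := correction_bound; have [L L0 hL] := normc_zl.
have d23 : 2 < c + 2 < 3 by apply/andP; split; lra.
have [K2 [M2 [K20 hK2]]] := rpoly_inner d23 q01.
have dA := sqrt_tA s2 r1; have tA1 := tA_gt1 s2 r1.
pose t : R := (Num.sqrt tA)^-1; have sA : 0 < Num.sqrt tA by rewrite -subr_gt0; lra.
have t1 : t < 1 by rewrite invf_lt1//; lra.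
have t0 : 0 < t by rewrite invr_gt0.
pose KA := L * (12 * (1 - t)^-1) / (Num.sqrt tA - 1) ^+ 2.
have KA0 : 0 < KA by rewrite divr_gt0 ?exprn_gt0// mulr_gt0// mulr_gt0// invr_gt0 subr_gt0.
pose KI := L * (K2 * 12) / (1 - q0) ^+ 2.
have KI0 : 0 < KI by rewrite divr_gt0 ?exprn_gt0 ?subr_gt0// !mulr_gt0.
exists (KA + KI + K1), (maxn 3 M2); split; first by rewrite !addr_gt0.
move=> m; rewrite geq_max => /andP[m3 mM2]; have [h hs hE] := hK1 m; exists (approx m h).
have [g3 g2] := coef_decay m3; rewrite -/(small m) in g3 g2.
have [s1 l1] := approx_monic (ltnW m3) hs; have sm := small_ge0 m; split => //.
- move=> z zG zA; have zt : 1 < tt z by exact: lt_le_trans zA.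
 have z0 : z != 0 by apply: outer_neq0 zt.
 have [u0 x1] := outer_uuV zt; have ws : z ^+ s != 0 by rewrite expf_neq0.
 rewrite addrAC (approx_eval m h zG z0) addrAC.
 rewrite (_ : KA + KI + K1 = KA + (KI + K1)); last by rewrite addrA.
 have hc := hE z zG z0; rewrite [leRHS]mulrDl; apply: normc_le2; last first.
  by rewrite normcN; apply: (le_trans hc); rewrite ler_wpM2r// lerDr ltW.
 set x := (uu z)^-1 in x1 *.
 (* on the annulus the partial sum is the full series up to a tail *)
 have e : z ^+ l * (rpoly (c + 2) m.+2).[uu z] / z ^+ s ^+ 2 - mainF m z =
   z ^+ l * (- (uu z ^+ m.+2 * ((1 + x) ^+ 2 * bser c x - bpoly (c + 2) m.+3 x))) / z ^+ s ^+ 2.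
  have zs : z ^+ s = (1 + x) * uu z.
   by rewrite mulrDl mul1r /x mulVf// uuE subrK.
  rewrite rpoly_bpoly// /mainF -/x zs (exprS _ m.+1) (exprS _ m); rewrite zs in ws.
  move: (bser _ _) (bpoly _ _ _) (z ^+ l) => a b d; move: ws u0; move: (uu z ^+ m) (uu z) (x) => um u y xu0 u0.
  have y0 : 1 + y != 0 by apply: contra xu0 => /eqP->; rewrite mul0r.
  by field; rewrite u0 y0.
 rewrite e normcM normcV normcX.
 have w1 := outer_w s2 r1 zA; have w0 : 0 < normc (z ^+ s) by exact: lt_le_trans w1.
 apply: (@le_trans _ _ (L * (12 * small m * (1 - t)^-1) / (Num.sqrt tA - 1) ^+ 2)); last first.
  by rewrite /KA; apply: le_of_eq; move: (_^-1) (_^-1) => y1 y2; ring.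
 apply: ler_pM; rewrite ?normc_ge0 ?invr_ge0 ?exprn_ge0 ?normc_ge0//; last first.
  by rewrite lef_pV2 ?posrE ?exprn_gt0// lerXn2r ?nnegrE ?normc_ge0// ltW.
 apply: (normcM_le (hL z zG)); rewrite normcN normcM normcX.
 have c01 : 0 <= c <= 1 by apply/andP; split; lra.
 have u1 : 0 < normc (uu z) by rewrite normc_gt0.
 have hb := bser_mul2_tail c01 (isT : (3 <= m.+3)%N) x1.
 apply: (le_trans (ler_wpM2l (exprn_ge0 _ (ltW u1)) hb)).
 have ux : normc (uu z) ^+ m.+2 * normc x ^+ m.+2 = 1.
  by rewrite -exprMn -normcM mulfV// (normc_nat R 1) expr1n.
 rewrite (exprSr (normc x)) (_ : normc (uu z) ^+ m.+2 * _ = normc (uu z) ^+ m.+2 * normc x ^+ m.+2 *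
  (`|gbin (c + 2) m.+3| * (normc x / (1 - normc x)))); last first.
  by move: (_^-1) (_ ^+ _) (_ ^+ _) => y1 y2 y3; ring.
 rewrite ux mul1r ler_pM// ?divr_ge0 ?normc_ge0 ?subr_ge0 ?(ltW x1)//.
 have xt : normc x <= t.
  rewrite /x normcV lef_pV2 ?posrE// -(@ler_pXn2r _ 2) ?nnegrE ?normc_ge0 ?sqrtr_ge0//.
  by rewrite sqr_sqrtr -?ttE// ltW// (lt_trans ltr01).
 rewrite -[leRHS]mul1r ler_pM ?normc_ge0 ?invr_ge0 ?subr_ge0 ?(ltW x1)//.
 by rewrite lef_pV2 ?posrE ?subr_gt0// lerD2l lerN2.
- move=> z uq.
 have zG : lem z.
  by apply/(lemE s2 r1); apply: (le_lt_trans uq); exact: lt_trans (rs_gt1 s2 r1).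
 have w1 : 1 - q0 <= normc (z ^+ s).
  have -> : z ^+ s = 1 + uu z by rewrite uuE addrC subrK.
  by have := normc_lb 1 (uu z); rewrite (normc_nat R 1); apply: le_trans; rewrite lerD2l lerN2.
 have q10 : 0 < 1 - q0 by rewrite subr_gt0.
 have w0 : 0 < normc (z ^+ s) by exact: lt_le_trans w1.
 have z0 : z != 0.
  by apply/eqP => z0; move: w0; rewrite z0 expr0n gtn_eqF// normc0 ltxx.
 rewrite (approx_eval m h zG z0) (_ : KA + KI + K1 = KI + (KA + K1)); last by rewrite addrCA addrA.
 have hc := hE z zG z0; rewrite [leRHS]mulrDl; apply: normc_le2; last first.
  by rewrite normcN; apply: (le_trans hc); rewrite ler_wpM2r// lerDr ltW.
 rewrite normcM normcV normcX.
 apply: (@le_trans _ _ (L * (K2 * (12 * small m)) / (1 - q0) ^+ 2)); last first.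
  by rewrite /KI; apply: le_of_eq; move: (_^-1) => y2; ring.
 apply: ler_pM; rewrite ?normc_ge0 ?invr_ge0 ?exprn_ge0 ?normc_ge0//; last first.
  by rewrite lef_pV2 ?posrE ?exprn_gt0// lerXn2r ?nnegrE ?normc_ge0// ltW.
 apply: (normcM_le (hL z zG)); apply: le_trans (hK2 m.+2 _ (uu z) uq) _.
  by rewrite (leq_trans mM2)// -addn2 leq_addr.
 by rewrite ler_wpM2l// ltW.
Qed.
End Approximant.

(** * The Gamma function *)
Section GammaFunction.
Variable R : realType.
Local Notation mu1 := (@lebesgue_measure R).
Local Notation mR := (measurableTypeR R).
Implicit Types (a b t x y th : R) (n : nat).

Definition gker a t : R := t `^ (a - 1) * expR (- t).
Definition window n : set R := `[n.+2%:R^-1, n.+2%:R]%classic.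
(** Euler's integral over a compact subinterval, where the integrand is continuous. *)
Definition J a n : R := Rintegral mu1 (window n) (gker a).

Lemma window_lt n : n.+2%:R^-1 < n.+2%:R :> R.
Proof.
have h : 1 < n.+2%:R :> R by rewrite (ltr_nat R 1).
by apply: lt_trans (h); rewrite invf_lt1 ?ltr0n.
Qed.

Lemma window_gt0 n t : window n t -> 0 < t.
Proof. by rewrite /window /= in_itv /= => /andP[+ _]; apply: lt_le_trans; rewrite invr_gt0 ltr0n. Qed.

Definition gprim a t : R := t `^ a * expR (- t).

Lemma gprim_derive a t : 0 < t -> is_derive t 1 (gprim a) (a * gker a t - gker (a + 1) t).
Proof.
move=> t0; have d1 := is_derive1_powR a t0.
have d2 : is_derive t 1 (fun t => expR (- t)) (- expR (- t)).
 have d3 : is_derive t 1 (fun x : R => - x) (- 1) by apply: is_deriveN.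
 have d4 : is_derive (- t) 1 (@expR R) (expR (- t)) by exact: is_derive_expR.
 have := @is_derive1_comp R (@expR R) (fun x => - x) t _ _ d4 d3.
 by rewrite mulrN1.
rewrite (_ : a * _ - _ = t `^ a *: - expR (- t) + expR (- t) *: (a * t `^ (a - 1))).
 exact: (is_deriveM d1 d2).
by rewrite /gker addrK /GRing.scale /=; ring.
Qed.

Lemma gker_continuous a t : 0 < t -> {for t, continuous (gker a)}.
Proof.
move=> t0; have := gprim_derive (a - 1) t0 => -[d _].
exact/differentiable_continuous/derivable1_diffP.
Qed.

Lemma window_continuous (g : R -> R) n : (forall t, 0 < t -> {for t, continuous g}) ->
 {within window n, continuous g}.
Proof. by move=> cg; apply: continuous_in_subspaceT => t /set_mem/window_gt0; exact: cg. Qed.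

Lemma window_integrable (g : R -> R) n : (forall t, 0 < t -> {for t, continuous g}) ->
 mu1.-integrable (window n) (EFin \o g).
Proof.
move=> cg; apply: continuous_compact_integrable; first exact: segment_compact.
exact: window_continuous.
Qed.

Lemma window_measurable n : measurable (window n : set mR).
Proof. exact: measurable_itv. Qed.

Lemma gker_integrable a n : mu1.-integrable (window n) (EFin \o gker a).
Proof. by apply: window_integrable => t; exact: gker_continuous. Qed.

Lemma gker_ge0 a t : 0 <= gker a t.
Proof. by rewrite mulr_ge0 ?powR_ge0 ?expR_ge0. Qed.

(** Integration by parts. *)
Lemma J_rec a n : a * J a n - J (a + 1) n = gprim a n.+2%:R - gprim a n.+2%:R^-1.
Proof.
have ia := gker_integrable a n; have ib := gker_integrable (a + 1) n.
have mW := window_measurable n.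
have ca t : 0 < t -> {for t, continuous (fun t => a * gker a t)}.
 by move=> t0; apply: continuousM; [exact: cst_continuous|exact: gker_continuous].
have iaz := window_integrable n ca.
rewrite -(RintegralZl a mW ia) -(RintegralB mW iaz ib) /Rintegral.
have w0 : 0 < n.+2%:R^-1 :> R by rewrite invr_gt0 ltr0n.
have gd t : 0 < t -> {for t, continuous (gprim a)}.
 by move=> t0; have [d _] := gprim_derive a t0; exact/differentiable_continuous/derivable1_diffP.
rewrite (@continuous_FTC2 R (fun t => a * gker a t - gker (a + 1) t) (gprim a))//.
- exact: window_lt.
- apply: window_continuous => t t0.
 by apply: continuousB; [exact: ca|exact: gker_continuous].
- split.
 + move=> t; rewrite in_itv /= => /andP[h _]; have t0 := lt_trans w0 h.
  by have [d _] := gprim_derive a t0.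
 + by apply: cvg_at_right_filter; exact: gd.
 + by apply: cvg_at_left_filter; apply: gd; rewrite ltr0n.
- move=> t; rewrite in_itv /= => /andP[h _]; have t0 := lt_trans w0 h.
 by rewrite derive1E; have [_ ->] := gprim_derive a t0.
Qed.

Lemma J_le a b c n : (forall t, 0 < t -> gker a t <= gker b t + gker c t) ->
 J a n <= J b n + J c n.
Proof.
move=> h; have mW := window_measurable n.
have ib := gker_integrable b n; have ic := gker_integrable c n.
rewrite /J -(RintegralD mW ib ic); apply: (le_Rintegral mW (gker_integrable a n)).
 by apply: window_integrable => t t0; apply: continuousD; exact: gker_continuous.
by move=> t /window_gt0; exact: h.
Qed.

Lemma gprim_ge0 a t : 0 <= gprim a t.
Proof. by rewrite mulr_ge0 ?powR_ge0 ?expR_ge0. Qed.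

Lemma expRN_le1 t : 0 <= t -> expR (- t) <= 1.
Proof. by move=> t0; rewrite -expR0 ler_expR oppr_le0. Qed.

Lemma gprim_small a t : 0 <= a -> 0 < t -> t <= 1 -> gprim a t <= t `^ a.
Proof. by move=> a0 t0 t1; rewrite -[leRHS]mulr1 ler_wpM2l ?powR_ge0 ?expRN_le1// ltW. Qed.

Lemma gprim_large a : exists2 K : R, 0 <= K & forall t, 1 <= t -> gprim a t <= K / t.
Proof.
pose N := (Num.truncn `|a|).+1; exists (N.+1)`!%:R => // t t1.
have t0 : 0 < t by exact: lt_le_trans t1.
have aN : a <= N%:R by apply: (le_trans (ler_norm a)); apply: ltW; exact: truncnS_gt.
have h1 : t `^ a <= t ^+ N by rewrite -powR_mulrn ?(ltW t0)// ler_powR.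
have h2 : t ^+ N.+1 / N.+1`!%:R <= expR t.
 by apply: le_trans (expR_ge1Dxn N (ltW t0)); rewrite lerDr.
rewrite /gprim expRN ler_pdivrMr ?expR_gt0//.
apply: (le_trans h1); apply: (@le_trans _ _ (N.+1`!%:R / t * (t ^+ N.+1 / N.+1`!%:R))).
 rewrite exprSr; apply: le_of_eq.
 have f0 : N.+1`!%:R != 0 :> R by rewrite pnatr_eq0 -lt0n fact_gt0.
 by move: (N.+1`!%:R) f0 (t ^+ N) => f f0 y; field; rewrite f0 gt_eqF.
by rewrite ler_wpM2l// divr_ge0// ltW.
Qed.

Lemma gprim_limit a : 0 < a -> (fun n => gprim a n.+2%:R - gprim a n.+2%:R^-1) @ \oo --> (0 : R).
Proof.
move=> a0; have [K K0 hK] := gprim_large a.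
have c1 : (fun n => gprim a n.+2%:R) @ \oo --> (0 : R).
 apply: (@squeeze_cvgr _ _ _ _ (fun=> 0) (fun n => K * n.+2%:R^-1)); last 2 first.
 - exact: cvg_cst.
 - rewrite -[X in _ --> X](mulr0 K); apply: cvgM; first exact: cvg_cst.
  have := @cvg_harmonic R; rewrite -(cvg_shiftS (@harmonic R)) => h; exact: h.
 by near=> n; rewrite gprim_ge0 hK// (ler_nat R 1).
have c2 : (fun n => gprim a n.+2%:R^-1) @ \oo --> (0 : R).
 apply/cvgrPdist_le => e e0; exists (Num.truncn (e `^ a^-1)^-1).+1 => // n /= hn.
 have n0 : 0 < n.+2%:R :> R by rewrite ltr0n.
 rewrite sub0r normrN ger0_norm ?gprim_ge0//.
 have n1 : n.+2%:R^-1 <= 1 :> R by rewrite invf_le1// (ler_nat R 1).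
 apply: le_trans (gprim_small (ltW a0) _ n1) _; first by rewrite invr_gt0.
 have p0 : 0 < e `^ a^-1 by exact: powR_gt0.
 have h : n.+2%:R^-1 <= e `^ a^-1.
  rewrite -[leRHS]invrK lef_pV2 ?posrE ?invr_gt0//.
  apply: ltW; apply: lt_le_trans (truncnS_gt _) _; rewrite ler_nat.
  by apply: (leq_trans hn); rewrite -addn2 leq_addr.
 apply: (@le_trans _ _ ((e `^ a^-1) `^ a)); last by rewrite -powRrM mulVf ?powRr1 ?gt_eqF// ltW.
 by apply: ge0_ler_powR; rewrite ?nnegrE ?invr_ge0 ?(ltW a0) ?(ltW p0).
by rewrite -[X in _ --> X](subrr 0); exact: cvgB.
Unshelve. all: by end_near. Qed.

Lemma J_bounded b : 0 < b -> exists K : R, forall n, J b n <= K.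
Proof.
have J1 n : J 1 n <= 1.
 have := J_rec 0 n; rewrite mul0r sub0r /gprim !powRr0 !mul1r => h.
 have -> : J 1 n = expR (- n.+2%:R^-1) - expR (- n.+2%:R) by rewrite -opprB -h add0r opprK.
 by rewrite lerBlDr (le_trans (expRN_le1 _)) ?invr_ge0// lerDl expR_ge0.
have JN N : exists K : R, forall n, J N.+1%:R n <= K.
 elim: N => [|N [K hK]]; first by exists 1.
 exists (N.+1%:R * K + 1) => n; have := J_rec N.+1%:R n; rewrite natr1 => h.
 have -> : J N.+2%:R n = N.+1%:R * J N.+1%:R n - (gprim N.+1%:R n.+2%:R - gprim N.+1%:R n.+2%:R^-1).
  by rewrite -h; ring.
 have i0 : 0 < n.+2%:R^-1 :> R by rewrite invr_gt0 ltr0n.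
 have i1 : n.+2%:R^-1 <= 1 :> R by rewrite invf_le1 ?ltr0n// (ler_nat R 1).
 have h1 : gprim N.+1%:R n.+2%:R^-1 <= 1.
  apply: le_trans (gprim_small _ i0 i1) _ => //.
  by rewrite powR_mulrn ?(ltW i0)// exprn_ile1// ltW.
 have h2 := gprim_ge0 N.+1%:R n.+2%:R; have h3 : N.+1%:R * J N.+1%:R n <= N.+1%:R * K.
  by rewrite ler_wpM2l.
 by rewrite opprB addrA (le_trans (y := N.+1%:R * K + gprim N.+1%:R n.+2%:R^-1)) ?lerD2l// lerBlDr (le_trans (lerD h3 (lexx _)))// lerDl.
have J_ge1 c : 1 <= c -> exists K : R, forall n, J c n <= K.
 move=> c1; pose N := (Num.truncn c).+1; have [K hK] := JN N.
 exists (1 + K) => n; apply: (@le_trans _ _ (J 1 n + J N.+1%:R n)); last exact: lerD.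
 apply: J_le => t t0; rewrite /gker -mulrDl ler_wpM2r ?expR_ge0// subrr powRr0 -natr1 addrK.
 have [t1|t1] := leP 1 t.
  apply: (@le_trans _ _ (t `^ N%:R)); last by rewrite lerDr.
  by rewrite ler_powR// (le_trans (y := c)) ?gerBl// ltW// truncnS_gt.
 rewrite -[leLHS]addr0 lerD ?powR_ge0// -[leRHS](powRr0 t).
 by apply: ger_powR; [rewrite t0 ltW | rewrite subr_ge0].
move=> b0; have b1 : 1 <= b + 1 by rewrite lerDr ltW.
have [K hK] := J_ge1 _ b1.
have [K' K'0 hK'] := gprim_large b; exists (b^-1 * (K + K')) => n.
rewrite -ler_pdivrMl ?invr_gt0// invrK.
have -> : b * J b n = J (b + 1) n + (gprim b n.+2%:R - gprim b n.+2%:R^-1).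
 by rewrite -J_rec addrC subrK.
apply: lerD => //; rewrite lerBlDr (le_trans (hK' _ _)) ?(ler_nat R 1)//.
rewrite (@le_trans _ _ K') ?lerDl ?gprim_ge0//.
by rewrite ler_pdivrMr ?ltr0n// ler_peMr// (ler_nat R 1).
Qed.

Lemma window_bigcup : \bigcup_n window n = `]0, +oo[%classic :> set R.
Proof.
apply/seteqP; split=> t; first by case=> n _ /window_gt0; rewrite /= in_itv /= andbT.
rewrite /= in_itv /= andbT => t0; pose N := maxn (Num.truncn t) (Num.truncn t^-1).
exists N => //; rewrite /window /= in_itv /=; apply/andP; split.
 rewrite -[leRHS]invrK lef_pV2 ?posrE ?invr_gt0 ?ltr0n//.
 apply: ltW; apply: lt_le_trans (truncnS_gt _) _; rewrite ler_nat.
 by apply: leqW; rewrite ltnS leq_maxr.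
apply: ltW; apply: lt_le_trans (truncnS_gt _) _; rewrite ler_nat.
by apply: leqW; rewrite ltnS leq_maxl.
Qed.

Lemma J_cvg b : 0 < b -> J b @ \oo --> Gamma_integral b.
Proof.
move=> b0; have [K hK] := J_bounded b0.
have fJ n : (\int[mu1]_(x in window n) (gker b x)%:E)%E = (J b n)%:E.
 by rewrite /J /Rintegral fineK//; apply: integrable_fin_num; [exact: measurable_itv|exact: gker_integrable].
have c : (fun n => (J b n)%:E) @ \oo --> (\int[mu1]_(x in `]0%R, +oo[) (gker b x)%:E)%E.
 have := @ge0_nondecreasing_set_cvg_integral _ mR R window (EFin \o gker b) mu1.
 rewrite window_bigcup.
 have -> : (fun n => (J b n)%:E) = (fun n => \int[mu1]_(x in window n) (EFin \o gker b) x)%E.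
  by apply/funext => n; rewrite -fJ.
 apply.
 - apply/nondecreasing_seqP => n; apply/subsetPset => t; rewrite /window /= !in_itv /= => /andP[h1 h2].
  apply/andP; split; last by apply: (le_trans h2); rewrite ler_nat.
  by apply: le_trans h1; rewrite lef_pV2 ?posrE ?ltr0n// ler_nat.
 - by move=> n; exact: window_measurable.
 - by move=> n; have /integrableP[] := gker_integrable b n.
 - by move=> n t _; rewrite lee_fin gker_ge0.
have fin : (\int[mu1]_(x in `]0%R, +oo[) (gker b x)%:E)%E \is a fin_num.
 rewrite ge0_fin_numE; last by apply: integral_ge0 => t _; rewrite lee_fin gker_ge0.
 apply: (@le_lt_trans _ _ K%:E); last exact: ltry.
 rewrite -(cvg_lim _ c)//; apply: lime_le; first by apply/cvg_ex; eexists; exact: c.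
 by apply: nearW => n; rewrite lee_fin.
have := c; rewrite -(fineK fin) => c'; exact: (fine_cvg c').
Qed.

Lemma Gamma_integral_rec b : 0 < b -> Gamma_integral (b + 1) = b * Gamma_integral b.
Proof.
move=> b0; have c1 := J_cvg b0; have c2 := J_cvg (addr_gt0 b0 ltr01).
have c3 : (fun n => b * J b n - J (b + 1) n) @ \oo --> b * Gamma_integral b - Gamma_integral (b + 1).
 by apply: cvgB c2; apply: cvgM c1; exact: cvg_cst.
have c4 : (fun n => b * J b n - J (b + 1) n) @ \oo --> (0 : R).
 by rewrite (_ : (fun n => _) = (fun n => gprim b n.+2%:R - gprim b n.+2%:R^-1)); [exact: gprim_limit|apply/funext => n; rewrite J_rec].
have l3 := cvg_lim (@norm_hausdorff _ _) c3; have l4 := cvg_lim (@norm_hausdorff _ _) c4.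
by apply/eqP; rewrite eq_sym -subr_eq0 -l3 l4.
Qed.

Lemma Gamma_integral_ge0 b : 0 <= Gamma_integral b.
Proof. by apply: Rintegral_ge0 => t _; exact: gker_ge0. Qed.

Lemma Gamma_integral_1 : Gamma_integral (1 : R) = 1.
Proof.
have c1 := J_cvg (@ltr01 R).
have c2 : (fun n => J 1 n) @ \oo --> (1 : R).
 apply/cvgrPdist_le => e e0; near=> n.
 have := J_rec 0 n; rewrite mul0r sub0r add0r /gprim !powRr0 !mul1r => /(congr1 -%R).
 rewrite opprK opprB => ->.
 have h1 := expR_ge1Dx (- n.+2%:R^-1 : R); have h2 : expR (- n.+2%:R^-1) <= 1 :> R.
  by apply: expRN_le1; rewrite invr_ge0.
 have h3 : expR (- n.+2%:R) <= n.+2%:R^-1 :> R.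
  rewrite expRN lef_pV2 ?posrE ?expR_gt0 ?ltr0n//.
  by apply: le_trans (expR_ge1Dx _); rewrite lerDr.
 have h4 := expR_ge0 (- n.+2%:R : R).
 have h5 : n.+2%:R^-1 <= e / 2.
  rewrite -[leRHS]invrK lef_pV2 ?posrE ?ltr0n ?invr_gt0 ?divr_gt0//.
  apply: ltW; apply: lt_le_trans (truncnS_gt _) _; rewrite ler_nat -addn1.
  rewrite (leq_trans (n := n + 1))// ?leq_add2r; last by rewrite addn1 ltnW.
  by near: n; exact: nbhs_infty_ge.
 have aux (x y d : R) : 1 + - d <= x -> x <= 1 -> y <= d -> 0 <= y -> d <= e / 2 -> `|1 - (x - y)| <= e.
  by move=> *; rewrite ler_norml; apply/andP; split; lra.
 exact: aux h1 h2 h3 h4 h5.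
by rewrite -(cvg_lim (@norm_hausdorff _ _) c1) (cvg_lim (@norm_hausdorff _ _) c2).
Unshelve. all: by end_near. Qed.

(** The tangent line to the concave power function. *)
Lemma powR_tangent x th : 0 < x -> 0 <= th <= 1 -> x `^ th <= 1 + th * (x - 1).
Proof.
move=> x0 /andP[t0 t1]; have h (y : R) : 1 + y <= expR y by exact: expR_ge1Dx.
have p0 : 0 < 1 + th * (x - 1).
 rewrite (_ : _ + _ = (1 - th) + th * x); last by ring.
 move: t0; rewrite le_eqVlt => /orP[/eqP<-|t0]; first by rewrite mul0r addr0 subr0.
 by rewrite ltr_wpDl ?subr_ge0// mulr_gt0.
rewrite /powR gt_eqF//; set y := 1 + _ in p0 *.
rewrite -[leRHS](lnK p0) ler_expR.
have l1 : ln (x / y) <= x / y - 1.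
 have := @le_ln1Dx R (x / y - 1); rewrite (_ : 1 + _ = x / y); last by ring.
 by apply; rewrite ltrBrDr addNr divr_gt0.
have l2 : ln (1 / y) <= 1 / y - 1.
 have := @le_ln1Dx R (1 / y - 1); rewrite (_ : 1 + _ = 1 / y); last by ring.
 by apply; rewrite ltrBrDr addNr divr_gt0.
rewrite ln_div ?posrE// in l1; rewrite ln_div ?posrE// ln1 in l2.
have e : th * (x / y - 1) + (1 - th) * (1 / y - 1) = 0.
 rewrite (_ : _ + _ = (1 + th * (x - 1)) / y - 1); last by ring.
 by rewrite divff ?subrr// gt_eqF.
have s1 := ler_wpM2l t0 l1; have s2 : (1 - th) * (0 - ln y) <= (1 - th) * (1 / y - 1).
 by rewrite ler_wpM2l// subr_ge0.
rewrite -subr_ge0; have : 0 <= (th * (x / y - 1) + (1 - th) * (1 / y - 1)) - (th * (ln x - ln y) + (1 - th) * (0 - ln y)).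
 by rewrite subr_ge0 lerD.
by rewrite e sub0r (_ : - (_ + _) = ln y - th * ln x)//; ring.
Qed.

Lemma gker_tangent x th t : 0 < x -> 0 <= th <= 1 -> 0 < t ->
 gker (x + th) t <= x `^ th * (1 - th) * gker x t + x `^ th * (th / x) * gker (x + 1) t.
Proof.
move=> x0 th01 s0; rewrite /gker addrK !mulrA -mulrDl ler_wpM2r ?expR_ge0//.
have pD p q : t `^ (p + q) = t `^ p * t `^ q by rewrite powRD// (gt_eqF s0) implybT.
have -> : t `^ (x + th - 1) = t `^ (x - 1) * t `^ th by rewrite (_ : x + th - 1 = (x - 1) + th) ?pD//; ring.
have -> : t `^ x = t `^ (x - 1) * t by rewrite -{3}[t]powRr1 ?(ltW s0)// -pD subrK.
have xp : 0 < x `^ th by exact: powR_gt0.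
have h : t `^ th <= x `^ th * (1 + th * (t / x - 1)).
 have e : t `^ th = x `^ th * (t / x) `^ th.
  have tx : x * (t / x) = t by field; rewrite gt_eqF.
  by rewrite -powRM ?tx ?divr_ge0 ?(ltW s0) ?(ltW x0).
 by rewrite e ler_wpM2l ?(ltW xp)// powR_tangent// divr_gt0.
apply: (le_trans (ler_wpM2l (powR_ge0 t (x - 1)) h)).
by apply: le_of_eq; move: (t `^ _) (x `^ _) => p q; ring.
Qed.

(** The integrand satisfies the same inequality, a tangent line in t / x. *)
Lemma Gamma_integral_shift x th : 0 < x -> 0 <= th <= 1 ->
 Gamma_integral (x + th) <= x `^ th * Gamma_integral x.
Proof.
move=> x0 th01; have /andP[t0 t1] := th01.
have c1 := J_cvg x0; have c2 := J_cvg (addr_gt0 x0 ltr01).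
have c3 := J_cvg (ltr_wpDr t0 x0).
have p0 : 0 <= x `^ th by exact: powR_ge0.
have E : x `^ th * Gamma_integral x =
  x `^ th * (1 - th) * Gamma_integral x + x `^ th * (th / x) * Gamma_integral (x + 1).
 by rewrite Gamma_integral_rec//; move: (Gamma_integral x) (x `^ th) => g p; field; rewrite gt_eqF.
rewrite E.
have c4 : (fun n => x `^ th * (1 - th) * J x n + x `^ th * (th / x) * J (x + 1) n) @ \oo -->
  x `^ th * (1 - th) * Gamma_integral x + x `^ th * (th / x) * Gamma_integral (x + 1).
 by apply: cvgD; [apply: cvgM c1|apply: cvgM c2]; exact: cvg_cst.
apply: (ler_cvg_to c3 c4); apply: nearW => n.
have mW := window_measurable n.
have cf (k : R) a t : 0 < t -> {for t, continuous (fun t => k * gker a t)}.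
 by move=> s0; apply: continuousM; [exact: cst_continuous|exact: gker_continuous].
have i1 := window_integrable n (cf (x `^ th * (1 - th)) x).
have i2 := window_integrable n (cf (x `^ th * (th / x)) (x + 1)).
rewrite /J -(RintegralZl _ mW (gker_integrable x n)) -(RintegralZl _ mW (gker_integrable (x + 1) n)).
rewrite -(RintegralD mW i1 i2); apply: (le_Rintegral mW (gker_integrable _ n)).
 by apply: window_integrable => t s0; apply: continuousD; exact: cf.
by move=> t /window_gt0 s0; exact: gker_tangent.
Qed.

Lemma Gamma_integral_gt0 b : 0 < b -> 0 < Gamma_integral b.
Proof.
move=> b0; rewrite lt_neqAle Gamma_integral_ge0 andbT eq_sym; apply/eqP => g0.
pose N := (Num.truncn b).+1.
have GN k : 0 < Gamma_integral (k.+1%:R : R).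
 elim: k => [|k ih]; first by rewrite Gamma_integral_1.
 by rewrite -natr1 Gamma_integral_rec// mulr_gt0.
have th : 0 <= N%:R - b <= 1.
 rewrite subr_ge0 (ltW (truncnS_gt _)) /= lerBlDr /N -natr1 addrC lerD2l.
 by rewrite truncn_le// ltW.
have := Gamma_integral_shift b0 th; rewrite g0 mulr0 addrC subrK leNgt => /negP; apply.
exact: GN.
Qed.

(** ** Ratios *)
Lemma ln_cubic x : 0 <= x -> x - x ^+ 2 / 2 <= ln (1 + x) <= x - x ^+ 2 / 2 + x ^+ 3 / 3.
Proof.
move=> x0; pose p (k : R) : {poly R} := 'X - 2^-1 *: 'X^2 + (k / 3) *: 'X^3.
have pE k y : (p k).[y] = y - y ^+ 2 / 2 + k * (y ^+ 3 / 3) by rewrite /p !(hornerD, hornerN, hornerZ, hornerX, hornerXn); field.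
have dpE k y : (p k)^`().[y] = 1 - y + k * y ^+ 2.
 rewrite /p derivD derivB derivX !derivZ !derivXn.
 by rewrite !(hornerD, hornerN, hornerZ, hornerC, hornerX, hornerXn, hornerMn); field.
pose f (k : R) y := ln (1 + y) - (p k).[y].
have d (k y : R) : 0 <= y -> is_derive y 1 (f k) ((1 + y)^-1 - (1 - y + k * y ^+ 2)).
 move=> y0; have y1 : 0 < 1 + y by rewrite ltr_pwDl.
 have d1 : is_derive y 1 (fun y => ln (1 + y)) ((1 + y)^-1).
  have d2 : is_derive y 1 (fun y : R => 1 + y) 1.
   by rewrite -[X in is_derive _ _ _ X]add0r; apply: is_deriveD.
  have := @is_derive1_comp R (@ln R) (fun y => 1 + y) y _ _ (is_derive1_ln y1) d2.
  by rewrite mulr1.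
 by rewrite -dpE; apply: is_deriveB.
have f0 (k : R) : f k 0 = 0 by rewrite /f pE addr0 ln1 !expr0n /=; ring.
have key y : 0 <= y -> 0 <= (1 + y)^-1 - (1 - y) <= y ^+ 2.
 move=> y0; have y1 : 0 < 1 + y by rewrite ltr_pwDl.
 have -> : (1 + y)^-1 - (1 - y) = y ^+ 2 / (1 + y) by field; rewrite gt_eqF.
 rewrite divr_ge0 ?exprn_ge0 ?(ltW y1)//= ler_pdivrMr// ler_peMr ?exprn_ge0//.
 by rewrite lerDl.
have mvt (k : R) : exists2 y, 0 <= y & f k x = ((1 + y)^-1 - (1 - y + k * y ^+ 2)) * x.
 move: x0; rewrite le_eqVlt => /orP[/eqP<-|x0].
  by exists 0 => //; rewrite f0 mulr0.
 have [||y yi fe] := @MVT R (f k) (fun y => (1 + y)^-1 - (1 - y + k * y ^+ 2)) 0 x x0.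
 - by move=> y; rewrite in_itv /= => /andP[y0 _]; apply: d; exact: ltW.
 - apply: continuous_in_subspaceT => y /set_mem; rewrite /= in_itv /= => /andP[y0 _].
  have [h _] := d k y y0; exact/differentiable_continuous/derivable1_diffP.
 move: yi; rewrite in_itv /= => /andP[y0 _]; exists y; first exact: ltW.
 by move: fe; rewrite f0 !subr0.
apply/andP; split.
 have [y y0] := mvt 0; rewrite /f pE !mul0r !addr0 => e.
 by rewrite -subr_ge0 e mulr_ge0//; have /andP[] := key y y0.
have [y y0] := mvt 1; rewrite /f pE !mul1r => e.
rewrite -subr_le0 e mulr_le0_ge0// opprD addrA subr_le0.
by have /andP[_] := key y y0.
Qed.

(** Only positivity, the functional equation and a convexity bound of Gamma are used. With H the
 ratio minus its expected leading term, H(y+1) - H(y) = O(y^-3) telescopes to O(y^-2). *)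
Section Ratio.
Variable G : R -> R.
Hypotheses (G_gt0 : forall y, 0 < y -> 0 < G y) (G_rec : forall y, 0 < y -> G (y + 1) = y * G y).
Hypothesis G_shift : forall y th, 0 < y -> 0 <= th <= 1 -> G (y + th) <= y `^ th * G y.
Variable e : R.
Hypotheses (e1 : 1 <= e) (e2 : e <= 2).
Definition lratio y : R := ln (G (y + e)) - ln (G y) - e * ln y.

Lemma lratio_bound y : 0 < y -> 0 <= lratio y <= (e - 1) / y.
Proof.
move=> y0; pose th := e - 1; have e1' := e1; have e2' := e2.
have th01 : 0 <= th <= 1 by rewrite /th; apply/andP; split; lra.
have /andP[t0 t1] := th01; have yt : 0 < y + th by rewrite ltr_wpDr.
have G0 := G_gt0 y0; have Gt := G_gt0 yt.
have Ge : G (y + e) = (y + th) * G (y + th).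
 by rewrite -G_rec// /th -addrA subrK.
have u := G_shift y0 th01.
have th01' : 0 <= 1 - th <= 1 by apply/andP; split; lra.
have w := G_shift yt th01'.
have e' : y + th + (1 - th) = y + 1 by ring.
rewrite e' G_rec// in w.
have ln_u : ln (G (y + th)) <= th * ln y + ln (G y).
 by rewrite -ln_powR -lnM ?posrE ?powR_gt0// ler_ln ?posrE// mulr_gt0// powR_gt0.
have ln_w : ln y + ln (G y) <= (1 - th) * ln (y + th) + ln (G (y + th)).
 by rewrite -ln_powR -!lnM ?posrE ?powR_gt0// ler_ln ?posrE// mulr_gt0// powR_gt0.
have lg : ln (G (y + e)) = ln (y + th) + ln (G (y + th)).
 by rewrite Ge lnM ?posrE.
have l1 : ln (y + th) <= ln y + th / y.
 rewrite -lerBlDl -ln_div ?posrE//.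
 have := @le_ln1Dx R (th / y); rewrite (_ : 1 + _ = (y + th) / y); last by field; rewrite gt_eqF.
 by apply; rewrite (lt_le_trans (ltrN10 R))// divr_ge0// ltW.
have l2 : ln y <= ln (y + th) by rewrite ler_ln ?posrE// lerDl.
have l3 : 0 <= th * (ln (y + th) - ln y) by rewrite mulr_ge0// subr_ge0.
rewrite /lratio lg (_ : ln _ + _ - _ - _ = (ln (y + th) - ln y) + (ln (G (y + th)) - ln (G y) - th * ln y)); last by rewrite /th; ring.
have aux (k a b c d f : R) : a <= k * d + b -> d + b <= (1 - k) * c + a -> c <= d + f ->
  0 <= k * (c - d) -> 0 <= (c - d) + (a - b - k * d) <= f.
 by move=> h1 h2 h3 h4; apply/andP; split; lra.
exact: aux ln_u ln_w l1 l3.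
Qed.

Let cc := e * (e - 1) / 2.
Lemma lratio_step y : 1 <= y ->
 `|(lratio (y + 1) - cc / (y + 1)) - (lratio y - cc / y)| <= 6 / y ^+ 3.
Proof.
move=> y1; have e1' := e1; have e2' := e2; have y0 : 0 < y by exact: lt_le_trans y1. have y10 : 0 < y + 1 by rewrite addr_gt0.
have ye : 0 < y + e by rewrite addr_gt0// (lt_le_trans _ e1).
have G0 := G_gt0 y0; have Ge := G_gt0 ye.
have lG : ln (G (y + 1)) = ln y + ln (G y).
 by rewrite G_rec// lnM ?posrE.
have lGe : ln (G (y + 1 + e)) = ln (y + e) + ln (G (y + e)).
 have -> : y + 1 + e = y + e + 1 by ring.
 by rewrite G_rec// lnM ?posrE.
pose t := y^-1; have t0 : 0 < t by rewrite invr_gt0.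
have t1 : t <= 1 by rewrite invf_le1.
have l1 : ln (y + 1) = ln y + ln (1 + t).
 by rewrite -lnM ?posrE ?addr_gt0//; congr ln; rewrite /t; field; rewrite gt_eqF.
have l2 : ln (y + e) = ln y + ln (1 + e * t).
 have e0 : 0 < e by exact: lt_le_trans e1.
 by rewrite -lnM ?posrE ?addr_gt0 ?mulr_gt0//; congr ln; rewrite /t; field; rewrite gt_eqF.
have cE : cc / y - cc / (y + 1) = cc * (t ^+ 2 - t ^+ 3 / (1 + t)).
 rewrite /t; have n1 : y + 1 != 0 by rewrite gt_eqF.
 by move: (cc) => k; field; rewrite n1 gt_eqF.
rewrite (_ : _ - _ = ln (1 + e * t) - e * ln (1 + t) + cc * (t ^+ 2 - t ^+ 3 / (1 + t))); last first.
 by rewrite -cE /lratio lG lGe l1 l2; ring.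
have et0 : 0 <= e * t by rewrite mulr_ge0 ?(ltW t0)// (le_trans _ e1).
have /andP[a1 a2] := ln_cubic et0; have /andP[b1 b2] := ln_cubic (ltW t0).
have -> : 6 / y ^+ 3 = 6 * t ^+ 3 by rewrite /t exprVn.
have q0 : 0 <= t ^+ 3 / (1 + t) by rewrite divr_ge0 ?exprn_ge0 ?addr_ge0// ltW.
have q1 : t ^+ 3 / (1 + t) <= t ^+ 3.
 by rewrite ler_pdivrMr ?addr_gt0// ler_peMr ?exprn_ge0 ?(ltW t0)// lerDl ltW.
have c0 : 0 <= cc <= 1 by rewrite /cc; apply/andP; split; nra.
move: a1 a2 b1 b2; rewrite !exprMn; move: (ln (1 + e * t)) (ln (1 + t)) q0 q1 => L1 L2.
move: (t ^+ 3 / (1 + t)) => q q0 q1 a1 a2 b1 b2.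
have t30 : 0 <= t ^+ 3 by rewrite exprn_ge0// ltW.
have ce : cc * t ^+ 2 = e ^+ 2 * t ^+ 2 / 2 - e * (t ^+ 2 / 2) by rewrite /cc; ring.
have e0 : 0 <= e by exact: le_trans e1.
have eb1 := ler_wpM2l e0 b1; have eb2 := ler_wpM2l e0 b2.
have /andP[c00 c11] := c0.
have cq0 : 0 <= cc * q by exact: mulr_ge0.
have cq1 : cc * q <= t ^+ 3 by apply: le_trans q1; rewrite ler_piMl.
have e3 : e ^+ 3 * t ^+ 3 <= 8 * t ^+ 3.
 by rewrite ler_wpM2r// (_ : 8 = 2 ^+ 3); [rewrite lerXn2r ?nnegrE|ring].
have et3 : e * (t ^+ 3 / 3) <= 2 * (t ^+ 3 / 3) by rewrite ler_wpM2r// divr_ge0.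
rewrite mulrBr ce ler_norml; apply/andP; split; lra.
Qed.

Lemma lratio_asymptotic y : 2 <= y -> `|lratio y - cc / y| <= 6 / y ^+ 2.
Proof.
move=> y2; have e1' := e1; have e2' := e2; have y0 : 0 < y by apply: lt_le_trans y2.
pose H x := lratio x - cc / x.
have tel n : `|H (y + n%:R) - H y| <= 6 / y ^+ 2 - 6 / (y + n%:R) ^+ 2.
 elim: n => [|n ih]; first by rewrite addr0 !subrr normr0.
 have yn : 2 <= y + n%:R by rewrite (le_trans y2)// lerDl.
 have yn1 : 1 <= y + n%:R by apply: le_trans yn; rewrite (ler_nat R 1).
 have hs := lratio_step yn1; rewrite -natr1 addrA.
 rewrite (_ : _ - _ = (H (y + n%:R + 1) - H (y + n%:R)) + (H (y + n%:R) - H y)); last by ring.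
 apply: (le_trans (ler_normD _ _)).
 have aux (x : R) : 2 <= x -> 6 / x ^+ 3 <= 6 / x ^+ 2 - 6 / (x + 1) ^+ 2.
  move=> x2; have x0 : 0 < x by apply: lt_le_trans x2.
  rewrite -subr_ge0 (_ : _ - _ = 6 * (x ^+ 2 - x - 1) / (x ^+ 3 * (x + 1) ^+ 2)).
   have q : 0 <= x ^+ 2 - x - 1 by nra.
   apply: divr_ge0; first by rewrite mulr_ge0.
   by rewrite mulr_ge0 ?exprn_ge0 ?addr_ge0// ltW.
  have n1 : x + 1 != 0 by rewrite gt_eqF// addr_gt0.
  by field; rewrite n1 gt_eqF.
 have := lerD (le_trans hs (aux _ yn)) ih; rewrite -/(H _) -/(H _) => h; apply: (le_trans h).
 by apply: le_of_eq; ring.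
have lim n : `|H (y + n%:R)| <= 2 / (y + n%:R).
 have yn : 0 < y + n%:R by rewrite ltr_pwDl.
 have /andP[h1 h2] := lratio_bound yn; have c0 : 0 <= cc <= 1 by rewrite /cc; apply/andP; split; nra.
 have i0 : 0 < (y + n%:R)^-1 by rewrite invr_gt0.
 have /andP[c00 c11] := c0.
 rewrite /H; move: h1 h2; move: (lratio _) => L h1 h2; move: (_^-1) i0 h2 => i i0 h2.
 by rewrite ler_norml; apply/andP; split; nra.
have all n : `|H y| <= 6 / y ^+ 2 + 2 / (y + n%:R).
 rewrite -[H y](subrK (H (y + n%:R))); apply: (le_trans (ler_normD _ _)); apply: lerD (lim n).
 by rewrite distrC (le_trans (tel n))// gerBl divr_ge0// exprn_ge0// addr_ge0// ltW.
rewrite leNgt; apply/negP => h.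
pose d := `|H y| - 6 / y ^+ 2; have d0 : 0 < d by rewrite subr_gt0.
pose n := (Num.truncn (2 / d)).+1; have nn : 2 / d < n%:R by exact: truncnS_gt.
have := all n; rewrite -lerBlDl -/d leNgt => /negP; apply.
have yn : 0 < y + n%:R by rewrite ltr_pwDl.
rewrite ltr_pdivrMr// mulrC -ltr_pdivrMr//; apply: (lt_le_trans nn); by rewrite lerDr ltW.
Qed.
End Ratio.
End GammaFunction.

(** * Asymptotics of the orthonormal polynomials *)
Section GammaValues.
Variable R : realType.
Implicit Types (x al : R).
Local Notation Gi := (@Gamma_integral R).

Lemma Gamma_pos x : 0 < x -> Gamma x = Gi x.
Proof. by move=> x0; rewrite /Gamma x0 /= big_ord0 divr1 addr0. Qed.

Lemma Gamma_m1 al : 0 < al < 1 -> Gamma (al - 1) = Gi al / (al - 1).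
Proof.
move=> /andP[a0 a1]; rewrite /Gamma subr_gt0 ltNge (ltW a1) /=.
have -> : Num.truncn (- (al - 1)) = 0%N.
 by apply/truncn_def; rewrite opprB; apply/andP; split; lra.
by rewrite big_ord_recl big_ord0 mulr1 addr0 subrK.
Qed.

Lemma Gamma_m2 al : 0 < al < 1 -> Gamma (al - 1) = (al - 2) * Gamma (al - 2).
Proof.
move=> a01; rewrite Gamma_m1//; move: a01 => /andP[a0 a1].
have -> : Gamma (al - 2) = Gi al / ((al - 2) * (al - 1)).
 rewrite /Gamma (_ : (0 < al - 2) = false); last by apply/negbTE; rewrite -leNgt; lra.
 have -> : Num.truncn (- (al - 2)) = 1%N.
  by apply/truncn_def; rewrite opprB; apply/andP; split; lra.
 rewrite !big_ord_recl big_ord0 mulr1 addr0 /=.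
 have -> : al - 2 + (bump 0 0)%:R = al - 1 by rewrite /bump /=; ring.
 by have -> : al - 2 + 2 = al by ring.
by field; apply/andP; split; rewrite subr_eq0 lt_eqF//; lra.
Qed.

Lemma fact_Gamma n : (n`!%:R : R) = Gi n.+1%:R.
Proof.
elim: n => [|n ih]; first by rewrite Gamma_integral_1.
by rewrite factS natrM ih -[n.+2%:R]natr1 Gamma_integral_rec// ltr0n.
Qed.

Lemma gbin_Gamma al m : 0 < al -> (-1) ^+ m.+1 * gbin (1 - al) m.+1 =
 (al - 1) * Gi (al + m%:R) / (Gi al * m.+1`!%:R).
Proof.
move=> a0; have Ga := Gamma_integral_gt0 a0; elim: m => [|m ih].
 have -> : 1`! = 1%N by [].
 by rewrite gbinS gbin0 addr0 expr1; move: (Gi al) Ga => g g0; field; rewrite gt_eqF.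
rewrite gbinS exprS (_ : _ * _ = ((-1) ^+ m.+1 * gbin (1 - al) m.+1) * - ((1 - al - m.+1%:R) / m.+2%:R)); last by ring.
have am : 0 < al + m%:R by rewrite ltr_pwDl.
rewrite ih (_ : al + m.+1%:R = al + m%:R + 1); last by rewrite -natr1 addrA.
rewrite Gamma_integral_rec// (factS m.+1) natrM.
have f0 : m.+1`!%:R != 0 :> R by rewrite pnatr_eq0 -lt0n fact_gt0.
have m2 : m.+2%:R != 0 :> R by rewrite pnatr_eq0.
rewrite (_ : 1 - al - m.+1%:R = - (al + m%:R)); last by rewrite -natr1; ring.
move: (Gi al) Ga (Gi _) (m.+1`!%:R) f0 (m.+2%:R) m2 => g g0 h f f0 x x0.
by field; rewrite f0 x0 gt_eqF.
Qed.

Lemma quotient_exp (e t y p q u v : R) : 0 < t -> 0 < y -> 0 < p -> 0 < q -> 0 < u -> 0 < v ->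
 p / q * (u / v) / t `^ e =
 expR ((ln p - ln q - e * ln (t * y)) - (ln v - ln u - e * ln y)).
Proof.
move=> t0 y0 p0 q0 u0 v0; have te : 0 < t `^ e by exact: powR_gt0.
have L0 : 0 < p / q * (u / v) / t `^ e by rewrite divr_gt0// mulr_gt0// divr_gt0.
have <- : ln (p / q * (u / v) / t `^ e) = (ln p - ln q - e * ln (t * y)) - (ln v - ln u - e * ln y).
 have pq : 0 < p / q by exact: divr_gt0. have uv : 0 < u / v by exact: divr_gt0.
 have h1 : ln (p / q) = ln p - ln q by rewrite ln_div.
 have h2 : ln (u / v) = ln u - ln v by rewrite ln_div.
 have h3 : ln (t * y) = ln t + ln y by rewrite lnM.
 have h4 : ln (p / q * (u / v)) = ln (p / q) + ln (u / v) by rewrite lnM.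
 have h5 : ln (p / q * (u / v) / t `^ e) = ln (p / q * (u / v)) - ln (t `^ e).
  by rewrite ln_div ?posrE//; exact: mulr_gt0.
 rewrite h5 ln_powR h4 h1 h2 h3; ring.
by rewrite lnK ?posrE.
Qed.

(** Both Gamma quotients are values of the ratio [lratio] with e = 2 - al, at s y and at y. *)
Lemma Gamma_quotient (s : nat) al : (2 <= s)%N -> 0 < al < 1 -> exists K : R, 0 < K /\
 forall x y : R, 2 <= y -> x = s%:R * y ->
 `|Gi (x + (2 - al)) / Gi x * (Gi y / Gi (y + (2 - al))) / s%:R `^ (2 - al)
  - (1 - (2 - al) * (1 - al) / 2 * (s%:R - 1) / x)| <= K / x ^+ 2.
Proof.
move=> s2 /andP[a0 a1]; pose e := 2 - al; pose cc := e * (e - 1) / 2.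
have e1 : 1 <= e by rewrite /e; lra. have e2 : e <= 2 by rewrite /e; lra.
have ss : 2 <= s%:R :> R by rewrite (ler_nat R 2).
have s0 : 0 < s%:R :> R by lra.
have H := lratio_asymptotic (@Gamma_integral_gt0 R) (@Gamma_integral_rec R) (@Gamma_integral_shift R) e1 e2.
pose K0 := 6 * (1 + s%:R ^+ 2) : R; pose K1 := cc * (s%:R - 1) + K0.
have cc0 : 0 <= cc by rewrite /cc; nra.
have K00 : 0 < K0 by rewrite /K0; nra.
have K10 : 0 < K1 by rewrite /K1 ltr_wpDl// mulr_ge0//; lra.
pose K2 := K0 + 2 * K1 ^+ 2 + (expR K1 + 1 + K1) * (2 * K1) ^+ 2.
have K20 : 0 < K2.
 have h1 : 0 <= (expR K1 + 1 + K1) * (2 * K1) ^+ 2.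
  by apply: mulr_ge0 (sqr_ge0 _); have := expR_ge0 K1; lra.
 have h2 : 0 <= 2 * K1 ^+ 2 by rewrite mulr_ge0 ?sqr_ge0.
 by rewrite /K2; lra.
exists K2; split => // x y y2 xE.
have y0 : 0 < y by lra.
have x0 : 0 < x by rewrite xE mulr_gt0.
have x2 : 2 <= x by rewrite xE; nra.
have hx := H x x2; have hy := H y y2.
have ye : 0 < y + e by lra. have xe : 0 < x + e by lra.
have Gy := Gamma_integral_gt0 y0; have Gx := Gamma_integral_gt0 x0.
have Gye := Gamma_integral_gt0 ye; have Gxe := Gamma_integral_gt0 xe.
pose d := lratio Gi e x - lratio Gi e y.
have E : Gi (x + e) / Gi x * (Gi y / Gi (y + e)) / s%:R `^ e = expR d.
 rewrite (quotient_exp e s0 y0 Gxe Gx Gy Gye); congr expR.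
 by rewrite -xE /d /lratio.
rewrite -/e E (_ : 1 - al = e - 1); last by rewrite /e; ring.
rewrite -/cc /d; clear Gy Gx Gye Gxe E d.
move: (lratio Gi e x) (lratio Gi e y) hx hy => lx ly hx hy; pose d := lx - ly; rewrite -/d.
have s10 : 0 <= s%:R - 1 :> R by lra.
have x1 : 1 <= x by lra.
have d1 : `|d + cc * (s%:R - 1) / x| <= K0 / x ^+ 2.
 have -> : d + cc * (s%:R - 1) / x = (lx - cc / x) - (ly - cc / y).
  have y0' : y != 0 by rewrite gt_eqF.
  have s0' : s%:R != 0 :> R by rewrite gt_eqF.
  by rewrite /d xE; field; rewrite y0' s0'.
 have -> : K0 / x ^+ 2 = 6 / x ^+ 2 + 6 / y ^+ 2.
  have y0' : y != 0 by rewrite gt_eqF.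
  have s0' : s%:R != 0 :> R by rewrite gt_eqF.
  by rewrite /K0 xE; field; rewrite y0' s0'.
 exact: le_trans (ler_normB _ _) (lerD hx hy).
have d2 : `|d| <= K1 / x.
 rewrite -[d](addrK (cc * (s%:R - 1) / x)); apply: (le_trans (ler_normB _ _)).
 rewrite /K1 mulrDl addrC; apply: lerD; first by rewrite (ger0_norm (divr_ge0 (mulr_ge0 cc0 s10) (ltW x0))).
 apply: (le_trans d1); rewrite ler_pdivrMr ?exprn_gt0// expr2 mulrA divfK ?gt_eqF//.
 by rewrite ler_peMr ?(ltW K00).
have d3 : `|expR d - 1 - d| <= (2 * K1 ^+ 2 + (expR K1 + 1 + K1) * (2 * K1) ^+ 2) / x ^+ 2.
 have dx : `|d| ^+ 2 <= K1 ^+ 2 / x ^+ 2.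
  by rewrite -expr_div_n lerXn2r ?nnegrE ?normr_ge0 ?divr_ge0 ?(ltW x0) ?(ltW K10).
 have [h|h] := leP `|d| 2^-1.
  apply: (le_trans (expR_quad h)); apply: (@le_trans _ _ (2 * (K1 ^+ 2 / x ^+ 2))).
   by rewrite ler_wpM2l// -[d ^+ 2]ger0_norm ?sqr_ge0// normrX.
  rewrite mulrA ler_wpM2r ?invr_ge0 ?sqr_ge0// lerDl.
  by apply: mulr_ge0 (sqr_ge0 _); have := expR_ge0 K1; lra.
 have dK : `|d| <= K1.
  by apply: (le_trans d2); rewrite ler_pdivrMr// ler_peMr ?(ltW K10).
 have b1 : `|expR d - 1 - d| <= expR K1 + 1 + K1.
  apply: (le_trans (ler_normB _ _)); apply: lerD => //; apply: (le_trans (ler_normB _ _)).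
  rewrite normr1 lerD2r ger0_norm ?expR_ge0// ler_expR.
  exact: le_trans (ler_norm d) dK.
 apply: (le_trans b1); rewrite ler_pdivlMr ?exprn_gt0//.
 have xk : x ^+ 2 <= (2 * K1) ^+ 2.
  rewrite lerXn2r ?nnegrE ?mulr_ge0 ?(ltW x0) ?(ltW K10)//.
  by move: (lt_le_trans h d2); rewrite ltr_pdivlMr//; lra.
 apply: (@le_trans _ _ ((expR K1 + 1 + K1) * (2 * K1) ^+ 2)); last by rewrite lerDr mulr_ge0 ?exprn_ge0// ltW.
 by rewrite ler_wpM2l// addr_ge0 ?(ltW K10)// addr_ge0 ?expR_ge0.
rewrite (_ : _ - _ = (expR d - 1 - d) + (d + cc * (s%:R - 1) / x)); last by ring.
apply: (le_trans (ler_normD _ _)); rewrite /K2 -(addrA K0) [leRHS]mulrDl [leLHS]addrC.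
exact: lerD d1 d3.
Qed.
End GammaValues.

Section Final.
Variables (R : realType) (s : nat) (r : R).
Hypotheses (s2 : (2 <= s)%N) (r1 : 1 < r).
Local Notation C := R[i].
Implicit Types (z w h : C).
Local Notation uu := (@uu R s).
Local Notation tt := (@tt R s).
Local Notation lem := (lem s r).
Local Notation pole := (pole s r).
Local Notation gam := (gam s r).
Variables (P : nat -> {poly C}).
Hypothesis hP : orthonormal_polynomials lem P.
Local Notation Gi := (@Gamma_integral R).

Let s0 : (0 < s)%N := ltnW s2.

(** The choice lam = 1 / (2 a) absorbs half of [x]. *)
Lemma eliminate (x a : R) : 0 <= a ->
 (forall lam, 0 < lam -> x <= a * (lam * x + lam^-1)) -> x <= 4 * a ^+ 2.
Proof.
rewrite le_eqVlt => /orP[/eqP<-|a0] h.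
 by have := h 1 ltr01; rewrite mul0r expr0n /= mulr0.
have l0 : 0 < (2 * a)^-1 by rewrite invr_gt0 mulr_gt0.
have := h _ l0; rewrite invrK (_ : a * _ = x / 2 + 2 * a ^+ 2); last by field; rewrite gt_eqF.
lra.
Qed.

(** ** The residue class s - 1 *)
Lemma bser_exp0 (x : C) : normc x < 1 -> bser 0 x = 1.
Proof.
move=> x1; have a1 : -1 <= (1 : R) <= 1 by rewrite lexx andbT (le_trans _ ler01) ?lerN10.
have := @bser_pow R 1 0 x a1; rewrite mul0r expr0 => -> //.
by rewrite ler01 andbT lerN10.
Qed.

Lemma last_class m z : (P (s * m + s.-1)).[z] =
 (Num.sqrt (s * m + s.-1).+1%:R / r ^+ (s * m + s.-1).+1)%:C * z ^+ s.-1 * (z ^+ s - 1) ^+ m.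
Proof.
have ls : (s.-1 < s)%N by rewrite prednK.
have [K [K0 hK]] : exists K, 0 < K /\ forall F g (sig lam : R), annular s r F -> 0 <= sig ->
 (forall z, lem z -> tA s r <= tt z -> normc (F z) <= sig) -> g.[0] = 0 -> 0 < lam ->
 normc (Dfun s r F g) <= K * sig * (lam * pnorm s r g^`() + lam^-1).
 by have [K K0 hK] := D_bound s2 r1; exists K.
have sq : size ('X^m : {poly C}) = m.+1 by rewrite size_polyXn.
have lq : lead_coef ('X^m : {poly C}) = 1 by rewrite lead_coefXn.
have aN : annular s r (fun=> 0).
 split=> [w _ _|]; first by exists 0; exact: wdiff_cst.
 by exists 0; split => // w _ _; rewrite normc0.
have N0 g : Dfun s r (fun=> 0) g = 0.
 transitivity (0 * Dfun s r (fun=> 0) g); last exact: mul0r.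
 by rewrite -(DfunZl s2 r1 0 g aN); congr (Dfun s r _ g); apply/funext => w; rewrite mul0r.
have hq w : lem w -> tA s r <= tt w ->
  normc ((upoly s s.-1 'X^m).[w] - mainF s s.-1 m w - 0) <= 0.
 move=> wG wA; have [u0 x1] := outer_uuV (lt_le_trans (tA_gt1 s2 r1) wA).
 rewrite /mainF /alpha prednK// divff; last by rewrite pnatr_eq0 -lt0n.
 by rewrite subrr bser_exp0// mulr1 horner_upoly hornerXn subrr subr0 normc0.
have gb := gap_bound s2 r1 ls hP hK sq lq aN N0 (lexx 0) hq.
have kb := kappa_bound s2 r1 ls hP hK sq lq aN N0 (lexx 0) hq.
set n := (s * m + s.-1)%N in gb kb *.
have [k k0 kE] := kappa_real s.-1 hP m; rewrite -/n in kE.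
have g0 : pnorm s r (gap s s.-1 P m 'X^m) = 0.
 apply/eqP; rewrite eq_le pnorm_ge0 andbT.
 by have := gb 1 ltr01; rewrite mulr0 mul0r.
have gz : gap s s.-1 P m 'X^m = 0.
 apply: (orth_zero s2 r1 hP (leqnn _)) => j _; apply/eqP.
 rewrite -normc_eq0 eq_le normc_ge0 andbT; apply/ler_addgt0Pr => e e0; rewrite add0r.
 pose lam := e / (pnorm s r (P j) + 1).
 have p0 : 0 < pnorm s r (P j) + 1 by rewrite ltr_wpDl// pnorm_ge0.
 have l0 : 0 < lam by rewrite divr_gt0.
 apply: (le_trans (pip_bound s2 r1 (P j) _ l0)); rewrite g0 mulr0 addr0.
 by rewrite /lam mulrAC ler_pdivrMr// ler_wpM2l ?(ltW e0)// lerDl.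
have kk : k = Num.sqrt n.+1%:R / r ^+ n.+1.
 have := kb 1 k ltr01 kE; rewrite mulr0 mul0r normr_le0 subr_eq0 => /eqP.
 rewrite /mass -/n => e; have p0 := pi_gt0 R; have n0 : 0 < n.+1%:R :> R by rewrite ltr0n.
 have rn : 0 < r ^+ n.+1 by rewrite exprn_gt0// (lt_trans ltr01).
 have e2 : k ^+ 2 = (Num.sqrt n.+1%:R / r ^+ n.+1) ^+ 2.
  rewrite expr_div_n sqr_sqrtr ?ltW// -exprM mulnC.
  have r2 : 0 < r ^+ (2 * n.+1) by rewrite exprn_gt0// (lt_trans ltr01).
  have k2 : 0 < k ^+ 2 by rewrite exprn_gt0.
  move: e; move: (k ^+ 2) (r ^+ _) (pi) (n.+1%:R) k2 r2 p0 n0 => a b p q a0 b0 p0 q0 e.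
  have -> : a = p / (p / a) by field; rewrite !gt_eqF.
  by rewrite e; field; rewrite !gt_eqF.
 have q0 : 0 <= Num.sqrt n.+1%:R / r ^+ n.+1 by rewrite divr_ge0 ?sqrtr_ge0// ltW.
 by apply/eqP; rewrite -(eqrXn2 (n := 2)) ?(ltW k0)//; apply/eqP.
have Pn : P n = lead_coef (P n) *: upoly s s.-1 'X^m.
 have l0 : lead_coef (P n) != 0 by have := lead_P hP n; exact: lt0r_neq0.
 have := gz; rewrite /gap -/n => /eqP; rewrite subr_eq0 => /eqP->.
 by rewrite scalerA divff// scale1r.
by rewrite Pn hornerZ horner_upoly hornerXn uuE kE kk mulrA.
Qed.

(** ** The other residue classes *)
Section Class.
Variable l : nat.
Hypothesis l1s : (l.+1 < s)%N.
Let ls : (l < s)%N := ltnW l1s.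
Local Notation al := (alpha R s l).
Local Notation k0 := (s - l - 1)%N.
Local Notation kernels := (kernels s r l).
Local Notation cf1 := (cf1 R s l).
Local Notation small := (small R s l).
Definition index m := (s * m + l)%N.
Local Notation n_ := index.
Definition leading m : R := Re (lead_coef (P (n_ m))).

Lemma leadingP m : 0 < leading m /\ lead_coef (P (n_ m)) = (leading m)%:C.
Proof.
have [k k0 kE] := kappa_real l hP m; rewrite -/(n_ m) in kE.
by rewrite /leading kE Re_real.
Qed.

Lemma small_le1 m : small m <= 1.
Proof.
have a0 := al_gt0 R s2 l; have a1 := al_lt1 R s2 l1s.
have g : `|cf1 m| <= 1 by apply: gbin_bound; apply/andP; split; lra.
rewrite /small ler_pdivrMr ?exprn_gt0 ?ltr0n// mul1r (le_trans g)//.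
by rewrite exprn_ege1// (ler_nat R 1).
Qed.

Lemma monic_asymptotics (q0 : R) : 0 <= q0 < 1 -> exists K N, 0 < K /\
 forall m, (N <= m)%N ->
  (forall z, normc (uu z) <= q0 ->
   normc ((leading m)^-1%:C * (P (n_ m)).[z] - kernels m z) <= K * small m) /\
  (forall lam, 0 < lam ->
   `|pi / leading m ^+ 2 - mass s r l m| <= K * (lam * (pi / leading m ^+ 2) + lam^-1)).
Proof.
move=> q01; have /andP[q00 q11] := q01.
have [K1 [M0 [K10 h1]]] := approximant s2 r1 l1s q01.
have [K2 K20 h2] := D_bound s2 r1.
have B1 := B_gt1 s2 r1; have [K3 K30 h3] := point_evaluation s2 r1 B1.
pose S := Num.sqrt (K3 * (4 * (K2 * K1) ^+ 2)).
have S0 : 0 <= S by exact: sqrtr_ge0.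
exists (K1 + S + K2 * K1), M0; split; first by have := mulr_gt0 K20 K10; lra.
move=> m mM; have [q [sq lq hA hI]] := h1 m mM; have sm := small_ge0 R s l m.
have [aN N0] := kernels_annular s2 r1 l1s m.
have sig0 : 0 <= K1 * small m by rewrite mulr_ge0// ltW.
have gb := gap_bound s2 r1 ls hP h2 sq lq aN N0 sig0 hA.
have kb := kappa_bound s2 r1 ls hP h2 sq lq aN N0 sig0 hA.
have [k0 kE] := leadingP m; split=> [z uq|lam lam0]; last first.
 apply: (le_trans (kb lam _ lam0 kE)); rewrite ler_wpM2r//.
  by rewrite addr_ge0 ?invr_ge0 ?(ltW lam0)// mulr_ge0 ?(ltW lam0)// divr_ge0 ?sqr_ge0 ?pi_ge0.
 rewrite mulrA (le_trans (y := K2 * K1)) ?lerDr ?addr_ge0 ?(ltW K10)//.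
 by rewrite ler_piMr ?small_le1// mulr_ge0// ltW.
have pg := eliminate (mulr_ge0 (ltW K20) sig0) gb.
have t1 : tt z <= 1 by rewrite ttE exprn_ile1 ?normc_ge0// (le_trans uq)// ltW.
have hg := h3 (gap s l P m q) z t1.
have gS : normc (gap s l P m q).[z] <= S * small m.
 rewrite -(@ler_pXn2r _ 2) ?nnegrE ?normc_ge0 ?mulr_ge0// exprMn sqr_sqrtr; last first.
  by rewrite !mulr_ge0 ?sqr_ge0// ltW.
 apply: (le_trans hg); apply: (le_trans (ler_wpM2l (ltW K30) pg)).
 by apply: le_of_eq; ring.
have e : (leading m)^-1%:C * (P (n_ m)).[z] = (upoly s l q).[z] - (gap s l P m q).[z].
 rewrite /gap hornerD hornerN hornerZ -/(n_ m) kE -fmorphV.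
 by rewrite opprD addNKr opprK.
rewrite e addrAC; apply: (@le_trans _ _ ((K1 + S) * small m)); last first.
 by rewrite ler_wpM2r// lerDl mulr_ge0// ltW.
by rewrite mulrDl; apply: normc_le2; rewrite ?normcN ?hI.
Qed.

Lemma root_near1 (w e : R) : 0 <= e -> e <= 2^-1 -> 0 < w -> `|w^-2 - 1| <= e * (w^-2 + 1) ->
 `|w - 1| <= 12 * e.
Proof.
move=> e0 e1 w0; pose v := w^-2; rewrite -/v => h.
have v0 : 0 < v by rewrite invr_gt0 exprn_gt0.
have ww : v * w ^+ 2 = 1 by rewrite mulVf// gt_eqF// exprn_gt0.
move: h; rewrite ler_norml => /andP[h1 h2].
have v1 : 3^-1 <= v by nra. have v3 : v <= 3 by nra.
have w3 : w ^+ 2 <= 3 by nra.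
have d1 : `|w ^+ 2 - 1| <= 12 * e.
 have -> : w ^+ 2 - 1 = w ^+ 2 * (1 - v) by rewrite mulrBr mulr1 [w ^+ 2 * v]mulrC ww.
 rewrite normrM ger0_norm ?sqr_ge0// (_ : 12 * e = 3 * (4 * e)); last by ring.
 by rewrite ler_pM ?sqr_ge0// ler_norml; apply/andP; split; nra.
apply: le_trans d1; rewrite (_ : w ^+ 2 - 1 = (w - 1) * (w + 1)); last by ring.
by rewrite normrM [X in _ <= _ * X]ger0_norm ?addr_ge0 ?(ltW w0)// ler_peMr ?lerDr// ltW.
Qed.

Definition norming m : R := leading m * r ^+ (n_ m).+1 / Num.sqrt (n_ m).+1%:R.

Lemma norming_near1 : exists K N, 0 < K /\ forall m, (N <= m)%N ->
 `|norming m - 1| <= K / (n_ m).+1%:R ^+ 2.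
Proof.
have q01 : 0 <= (0 : R) < 1 by rewrite lexx ltr01.
have [K [N [K0 h]]] := monic_asymptotics q01.
have r0 : 0 < r by exact: lt_trans r1.
have t01 : 0 <= r^-1 < 1 by rewrite invr_ge0 (ltW r0) invf_lt1.
have [M M0 hM] := pow4_bound t01.
pose A := K * M; have A0 : 0 < A by rewrite mulr_gt0.
exists (12 * A), (maxn N (Num.truncn (2 * A)).+1); split; first by rewrite mulr_gt0.
move=> m; rewrite geq_max => /andP[mN mA]; have [_ hk] := h m mN.
have [k0 kE] := leadingP m; set n := n_ m in k0 kE hk *.
have n0 : 0 < n.+1%:R :> R by rewrite ltr0n.
have n1 : 1 <= n.+1%:R :> R by rewrite (ler_nat R 1).
have p1 : 1 <= pi :> R by apply: le_trans (pi_ge2 R); rewrite (ler_nat R 1).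
have p0 : 0 < pi :> R by exact: pi_gt0.
have rn : 0 < r ^+ n.+1 by rewrite exprn_gt0.
pose sq := Num.sqrt (mass s r l m).
have mE : mass s r l m = pi * (r ^+ n.+1) ^+ 2 / n.+1%:R by rewrite /mass -exprM mulnC.
have m0 : 0 < mass s r l m by rewrite mE divr_gt0// mulr_gt0// exprn_gt0.
have sq0 : 0 < sq by rewrite sqrtr_gt0.
have sqE : sq ^+ 2 = mass s r l m by rewrite sqr_sqrtr// ltW.
pose w := norming m.
have w0 : 0 < w by rewrite /w /norming divr_gt0 ?mulr_gt0 ?sqrtr_gt0.
have wE : w^-2 = pi / leading m ^+ 2 / mass s r l m.
 rewrite /w /norming -/n expr_div_n exprMn sqr_sqrtr ?(ltW n0)// mE.
 move: (leading m) k0 (r ^+ _) rn (pi) p0 (n.+1%:R) n0 => a a0 b b0 p p00 c c0.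
 by field; rewrite !gt_eqF.
pose e := K / sq.
have eA : e <= A / n.+1%:R ^+ 2.
 rewrite /e /A -mulrA ler_wpM2l ?(ltW K0)// -[leLHS]div1r ler_pdivrMr// mulrAC ler_pdivlMr ?exprn_gt0// mul1r.
 have h4 : n.+1%:R ^+ 4 <= M * r ^+ n.+1.
  by have := hM n.+1; rewrite exprVn ler_pdivrMr.
 have sq1 : r ^+ n.+1 <= sq * n.+1%:R ^+ 2.
  rewrite -(@ler_pXn2r _ 2) ?nnegrE ?mulr_ge0 ?(ltW sq0) ?(ltW rn) ?exprn_ge0// exprMn sqE mE.
  move: (r ^+ n.+1) (n.+1%:R) n0 n1 => b c c0 c1.
  rewrite (_ : pi * b ^+ 2 / c * (c ^+ 2) ^+ 2 = b ^+ 2 * (pi * c ^+ 3)); last by field; rewrite gt_eqF.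
  by rewrite ler_peMr ?sqr_ge0// mulr_ege1// exprn_ege1.
 have c2 : 0 < n.+1%:R ^+ 2 :> R by exact: exprn_gt0.
 rewrite -(ler_pM2r c2) -exprD; apply: (le_trans h4).
 by rewrite -mulrA ler_wpM2l// ltW.
have e0 : 0 <= e by rewrite divr_ge0// ltW.
have e1 : e <= 2^-1.
 apply: (le_trans eA); rewrite ler_pdivrMr ?exprn_gt0// mulrC ler_pdivlMr// mulrC.
 apply: (@le_trans _ _ n.+1%:R); last by rewrite expr2 ler_peMr.
 apply: ltW; apply: lt_le_trans (truncnS_gt _) _; rewrite ler_nat.
 apply: (leq_trans mA); apply: leqW; rewrite /n /n_.
 by apply: leq_trans (leq_addr _ _); rewrite leq_pmull.
have := hk sq^-1; rewrite invr_gt0 sq0 invrK => /(_ isT) hh.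
have hw : `|w^-2 - 1| <= e * (w^-2 + 1).
 rewrite wE -sqE; rewrite -sqE in hh; move: hh; move: (pi / _) => X hh.
 have -> : X / sq ^+ 2 - 1 = (X - sq ^+ 2) / sq ^+ 2 by field; rewrite gt_eqF.
 rewrite normrM normfV [`|sq ^+ 2|]ger0_norm ?sqr_ge0// ler_pdivrMr ?exprn_gt0//.
 apply: (le_trans hh); rewrite /e; apply: le_of_eq.
 by field; rewrite gt_eqF.
apply: (le_trans (root_near1 e0 e1 w0 hw)).
by rewrite -mulrA ler_wpM2l.
Qed.

Local Notation e := (2 - al).
Definition first_coef : R := e * (1 - al) / 2 * (s%:R - 1).
Local Notation a_ := first_coef.
Definition ka z : C := pole k0 z.
Definition kb z : C := pole (s + k0) z - gam * k0%:R * pole k0 z.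
Definition c0 : R := s%:R `^ e / Gamma (al - 1).

(** P_n in the normalization of the asymptotic expansion. *)
Definition scaled m z : C :=
 ((-1) ^+ m * r ^+ (n_ m).+1 * Gi ((n_ m)%:R + (3 - al)))%:C * (P (n_ m)).[z]
  / ((n_ m)`!%:R * Num.sqrt (n_ m).+1%:R)%:C.

Lemma cf1_neq0 m : cf1 m != 0.
Proof.
apply: gbin_neq0 => i; have a0 := al_gt0 R s2 l; have a1 := al_lt1 R s2 l1s.
case: i => [|i]; first by rewrite gt_eqF// subr_gt0.
by rewrite lt_eqF// (@lt_le_trans _ _ 1)// ?(ler_nat R 1)//; lra.
Qed.

Definition quot m : R :=
 Gi ((n_ m).+1%:R + e) / Gi (n_ m).+1%:R * (Gi (al + m%:R) / Gi (al + m%:R + e)).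

(** All normalizing factors are collected in [norming] and a quotient of Gamma values, both
 close to 1 after division by s^e. *)
Lemma scaledE m z : scaled m z = (norming m * (quot m / s%:R `^ e))%:C *
 (c0%:C * (- (cf1 m)^-1%:C * ((leading m)^-1%:C * (P (n_ m)).[z]))).
Proof.
have al0 := al_gt0 R s2 l; have al1 := al_lt1 R s2 l1s.
have [k0 _] := leadingP m; have c10 := cf1_neq0 m.
have p0 : 0 < s%:R `^ e :> R by rewrite powR_gt0// ltr0n.
have q0 : 0 < Num.sqrt (n_ m).+1%:R :> R by rewrite sqrtr_gt0 ltr0n.
have f0 : 0 < (n_ m)`!%:R :> R by rewrite ltr0n fact_gt0.
have al01 : 0 < al < 1 by rewrite al0.
have Ga := Gamma_integral_gt0 al0.
have E : (-1) ^+ m * Gi ((n_ m)%:R + (3 - al)) / (n_ m)`!%:R =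
  - (quot m / Gamma (al - 1) / cf1 m).
 have := gbin_Gamma m al0; rewrite -/(cf1 m) fact_Gamma => g.
 have {}g : cf1 m = (-1) ^+ m.+1 * ((al - 1) * Gi (al + m%:R) / (Gi al * Gi m.+2%:R)).
  by rewrite -g mulrA -exprMn mulrNN mulr1 expr1n mul1r.
 have gm : 0 < Gi (al + m%:R) by rewrite Gamma_integral_gt0// ltr_pwDl.
 have gm2 : 0 < Gi m.+2%:R by rewrite Gamma_integral_gt0// ltr0n.
 have gn : 0 < Gi (n_ m).+1%:R by rewrite Gamma_integral_gt0// ltr0n.
 have e1 : (n_ m).+1%:R + e = (n_ m)%:R + (3 - al) by rewrite -natr1; ring.
 have e2 : al + m%:R + e = m.+2%:R by rewrite -[m.+2]addn2 natrD; ring.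
 rewrite /quot e1 e2 fact_Gamma Gamma_m1// g exprS.
 have a1 : al - 1 != 0 by rewrite lt_eqF// subr_lt0.
 have s1 : (-1) ^+ m != 0 :> R by rewrite expf_neq0// oppr_eq0 oner_eq0.
 have ss : (-1) ^+ m * (-1) ^+ m = 1 :> R by rewrite -exprMn mulrNN mulr1 expr1n.
 move: (Gi (_ + (3 - _))) (Gi (al + _)) gm (Gi m.+2%:R) gm2 (Gi (n_ m).+1%:R) gn (Gi al) Ga.
 move=> x1 x2 x20 x3 x30 x4 x40 x5 x50.
 have uE : (-1) ^+ m = ((-1) ^+ m)^-1 :> R by apply: (mulfI s1); rewrite ss divff.
 rewrite -mulrA {1}uE; move: ((-1) ^+ m) s1 => u u0.
 by field; rewrite a1 u0 !gt_eqF.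
have F1 (x y : R) (p : C) : x%:C * p / y%:C = (x / y)%:C * p.
 by rewrite rmorphM fmorphV mulrAC.
have F2 (x y u v : R) (p : C) : x%:C * (y%:C * (- u%:C * (v%:C * p))) = (x * (y * (- u * v)))%:C * p.
 by rewrite !(rmorphM, rmorphN) /=; ring.
rewrite /scaled F1 F2.
congr (_%:C * _); rewrite /norming /c0.
rewrite (_ : _ * _ / (_ * _) = ((-1) ^+ m * Gi ((n_ m)%:R + (3 - al)) / (n_ m)`!%:R) * (r ^+ (n_ m).+1 / Num.sqrt (n_ m).+1%:R)); last first.
 by move: (Gi _) => x; field; rewrite !gt_eqF.
rewrite E; have G0 : Gamma (al - 1) != 0.
 by rewrite Gamma_m1// mulf_neq0//; [rewrite gt_eqF | rewrite invr_eq0 lt_eqF// subr_lt0].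
move: (quot m) (Gamma _) G0 (r ^+ _) => x g g0 y.
by field; rewrite g0 c10 !gt_eqF.
Qed.

Lemma kernels_bounded (q0 : R) : 0 <= q0 < 1 -> exists2 K : R, 0 < K &
 forall z, normc (uu z) <= q0 -> normc (ka z) <= K /\ normc (kb z) <= K.
Proof.
move=> /andP[q00 q1]; have q10 : 0 < 1 - q0 by rewrite subr_gt0.
have [L L0 hL] := normc_zl s2 r1 l; have [_ [M M0 hM]] := nice_kap s2 r1.
pose D : R := 1 + normc (delta s r l) * (1 + q0).
have D0 : 0 <= D by rewrite addr_ge0// mulr_ge0 ?normc_ge0 ?addr_ge0.
pose K1 := L * M ^+ l.+1 / (1 - q0); pose K2 := L * M ^+ l.+1 * D / (1 - q0) ^+ 2.
have K10 : 0 <= K1 by rewrite divr_ge0 ?mulr_ge0 ?exprn_ge0// ltW.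
have K20 : 0 <= K2 by rewrite divr_ge0 ?mulr_ge0 ?exprn_ge0// ltW.
exists (1 + K1 + K2); first by rewrite -addrA ltr_pwDl// addr_ge0.
move=> z uq.
have zG : lem z.
 by apply/(lemE s2 r1); apply: (le_lt_trans uq); exact: lt_trans (rs_gt1 s2 r1).
have zs : z ^+ s = 1 + uu z by rewrite uuE addrC subrK.
have w1 : 1 - q0 <= normc (z ^+ s).
 by rewrite zs; have := normc_lb 1 (uu z); rewrite (normc_nat R 1); apply: le_trans; rewrite lerD2l lerN2.
have w2 : normc (z ^+ s) <= 1 + q0 by rewrite zs normc_le2// (normc_nat R 1).
have w0 : 0 < normc (z ^+ s) by exact: lt_le_trans w1.
have z0 : z != 0.
 by apply/eqP => z0; move: w0; rewrite z0 expr0n gtn_eqF// normc0 ltxx.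
have yk : normc (z ^+ l * kap s r z ^+ l.+1) <= L * M ^+ l.+1.
 apply: normcM_le (hL z zG) _; rewrite normcX lerXn2r ?nnegrE ?normc_ge0//; exact: hM.
split.
 rewrite /ka (pole_first s2 r1 l1s zG z0); apply: (@le_trans _ _ K1); last by lra.
 rewrite normcM_le// normcV lef_pV2 ?posrE//.
rewrite /kb (pole_second s2 r1 l1s zG z0); apply: (@le_trans _ _ K2); last by lra.
apply: normcM_le; last by rewrite normcV normcX lef_pV2 ?posrE ?exprn_gt0// lerXn2r ?nnegrE ?normc_ge0// ltW.
apply: (normcM_le yk); apply: normc_le2; first by rewrite (normc_nat R 1).
exact: normcM_le.
Qed.

Lemma gain_asymptotics : exists K N, 0 < K /\ forall m, (N <= m)%N ->
 `|norming m * (quot m / s%:R `^ e) - (1 - a_ / (n_ m).+1%:R)| <= K / (n_ m).+1%:R ^+ 2.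
Proof.
have al0 := al_gt0 R s2 l; have al1 := al_lt1 R s2 l1s.
have al01 : 0 < al < 1 by rewrite al0.
have [K1 [N [K10 h1]]] := norming_near1; have [K2 [K20 h2]] := Gamma_quotient s2 al01.
have ss : 2 <= s%:R :> R by rewrite (ler_nat R 2).
have a0 : 0 <= a_ by rewrite /first_coef !mulr_ge0//; lra.
exists (K1 * (1 + a_ + K2) + K2), (maxn N 2); split.
 by rewrite addr_gt0// mulr_gt0//; lra.
move=> m; rewrite geq_max => /andP[mN m2].
have y2 : 2 <= al + m%:R.
 by rewrite (@le_trans _ _ m%:R) ?(ler_nat R 2)// lerDr ltW.
have xE : s%:R * (al + m%:R) = (n_ m).+1%:R.
 have s0' : s%:R != 0 :> R by rewrite pnatr_eq0 -lt0n.
 by rewrite mulrDr /alpha mulrC divfK// /index -addnS natrD natrM addrC.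
have := h2 _ _ y2 (esym xE); rewrite -/(quot m) -/a_.
have := h1 m mN; have x1 : 1 <= (n_ m).+1%:R :> R by rewrite (ler_nat R 1).
set w := norming m; set v := quot m / _.
move: ((n_ m).+1%:R) x1 w v => x x1 w v hw hv.
have x0 : 0 < x by lra. have x20 : 0 < x ^+ 2 by exact: exprn_gt0.
have i1 : x^-1 <= 1 by rewrite invf_le1.
have i2 : (x ^+ 2)^-1 <= 1 by rewrite invf_le1// exprn_ege1.
have i10 : 0 <= x^-1 by rewrite invr_ge0 ltW.
have v1 : `|v| <= 1 + a_ + K2.
 rewrite -[v](subrK (1 - a_ / x)); apply: (le_trans (ler_normD _ _)); rewrite addrC; apply: lerD.
  apply: (le_trans (ler_normB _ _)); rewrite normr1 lerD2l (ger0_norm (divr_ge0 a0 (ltW x0))).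
  by rewrite ler_piMr.
 by apply: (le_trans hv); rewrite ler_piMr// ltW.
rewrite (_ : w * v - _ = (w - 1) * v + (v - (1 - a_ / x))); last by ring.
apply: (le_trans (ler_normD _ _)); rewrite [leRHS]mulrDl; apply: lerD => //.
by rewrite normrM mulrAC ler_pM.
Qed.

(** The error of the second order expansion, split into the three sources: the gain [g], the
 index shift in the second coefficient, and the remainder. *)
Lemma expansion_identity (n : nat) (g b a t c : R) (x y err : C) :
 n%:R * (g%:C * (c%:C * (x + b%:C * y + err)) - c%:C * x) - c%:C * (- a%:C * x + t%:C * y) =
 c%:C * ((n%:R * (g - 1) + a)%:C * x + (n%:R * g * b - t)%:C * y + g%:C * (n%:R * err)).
Proof.
have h1 : (n%:R * (g - 1) + a)%:C = n%:R * (g%:C - 1) + a%:C.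
 by rewrite rmorphD rmorphM rmorphB rmorph_nat rmorph1.
have h2 : (n%:R * g * b - t)%:C = n%:R * g%:C * b%:C - t%:C.
 by rewrite rmorphB !rmorphM rmorph_nat.
rewrite h1 h2; move: (g%:C) (b%:C) (a%:C) (t%:C) (c%:C) => g' b' a' t' c'; ring.
Qed.

Theorem class_asymptotics (q0 : R) : 0 <= q0 < 1 -> exists K N, 0 < K /\
 forall m, (N <= m)%N -> forall z, normc (uu z) <= q0 ->
 normc (scaled m z - c0%:C * ka z) <= K / (n_ m)%:R /\
 normc ((n_ m)%:R * (scaled m z - c0%:C * ka z)
   - c0%:C * (- a_%:C * ka z + (s%:R * e)%:C * kb z)) <= K / (n_ m)%:R.
Proof.
move=> q01; have al0 := al_gt0 R s2 l; have al1 := al_lt1 R s2 l1s.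
have [K1 [N1 [K10 h1]]] := monic_asymptotics q01.
have [K2 [N2 [K20 h2]]] := gain_asymptotics.
have [K3 K30 h3] := kernels_bounded q01.
have ss : 2 <= s%:R :> R by rewrite (ler_nat R 2).
have a0 : 0 <= a_ by rewrite /first_coef !mulr_ge0//; lra.
pose A := K2 + a_; have A0 : 0 < A by rewrite ltr_pwDl.
pose T := A * K3 + (A * (s%:R * e) + 2 * s%:R ^+ 2 * e) * K3 + (1 + A) * (s%:R ^+ 2 * K1).
have se0 : 0 <= s%:R * e by rewrite mulr_ge0//; lra.
have T0 : 0 < T.
 have t1 : 0 < A * K3 by exact: mulr_gt0.
 have t2 : 0 <= (A * (s%:R * e) + 2 * s%:R ^+ 2 * e) * K3.
  have q1 : 0 <= A * (s%:R * e) by rewrite mulr_ge0// ltW.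
  have q2 : 0 <= 2 * s%:R ^+ 2 * e by rewrite mulr_ge0 ?mulr_ge0 ?sqr_ge0//; lra.
  by rewrite mulr_ge0 ?addr_ge0// ltW.
 have t3 : 0 <= (1 + A) * (s%:R ^+ 2 * K1).
  exact: mulr_ge0 (addr_ge0 ler01 (ltW A0)) (mulr_ge0 (sqr_ge0 _) (ltW K10)).
 by rewrite /T; lra.
pose Q := `|c0| * T + `|c0| * (a_ * K3 + s%:R * e * K3) + 1.
have Q1 : 0 <= `|c0| * T by rewrite mulr_ge0// ltW.
have Q2 : 0 <= `|c0| * (a_ * K3 + s%:R * e * K3).
 by rewrite mulr_ge0// addr_ge0// mulr_ge0// ltW.
exists Q, (maxn 1 (maxn N1 N2)); split; first by rewrite /Q; lra.
move=> m; rewrite !geq_max => /and3P[m1 mN1 mN2] z uq.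
have [hk _] := h1 m mN1; have {}hk := hk z uq; have hg := h2 m mN2.
have [ka3 kb3] := h3 z uq; have c10 := cf1_neq0 m.
set g := norming m * _ in hg; set n := n_ m in hg *.
have n0 : (0 < n)%N by rewrite /n /index addn_gt0 muln_gt0 s0 m1.
have nR : 0 < n%:R :> R by rewrite ltr0n.
have xR : n.+1%:R = n%:R + 1 :> R by rewrite natr1.
have nE : n%:R = s%:R * m%:R + l%:R :> R by rewrite /n /index natrD natrM.
have lsR : l%:R <= s%:R :> R by rewrite ler_nat ltnW.
have l0 : 0 <= l%:R :> R by [].
have nm : n%:R <= s%:R * (m%:R + 1) :> R by rewrite nE mulrDr mulr1 lerD2l.
have e0 : 0 <= e by lra.
have m12 : m%:R + 1 <= m%:R + 2 :> R by rewrite lerD2l (ler_nat R 1 2).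
pose err : C := - (cf1 m)^-1%:C * ((leading m)^-1%:C * (P n).[z] - kernels m z).
have errb : normc err <= K1 / (m%:R + 1) ^+ 2.
 rewrite /err mulNr normcN normcM normc_real normfV.
 rewrite ler_pdivrMl ?normr_gt0//; apply: (le_trans hk).
 by rewrite /small natr1; apply: le_of_eq; ring.
pose b := e / (m%:R + 2).
have sE : scaled m z = g%:C * (c0%:C * (ka z + b%:C * kb z + err)).
 rewrite scaledE -/n -/g; congr (_ * (_ * _)); rewrite /err (mulrBr (- ((cf1 m)^-1)%:C)).
 have kE : - (cf1 m)^-1%:C * kernels m z = ka z + b%:C * kb z.
  rewrite /kernels -/(ka z) -/(kb z) (cf2_cf1 R s l m) -/b.
  have -> : e / m.+2%:R = b by rewrite /b -[m.+2]addn2 natrD.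
  have F (f b' : R) (x y : C) : f != 0 -> - (f^-1)%:C * - (f%:C * x + (b' * f)%:C * y) = x + b'%:C * y.
   move=> f0; have fC : f%:C != 0 :> C by rewrite -normc_gt0 normc_real normr_gt0.
   by rewrite rmorphM fmorphV; field.
  exact: F.
 by rewrite kE addrC subrK.
have i1 : n.+1%:R^-1 <= n%:R^-1 :> R by rewrite lef_pV2 ?posrE ?ltr0n// ler_nat.
have i0 : 0 < n.+1%:R^-1 :> R by rewrite invr_gt0 ltr0n.
have j0 : 0 < n%:R^-1 :> R by rewrite invr_gt0.
have j1 : n%:R^-1 <= 1 :> R by rewrite invf_le1// (ler_nat R 1).
have i2 : n.+1%:R^-1 <= 1 :> R by exact: le_trans i1 j1.
have ni : n%:R * n.+1%:R^-1 <= 1 :> R by rewrite ler_pdivrMr ?ltr0n// mul1r ler_nat.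
have ni1 : 1 - n%:R * n.+1%:R^-1 = n.+1%:R^-1 :> R.
 by rewrite xR; field; rewrite -xR pnatr_eq0.
have g1 : `|g - 1| <= A * n%:R^-1.
 rewrite (_ : g - 1 = (g - (1 - a_ / n.+1%:R)) - a_ / n.+1%:R); last by ring.
 apply: (le_trans (ler_normB _ _)); rewrite [leRHS]mulrDl; apply: lerD.
  apply: (le_trans hg); rewrite ler_wpM2l ?(ltW K20)// expr2 invfM.
  by apply: le_trans i1; rewrite ler_piMr// ltW.
 by rewrite (ger0_norm (mulr_ge0 a0 (ltW i0))) ler_wpM2l.
have g2 : `|n%:R * (g - 1) + a_| <= A * n%:R^-1.
 rewrite (_ : _ + a_ = n%:R * (g - (1 - a_ / n.+1%:R)) + a_ * (1 - n%:R * n.+1%:R^-1)); last by ring.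
 apply: (le_trans (ler_normD _ _)); rewrite [leRHS]mulrDl ni1; apply: lerD.
  rewrite normrM ger0_norm ?(ltW nR)//; apply: (le_trans (ler_wpM2l (ltW nR) hg)).
  rewrite expr2 invfM mulrCA ler_wpM2l ?(ltW K20)// mulrA.
  by apply: le_trans i1; rewrite ler_piMl// ltW.
 by rewrite (ger0_norm (mulr_ge0 a0 (ltW i0))) ler_wpM2l.
have m20 : 0 < m%:R + 2 :> R by rewrite ltr_wpDl.
have m10 : 0 < m%:R + 1 :> R by rewrite ltr_wpDl.
have mi : (m%:R + 2)^-1 <= s%:R * n%:R^-1 :> R.
 rewrite -[leLHS]mul1r ler_pdivrMr// mulrAC ler_pdivlMr// mul1r; apply: (le_trans nm).
 by rewrite ler_wpM2l.
have mi1 : (m%:R + 1)^-1 <= s%:R * n%:R^-1 :> R.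
 by rewrite -[leLHS]mul1r ler_pdivrMr// mulrAC ler_pdivlMr// mul1r.
have nb : n%:R * b <= s%:R * e.
 rewrite /b mulrCA mulrC ler_wpM2r//.
 by rewrite ler_pdivrMr//; apply: (le_trans nm); rewrite ler_wpM2l.
have nb0 : 0 <= n%:R * b by rewrite mulr_ge0 ?(ltW nR)// divr_ge0 ?(ltW m20).
have g3 : `|n%:R * g * b - s%:R * e| <= (A * (s%:R * e) + 2 * s%:R ^+ 2 * e) * n%:R^-1.
 rewrite (_ : _ - _ = (g - 1) * (n%:R * b) + (n%:R * b - s%:R * e)); last by ring.
 apply: (le_trans (ler_normD _ _)); rewrite [leRHS]mulrDl; apply: lerD.
  by rewrite normrM mulrAC ler_pM// ger0_norm.
 have -> : n%:R * b - s%:R * e = - (e * (2 * s%:R - l%:R) / (m%:R + 2)).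
  by rewrite /b nE; field; rewrite gt_eqF.
 have q : 0 <= e * (2 * s%:R - l%:R).
  by rewrite mulr_ge0// subr_ge0 (le_trans lsR)// ler_peMl// (ler_nat R 1 2).
 rewrite normrN ger0_norm ?divr_ge0 ?(ltW m20)//.
 apply: (@le_trans _ _ (e * (2 * s%:R) * (s%:R * n%:R^-1))).
  apply: ler_pM => //.
  by rewrite ler_wpM2l// gerBl.
 by apply: le_of_eq; ring.
have gA : `|g| <= 1 + A.
 rewrite -[g](subrK 1) addrC (le_trans (ler_normD _ _))// normr1 lerD2l.
 by apply: (le_trans g1); rewrite ler_piMr// ltW.
have g4 : n%:R * normc err <= s%:R ^+ 2 * K1 * n%:R^-1.
 apply: (le_trans (ler_wpM2l (ltW nR) errb)).
 have y0 : 0 <= (m%:R + 1)^-1 :> R by rewrite invr_ge0 ltW.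
 rewrite -exprVn; move: ((m%:R + 1)^-1) y0 mi1 => y y0 hy.
 have yy : y ^+ 2 <= (s%:R * n%:R^-1) ^+ 2.
  by rewrite lerXn2r ?nnegrE// mulr_ge0// ltW.
 apply: (@le_trans _ _ (n%:R * (K1 * (s%:R * n%:R^-1) ^+ 2))).
  by rewrite ler_wpM2l ?(ltW nR)// ler_wpM2l// ltW.
 apply: le_of_eq; move: (n%:R) nR => x x0; field.
 by rewrite gt_eqF.
have main : normc (n%:R * (scaled m z - c0%:C * ka z)
   - c0%:C * (- a_%:C * ka z + (s%:R * e)%:C * kb z)) <= `|c0| * T / n%:R.
 have X1 : normc ((n%:R * (g - 1) + a_)%:C * ka z) <= A * n%:R^-1 * K3.
  by apply: normcM_le => //; rewrite normc_real.
 have X2 : normc ((n%:R * g * b - s%:R * e)%:C * kb z) <=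
   (A * (s%:R * e) + 2 * s%:R ^+ 2 * e) * n%:R^-1 * K3.
  by apply: normcM_le => //; rewrite normc_real.
 have X3 : normc (g%:C * (n%:R * err)) <= (1 + A) * (s%:R ^+ 2 * K1 * n%:R^-1).
  apply: normcM_le; first by rewrite normc_real.
  by rewrite normcM (normc_nat R n).
 have X0 : normc (c0%:C : C) <= `|c0| by rewrite normc_real.
 rewrite sE expansion_identity; apply: (le_trans (normcM_le X0 (normc_le2 (normc_le2 X1 X2) X3))).
 by rewrite /T; apply: le_of_eq; move: (n%:R^-1) => ni'; ring.
split; last first.
 by apply: (le_trans main); rewrite ler_wpM2r ?(ltW j0)// /Q; lra.
set D := c0%:C * (- _ * _ + _) in main.
have nC : n%:R != 0 :> C by rewrite pnatr_eq0 -lt0n.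
rewrite (_ : scaled m z - _ = n%:R^-1 * ((n%:R * (scaled m z - c0%:C * ka z) - D) + D)); last first.
 by rewrite subrK mulKf.
rewrite normcM normcV (normc_nat R n) mulrC ler_wpM2r ?(ltW j0)//.
rewrite /Q; apply: (@le_trans _ _ (`|c0| * T + `|c0| * (a_ * K3 + s%:R * e * K3))); last by rewrite lerDl.
apply: normc_le2.
 by apply: (le_trans main); rewrite ler_piMr.
apply: normcM_le; first by rewrite normc_real.
apply: normc_le2; apply: normcM_le => //; first by rewrite normcN normc_real ger0_norm.
by rewrite normc_real ger0_norm.
Qed.
End Class.

End Final.

Section Uniform.
Variables (R : realType) (s : nat) (r : R).
Hypotheses (s2 : (2 <= s)%N) (r1 : 1 < r).
Local Notation C := R[i].
Implicit Types (z w : C).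
Local Notation uu := (@uu R s).
Variables (P : nat -> {poly C}).
Hypothesis hP : orthonormal_polynomials (lem s r) P.
Local Notation scaled := (scaled s r P).
Local Notation index := (index s).
Local Notation c0 := (c0 R s).
Local Notation ka := (ka s r).
Local Notation kb := (kb s r).
Local Notation first_coef := (first_coef R s).

Let s0 : (0 < s)%N := ltnW s2.

(** One constant for the finitely many residue classes. *)
Lemma uniform_asymptotics (q0 : R) : 0 <= q0 < 1 -> exists K N, 0 < K /\
 forall l m, (l.+1 < s)%N -> (N <= index l m)%N -> forall z, normc (uu z) <= q0 ->
 normc (scaled l m z - (c0 l)%:C * ka l z) <= K / (index l m)%:R /\
 normc ((index l m)%:R * (scaled l m z - (c0 l)%:C * ka l z)
   - (c0 l)%:C * (- (first_coef l)%:C * ka l z + (s%:R * (2 - alpha R s l))%:C * kb l z))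
  <= K / (index l m)%:R.
Proof.
move=> q01.
suff h t : exists K N, 0 < K /\ forall l m, (l < t)%N -> (l.+1 < s)%N -> (N <= index l m)%N ->
 forall z, normc (uu z) <= q0 ->
 normc (scaled l m z - (c0 l)%:C * ka l z) <= K / (index l m)%:R /\
 normc ((index l m)%:R * (scaled l m z - (c0 l)%:C * ka l z)
   - (c0 l)%:C * (- (first_coef l)%:C * ka l z + (s%:R * (2 - alpha R s l))%:C * kb l z))
  <= K / (index l m)%:R.
 have [K [N [K0 hK]]] := h s; exists K, N; split => // l m ls; apply: hK => //.
 exact: ltn_trans ls.
elim: t => [|t [K [N [K0 hK]]]]; first by exists 1, 0%N.
have [ts|ts] := boolP (t.+1 < s)%N; last first.
 exists K, N; split => // l m; rewrite ltnS leq_eqVlt => /orP[/eqP-> h|lt]; last exact: hK.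
 by rewrite h in ts.
have [K1 [N1 [K10 h1]]] := class_asymptotics s2 r1 hP ts q01.
exists (K + K1), (N + s * N1.+1)%N; split; first exact: addr_gt0.
move=> l m; rewrite ltnS leq_eqVlt => lt ls hN z uq.
have i0 : 0 <= (index l m)%:R^-1 :> R by rewrite invr_ge0.
have le1 : K / (index l m)%:R <= (K + K1) / (index l m)%:R.
 by rewrite ler_wpM2r// lerDl ltW.
have le2 : K1 / (index l m)%:R <= (K + K1) / (index l m)%:R.
 by rewrite ler_wpM2r// lerDr ltW.
case/orP: lt => [/eqP lE|lt].
 have mN : (N1 <= m)%N.
  apply: ltnW; rewrite -ltnS -(ltn_pmul2l s0).
  apply: leq_ltn_trans (leq_trans (leq_addl N _) hN) _.
  by rewrite /index mulnS addnC ltn_add2r ltnW.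
 rewrite lE in mN uq i0 le1 le2 *; have [u v] := h1 m mN z uq.
 by split; [exact: le_trans u le2|exact: le_trans v le2].
have [u v] := hK l m lt ls (leq_trans (leq_addr _ _) hN) z uq.
by split; [exact: le_trans u le1|exact: le_trans v le1].
Qed.

Lemma near_inside (z0 : C) (q0 : R) : normc (uu z0) < q0 ->
 \forall z \near (z0 : C^o), normc (uu z) <= q0.
Proof.
move=> h; have e0 : 0 < q0 - normc (uu z0) by rewrite subr_gt0.
have [d d0 hd] := @ccont_uu R s z0 _ e0.
apply/nbhs_ballP; exists d%:C; first by rewrite /= ltcR.
move=> z /=; rewrite -ball_normE /= => hz.
have hz' : normc (z - z0) < d by rewrite normcBC -ltcR -normrE.
have := hd _ hz'; rewrite (_ : z0 + (z - z0) = z); last by rewrite addrC subrK.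
move=> h1.
rewrite -[uu z](subrK (uu z0)); apply: (le_trans (normc_le2 (ltW h1) (lexx _))).
by rewrite subrK.
Qed.
End Uniform.

Theorem theorem2p13 (R : realType) (s : nat) (r : R) (P : nat -> {poly R[i]})
    (hs : (2 <= s)%N) (hr : 1 < r)
    (hP : orthonormal_polynomials (lemniscate_interior s (r ^+ s)) P) :
  (forall m n : nat, n = (s * m + (s - 1))%N -> forall z : R[i],
     (P n).[z] = (Num.sqrt (n.+1%:R : R) / r ^+ n.+1)%:C
                 * z ^+ (s - 1) * (z ^+ s - 1) ^+ m)
  /\
  (forall phi : R[i] -> R[i],
     conformal_onto_disk (lemniscate_interior s (r ^+ s)) phi ->
     exists Rem : nat -> R[i] -> R[i],
     [/\ forall m l n : nat, (l <= s - 2)%N -> n = (s * m + l)%N ->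
           forall z : R[i], lemniscate_interior s (1 : R) z ->
           ((-1) ^+ m * r ^+ n.+1
              * Gamma (n%:R + (3 * s%:R - l%:R - 1) / s%:R))%:C * (P n).[z]
             / (n`!%:R * Num.sqrt (n.+1%:R : R))%:C
           = (s%:R `^ ((2 * s%:R - l%:R - 1) / s%:R)
                / ((s - l - 1)`!%:R * Gamma ((1 + l%:R - s%:R) / s%:R) : R))%:C
               * dLker0 phi (s - l - 2) z
             + Rem n z,
         locally_uniformly_O (lemniscate_interior s (1 : R))
           [set n | (n %% s)%N <> (s - 1)%N]
           Rem (fun n => n%:R^-1)
       & locally_uniformly_O (lemniscate_interior s (1 : R))
           [set n | (n %% s)%N <> (s - 1)%N]
           (fun n z => let l := (n %% s)%N in
              n%:R * Rem n z
              - (s%:R `^ ((s%:R - l%:R - 1) / s%:R)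
                   / Gamma ((1 + l%:R - 2 * s%:R) / s%:R) : R)%:C
                * (((s%:R - 1) / (2 * (s - l - 2)`!%:R) : R)%:C
                     * dLker0 phi (s - l - 2) z
                   - (s%:R ^+ 2 / (2 * s - l - 1)`!%:R : R)%:C
                     * dLker0 phi (2 * s - l - 2) z))
           (fun n => n%:R^-1)]).
Proof.
have LE : lemniscate_interior s (r ^+ s) = lem s r by rewrite -lem_interior.
rewrite LE in hP *; have s0 : (0 < s)%N := ltnW hs.
split=> [m n -> z|phi hphi]; first by rewrite !subn1 (last_class hs hr hP).
have in1 z : lemniscate_interior s (1 : R) z -> normc (uu s z) < 1.
 by rewrite /lemniscate_interior /= normrE uuE ltcR.
have inG z : normc (uu s z) < 1 -> lem s r z /\ z != 0.
 move=> u1; split; first by apply/(lemE hs hr); exact: lt_trans (rs_gt1 hs hr).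
 by apply: contraTneq u1 => ->; rewrite uu0// normcN (normc_nat R 1) ltxx.
pose Rem n z := scaled s r P (n %% s) (n %/ s) z
 - (c0 R s (n %% s))%:C * ka s r (n %% s) z.
have ssR : s%:R != 0 :> R by rewrite pnatr_eq0 -lt0n.
have alE l : alpha R s l = (l%:R + 1) / s%:R by rewrite /alpha natr1.
have idx n : index s (n %% s) (n %/ s) = n by rewrite /index mulnC -divn_eq.
have cls n : (n %% s)%N <> (s - 1)%N -> ((n %% s).+1 < s)%N.
 move=> h; rewrite ltn_neqAle ltn_mod s0 andbT; apply/eqP => e; apply: h.
 by apply/eqP; rewrite -eqSS e subn1 prednK.
have kaE l z : (l.+1 < s)%N -> normc (uu s z) < 1 ->
  dLker0 phi (s - l - 2) z = (s - l - 1)`!%:R * ka s r l z.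
 move=> ls /inG[zG z0].
 have -> : (s - l - 2)%N = (s - l - 1).-1 by lia.
 rewrite (dLker0_ker0 hs hr hphi zG z0); [by []|lia|lia].
have kbE l z : (l.+1 < s)%N -> normc (uu s z) < 1 ->
  dLker0 phi (2 * s - l - 2) z = (2 * s - l - 1)`!%:R * kb s r l z.
 move=> ls /inG[zG z0].
 have e : (2 * s - l - 1 = s + (s - l - 1))%N by lia.
 have -> : (2 * s - l - 2)%N = (s + (s - l - 1)).-1 by lia.
 rewrite e (dLker0_ker1 hs hr hphi zG z0); [by []|lia|lia].
have fne k : k`!%:R != 0 :> R by rewrite pnatr_eq0 -lt0n fact_gt0.
have main l z : (l.+1 < s)%N -> normc (uu s z) < 1 ->
  (s%:R `^ ((2 * s%:R - l%:R - 1) / s%:R)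
   / ((s - l - 1)`!%:R * Gamma ((1 + l%:R - s%:R) / s%:R) : R))%:C
   * dLker0 phi (s - l - 2) z = (c0 R s l)%:C * ka s r l z.
 move=> ls z1; rewrite kaE// mulrA; congr (_ * _); rewrite /c0.
 have -> : (1 + l%:R - s%:R) / s%:R = alpha R s l - 1 by rewrite alE; field.
 have -> : (2 * s%:R - l%:R - 1) / s%:R = 2 - alpha R s l by rewrite alE; field.
 have fC : ((s - l - 1)`!%:R : R[i]) = ((s - l - 1)`!%:R : R)%:C by rewrite rmorph_nat.
 rewrite fC -rmorphM; congr (_%:C); have := fne (s - l - 1)%N.
 by move: (_`!%:R) => f f0; rewrite invfM -!mulrA (mulrC _^-1 f) mulKf.
have second l z : (l.+1 < s)%N -> normc (uu s z) < 1 ->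
  (s%:R `^ ((s%:R - l%:R - 1) / s%:R) / Gamma ((1 + l%:R - 2 * s%:R) / s%:R) : R)%:C
   * (((s%:R - 1) / (2 * (s - l - 2)`!%:R) : R)%:C * dLker0 phi (s - l - 2) z
     - (s%:R ^+ 2 / (2 * s - l - 1)`!%:R : R)%:C * dLker0 phi (2 * s - l - 2) z)
  = (c0 R s l)%:C * (- (first_coef R s l)%:C * ka s r l z
    + (s%:R * (2 - alpha R s l))%:C * kb s r l z).
 move=> ls z1; rewrite kaE// kbE//.
 have a0 := al_gt0 R hs l; have a1 := al_lt1 R hs ls.
 have al01 : 0 < alpha R s l < 1 by rewrite a0.
 have G2 := Gamma_m2 al01.
 have G0 : Gamma (alpha R s l - 1) != 0.
  rewrite Gamma_m1// mulf_neq0//; last by rewrite invr_eq0 lt_eqF// subr_lt0.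
  by rewrite gt_eqF// Gamma_integral_gt0.
 have e1 : (1 + l%:R - 2 * s%:R) / s%:R = alpha R s l - 2 by rewrite alE; field.
 have e2 : (s%:R - l%:R - 1) / s%:R = 1 - alpha R s l by rewrite alE; field.
 have sR0 : 0 < s%:R :> R by rewrite ltr0n.
 have e3 : s%:R `^ (2 - alpha R s l) = s%:R * s%:R `^ (1 - alpha R s l).
  rewrite -{2}[s%:R]powRr1 ?(ltW sR0)// -powRD ?(gt_eqF sR0) ?implybT//.
  by congr (_ `^ _); ring.
 have e4 : (s - l - 1)`!%:R = s%:R * (1 - alpha R s l) * (s - l - 2)`!%:R :> R.
  have -> : (s - l - 1)%N = (s - l - 2).+1 by lia.
  rewrite factS natrM; congr (_ * _).
  have -> : (s - l - 2).+1 = (s - l.+1)%N by lia.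
  by rewrite (natrB _ (ltnW ls)) /alpha mulrBr mulr1 [X in _ = _ - X]mulrC (divfK ssR).
 have g0 : Gamma (alpha R s l - 2) != 0.
  by apply: contraNneq G0; rewrite G2 => ->; rewrite mulr0.
 have fC k : (k`!%:R : R[i]) = (k`!%:R : R)%:C by rewrite rmorph_nat.
 have E1 : s%:R `^ (1 - alpha R s l) / Gamma (alpha R s l - 2)
    * ((s%:R - 1) / (2 * (s - l - 2)`!%:R)) * (s - l - 1)`!%:R
   = c0 R s l * - first_coef R s l.
  rewrite /c0 /first_coef e3 G2 e4; have := fne (s - l - 2)%N.
  move: a1 g0 (s%:R `^ (1 - alpha R s l)); move: (Gamma (alpha R s l - 2)).
  move: (_`!%:R) (alpha R s l) s%:R => f a q g a1 g0 b f0; field.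
  by rewrite g0 f0 subr_eq0 lt_eqF// (lt_trans a1) ?ltr1n.
 have E2 : s%:R `^ (1 - alpha R s l) / Gamma (alpha R s l - 2)
    * (- (s%:R ^+ 2 / (2 * s - l - 1)`!%:R)) * (2 * s - l - 1)`!%:R
   = c0 R s l * (s%:R * (2 - alpha R s l)).
  rewrite /c0 e3 G2; have := fne (2 * s - l - 1)%N.
  move: a1 g0 (s%:R `^ (1 - alpha R s l)); move: (Gamma (alpha R s l - 2)).
  move: (_`!%:R) (alpha R s l) s%:R => f a q g a1 g0 b f0; field.
  by rewrite g0 f0 subr_eq0 lt_eqF// (lt_trans a1) ?ltr1n.
 rewrite e1 e2 !fC.
 have lift (x y u f g : R) (A B : R[i]) : x%:C * (y%:C * (f%:C * A) - u%:C * (g%:C * B))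
   = (x * y * f)%:C * A + (x * - u * g)%:C * B.
  rewrite !rmorphM !rmorphN /=.
  by move: x%:C y%:C u%:C f%:C g%:C => x' y' u' f' g'; ring.
 have lift2 (c f q : R) (A B : R[i]) :
   (c * - f)%:C * A + (c * q)%:C * B = c%:C * (- f%:C * A + q%:C * B).
  rewrite !rmorphM !rmorphN /=.
  by move: c%:C f%:C q%:C => c' f' q'; ring.
 by rewrite lift E1 E2 lift2.
have locally (z0 : R[i]) : lemniscate_interior s (1 : R) z0 ->
  exists q0 : R, [/\ 0 <= q0 < 1, normc (uu s z0) < q0 & forall z, normc (uu s z) <= q0 -> normc (uu s z) < 1].
 move=> /in1 h; have h0 := normc_ge0 (uu s z0).
 exists ((1 + normc (uu s z0)) / 2); move: h h0; move: (normc (uu s z0)) => t h h0.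
 split; [by apply/andP; split; lra|lra|].
 by move=> z hz; apply: le_lt_trans hz _; lra.
exists Rem; split.
- move=> m l n ls2 nE z /in1 z1.
 have ls : (l.+1 < s)%N by lia.
 have lE : (n %% s)%N = l by rewrite nE mulnC modnMDl modn_small// ltnW.
 have mE : (n %/ s)%N = m by rewrite nE mulnC divnMDl// divn_small ?addn0// ltnW.
 rewrite (main l z ls z1) /Rem lE mE [RHS]addrC subrK /scaled -[index s l m]/(s * m + l)%N -nE.
 have -> : (3 * s%:R - l%:R - 1) / s%:R = 3 - alpha R s l by rewrite alE; field.
 rewrite Gamma_pos//; have := al_lt1 R hs ls; move: (alpha R s l) => a a1.
 by apply: ltr_wpDl; [exact: ler0n|lra].
- move=> z0 /locally[q0 [q01 h0 hq]].
 have [K [N [K0 hK]]] := uniform_asymptotics hs hr hP q01; exists K, N.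
 apply: filterS (near_inside h0) => z hz n nN /= /cls ln.
 have := hK (n %% s)%N (n %/ s)%N ln; rewrite idx => /(_ nN z hz)[h _].
 by rewrite normrE lecR.
move=> z0 /locally[q0 [q01 h0 hq]].
have [K [N [K0 hK]]] := uniform_asymptotics hs hr hP q01; exists K, N.
apply: filterS (near_inside h0) => z hz n nN /= /cls ln.
have := hK (n %% s)%N (n %/ s)%N ln; rewrite idx => /(_ nN z hz)[_ h].
by rewrite (second _ _ ln (hq z hz)) normrE lecR.
Qed.
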